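(* Let $\mathcal{T}$ be a finite conforming triangulation (simplicial complex) in $\mathbb{R}^2$. For triangles $T$, edges $E$ and vertices $V$ of $\mathcal{T}$ put $$A^0(T)=\mathrm{C}^0_{\mathrm{curl}\,{}^T}\mathrm{P}^2(\mathcal{R}(T),\mathbb{V}),\quad A^1(T)=\mathrm{def}\,A^0(T)\oplus W(T),\quad A^2(T)=\mathrm{P}^0(\mathcal{R}(T),\mathbb{R}),$$ $$A^0(E)=\mathrm{P}^2(E)\times\mathrm{P}^2(E)\times\mathrm{P}^1(E),\quad A^1(E)=\mathrm{P}^1(E)\times\mathrm{P}^1(E)\times\mathrm{P}^0(E),\quad A^0(V)=\mathbb{V}\times\mathbb{R},$$ all other spaces being $0$, with the differentials, restrictions and evaluations of the low regularity strain complex (specified in the context). Then this is a compatible finite element system. Moreover the following system of degrees of freedom is unisolvent on it: $$F^0(V)=\{(u,v)\mapsto u\cdot\phi+v\psi:(\phi,\psi)\in M(V)\},$$ $$F^0(E)=\mathbb{R}\{(u,v,u')\mapsto\textstyle\int_E\partial_\tau u\,\chi_E\}\oplus\mathbb{R}\{(u,v,u')\mapsto\textstyle\int_E\frac12(u'+\partial_\tau v)\chi_E\},$$ $$F^1(E)=\{u\mapsto\langle u,\phi\rangle_E:\phi\in M(E)\}\oplus\mathbb{R}\{(u,v,u')\mapsto\textstyle\int_Eu\chi_E\}\oplus\mathbb{R}\{(u,v,u')\mapsto\textstyle\int_Ev\chi_E\},$$ $$F^2(T)=\{u\mapsto\textstyle\int_Tu\phi:\phi\in M(T)\},$$ the other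 spaces being $0$.
   Context: **Notation.** $\mathbb{V}=\mathbb{R}^2$ (column vectors), $\mathbb{S}$: symmetric $2\times2$ matrices. $\mathrm{P}^r$: polynomials of degree at most $r$. $\mathcal{R}(T)$: Clough--Tocher split of $T$ (into three triangles, joining an interior point to the vertices); $\mathrm{P}^r(\mathcal{R}(T),\cdot)$: piecewise $\mathrm{P}^r$ fields. For a column vector field $u$, $\mathrm{def}\,u$ is the symmetric part of the Jacobian matrix and $\mathrm{curl}\,u^T=\partial_1u_2-\partial_2u_1$. $\mathrm{sven}\,u=\partial_{22}u_{11}+\partial_{11}u_{22}-\partial_{12}u_{21}-\partial_{21}u_{12}$ (distributional) for matrix fields. $\mathrm{C}^0_{\mathrm{curl}\,{}^T}\mathrm{P}^2(\mathcal{R}(T),\mathbb{V})$: continuous piecewise $\mathrm{P}^2$ vector fields $u$ with $\mathrm{curl}\,u^T$ continuous on $T$. On an edge $E$, $\tau$ is the oriented unit tangent and $\nu$ the unit normal with $(\tau,\nu)$ positively oriented; $\chi_E$ is a fixed nonzero affine function on $E$ with $\int_E\chi_E=0$. $W(T)$: the space of continuous piecewise $\mathrm{P}^2$ (on $\mathcal{R}(T)$) $\mathbb{S}$-valued fields $u$ with $\mathrm{sven}\,u$ an integrable function, $u|_{\partial T}=0$, and $\partial_\nu u\,\tau\cdot\tau$ constant on each edge of $T$; $\mathrm{sven}:W(T)\to\mathrm{P}^0(\mathcal{R}(T),\mathbb{R})$ is bijective. **Orientations.** $T'\trianglelefteq T$ means subcell. $\mathrm{o}(E,V)=+1$ if $\tau$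 points towards $V$ along $E$, $-1$ for the other endpoint; triangles are oriented counterclockwise, $\mathrm{o}(T,E)=+1$ if $\tau$ is counterclockwise along $\partial T$ (i.e. $\nu$ is inward), $-1$ otherwise; $\mathrm{o}$ is $0$ for cells that are not a pair (cell, codimension 1 face). **Differentials.** $\mathrm{def}:A^0(T)\to A^1(T)$, $\mathrm{sven}:A^1(T)\to A^2(T)$; $A^0(E)\to A^1(E)$: $(u,v,u')\mapsto(\partial_\tau u,\frac12(u'+\partial_\tau v),\partial_\tau u')$; the others are $0$. **Restrictions.** $A^0(T)\to A^0(E)$: $u\mapsto(u\cdot\tau,u\cdot\nu,\partial_\nu u\cdot\tau)|_E$; $A^1(T)\to A^1(E)$: $u\mapsto(u\tau\cdot\tau,u\tau\cdot\nu,\partial_\nu u\,\tau\cdot\tau)|_E$; $A^0(E)\to A^0(V)$: $(u,v,u')\mapsto(u\tau+v\nu,\frac12(\partial_\tau v-u'))(V)$; $A^0(T)\to A^0(V)$: $u\mapsto(u,\frac12\mathrm{curl}\,u^T)(V)$. **Discrete vector bundle.** $M(T)$: affine functions on $T$; $M(E)$: pairs $(\phi,\psi)$ with $\phi$ an affine function on $E$ and $\psi$ a constant; $M(V)=\mathbb{V}\times\mathbb{R}$. Restriction maps: $s_{ET}:M(T)\to M(E)$, $\phi\mapsto(\phi|_E,\partial_\nu\phi|_E)$; $s_{VE}:M(E)\to M(V)$, $(\phi,\psi)\mapsto(\psi\tau-\partial_\tau\phi\,\nu,\phi)(V)$. Pairings: $\langle u,\phi\rangle_T=\int_Tu\phi$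 on $A^2(T)\times M(T)$; $\langle(u,v,u'),(\phi,\psi)\rangle_E=\int_Eu\psi+\partial_\tau v\,\phi-v\,\partial_\tau\phi-u'\phi$ on $A^1(E)\times M(E)$; $\langle(u,v),(\phi,\psi)\rangle_V=u\cdot\phi+v\psi$ on $A^0(V)\times M(V)$. The flat discrete vector bundle is $L(\cdot)=M(\cdot)^\star$ with transport maps $\mathsf{t}_{T'T''}=s_{T''T'}^\star$ (for $T''$ a codimension 1 face of $T'$) and evaluation maps $\mathsf{e}:u\mapsto\langle u,\cdot\rangle$. **Finite element system (FES).** For a flat discrete vector bundle $L$ (vector spaces $L(T)$ and isomorphisms $\mathsf{t}_{TT'}$ for codimension 1 faces, with $\mathsf{t}_{TT'_0}\mathsf{t}_{T'_0T''}=\mathsf{t}_{TT'_1}\mathsf{t}_{T'_1T''}$ for codimension 2 faces $T''$), a FES consists of complexes $(A^\bullet(T),\mathsf{d})$ for every cell $T$, restrictions $\mathsf{r}_{T'T}:A^k(T)\to A^k(T')$ for $T'\trianglelefteq T$ commuting with $\mathsf{d}$ and satisfying $\mathsf{r}_{T''T}=\mathsf{r}_{T''T'}\mathsf{r}_{T'T}$, and evaluations $\mathsf{e}_T:A^k(T)\to L(T)$ for $k=\dim T$ with $\mathsf{e}_T\mathsf{d}u=\sum_{T'\trianglelefteq T}\mathrm{o}(T,T')\mathsf{t}_{TT'}\mathsf{e}_{T'}\mathsf{r}_{T'T}u$ for $u\in A^{k-1}(T)$. For a subcomplex $\mathcal{T}'$, $A^k(\mathcal{T}')$ is the space of families $(u_T)_{T\in\mathcal{T}'}$,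 $u_T\in A^k(T)$, with $u_{T'}=\mathsf{r}_{T'T}u_T$ for $T'\trianglelefteq T$. $\mathcal{C}^k(\mathcal{T}',L)$ is the product of the $L(T)$ over $k$-dimensional $T\in\mathcal{T}'$, with differential $(\delta_{\mathsf{t}}u)(T)=\sum_{T'}\mathrm{o}(T,T')\mathsf{t}_{TT'}u(T')$. The FES is *compatible* if it is flabby ($A^k(T)\to A^k(\partial T)$ surjective for every cell $T$ and all $k$, with $\partial T$ the complex of strict subcells) and locally exact (for every cell $T$, with $\mathcal{S}(T)$ the complex of all subcells, the map $A^\bullet(T)\to\mathcal{C}^\bullet(\mathcal{S}(T),L)$ given by restriction and evaluation induces isomorphisms on cohomology). **Unisolvence.** A system of degrees of freedom is a choice of subspaces $F^k(T)\subseteq A^k(T)^\star$. It is unisolvent if for each cell $T$ and each $k$ the map $A^k(T)\to\bigoplus_{T'\trianglelefteq T}F^k(T')^\star$, $u\mapsto(l\mapsto l(\mathsf{r}_{T'T}u))_{T'\trianglelefteq T}$, is an isomorphism. *)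

(* Defs.v *)
From HB Require Import structures.
From mathcomp Require Import all_boot all_order all_algebra.
From mathcomp Require Import all_classical all_reals all_analysis.

Set Implicit Arguments.
Unset Strict Implicit.
Unset Printing Implicit Defensive.

Import Order.TTheory GRing.Theory Num.Theory numFieldNormedType.Exports.

Local Open Scope classical_set_scope.
Local Open Scope ring_scope.

(** * Finite element systems with coefficients in a discrete vector bundle

    Vector spaces are given as subsets of ambient left modules, and linear maps
    between them as functions between the ambient modules; every condition is
    required on the subsets only. *)

Section LinearOnSubsets.
Variable R : fieldType.

Definition subspace (U : lmodType R) (A : set U) : Prop :=
  A 0 /\ forall (a : R) (x y : U), A x -> A y -> A (a *: x + y).

Definition linear_on (U V : lmodType R) (A : set U) (f : U -> V) : Prop :=
  forall (a : R) (x y : U), A x -> A y -> f (a *: x + y) = a *: f x + f y.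

End LinearOnSubsets.

Record cell_complex := CellComplex {
  cell : finType;
  dim : cell -> nat;
  subcell : rel cell;                  (* subcell T' T reads T' ⊴ T *)
  orient : cell -> cell -> int         (* orient T T' reads o(T, T') *)
}.

Definition face (X : cell_complex) (c' c : cell X) : bool :=
  subcell c' c && (dim c == (dim c').+1).

(** [transport c c' : L(c') -> L(c)] is t_{c c'}; it matters only when [c'] is a
    codimension one face of [c]. *)
Record vector_bundle (R : fieldType) (X : cell_complex) := VectorBundle {
  fiber : cell X -> lmodType R;
  transport : forall c c' : cell X, fiber c' -> fiber c
}.

Section FES.
Variables (R : fieldType) (X : cell_complex).

Definition flat_bundle (L : vector_bundle R X) : Prop :=
  (forall c c' : cell X, face c' c ->
     linear (@transport R X L c c') /\ bijective (@transport R X L c c')) /\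
  (forall c c0 c1 c2 : cell X,
     face c0 c -> face c1 c -> face c2 c0 -> face c2 c1 ->
     forall l : fiber L c2,
       transport c (transport c0 l) = transport c (transport c1 l)).

(** [res k c' c] is r_{c' c}, relevant when [c'] is a subcell of [c];
    [ev k c] is e_c, relevant when [k = dim c]. *)
Record fe_data (L : vector_bundle R X) := FEData {
  amb : nat -> cell X -> lmodType R;
  fe : forall (k : nat) (c : cell X), set (amb k c);
  dif : forall (k : nat) (c : cell X), amb k c -> amb k.+1 c;
  res : forall (k : nat) (c' c : cell X), amb k c -> amb k c';
  ev : forall (k : nat) (c : cell X), amb k c -> fiber L c
}.

Variables (L : vector_bundle R X) (A : fe_data L).

Arguments amb {L} f k c.
Arguments fe {L} f k c.
Arguments dif {L} f {k c}.
Arguments res {L} f {k} c' {c}.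
Arguments ev {L} f {k c}.

Record is_fes : Prop := IsFES {
  fe_subspace : forall k (c : cell X), subspace (fe A k c);
  dif_linear : forall k (c : cell X), linear_on (fe A k c) (@dif L A k c);
  dif_fe : forall k (c : cell X) u, fe A k c u -> fe A k.+1 c (dif A u);
  dif_dif : forall k (c : cell X) u, fe A k c u -> dif A (dif A u) = 0;
  res_linear : forall k (c' c : cell X), subcell c' c ->
    linear_on (fe A k c) (@res L A k c' c);
  res_fe : forall k (c' c : cell X), subcell c' c ->
    forall u, fe A k c u -> fe A k c' (res A c' u);
  res_dif : forall k (c' c : cell X), subcell c' c ->
    forall u, fe A k c u -> res A c' (dif A u) = dif A (res A c' u);
  res_id : forall k (c : cell X) u, fe A k c u -> res A c u = u;
  res_res : forall k (c'' c' c : cell X), subcell c'' c' -> subcell c' c ->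
    forall u, fe A k c u -> res A c'' u = res A c'' (res A c' u);
  ev_linear : forall k (c : cell X), dim c = k ->
    linear_on (fe A k c) (@ev L A k c);
  ev_dif : forall k (c : cell X), dim c = k.+1 ->
    forall u, fe A k c u ->
      ev A (dif A u) =
      \sum_(c' | face c' c) transport c (ev A (res A c' u)) *~ orient c c'
}.

Definition fe_family (P : pred (cell X)) (k : nat)
    (w : forall c : cell X, amb A k c) : Prop :=
  (forall c, P c -> fe A k c (w c)) /\
  (forall c' c, P c' -> P c -> subcell c' c -> w c' = res A c' (w c)).

Definition boundary (c : cell X) : pred (cell X) :=
  [pred c' | subcell c' c && (c' != c)].

Definition flabby : Prop :=
  forall (c : cell X) (k : nat) (w : forall c' : cell X, amb A k c'),
    fe_family (boundary c) w ->
    exists2 u, fe A k c u & forall c', boundary c c' -> res A c' u = w c'.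

(** Elements of C^k(P, L) are encoded as families indexed by all the cells and
    vanishing off the [k]-dimensional cells of P. *)
Definition cochain (P : pred (cell X)) (k : nat) :
    set (forall c : cell X, fiber L c) :=
  [set f | forall c, ~~ (P c && (dim c == k)) -> f c = 0].

Definition delta (P : pred (cell X)) (f : forall c : cell X, fiber L c) :
    forall c : cell X, fiber L c :=
  fun c => if P c then \sum_(c' | face c' c) transport c (f c') *~ orient c c'
           else 0.

Definition fe_cocycle (k : nat) (c : cell X) : set (amb A k c) :=
  [set u | fe A k c u /\ dif A u = 0].

Definition fe_coboundary (k : nat) (c : cell X) : set (amb A k c) :=
  match k return set (amb A k c) with
  | 0 => [set 0]
  | j.+1 => @dif L A j c @` fe A j c
  end.

Arguments fe_cocycle k c : clear implicits.
Arguments fe_coboundary k c : clear implicits.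

Definition cocycle (P : pred (cell X)) (k : nat) :
    set (forall c : cell X, fiber L c) :=
  [set f | cochain P k f /\ forall c, delta P f c = 0].

Definition coboundary (P : pred (cell X)) (k : nat) :
    set (forall c : cell X, fiber L c) :=
  match k with
  | 0 => [set f | forall c, f c = 0]
  | j.+1 => [set f | exists2 g, cochain P j g & forall c, f c = delta P g c]
  end.

Definition subcells (c : cell X) : pred (cell X) := [pred c' | subcell c' c].

(** The de Rham map A^k(c) -> C^k(S(c), L). *)
Definition derham (k : nat) (c : cell X) (u : amb A k c) :
    forall c' : cell X, fiber L c' :=
  fun c' => if subcell c' c && (dim c' == k) then ev A (res A c' u) else 0.

(** Injectivity and surjectivity of the map induced by [derham] on the
    quotients of cocycles by coboundaries. *)
Definition locally_exact : Prop :=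
  forall (c : cell X) (k : nat),
    (forall u, fe_cocycle k c u -> coboundary (subcells c) k (derham u) ->
       fe_coboundary k c u) /\
    (forall f, cocycle (subcells c) k f ->
       exists2 u, fe_cocycle k c u &
         coboundary (subcells c) k (fun c' => f c' - derham u c')).

Definition compatible : Prop := flabby /\ locally_exact.

(** A subset [F k c] of functions on the ambient module of A^k(c) stands for the
    set of their restrictions to A^k(c), a subset of the dual of A^k(c). *)
Definition dof_family := forall (k : nat) (c : cell X), set (amb A k c -> R).

Definition dof_system (F : dof_family) : Prop :=
  forall (k : nat) (c : cell X),
    [/\ forall l, F k c l ->
          forall (a : R) u v, fe A k c u -> fe A k c v ->
            l (a *: u + v) = a * l u + l v,
        exists2 l, F k c l & forall u, fe A k c u -> l u = 0
      & forall (a : R) l1 l2, F k c l1 -> F k c l2 ->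
          exists2 l, F k c l & forall u, fe A k c u -> l u = a * l1 u + l2 u].

(** [y] defines an element of the dual of F^k(c). The condition also forces [y]
    to agree on representatives with the same restriction to A^k(c). *)
Definition dof_dual (F : dof_family) (k : nat) (c : cell X)
    (y : (amb A k c -> R) -> R) : Prop :=
  forall (a : R) l1 l2 l, F k c l1 -> F k c l2 -> F k c l ->
    (forall u, fe A k c u -> l u = a * l1 u + l2 u) -> y l = a * y l1 + y l2.

Definition unisolvent (F : dof_family) : Prop :=
  forall (k : nat) (c : cell X),
    (forall u v, fe A k c u -> fe A k c v ->
       (forall c', subcell c' c ->
          forall l, F k c' l -> l (res A c' u) = l (res A c' v)) -> u = v) /\
    (forall y : forall c' : cell X, (amb A k c' -> R) -> R,
       (forall c', subcell c' c -> dof_dual F (y c')) ->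
       exists2 u, fe A k c u &
         forall c', subcell c' c -> forall l, F k c' l -> l (res A c' u) = y c' l).

End FES.

Section Hull.
Variables (R : realType) (I : finType) (pos : I -> R * R).

Definition hull (s : {set I}) : set (R * R) :=
  [set x | exists w : I -> R,
     [/\ forall i, 0 <= w i, \sum_(i in s) w i = 1
       & x = \sum_(i in s) w i *: pos i]].

Definition affinely_independent (s : {set I}) : Prop :=
  forall w : I -> R, \sum_(i in s) w i = 0 -> \sum_(i in s) w i *: pos i = 0 ->
    forall i, i \in s -> w i = 0.

End Hull.

Record triangulation (R : realType) := Triangulation {
  vert : finType;
  pos : vert -> R * R;
  simplices : {set {set vert}};
  simplices_vert : forall v : vert, finset.set1 v \in simplices;
  simplices_neq0 : finset.set0 \notin simplices;
  simplices_sub : forall s s' : {set vert},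
    s \in simplices -> s' \subset s -> s' != finset.set0 -> s' \in simplices;
  simplices_indep : forall s : {set vert},
    s \in simplices -> affinely_independent pos s;
  simplices_conforming : forall s s' : {set vert},
    s \in simplices -> s' \in simplices ->
    hull pos s `&` hull pos s' `<=` hull pos (s :&: s')%SET
}.

Definition edge (R : realType) (K : triangulation R) :=
  {e : {set vert K} | (e \in simplices K) && (#|e| == 2)%N}.

Definition triangle (R : realType) (K : triangulation R) :=
  {t : {set vert K} | (t \in simplices K) && (#|t| == 3)%N}.

(** A triangulation with an orientation of its edges (the oriented tangent of
    [e] points towards [head e]) and the interior points defining the
    Clough--Tocher splits. *)
Record ct_mesh (R : realType) := CTMesh {
  mesh :> triangulation R;
  head : edge mesh -> vert mesh;
  head_in : forall e : edge mesh, head e \in val e;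
  center : triangle mesh -> R * R;
  center_in : forall t : triangle mesh, (hull (@pos R mesh) (val t))° (center t)
}.

Section Calculus.
Variable R : realType.

Definition dot (v w : R * R) : R := v.1 * w.1 + v.2 * w.2.

Definition rot (v : R * R) : R * R := (- v.2, v.1).

Definition coordi (v : R * R) (i : 'I_2) : R := if i == ord0 then v.1 else v.2.

Definition apply_mx (m : 'M[R]_2) (v : R * R) : R * R :=
  (m ord0 ord0 * v.1 + m ord0 ord_max * v.2,
   m ord_max ord0 * v.1 + m ord_max ord_max * v.2).

Definition partial (i : 'I_2) (f : R * R -> R) : R * R -> R :=
  'D_(if i == ord0 then (1, 0) else (0, 1)) f.

Definition def (u : R * R -> R * R) (x : R * R) : 'M[R]_2 :=
  \matrix_(i, j) (2^-1 * (partial j (fun y => coordi (u y) i) x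
                          + partial i (fun y => coordi (u y) j) x)).

Definition curlT (u : R * R -> R * R) (x : R * R) : R :=
  partial ord0 (fun y => (u y).2) x - partial ord_max (fun y => (u y).1) x.

Definition smooth (f : R * R -> R) : Prop :=
  forall (s : seq 'I_2) (x : R * R), differentiable (foldr partial f s) x.

Definition lebesgue2 := ((@lebesgue_measure R) \x (@lebesgue_measure R))%E.

Definition poly2 (r : nat) (Y : lmodType R) : set (R * R -> Y) :=
  [set f | exists c : nat -> nat -> Y,
     f = fun x => \sum_(i < r.+1) \sum_(j < r.+1 | (i + j <= r)%N)
                    (x.1 ^+ i * x.2 ^+ j) *: c i j].

Definition poly1 (r : nat) : set (R -> R) :=
  [set f | exists p : {poly R}, (size p <= r.+1)%N /\ f = horner p].

(** Affine functions are encoded by their constant term and gradient. *)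
Definition aff1 (phi : R * R) (s : R) : R := phi.1 + phi.2 * s.

Definition aff2 (phi : R * (R * R)) (x : R * R) : R := phi.1 + dot phi.2 x.

End Calculus.

Section LowRegularityStrain.
Variables (R : realType) (K : ct_mesh R).

Local Notation vert := (vert K).
Local Notation edge := (edge K).
Local Notation triangle := (triangle K).
Local Notation pos := (@pos R K).
Local Notation hull := (hull pos).
Local Notation efield := ((R -> R) * (R -> R) * (R -> R))%type.

(** An edge [e] is parametrized by arc length [s] in [0, len e], from its tail to
    its head. Polynomials on [e] are polynomial functions of [s]. *)

Definition tail (e : edge) : vert :=
  odflt (head e) [pick v in val e | v != head e].

Definition len (e : edge) : R :=
  Num.sqrt (dot (pos (head e) - pos (tail e)) (pos (head e) - pos (tail e))).

Definition tau (e : edge) : R * R :=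
  (len e)^-1 *: (pos (head e) - pos (tail e)).

Definition nu (e : edge) : R * R := rot (tau e).

Definition epoint (e : edge) (s : R) : R * R := pos (tail e) + s *: tau e.

Definition ecoord (e : edge) (v : vert) : R := dot (pos v - pos (tail e)) (tau e).

Definition eint (e : edge) (f : R -> R) : R :=
  \int[lebesgue_measure]_(s in `[0, len e]) f s.

(** The subtriangles of the Clough--Tocher split of [t] correspond to the edges
    of [t]. A piecewise polynomial field on [t] is encoded by the polynomials of
    the plane giving its restrictions to the subtriangles, indexed by the edges
    of [t], and extended by 0 to the other edges of the mesh. *)

Definition tedge (t : triangle) (e : edge) : bool := val e \subset val t.

Definition subtriangle (t : triangle) (e : edge) : set (R * R) :=
  [set x | exists a y, [/\ 0 <= a <= 1, hull (val e) y
                         & x = a *: center t + (1 - a) *: y]].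

Definition pwpoly (r : nat) (Y : lmodType R) (t : triangle) :
    set (edge -> R * R -> Y) :=
  [set u | (forall e, tedge t e -> poly2 r (u e)) /\
           (forall e, ~~ tedge t e -> u e = 0)].

Definition pwcontinuous (Y : topologicalType) (t : triangle)
    (u : edge -> R * R -> Y) : Prop :=
  exists f : R * R -> Y, {within hull (val t), continuous f} /\
    forall e, tedge t e -> forall x, subtriangle t e x -> f x = u e x.

Definition pwint (t : triangle) (g : edge -> R * R -> R) : R :=
  \sum_(e | tedge t e) \int[@lebesgue2 R]_(x in subtriangle t e) g e x.

Definition test_function (t : triangle) (phi : R * R -> R) : Prop :=
  [/\ smooth phi, compact (closure [set x | phi x != 0])
    & closure [set x | phi x != 0] `<=` (hull (val t))°].

(** The integrable function [f] is the distribution sven [u] on the interior of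
    [t]. *)
Definition is_sven (t : triangle) (u : edge -> R * R -> 'M[R]_2)
    (f : R * R -> R) : Prop :=
  (@lebesgue2 R).-integrable (hull (val t)) (EFin \o f) /\
  forall phi, test_function t phi ->
    \int[@lebesgue2 R]_(x in hull (val t)) (f x * phi x) =
    pwint t (fun e x =>
      u e x ord0 ord0 * partial ord_max (partial ord_max phi) x
      + u e x ord_max ord_max * partial ord0 (partial ord0 phi) x
      - u e x ord_max ord0 * partial ord0 (partial ord_max phi) x
      - u e x ord0 ord_max * partial ord_max (partial ord0 phi) x).

Definition A0T (t : triangle) : set (edge -> R * R -> R * R) :=
  [set u | [/\ @pwpoly 2 (R * R)%type t u, @pwcontinuous (R * R)%type t u
             & @pwcontinuous R t (fun e => curlT (u e))]].

Definition defT (u : edge -> R * R -> R * R) : edge -> R * R -> 'M[R]_2 :=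
  fun e => def (u e).

Definition mx_tt (e : edge) (u : R * R -> 'M[R]_2) (x : R * R) : R :=
  dot (apply_mx (u x) (tau e)) (tau e).

Definition mx_tn (e : edge) (u : R * R -> 'M[R]_2) (x : R * R) : R :=
  dot (apply_mx (u x) (tau e)) (nu e).

Definition W (t : triangle) : set (edge -> R * R -> 'M[R]_2) :=
  [set u | [/\ @pwpoly 2 'M[R]_2 t u, forall e x, (u e x)^T = u e x
             & @pwcontinuous 'M[R]_2 t u] /\
           [/\ exists f, is_sven t u f,
               forall e, tedge t e -> forall x, hull (val e) x -> u e x = 0
             & forall e, tedge t e -> exists c : R,
                 forall x, hull (val e) x -> 'D_(nu e) (mx_tt e (u e)) x = c]].

Definition A1T (t : triangle) : set (edge -> R * R -> 'M[R]_2) :=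
  [set u | exists v w, [/\ A0T t v, W t w & u = defT v + w]].

Definition A2T (t : triangle) : set (edge -> R * R -> R) := @pwpoly 0 R t.

(** The piecewise constant field which is the distribution sven [u]. *)
Definition svenT (t : triangle) (u : edge -> R * R -> 'M[R]_2) :
    edge -> R * R -> R :=
  xget 0 [set g | A2T t g /\ exists2 f, is_sven t u f &
    forall e, tedge t e -> forall x, (subtriangle t e)° x -> f x = g e x].

Definition A0E : set efield :=
  [set u | [/\ @poly1 R 2 u.1.1, @poly1 R 2 u.1.2 & @poly1 R 1 u.2]].

Definition A1E : set efield :=
  [set u | [/\ @poly1 R 1 u.1.1, @poly1 R 1 u.1.2 & @poly1 R 0 u.2]].

Definition difE (u : efield) : efield :=
  (derive1 u.1.1, fun s => 2^-1 * (u.2 s + derive1 u.1.2 s), derive1 u.2).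

Definition res0ET (e : edge) (u : edge -> R * R -> R * R) : efield :=
  (fun s => dot (u e (epoint e s)) (tau e),
   fun s => dot (u e (epoint e s)) (nu e),
   fun s => 'D_(nu e) (fun x => dot (u e x) (tau e)) (epoint e s)).

Definition res1ET (e : edge) (u : edge -> R * R -> 'M[R]_2) : efield :=
  (fun s => mx_tt e (u e) (epoint e s),
   fun s => mx_tn e (u e) (epoint e s),
   fun s => 'D_(nu e) (mx_tt e (u e)) (epoint e s)).

Definition res0VE (v : vert) (e : edge) (u : efield) :
    (R * R) * R :=
  let s := ecoord e v in
  (u.1.1 s *: tau e + u.1.2 s *: nu e, 2^-1 * (derive1 u.1.2 s - u.2 s)).

(** The values at [v] are read on an arbitrary subtriangle containing [v]: the
    field and its curl are continuous on [t]. *)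
Definition res0VT (v : vert) (t : triangle) (u : edge -> R * R -> R * R) :
    (R * R) * R :=
  if [pick e : edge | tedge t e && (v \in val e)] is Some e
  then (u e (pos v), 2^-1 * curlT (u e) (pos v)) else 0.

Definition mesh_cell : finType := (vert + edge + triangle)%type.

Definition mesh_dim (c : mesh_cell) : nat :=
  match c with inl (inl _) => 0 | inl (inr _) => 1 | inr _ => 2 end.

Definition cell_vert (c : mesh_cell) : {set vert} :=
  match c with
  | inl (inl v) => finset.set1 v
  | inl (inr e) => val e
  | inr t => val t
  end.

(** For an edge of a triangle, the sign is + if [nu e] points inwards, that is,
    towards the vertex opposite to [e]. *)
Definition mesh_orient (c c' : mesh_cell) : int :=
  match c, c' with
  | inl (inr e), inl (inl v) =>
      if v == head e then 1 else if v \in val e then -1 else 0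
  | inr t, inl (inr e) =>
      if tedge t e then
        if [forall v in val t, (v \in val e) || (0 < dot (nu e) (pos v - pos (tail e)))]
        then 1 else -1
      else 0
  | _, _ => 0
  end.

Definition mesh_complex : cell_complex :=
  @CellComplex mesh_cell mesh_dim
    (fun c' c => cell_vert c' \subset cell_vert c) mesh_orient.

(** M(T): affine functions on T; M(E): pairs of an affine function of the arc
    length and a constant; M(V) = V x R. *)

Definition M (c : mesh_cell) : vectType R :=
  match c with
  | inl (inl _) => ((R * R) * R)%type
  | inl (inr _) => ((R * R) * R)%type
  | inr _ => (R * (R * R))%type
  end.

Definition sET (e : edge) (phi : R * (R * R)) : (R * R) * R :=
  ((aff2 phi (pos (tail e)), dot phi.2 (tau e)), dot phi.2 (nu e)).

Definition sVE (v : vert) (e : edge) (m : (R * R) * R) : (R * R) * R :=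
  (m.2 *: tau e - m.1.2 *: nu e, aff1 m.1 (ecoord e v)).

Definition smap (c' c : mesh_cell) : M c -> M c' :=
  match c', c return M c -> M c' with
  | inl (inl v), inl (inr e) => sVE v e
  | inl (inr e), inr _ => sET e
  | _, _ => fun=> 0
  end.

Definition pairV (u m : (R * R) * R) : R := dot u.1 m.1 + u.2 * m.2.

Definition pairE (e : edge) (u : efield)
    (m : (R * R) * R) : R :=
  eint e (fun s => u.1.1 s * m.2 + derive1 u.1.2 s * aff1 m.1 s
                   - u.1.2 s * derive1 (aff1 m.1) s - u.2 s * aff1 m.1 s).

Definition pairT (t : triangle) (u : edge -> R * R -> R) (phi : R * (R * R)) : R :=
  pwint t (fun e x => u e x * aff2 phi x).

Definition mesh_bundle : vector_bundle R mesh_complex :=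
  @VectorBundle R mesh_complex
    (fun c => 'Hom(M c, R))
    (fun c c' l => (l \o linfun (@smap c' c))%VF).

Definition mesh_amb (k : nat) (c : mesh_cell) : lmodType R :=
  match c, k with
  | inl (inl _), 0 => ((R * R) * R)%type
  | inl (inr _), 0 => efield
  | inl (inr _), 1 => efield
  | inr _, 0 => (edge -> R * R -> R * R)
  | inr _, 1 => (edge -> R * R -> 'M[R]_2)
  | inr _, 2 => (edge -> R * R -> R)
  | _, _ => 'rV[R]_0
  end.

Definition mesh_fe (k : nat) (c : mesh_cell) : set (mesh_amb k c) :=
  match c, k return set (mesh_amb k c) with
  | inl (inl _), 0 => setT
  | inl (inr _), 0 => A0E
  | inl (inr _), 1 => A1E
  | inr t, 0 => A0T t
  | inr t, 1 => A1T t
  | inr t, 2 => A2T t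
  | _, _ => [set 0]
  end.

Definition mesh_dif (k : nat) (c : mesh_cell) : mesh_amb k c -> mesh_amb k.+1 c :=
  match c, k return mesh_amb k c -> mesh_amb k.+1 c with
  | inl (inr _), 0 => difE
  | inr _, 0 => defT
  | inr t, 1 => svenT t
  | _, _ => fun=> 0
  end.

Definition mesh_res (k : nat) (c' c : mesh_cell) : mesh_amb k c -> mesh_amb k c' :=
  match c', c, k return mesh_amb k c -> mesh_amb k c' with
  | inl (inl _), inl (inl _), 0 => id
  | inl (inl v), inl (inr e), 0 => res0VE v e
  | inl (inl v), inr t, 0 => res0VT v t
  | inl (inr _), inl (inr _), 0 => id
  | inl (inr _), inl (inr _), 1 => id
  | inl (inr e), inr _, 0 => res0ET e
  | inl (inr e), inr _, 1 => res1ET e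
  | inr _, inr _, 0 => id
  | inr _, inr _, 1 => id
  | inr _, inr _, 2 => id
  | _, _, _ => fun=> 0
  end.

Definition mesh_ev (k : nat) (c : mesh_cell) : mesh_amb k c -> 'Hom(M c, R) :=
  match c, k return mesh_amb k c -> 'Hom(M c, R) with
  | inl (inl _), 0 => fun u => linfun (pairV u)
  | inl (inr e), 1 => fun u => linfun (pairE e u)
  | inr t, 2 => fun u => linfun (pairT t u)
  | _, _ => fun=> 0
  end.

Definition mesh_fes : fe_data mesh_bundle :=
  @FEData R mesh_complex mesh_bundle mesh_amb mesh_fe mesh_dif mesh_res mesh_ev.

Definition mesh_dof (chi : edge -> R * R) : dof_family mesh_fes :=
  fun (k : nat) (c : mesh_cell) =>
  match c, k return set (mesh_amb k c -> R) with
  | inl (inl _), 0 => [set l | exists m : (R * R) * R, l = fun u => pairV u m]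
  | inl (inr e), 0 =>
      [set l | exists a b : R, l = fun u : efield =>
         a * eint e (fun s => derive1 u.1.1 s * aff1 (chi e) s) +
         b * eint e (fun s => 2^-1 * (u.2 s + derive1 u.1.2 s) * aff1 (chi e) s)]
  | inl (inr e), 1 =>
      [set l | exists (m : (R * R) * R) (a b : R), l = fun u : efield =>
         pairE e u m +
         a * eint e (fun s => u.1.1 s * aff1 (chi e) s) +
         b * eint e (fun s => u.1.2 s * aff1 (chi e) s)]
  | inr t, 2 => [set l | exists phi : R * (R * R), l = fun u => pairT t u phi]
  | _, _ => [set l | l = fun=> 0]
  end.

End LowRegularityStrain.

(* Main.v *)
(** On each piece of the Clough--Tocher split a field is a polynomial, and a field
    on the split of [t] is described by its three polynomials in the frames
    [o + x p + y q] with vertex the centre [o] and [p], [q] two of the vectors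
    [a], [b], [c] from [o] to the vertices. The relation
    [crs b c a + crs c a b + crs a b c = 0] then turns all matching conditions
    into linear algebra.

    Integrating by parts twice in each frame, the pairing of a continuous field
    with [curl curl phi] is the integral of [phi] against the piecewise constant
    sven plus, on each ray, an integral against the jump of a first derivative.
    Testing with bumps that concentrate on a ray shows that sven is a function
    only if these jumps vanish. An element of W(T) is therefore determined by the
    three constants of its normal derivatives on the edges, explicit fields realize
    all of them, and the values of sven are explicit in these constants. Likewise
    an element of A^0(T) is determined by its values and curls at the vertices and
    its values at the midpoints of the edges, which are arbitrary.

    An element of A^1(T) with zero traces has zero sven by Green's formula with
    affine test functions, hence is [def v]; subtracting a rigid motion, [v] has
    zero traces too, so [v = 0]. Conversely, given traces on the edges, an element
    of W(T) adjusts their pairings with affine functions; what remains is a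
    1-cochain on the boundary that is exact, and a potential for it on the edges
    extends to A^0(T). Flabbiness and local exactness follow from the same facts. *)

(* Dimensions explain why edge traces decide everything: [A^0(T)] has dimension 15 (values and curls
   at three vertices, values at three midpoints), [def] kills the 3 rigid motions, [W(T)] has
   dimension 3, so [A^1(T)] has dimension 15, like the product of the three spaces [A^1(E)].

   Convention: [a], [b], [c] run counterclockwise around the centre, and a field with index [A]
   lives on the piece [[b, c]] opposite to [A], and so on cyclically. Statements are proved for one
   ray or one side and then rotated.

   Three obstacles shape the file. A field [def v] may jump across the rays, so Green's formula is
   proved under the weaker condition [ray_cond], shared by [def v] and continuous tensors. The map
   [svenT] is selected by [xget] and can be computed only after a uniqueness proof; this takes test
   functions inside one piece, besides those concentrating on a ray. Finally, integration by parts
   over a triangle has moving limits; since test functions vanish beyond the outer side, each piece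
   is replaced by the parallelogram spanned by its frame. *)
From HB Require Import structures.
From mathcomp Require Import all_boot all_order all_algebra.
From mathcomp Require Import all_classical all_reals all_analysis.
From mathcomp Require Import measurable_realfun.
From mathcomp Require Import ring lra.
Require Import Defs.

Set Implicit Arguments.
Unset Strict Implicit.
Unset Printing Implicit Defensive.

Import Order.TTheory GRing.Theory Num.Theory numFieldNormedType.Exports.

Local Open Scope classical_set_scope.
Local Open Scope ring_scope.

(** * Integration in the plane *)

Section PlaneLebesgue.
Variable R : realType.
Local Notation mu := (@lebesgue_measure R).
Local Notation mu2 := (mu \x mu)%E.
Local Notation RR := (measurableTypeR R * measurableTypeR R)%type.

(** Rescaled by [k], the pushforward of [mu] gives every half-open interval its length, and Lebesgue
    measure is the only measure that does. *)
Lemma lebesgue_measure_affine_pos (k c : R) (B : set (measurableTypeR R)) :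
  0 < k -> measurable B -> mu [set x | B (k * x + c)] = ((k^-1)%:E * mu B)%E.
Proof.
move=> k0 mB; have k0' : 0 <= k by apply: ltW.
pose f : measurableTypeR R -> measurableTypeR R := fun x => k * x + c.
have mf : measurable_fun setT f.
  by apply: measurable_funD => //; exact: measurable_funM.
have := @lebesgue_measure_unique R (mscale (NngNum k0') (pushforward mu f)).
move=> /(_ mf _ B mB) ->; first by rewrite /mscale /= muleA -EFinM mulVf ?gt_eqF // mul1e.
move=> _ /= [[a b]] _ <-.
rewrite /mscale /= /pushforward.
have -> : f @^-1` `]a, b] = `](a - c) / k, (b - c) / k]%classic.
  by apply/seteqP; split => x /=; rewrite !in_itv /= ltr_pdivrMr // ler_pdivlMr //;
    rewrite /f ltrBlDr lerBrDr mulrC.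
rewrite !lebesgue_measure_itv /= !lte_fin ltr_pM2r ?invr_gt0 // ltrD2r.
case: ifP => _; last by rewrite mule0.
by rewrite -!EFinB -EFinM; congr EFin; field; rewrite gt_eqF.
Qed.

Lemma lebesgue_measure_affine (k c : R) (B : set (measurableTypeR R)) : k != 0 -> measurable B ->
  mu [set x | B (k * x + c)] = ((`|k|^-1)%:E * mu B)%E.
Proof.
move=> k0 mB; have [kp|kn|/eqP] := ltgtP 0 k; last by rewrite eq_sym (negbTE k0).
  by rewrite gtr0_norm // lebesgue_measure_affine_pos.
pose B' := (-%R : _ -> measurableTypeR R) @^-1` B.
have mB' : measurable (B' : set (measurableTypeR R)).
  by rewrite -[X in measurable X]setTI; exact: (@oppr_measurable R setT).
rewrite -(lebesgue_measureN mB) ltr0_norm // -/B'.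
rewrite -(@lebesgue_measure_affine_pos _ (- c) B') ?oppr_gt0 //.
by congr (mu _); apply/seteqP; split => x; rewrite /B' /= mulNr -opprD opprK.
Qed.

(* [X] multiplies areas by [k], in terms of preimages so as not to need images *)
Definition scales_area (X : R * R -> R * R) (k : R) : Prop :=
  [/\ 0 < k, measurable_fun setT (X : RR -> RR)
    & forall A : set RR, measurable A -> mu2 (X @^-1` A) = ((k^-1)%:E * mu2 A)%E].

(** The shear of the first coordinate is affine on sections with fixed second coordinate, so its
    area factor is read off the product measure in the other order. *)
Lemma mu2_swap (A : set RR) : measurable A -> mu2 A = (mu \x^ mu)%E A.
Proof.
by move=> mA; apply: product_measure_unique => // B C mB mC /=; rewrite product_measure2E.
Qed.

Lemma scales_area_comp X Y k l : scales_area X k -> scales_area Y l ->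
  scales_area (X \o Y) (k * l).
Proof.
move=> [k0 mX hX] [l0 mY hY]; split; first exact: mulr_gt0.
  exact: measurableT_comp.
move=> A mA; rewrite comp_preimage hY ?hX ?muleA -?EFinM ?invfM ?[l^-1 * _]mulrC //.
by rewrite -[X in measurable X]setTI; exact: mX.
Qed.

(** Cavalieri's principle: each section with fixed second coordinate undergoes an affine map of
    slope [k], and translations by [f x.2] preserve length. *)
Lemma scales_area_shear1 (k : R) (f : R -> R) : k != 0 -> measurable_fun setT f ->
  scales_area (fun x => (k * x.1 + f x.2, x.2)) `|k|.
Proof.
move=> k0 mf.
have mX : measurable_fun setT ((fun x => (k * x.1 + f x.2, x.2)) : RR -> RR).
  apply: measurable_fun_pair; last exact: measurable_snd.
  apply: measurable_funD; last exact: (measurableT_comp mf measurable_snd).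
  by apply: measurable_funM => //; exact: measurable_fst.
split => //; first by rewrite normr_gt0.
move=> A mA; rewrite !mu2_swap //; last first.
  by rewrite -[X in measurable X]setTI; exact: mX.
rewrite /product_measure2 -ge0_integralZl //;
  last exact: measurable_fun_ysection.
apply: eq_integral => y _ /=.
rewrite -(lebesgue_measure_affine (f y)) //; last exact: measurable_ysection.
Qed.

Lemma scales_area_shear2 (k : R) (f : R -> R) : k != 0 -> measurable_fun setT f ->
  scales_area (fun x => (x.1, k * x.2 + f x.1)) `|k|.
Proof.
move=> k0 mf.
have mX : measurable_fun setT ((fun x => (x.1, k * x.2 + f x.1)) : RR -> RR).
  apply: measurable_fun_pair; first exact: measurable_fst.
  apply: measurable_funD; last exact: (measurableT_comp mf measurable_fst).
  by apply: measurable_funM => //; exact: measurable_snd.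
split => //; first by rewrite normr_gt0.
move=> A mA; rewrite /product_measure1 -ge0_integralZl //;
  last exact: measurable_fun_xsection.
apply: eq_integral => x _ /=.
rewrite -(lebesgue_measure_affine (f x)) //; last exact: measurable_xsection.
Qed.

Definition crs (p q : R * R) : R := p.1 * q.2 - p.2 * q.1.

Definition aff (o p q : R * R) (x : R * R) : R * R := o + x.1 *: p + x.2 *: q.

Lemma scales_area_aff (o p q : R * R) : crs p q != 0 ->
  scales_area (aff o p q) `|crs p q|.
Proof.
(* LU factorization of the matrix with columns [p'], [q'], available when the pivot [p'.1] is
   nonzero: one shear for each coordinate. *)
have H p' q' : p'.1 != 0 -> crs p' q' != 0 -> scales_area (aff o p' q') `|crs p' q'|.
  case: p' q' => [p1 p2] [q1 q2]; rewrite /crs /= => p0 c0.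
  have k0 : q2 - p2 / p1 * q1 != 0.
    apply: contra_neq c0 => E; rewrite -[RHS](mulr0 p1) -E; field; exact: p0.
  have := @scales_area_comp _ _ _ _
    (@scales_area_shear2 _ (fun a => p2 / p1 * a + (o.2 - p2 / p1 * o.1)) k0 _)
    (@scales_area_shear1 _ (fun b => q1 * b + o.1) p0 _).
  rewrite -normrM [in X in scales_area _ X](_ : _ * p1 = p1 * q2 - p2 * q1); last by field.
  rewrite (_ : _ \o _ = aff o (p1, p2) (q1, q2)); last first.
    apply/funext => -[a b]; rewrite /aff /=.
    by apply: injective_projections => /=; rewrite /GRing.scale /=; field.
  by apply; apply: measurable_funD => //; exact: measurable_funM.
(* A zero pivot is avoided by replacing [p] with [p - q], which amounts to a unimodular shear of the
   parameters. *)
move=> c0; have [p0|] := eqVneq p.1 0; last by move=> p0; exact: H.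
have q0 : q.1 != 0.
  by apply: contra_neq c0; rewrite /crs p0 => ->; rewrite mulr0 mul0r subrr.
have c1 : crs (p - q) q != 0.
  by apply: contra_neq c0 => <-; rewrite /crs /=; ring.
have p1 : (p - q).1 != 0 by rewrite /= p0 sub0r oppr_eq0.
have := @scales_area_comp _ _ _ _ (H _ _ p1 c1)
  (@scales_area_shear2 1 id (oner_neq0 _) (@measurable_id _ _ _)).
rewrite normr1 mulr1 (_ : crs (p - q) q = crs p q); last by rewrite /crs /=; ring.
rewrite (_ : _ \o _ = aff o p q) //.
apply/funext => -[a b]; rewrite /aff /=.
by apply: injective_projections => /=; rewrite /GRing.scale /=; ring.
Qed.


(** Measurability refers to the product sigma-algebra; an open set belongs to it because it is a
    countable union of boxes with rational centre and size. *)
Lemma continuous_measurable2 (F : R * R -> R) : continuous F ->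
  measurable_fun setT (F : RR -> R).
Proof.
move=> cF; apply: (measurability _ (RGenOpens.measurableE R)).
move=> _ [_ [a [b ->] <-]]; rewrite setTI.
have : open (F @^-1` `]a, b[%classic) by move/continuousP : cF; apply; exact: interval_open.
set O := (X in open X) => oO; rewrite -/O.
pose box (q r e : rat) : set RR :=
  [set x | `|ratr q - x.1| < ratr e :> R] `&` [set x | `|ratr r - x.2| < ratr e :> R].
have mbox q r e : measurable (box q r e).
  apply: measurableI.
    have mf : measurable_fun setT (fun x : RR => `|ratr q - x.1|).
      apply: measurableT_comp => //; apply: measurable_funB => //; exact: measurable_fst.
    have := mf measurableT _ (measurable_itv `]-oo, (ratr e : R)[); rewrite setTI.
    by congr measurable; apply/seteqP; split => x /=; rewrite in_itv.
  have mf : measurable_fun setT (fun x : RR => `|ratr r - x.2|).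
    apply: measurableT_comp => //; apply: measurable_funB => //; exact: measurable_snd.
  have := mf measurableT _ (measurable_itv `]-oo, (ratr e : R)[); rewrite setTI.
  by congr measurable; apply/seteqP; split => x /=; rewrite in_itv.
rewrite (_ : O = \bigcup_q \bigcup_r \bigcup_e
    (if `[< box q r e `<=` O >] then box q r e else set0)).
  do 3 (apply: bigcupT_measurable_rat => ?).
  by case: asboolP.
apply/seteqP; split => [x Ox|x [q _ [r _ [e _]]]]; last first.
  by case: asboolP => // + xb; exact.
have /nbhs_ballP[d /= d0 dO] : nbhs x O by exact: open_nbhs_nbhs.
have /rat_in_itvoo[e] : 0 < d / 2 by rewrite divr_gt0.
rewrite in_itv /= => /andP[e0 ed].
have /rat_in_itvoo[q] : x.1 - ratr e < x.1 + ratr e by rewrite ltrD2l gtrN.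
rewrite in_itv /= => qx.
have /rat_in_itvoo[r] : x.2 - ratr e < x.2 + ratr e by rewrite ltrD2l gtrN.
rewrite in_itv /= => rx.
have bx : box q r e x by split => /=; rewrite ltr_distl.
exists q => //; exists r => //; exists e => //.
case: asboolP => // -[] y [/= y1 y2]; apply: dO.
have {}bx := bx; case: bx => /= x1 x2.
split => /=.
  rewrite /ball /= (le_lt_trans (ler_distD (ratr q) _ _)) //.
  by rewrite (splitr d) ltrD // (lt_trans _ ed) // distrC.
rewrite /ball /= (le_lt_trans (ler_distD (ratr r) _ _)) //.
by rewrite (splitr d) ltrD // (lt_trans _ ed) // distrC.
Qed.

(** The pushforward of [mu2] along [X] is [mu2] scaled by [k^-1]. Positive and negative parts are
    transported separately, since the rules used are those for nonnegative functions. *)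
Lemma Rintegral_scales_area X k (S : set RR) (F : R * R -> R) :
  scales_area X k -> measurable S -> mu2.-integrable S (EFin \o F) ->
  \int[mu2]_(x in S) F x = k * \int[mu2]_(x in X @^-1` S) F (X x).
Proof.
move=> [k0 mX hX] mS iF.
have k0' : 0 <= k^-1 by rewrite invr_ge0 ltW.
have ge0E (f : RR -> \bar R) : measurable_fun S f -> (forall x, (0 <= f x)%E) ->
    (\int[mu2]_(x in X @^-1` S) f (X x))%E = ((k^-1)%:E * \int[mu2]_(x in S) f x)%E.
  move=> mf f0; rewrite -(ge0_integral_mscale _ mS (NngNum k0')) //.
  rewrite -[LHS](@ge0_integral_pushforward _ _ _ _ _ (X : RR -> RR) mX) //.
  apply: eq_measure_integral => A mA _ /=.
  by rewrite /mscale /pushforward /= hX.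
have /integrableP[mF _] := iF.
rewrite /Rintegral [in RHS]integralE.
have -> : (\int[mu2]_(x in X @^-1` S) ((fun x => (F (X x))%:E)^\+ x) =
    (k^-1)%:E * \int[mu2]_(x in S) (EFin \o F)^\+ x)%E.
  rewrite -(ge0E ((EFin \o F)^\+)%E); [|exact: measurable_funepos|exact: funepos_ge0].
  by apply: eq_integral => x _; rewrite !funeposE.
have -> : (\int[mu2]_(x in X @^-1` S) ((fun x => (F (X x))%:E)^\- x) =
    (k^-1)%:E * \int[mu2]_(x in S) (EFin \o F)^\- x)%E.
  rewrite -(ge0E ((EFin \o F)^\-)%E); [|exact: measurable_funeneg|exact: funeneg_ge0].
  by apply: eq_integral => x _; rewrite !funenegE.
have fp : (\int[mu2]_(x in S) (EFin \o F)^\+ x)%E \is a fin_num.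
  by apply: integral_fune_fin_num => //; exact: integrable_funepos.
have fn : (\int[mu2]_(x in S) (EFin \o F)^\- x)%E \is a fin_num.
  by apply: integral_fune_fin_num => //; exact: integrable_funeneg.
rewrite [in LHS]integralE -(fineK fp) -(fineK fn) -!EFinM -!EFinB /=.
by field; rewrite gt_eqF.
Qed.

Lemma Rintegral_iterated1 (S : set RR) (G : R * R -> R) (H : R -> R) :
  measurable S -> mu2.-integrable S (EFin \o G) ->
  (forall a, (\int[mu]_b ((G \_ S) (a, b))%:E)%E = (H a)%:E) ->
  \int[mu2]_(x in S) G x = \int[mu]_a H a.
Proof.
move=> mS iG hH; rewrite Rintegral_mkcond /Rintegral.
have iG' : mu2.-integrable setT (EFin \o (G \_ S)).
  by rewrite -restrict_EFin; apply/integrable_restrict => //; rewrite setTI.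
rewrite -(integral12_prod_meas1 iG') /fubini_F /=.
by under eq_integral do rewrite hH.
Qed.

Lemma Rintegral_iterated2 (S : set RR) (G : R * R -> R) (H : R -> R) :
  measurable S -> mu2.-integrable S (EFin \o G) ->
  (forall b, (\int[mu]_a ((G \_ S) (a, b))%:E)%E = (H b)%:E) ->
  \int[mu2]_(x in S) G x = \int[mu]_b H b.
Proof.
move=> mS iG hH; rewrite Rintegral_mkcond /Rintegral.
have iG' : mu2.-integrable setT (EFin \o (G \_ S)).
  by rewrite -restrict_EFin; apply/integrable_restrict => //; rewrite setTI.
rewrite -(integral21_prod_meas1 iG') /fubini_G /=.
by under eq_integral do rewrite hH.
Qed.

Definition box (m M m' M' : R) : set (R * R) := `[m, M]%classic `*` `[m', M']%classic.

Lemma box_compact m M m' M' : compact (box m M m' M').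
Proof. by apply: compact_setX; exact: segment_compact. Qed.

Lemma box_measurable m M m' M' : measurable (box m M m' M' : set RR).
Proof. by apply: measurableX; exact: measurable_itv. Qed.

Lemma box_finite m M m' M' : (mu2 (box m M m' M') < +oo)%E.
Proof.
have fin a b : (mu `[a, b]%classic < +oo)%E.
  by rewrite lebesgue_measure_itv /=; case: ifP => _; rewrite ?ltry // -EFinB ltry.
rewrite product_measure1E; [|exact: measurable_itv..].
have fn a b : mu `[a, b]%classic \is a fin_num by rewrite ge0_fin_numE.
exact: lte_mul_pinfty (measure_ge0 _ _) (fn _ _) (fin _ _).
Qed.

Lemma continuous_integrable2 (G : R * R -> R) (S : set RR) m M m' M' :
  continuous G -> measurable S -> S `<=` box m M m' M' ->
  mu2.-integrable S (EFin \o G).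
Proof.
move=> cG mS Sb; apply: measurable_bounded_integrable => //.
- apply: le_lt_trans (box_finite m M m' M').
  by apply: le_measure => //; rewrite inE //; exact: box_measurable.
- by apply: measurable_funTS; exact: continuous_measurable2.
- have : compact (G @` box m M m' M').
    apply: continuous_compact; last exact: box_compact.
    exact: continuous_subspaceT.
  move/(@compact_bounded R R^o) => [N [Nr HN]].
  by exists N; split => // M0 /HN {}HN x /Sb ?; apply: HN; exists x.
Qed.

Lemma Rintegral_FTC (f F : R -> R) (a b : R) : a <= b ->
  continuous f -> (forall x : R, is_derive x 1 F (f x)) ->
  (\int[mu]_(x in `[a, b]) (f x)%:E)%E = (F b - F a)%:E.
Proof.
rewrite le_eqVlt => /predU1P[<- _ _|ab cf dF].
  by rewrite subrr set_itv1 integral_set1.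
have cF : continuous F.
  move=> x; apply: differentiable_continuous; apply/derivable1_diffP.
  by case: (dF x).
rewrite (@continuous_FTC2 R f F) ?EFinB //.
- exact: continuous_subspaceT.
- split => [x _||]; first by case: (dF x).
  + by apply: cvg_at_right_filter; exact: cF.
  + by apply: cvg_at_left_filter; exact: cF.
- by move=> x _; rewrite derive1E; apply: derive_val.
Qed.

Lemma continuous_section1 (b : R) (g : R * R -> R) : continuous g ->
  continuous (fun a => g (a, b)).
Proof.
move=> cg a; apply: (@continuous_comp _ _ _ (fun a => (a, b)) g).
by apply: (@cvg_pair _ _ _ _ (nbhs a) (nbhs b)); [exact: cvg_id|exact: cvg_cst].
exact: cg.
Qed.

Lemma continuous_section2 (a : R) (g : R * R -> R) : continuous g ->
  continuous (fun b => g (a, b)).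
Proof.
move=> cg b; apply: (@continuous_comp _ _ _ (fun b => (a, b)) g).
by apply: (@cvg_pair _ _ _ _ (nbhs a) (nbhs b)); [exact: cvg_cst|exact: cvg_id].
exact: cg.
Qed.

Definition unit_square : set (R * R) := box 0 1 0 1.

Lemma unit_square_FTC2 (G g : R * R -> R) : continuous g ->
  (forall a b : R, is_derive b 1 (fun b => G (a, b)) (g (a, b))) ->
  \int[mu2]_(x in unit_square) g x = \int[mu]_(a in `[0, 1]) (G (a, 1) - G (a, 0)).
Proof.
move=> cg dG; rewrite [RHS]Rintegral_mkcond.
apply: Rintegral_iterated1; first exact: box_measurable.
  exact: (continuous_integrable2 (m := 0) (M := 1) (m' := 0) (M' := 1) cg (box_measurable _ _ _ _)).
move=> a; rewrite patchE; case: ifPn => [|] a01; last first.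
  rewrite (_ : (fun _ => _) = cst 0%E) ?integral0 //.
  apply/funext => b; rewrite patchE memNset // => -[/= ha _].
  by move/negP : a01; apply; rewrite inE.
transitivity (\int[mu]_(b in `[0%R, 1%R]) (g (a, b))%:E)%E.
  rewrite [RHS]integral_mkcond; apply: eq_integral => b _.
  rewrite /patch (_ : ((a, b) \in unit_square) = (b \in `[0, 1]%classic)); first by case: ifP.
  by move/set_mem : a01 => ?; apply/idP/idP => /set_mem h; apply/mem_set; [case: h|split].
exact: (@Rintegral_FTC _ (fun b => G (a, b)) 0 1 ler01 (@continuous_section2 a g cg) (dG a)).
Qed.

Lemma unit_square_FTC1 (G g : R * R -> R) : continuous g ->
  (forall a b : R, is_derive a 1 (fun a => G (a, b)) (g (a, b))) ->
  \int[mu2]_(x in unit_square) g x = \int[mu]_(b in `[0, 1]) (G (1, b) - G (0, b)).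
Proof.
move=> cg dG; rewrite [RHS]Rintegral_mkcond.
apply: Rintegral_iterated2; first exact: box_measurable.
  exact: (continuous_integrable2 (m := 0) (M := 1) (m' := 0) (M' := 1) cg (box_measurable _ _ _ _)).
move=> b; rewrite patchE; case: ifPn => [|] b01; last first.
  rewrite (_ : (fun _ => _) = cst 0%E) ?integral0 //.
  apply/funext => a; rewrite patchE memNset // => -[/= _ hb].
  by move/negP : b01; apply; rewrite inE.
transitivity (\int[mu]_(a in `[0%R, 1%R]) (g (a, b))%:E)%E.
  rewrite [RHS]integral_mkcond; apply: eq_integral => a _.
  rewrite /patch (_ : ((a, b) \in unit_square) = (a \in `[0, 1]%classic)); first by case: ifP.
  by move/set_mem : b01 => ?; apply/idP/idP => /set_mem h; apply/mem_set; [case: h|split].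
exact: (@Rintegral_FTC _ (fun a => G (a, b)) 0 1 ler01 (@continuous_section1 b g cg) (dG^~ b)).
Qed.


(** Turns derivatives of polynomials of degree at most three into a [ring] identity. The cubic
    coefficient [b1] serves the primitive of a quadratic; elsewhere it is 0. *)
Lemma is_derive_expand (V : normedModType R) (f : V -> R) (x v : V) (A b0 b1 : R) :
  (forall h : R, f (h *: v + x) = f x + h * A + h ^+ 2 * (b0 + h * b1)) ->
  is_derive x v f A.
Proof.
move=> hf.
have cv : h^-1 *: (f (h *: v + x) - f x) @[h --> 0^'] --> A.
  have -> : A = A + 0 * (b0 + 0 * b1) by rewrite mul0r addr0.
  apply: cvg_trans (_ : A + h * (b0 + h * b1) @[h --> 0^'] --> _).
    apply: near_eq_cvg; near=> h.
    have h0 : h != 0 by near: h; exact: nbhs_dnbhs_neq.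
    by rewrite hf /GRing.scale /=; field.
  apply: cvg_within_filter.
  apply: cvgD; first exact: cvg_cst.
  apply: cvgM; first exact: cvg_id.
  by apply: cvgD; [exact: cvg_cst|apply: cvgMl; exact: cvg_id].
apply: DeriveDef; first by apply/cvg_ex; exists A.
by apply/cvg_lim.
Unshelve. all: by end_near. Qed.

Definition ref_triangle : set (R * R) := [set x | [/\ 0 <= x.1, 0 <= x.2 & x.1 + x.2 <= 1]].

Lemma measurable_ge0 (f : R * R -> R) : continuous f ->
  measurable ([set x | 0 <= f x] : set RR).
Proof.
move=> /continuous_measurable2 mf.
have := mf measurableT _ (measurable_itv `[(0:R), +oo[); rewrite setTI.
by congr measurable; apply/seteqP; split => x /=; rewrite in_itv /= andbT.
Qed.

Lemma cst_continuous2 (k : R) : continuous (fun _ : R * R => k).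
Proof. by move=> x; exact: cvg_cst. Qed.

Lemma fst_continuous2 : continuous (fun x : R * R => x.1).
Proof. by move=> x; exact: cvg_fst. Qed.

Lemma snd_continuous2 : continuous (fun x : R * R => x.2).
Proof. by move=> x; exact: cvg_snd. Qed.

Lemma add_continuous2 (f g : R * R -> R) : continuous f -> continuous g ->
  continuous (fun x => f x + g x).
Proof. by move=> cf cg x; apply: cvgD; [exact: cf|exact: cg]. Qed.

Lemma mul_continuous2 (f g : R * R -> R) : continuous f -> continuous g ->
  continuous (fun x => f x * g x).
Proof. by move=> cf cg x; apply: cvgM; [exact: cf|exact: cg]. Qed.

Lemma opp_continuous2 (f : R * R -> R) : continuous f -> continuous (fun x => - f x).
Proof. by move=> cf x; apply: cvgN; exact: cf. Qed.

Lemma ref_triangle_box : ref_triangle `<=` box 0 1 0 1.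
Proof.
by move=> x [x1 x2 x12]; split; rewrite /= in_itv /=; apply/andP; split => //;
  apply: le_trans x12; rewrite ?lerDl ?lerDr.
Qed.

Lemma ref_triangle_measurable : measurable (ref_triangle : set RR).
Proof.
rewrite (_ : ref_triangle = [set x | 0 <= x.1] `&` [set x | 0 <= x.2]
   `&` [set x | 0 <= 1 + - (x.1 + x.2)]); last first.
  apply/seteqP; split => x /=; rewrite /ref_triangle /= subr_ge0; first by case.
  by case => -[].
apply: measurableI; [apply: measurableI|]; apply: measurable_ge0.
- exact: fst_continuous2.
- exact: snd_continuous2.
- apply: add_continuous2; first exact: cst_continuous2.
  apply: opp_continuous2; apply: add_continuous2; first exact: fst_continuous2.
  exact: snd_continuous2.
Qed.

Lemma continuous_poly2 (k0 k1 k2 : R) : continuous (fun s : R => k0 + k1 * s + k2 * s ^+ 2).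
Proof.
move=> s; apply: cvgD.
  by apply: cvgD; [exact: cvg_cst|apply: cvgM; [exact: cvg_cst|exact: cvg_id]].
by apply: cvgM; [exact: cvg_cst|apply: cvgM; exact: cvg_id].
Qed.

Lemma integral_quadratic (k0 k1 k2 L : R) : 0 <= L ->
  (\int[mu]_(s in `[0%R, L]) (k0 + k1 * s + k2 * s ^+ 2)%:E)%E =
  (k0 * L + k1 * L ^+ 2 / 2 + k2 * L ^+ 3 / 3)%:E.
Proof.
move=> L0.
have dF s : is_derive s (1 : R) (fun s => k0 * s + k1 * s ^+ 2 / 2 + k2 * s ^+ 3 / 3)
    (k0 + k1 * s + k2 * s ^+ 2).
  apply: (@is_derive_expand _ _ _ _ _ (k1 / 2 + k2 * s) (k2 / 3)) => h.
  by rewrite /GRing.scale /=; field.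
by rewrite (Rintegral_FTC L0 (@continuous_poly2 k0 k1 k2) dF); congr EFin; field.
Qed.

Lemma Rintegral_ref_triangle (A B C : R) :
  \int[mu2]_(x in ref_triangle) (A + B * x.1 + C * x.2) = A / 2 + B / 6 + C / 6.
Proof.
have cG : continuous (fun x : R * R => A + B * x.1 + C * x.2).
  apply: add_continuous2; [apply: add_continuous2|].
  - exact: cst_continuous2.
  - by apply: mul_continuous2; [exact: cst_continuous2|exact: fst_continuous2].
  - by apply: mul_continuous2; [exact: cst_continuous2|exact: snd_continuous2].
(* The quadratic in [a] is the integral of the integrand over [b] in [[0, 1 - a]]. *)
transitivity (\int[mu]_a (((fun a => A + C / 2 + (B - A - C) * a + (C / 2 - B) * a ^+ 2)
    \_ `[0, 1]%classic) a)).
  apply: Rintegral_iterated1; first exact: ref_triangle_measurable.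
    apply: (continuous_integrable2 cG _ ref_triangle_box).
    exact: ref_triangle_measurable.
  move=> a; rewrite patchE; case: ifPn => [/set_mem|] a01; last first.
    rewrite (_ : (fun _ => _) = cst 0%E) ?integral0 //.
    apply/funext => b; rewrite patchE memNset // => /ref_triangle_box[ha _].
    by move/negP : a01; apply; exact/mem_set.
  move: a01; rewrite /= in_itv /= => /andP[a0 a1].
  transitivity (\int[mu]_(b in `[0%R, (1 - a)%R]) ((A + B * a) + C * b + 0 * b ^+ 2)%:E)%E.
    rewrite [RHS]integral_mkcond; apply: eq_integral => b _.
    rewrite /patch (_ : ((a, b) \in ref_triangle) = (b \in `[0, (1 - a)]%classic)).
      by case: ifP => // _; rewrite mul0r addr0.
    apply/idP/idP => /set_mem h; apply/mem_set; move: h; rewrite /ref_triangle /= in_itv /=.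
      by move=> [_ -> ab] /=; rewrite lerBrDl.
    by move=> /andP[-> ab]; split => //; rewrite -lerBrDl.
  by rewrite integral_quadratic ?subr_ge0 //; congr EFin; field.
by rewrite -Rintegral_mkcond /Rintegral integral_quadratic //=; field.
Qed.

End PlaneLebesgue.

(** * Smooth bump functions *)

Section Bump.
Variable R : realType.

(** Both difference quotients are the same function of [h]. This transfers the one-variable
    differentiation rules to directional derivatives. *)
Lemma is_derive_line (V : normedModType R) (F : V -> R) (x v : V) (t A : R) :
  is_derive t (1 : R) (fun h : R => F (h *: v + x)) A <->
  is_derive (t *: v + x) v F A.
Proof.
have E : (fun h : R => h^-1 *: (((fun h : R => F (h *: v + x)) \o shift t) (h *: (1 : R))
     - F (t *: v + x))) =
   (fun h : R => h^-1 *: ((F \o shift (t *: v + x)) (h *: v) - F (t *: v + x))).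
  apply/funext => h /=.
  by rewrite [h *: (1 : R)]mulr1 scalerDl addrA.
split=> -[d e]; apply: DeriveDef.
- by move: d; rewrite /derivable E.
- by rewrite -e /derive E.
- by rewrite /derivable E.
- by rewrite -e /derive E.
Qed.

(* Up to a polynomial factor in [1/s], the derivatives of [exp(-1/s)] are the
   function itself; extended by 0 to [s <= 0], they form a family closed under
   derivation. *)
Definition flat_exp (p : {poly R}) (s : R) : R :=
  if 0 < s then p.[s^-1] * expR (- s^-1) else 0.

(** With [y = 1/s] one has [d/ds = - y^2 d/dy], and [d/dy (p(y) e^(-y)) = (p'(y) - p(y)) e^(-y)]. *)
Definition flat_exp_deriv (p : {poly R}) : {poly R} := 'X^2 * (p - p^`()).

Lemma horner_bound (p : {poly R}) (y : R) : 1 <= y ->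
  `|p.[y]| <= (\sum_(i < size p) `|p`_i|) * y ^+ size p.
Proof.
move=> y1; rewrite horner_coef mulr_suml (le_trans (ler_norm_sum _ _ _)) //.
apply: ler_sum => i _; rewrite normrM ler_wpM2l // normrX ger0_norm; last first.
  by apply: le_trans y1.
by apply: ler_weXn2l => //; apply/ltnW/ltn_ord.
Qed.

(** One term of the exponential series, [y^(n+2) / (n+2)!] with [n] the size of [p], absorbs the
    polynomial and leaves [s^2]. A quadratic bound is what makes the difference quotient at 0 tend
    to 0. *)
Lemma flat_exp_bound (p : {poly R}) : exists2 C : R, 0 <= C &
  forall s, `|s| <= 1 -> `|flat_exp p s| <= C * s ^+ 2.
Proof.
set n := size p; set S := \sum_(i < n) `|p`_i|.
have S0 : 0 <= S by apply: sumr_ge0.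
exists (S * (n.+2)`!%:R) => [|s s1]; first by rewrite mulr_ge0.
rewrite /flat_exp; case: ifPn => s0; last first.
  by rewrite normr0; apply: mulr_ge0; rewrite ?sqr_ge0 // mulr_ge0.
rewrite gtr0_norm // in s1.
have y1 : 1 <= s^-1 by rewrite invf_ge1.
set y := s^-1 in y1 *.
have y0 : 0 < y by rewrite invr_gt0.
rewrite normrM [`|expR _|]gtr0_norm ?expR_gt0 // expRN.
have Ey : y ^+ n.+2 / (n.+2)`!%:R <= expR y.
  by apply: le_trans (expR_ge1Dxn n.+1 (ltW y0)); rewrite lerDr.
rewrite ler_pdivrMr ?expR_gt0 //; apply: le_trans (horner_bound p y1) _.
have -> : S * (n.+2)`!%:R * s ^+ 2 * expR y = S * ((n.+2)`!%:R * s ^+ 2 * expR y) by rewrite !mulrA.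
apply: ler_wpM2l => //; rewrite -/n.
have -> : y ^+ n = (n.+2)`!%:R * s ^+ 2 * (y ^+ n.+2 / (n.+2)`!%:R).
  rewrite -[s]invrK -/y !exprS; field; rewrite pnatr_eq0 -lt0n fact_gt0.
  by rewrite gt_eqF.
by apply: ler_wpM2l => //; rewrite mulr_ge0 ?sqr_ge0.
Qed.

Lemma is_derive_flat_exp p (s : R) :
  is_derive s 1 (flat_exp p) (flat_exp (flat_exp_deriv p) s).
Proof.
have [s0|s0|<-{s}] := ltgtP 0 s.
- have dV : is_derive s 1 (fun s : R => s^-1) (- s ^- 2).
    have := is_deriveV (lt0r_neq0 s0) (is_derive_id s 1).
    by rewrite /GRing.scale /= mulr1.
  have d1 := is_derive1_comp (is_derive_poly p s^-1) dV.
  have d2 := is_derive1_comp (f := expR) (g := fun s : R => - s^-1) (is_derive_expR _) (is_deriveN dV).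
  have d3 := is_deriveM d1 d2.
  have E : \near s, (horner p \o (fun s : R => s^-1)) s * (expR \o (fun s : R => - s^-1)) s
      = flat_exp p s.
    near=> x; have x0 : 0 < x by near: x; exact: lt_nbhsr.
    by rewrite /flat_exp x0.
  apply: is_derive_eq (near_eq_is_derive E d3) _.
  rewrite /flat_exp s0 /flat_exp_deriv /GRing.scale /= !hornerE /=.
  by field; rewrite gt_eqF.
- have E : \near s, cst 0 s = flat_exp p s.
    near=> x; have x0 : x < 0 by near: x; exact: lt_nbhsl.
    by rewrite /flat_exp ltNge (ltW x0).
  by apply: is_derive_eq (near_eq_is_derive E (is_derive_cst _ _ _)) _; rewrite /flat_exp ltNge (ltW s0).
rewrite {2}/flat_exp ltxx.
have [C C0 hC] := flat_exp_bound p.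
have cv : h^-1 *: (flat_exp p (h *: (1 : R) + 0) - flat_exp p 0) @[h --> 0^'] --> (0 : R).
  apply/cvgrPdist_lt => e e0; near=> h.
  have h0 : h != 0 by near: h; exact: nbhs_dnbhs_neq.
  have h1 : `|h| <= 1.
    by near: h; apply: dnbhs0_le.
  have h2 : `|h| < e / (C + 1).
    by near: h; apply: dnbhs0_lt; rewrite divr_gt0 // ltr_wpDl.
  rewrite {2}/flat_exp ltxx subr0 sub0r normrN addr0 [h *: 1]mulr1 normrM normfV.
  rewrite mulrC ltr_pdivrMr ?normr_gt0 //; apply: le_lt_trans (hC _ h1) _.
  have -> : h ^+ 2 = `|h| * `|h| by rewrite -normrM -expr2 ger0_norm ?sqr_ge0.
  rewrite mulrA ltr_pM2r ?normr_gt0 //.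
  rewrite ltr_pdivlMr ?ltr_wpDl // in h2.
  by apply: le_lt_trans h2; rewrite mulrC ler_wpM2l // lerDl.
apply: DeriveDef; first by apply/cvg_ex; exists 0.
by apply/cvg_lim.
Unshelve. all: by end_near. Qed.

Lemma differentiable_aff2 (l : R * (R * R)) (x : R * R) : differentiable (aff2 l) x.
Proof.
have -> : aff2 l = cst l.1 + dot l.2 by [].
apply: differentiableD; first exact: differentiable_cst.
have lin : linear (dot l.2 : R * R -> R^o).
  by move=> a u v; rewrite /dot /= /GRing.scale /=; ring.
pose lin_mixin := GRing.isLinear.Build R (R * R)%type R^o *:%R (dot l.2) lin.
pose d : {linear (R * R)%type -> R^o} := HB.pack (dot l.2) lin_mixin.
apply: (@linear_differentiable _ _ _ d) => {}x.
rewrite /d /= /dot; apply: cvgD; apply: cvgM; (try exact: cvg_cst).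
  exact: cvg_fst.
exact: cvg_snd.
Qed.

Lemma is_derive_aff2 (l : R * (R * R)) (x v : R * R) : is_derive x v (aff2 l) (dot l.2 v).
Proof.
apply: (@is_derive_expand _ _ _ _ _ _ 0 0) => h.
by rewrite /aff2 /dot /= /GRing.scale /=; ring.
Qed.

(** An algebra of differentiable functions stable under [partial]: smoothness, which asks for all
    iterated partial derivatives, follows by induction on their order. *)
Inductive bump_alg : (R * R -> R) -> Prop :=
| bump_flat p l : bump_alg (fun x => flat_exp p (aff2 l x))
| bump_cst c : bump_alg (fun _ => c)
| bump_add f g : bump_alg f -> bump_alg g -> bump_alg (fun x => f x + g x)
| bump_mul f g : bump_alg f -> bump_alg g -> bump_alg (fun x => f x * g x).

Lemma bump_differentiable f : bump_alg f -> forall x, differentiable f x.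
Proof.
elim=> {f} [p l x|c x|f g _ hf _ hg x|f g _ hf _ hg x].
- apply: (@differentiable_comp _ _ _ _ (aff2 l) (flat_exp p)).
    exact: differentiable_aff2.
  by apply/derivable1_diffP; case: (is_derive_flat_exp p (aff2 l x)).
- exact: differentiable_cst.
- exact: (differentiableD (hf x) (hg x)).
- exact: (differentiableM (hf x) (hg x)).
Qed.

Lemma bump_partial f i : bump_alg f -> bump_alg (partial i f).
Proof.
rewrite /partial; set v : R * R := if _ then _ else _.
elim=> {f} [p l|c|f g bf hf bg hg|f g bf hf bg hg].
- rewrite (_ : 'D_v _ = fun x => flat_exp (flat_exp_deriv p) (aff2 l x) * dot l.2 v).
    by apply: bump_mul; [exact: bump_flat|exact: bump_cst].
  apply/funext => x; apply: derive_val; rewrite -[x]add0r -(scale0r v).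
  apply/is_derive_line.
  have := is_derive1_comp (f := flat_exp p) (g := fun h : R => aff2 l (h *: v + x))
    (is_derive_flat_exp p (aff2 l (0 *: v + x))) ((is_derive_line (aff2 l) x v 0 (dot l.2 v)).2 (is_derive_aff2 l _ v)).
  by [].
- rewrite (_ : 'D_v _ = fun=> 0); first exact: bump_cst.
  by apply/funext => x; exact: derive_cst.
- rewrite (_ : 'D_v _ = fun x => 'D_v f x + 'D_v g x); first exact: bump_add.
  by apply/funext => x; apply: deriveD; apply: diff_derivable; exact: bump_differentiable.
- rewrite (_ : 'D_v _ = fun x => f x * 'D_v g x + g x * 'D_v f x).
    by apply: bump_add; apply: bump_mul.
  by apply/funext => x; apply: deriveM; apply: diff_derivable; exact: bump_differentiable.
Qed.

Lemma bump_smooth f : bump_alg f -> smooth f.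
Proof.
move=> bf s x; apply: bump_differentiable.
by elim: s => //= i s; exact: bump_partial.
Qed.

End Bump.

(** * Green's formula on the pieces of the split *)

Section Quadratic.
Variable R : realType.
Local Notation mu := (@lebesgue_measure R).
Local Notation mu2 := (mu \x mu)%E.

(** Coefficients instead of functions: identities between quadratics become [ring] goals, and
    equality of polynomials becomes equality of coefficients. *)
Record quadr := Quadr { q0 : R; q1 : R; q2 : R; q11 : R; q12 : R; q22 : R }.

Definition qv (c : quadr) (x : R * R) : R :=
  q0 c + q1 c * x.1 + q2 c * x.2 + q11 c * x.1 ^+ 2 + q12 c * (x.1 * x.2) + q22 c * x.2 ^+ 2.

Definition qd1 (c : quadr) := Quadr (q1 c) (2 * q11 c) (q12 c) 0 0 0.
Definition qd2 (c : quadr) := Quadr (q2 c) (q12 c) (2 * q22 c) 0 0 0.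

Definition qlin (k : R) (c d : quadr) := Quadr (k * q0 c + q0 d) (k * q1 c + q1 d)
  (k * q2 c + q2 d) (k * q11 c + q11 d) (k * q12 c + q12 d) (k * q22 c + q22 d).

Lemma qv_lin k c d x : qv (qlin k c d) x = k * qv c x + qv d x.
Proof. by rewrite /qv /=; ring. Qed.

Lemma is_derive_qv c (x v : R * R) :
  is_derive x v (qv c) (qv (qd1 c) x * v.1 + qv (qd2 c) x * v.2).
Proof.
apply: (@is_derive_expand _ _ _ _ _ _ (q11 c * v.1 ^+ 2 + q12 c * (v.1 * v.2) + q22 c * v.2 ^+ 2) 0) => h.
by rewrite /qv /= /GRing.scale /=; ring.
Qed.

Lemma is_derive_qv1 c (a b : R) : is_derive a 1 (fun a => qv c (a, b)) (qv (qd1 c) (a, b)).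
Proof.
apply: (@is_derive_expand _ _ _ _ _ _ (q11 c) 0) => h.
by rewrite /qv /= /GRing.scale /=; ring.
Qed.

Lemma is_derive_qv2 c (a b : R) : is_derive b 1 (fun b => qv c (a, b)) (qv (qd2 c) (a, b)).
Proof.
apply: (@is_derive_expand _ _ _ _ _ _ (q22 c) 0) => h.
by rewrite /qv /= /GRing.scale /=; ring.
Qed.

Lemma continuous_qv c : continuous (qv c).
Proof.
have c1 (k : R) f : continuous f -> continuous (fun x : R * R => k * f x).
  by apply: mul_continuous2; exact: cst_continuous2.
have cx := @fst_continuous2 R; have cy := @snd_continuous2 R.
exact: (add_continuous2 (add_continuous2 (add_continuous2 (add_continuous2 (add_continuous2
  (@cst_continuous2 R (q0 c)) (c1 (q1 c) _ cx)) (c1 (q2 c) _ cy))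
  (c1 (q11 c) _ (mul_continuous2 cx cx))) (c1 (q12 c) _ (mul_continuous2 cx cy)))
  (c1 (q22 c) _ (mul_continuous2 cy cy))).
Qed.

Lemma qv_eq0 c : (forall x, qv c x = 0) -> c = Quadr 0 0 0 0 0 0.
Proof.
move=> h; have e0 := h (0, 0); have e1 := h (1, 0); have e1' := h (-1, 0).
have e2 := h (0, 1); have e2' := h (0, -1); have e3 := h (1, 1).
case: c {h} e0 e1 e1' e2 e2' e3 => a b c d e f; rewrite /qv /= => *.
by congr Quadr; lra.
Qed.

Lemma qv_inj c d : qv c = qv d -> c = d.
Proof.
move=> h; have : qlin (-1) c d = Quadr 0 0 0 0 0 0.
  by apply: qv_eq0 => x; rewrite qv_lin h; ring.
case: c d {h} => [????? ?] [????? ?] [*]; congr Quadr; lra.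
Qed.

(* coordinates with respect to the frame [p, q] at [o]; inverse of [aff o p q] *)
Definition lc (o p q x : R * R) : R * R :=
  (crs (x - o) q / crs p q, crs p (x - o) / crs p q).

Lemma lcK o p q : crs p q != 0 -> cancel (lc o p q) (aff o p q).
Proof.
move: o p q => [r1 r2] [p1 p2] [s1 s2]; rewrite /crs /= => h [x1 x2].
by rewrite /lc /aff /crs /=; apply: injective_projections; rewrite /= /GRing.scale /=; field.
Qed.

Lemma affK o p q : crs p q != 0 -> cancel (aff o p q) (lc o p q).
Proof.
move: o p q => [r1 r2] [p1 p2] [s1 s2]; rewrite /crs /= => h [x1 x2].
by rewrite /lc /aff /crs /=; apply: injective_projections; rewrite /= /GRing.scale /=; field.
Qed.

Definition qcomp (c : quadr) (o p q : R * R) : quadr :=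
  Quadr (qv c o)
    (qv (qd1 c) o * p.1 + qv (qd2 c) o * p.2)
    (qv (qd1 c) o * q.1 + qv (qd2 c) o * q.2)
    (q11 c * p.1 ^+ 2 + q12 c * (p.1 * p.2) + q22 c * p.2 ^+ 2)
    (q11 c * (2 * p.1 * q.1) + q12 c * (p.1 * q.2 + p.2 * q.1) + q22 c * (2 * p.2 * q.2))
    (q11 c * q.1 ^+ 2 + q12 c * (q.1 * q.2) + q22 c * q.2 ^+ 2).

Lemma qv_comp c o p q x : qv (qcomp c o p q) x = qv c (aff o p q x).
Proof.
move: o p q x => [r1 r2] [p1 p2] [s1 s2] [x1 x2].
by rewrite {1}/qv /aff /= /qv /= /GRing.scale /=; ring.
Qed.

Lemma lcE o p q : lc o p q = aff (lc o p q 0) (q.2 / crs p q, - p.2 / crs p q)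
  (- q.1 / crs p q, p.1 / crs p q).
Proof.
apply/funext => x; move: o p q x => [r1 r2] [p1 p2] [s1 s2] [x1 x2].
by rewrite /lc /aff /crs /=; apply: injective_projections; rewrite /= /GRing.scale /=; ring.
Qed.

Lemma continuous_aff o p q : continuous (aff o p q : R * R -> R * R).
Proof.
move=> x; rewrite /aff; apply: cvgD; [apply: cvgD|]; [exact: cvg_cst| |].
  by apply: cvgZ; [exact: cvg_fst|exact: cvg_cst].
by apply: cvgZ; [exact: cvg_snd|exact: cvg_cst].
Qed.

Lemma continuous_comp_aff (F : R * R -> R) o p q : continuous F ->
  continuous (fun x => F (aff o p q x)).
Proof.
move=> cF x; apply: (@continuous_comp _ _ _ (aff o p q) F).
  exact: continuous_aff.
exact: cF.
Qed.

Definition unit_int (f : R -> R) : R := \int[mu]_(a in `[0, 1]) f a.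
Definition square_int (f : R * R -> R) : R := \int[mu2]_(x in @unit_square R) f x.

Lemma unit_integrable (f : R -> R) : continuous f ->
  mu.-integrable `[0, 1]%classic (EFin \o f).
Proof.
move=> cf; apply: continuous_compact_integrable; first exact: segment_compact.
exact: continuous_subspaceT.
Qed.

Lemma unit_int_lin k (f g : R -> R) : continuous f -> continuous g ->
  unit_int (fun a => k * f a + g a) = k * unit_int f + unit_int g.
Proof.
move=> cf cg; rewrite /unit_int RintegralD //=; last 2 first.
  apply: (@unit_integrable (fun a => k * f a)) => a.
  by apply: cvgM; [exact: cvg_cst|exact: cf].
  exact: unit_integrable.
by rewrite RintegralZl //; exact: unit_integrable.
Qed.

Lemma square_int_lin k (f g : R * R -> R) : continuous f -> continuous g ->
  square_int (fun a => k * f a + g a) = k * square_int f + square_int g.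
Proof.
have I (h : R * R -> R) : continuous h -> mu2.-integrable (@unit_square R) (EFin \o h).
  by move=> ch; exact: (continuous_integrable2 (m := 0) (M := 1) (m' := 0) (M' := 1) ch (box_measurable _ _ _ _)).
move=> cf cg; rewrite /square_int RintegralD //=; last 3 first.
- exact: box_measurable.
- apply: (I (fun a => k * f a)).
  by apply: mul_continuous2 => //; exact: cst_continuous2.
- exact: I.
by rewrite RintegralZl //; [exact: box_measurable|exact: I].
Qed.

Lemma square_int_lin4 k (f1 f2 f3 f4 : R * R -> R) : continuous f1 -> continuous f2 ->
  continuous f3 -> continuous f4 ->
  square_int (fun x => k * (f1 x + f2 x - f3 x - f4 x)) =
  k * (square_int f1 + square_int f2 - square_int f3 - square_int f4).
Proof.
move=> c1 c2 c3 c4.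
have cs (l : R) (f g : R * R -> R) : continuous f -> continuous g ->
      continuous (fun x : R * R => l * f x + g x).
  move=> cf; apply: add_continuous2; apply: mul_continuous2 => //; exact: cst_continuous2.
have c0 := @cst_continuous2 R 0.
have d4 := cs (- k) _ _ c4 c0; have d3 := cs (- k) _ _ c3 d4; have d2 := cs k _ _ c2 d3.
transitivity (square_int (fun x => k * f1 x + (k * f2 x + (- k * f3 x + (- k * f4 x + 0))))).
  by congr square_int; apply/funext => x; ring.
rewrite !square_int_lin //.
have -> : square_int (fun=> 0) = 0.
  by rewrite /square_int Rintegral_cst ?mul0r //; exact: box_measurable.
by ring.
Qed.

Lemma unit_FTC (f F : R -> R) : continuous f -> (forall x : R, is_derive x 1 F (f x)) ->
  unit_int f = F 1 - F 0.
Proof. by move=> cf dF; rewrite /unit_int /Rintegral (Rintegral_FTC ler01 cf dF). Qed.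


Lemma eq_unit_int (f g : R -> R) : (forall a, 0 <= a <= 1 -> f a = g a) -> unit_int f = unit_int g.
Proof. by move=> h; apply: eq_Rintegral => a /set_mem /=; rewrite in_itv /= => /h. Qed.

Lemma square_int_by_parts2 P (Y Yb : R * R -> R) : continuous Y -> continuous Yb ->
  (forall a b : R, is_derive b 1 (fun b => Y (a, b)) (Yb (a, b))) ->
  (forall a, 0 <= a <= 1 -> Y (a, 1) = 0) ->
  square_int (fun x => qv P x * Yb x) =
  - square_int (fun x => qv (qd2 P) x * Y x) - unit_int (fun a => qv P (a, 0) * Y (a, 0)).
Proof.
move=> cY cYb dY Y1; have cP := @continuous_qv P; have cP' := @continuous_qv (qd2 P).
have E : square_int (fun x => 1 * (qv P x * Yb x) + qv (qd2 P) x * Y x) =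
    unit_int (fun a => - 1 * (qv P (a, 0) * Y (a, 0)) + 0).
  have dF (a b : R) : is_derive b 1 (fun b => qv P (a, b) * Y (a, b))
      (1 * (qv P (a, b) * Yb (a, b)) + qv (qd2 P) (a, b) * Y (a, b)).
    apply: is_derive_eq (is_deriveM (is_derive_qv2 P a b) (dY a b)) _.
    by rewrite /GRing.scale /=; ring.
  have cF : continuous (fun x => 1 * (qv P x * Yb x) + qv (qd2 P) x * Y x).
    apply: add_continuous2; last exact: mul_continuous2.
    by apply: mul_continuous2; [exact: cst_continuous2|exact: mul_continuous2].
  rewrite /square_int (@unit_square_FTC2 _ (fun x => qv P x * Y x) _ cF dF).
  by apply: eq_unit_int => a /Y1 ->; ring.
move: E; rewrite square_int_lin; [|exact: mul_continuous2..].
rewrite (@unit_int_lin (-1) (fun a => qv P (a, 0) * Y (a, 0)) (fun=> 0)); last 2 first.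
- exact: (continuous_section1 (mul_continuous2 cP cY)).
- by move=> a; exact: cvg_cst.
have -> : unit_int (fun=> 0) = 0 by rewrite /unit_int Rintegral_cst // mul0r.
by move=> E; lra.
Qed.

Lemma square_int_by_parts1 P (Y Ya : R * R -> R) : continuous Y -> continuous Ya ->
  (forall a b : R, is_derive a 1 (fun a => Y (a, b)) (Ya (a, b))) ->
  (forall b, 0 <= b <= 1 -> Y (1, b) = 0) ->
  square_int (fun x => qv P x * Ya x) =
  - square_int (fun x => qv (qd1 P) x * Y x) - unit_int (fun b => qv P (0, b) * Y (0, b)).
Proof.
move=> cY cYa dY Y1; have cP := @continuous_qv P; have cP' := @continuous_qv (qd1 P).
have E : square_int (fun x => 1 * (qv P x * Ya x) + qv (qd1 P) x * Y x) =
    unit_int (fun a => - 1 * (qv P (0, a) * Y (0, a)) + 0).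
  have dF (a b : R) : is_derive a 1 (fun a => qv P (a, b) * Y (a, b))
      (1 * (qv P (a, b) * Ya (a, b)) + qv (qd1 P) (a, b) * Y (a, b)).
    apply: is_derive_eq (is_deriveM (is_derive_qv1 P a b) (dY a b)) _.
    by rewrite /GRing.scale /=; ring.
  have cF : continuous (fun x => 1 * (qv P x * Ya x) + qv (qd1 P) x * Y x).
    apply: add_continuous2; last exact: mul_continuous2.
    by apply: mul_continuous2; [exact: cst_continuous2|exact: mul_continuous2].
  rewrite /square_int (@unit_square_FTC1 _ (fun x => qv P x * Y x) _ cF dF).
  by apply: eq_unit_int => a /Y1 ->; ring.
move: E; rewrite square_int_lin; [|exact: mul_continuous2..].
rewrite (@unit_int_lin (-1) (fun a => qv P (0, a) * Y (0, a)) (fun=> 0)); last 2 first.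
- exact: (continuous_section2 (mul_continuous2 cP cY)).
- by move=> a; exact: cvg_cst.
have -> : unit_int (fun=> 0) = 0 by rewrite /unit_int Rintegral_cst // mul0r.
by move=> E; lra.
Qed.

Lemma unit_int_by_parts (f df g dg : R -> R) : continuous df -> continuous dg ->
  (forall x : R, is_derive x 1 f (df x)) -> (forall x : R, is_derive x 1 g (dg x)) ->
  unit_int (fun a => f a * dg a) = f 1 * g 1 - f 0 * g 0 - unit_int (fun a => df a * g a).
Proof.
move=> cdf cdg hf hg.
have cf : continuous f.
  move=> x; apply: differentiable_continuous; apply/derivable1_diffP.
  by case: (hf x).
have cg : continuous g.
  move=> x; apply: differentiable_continuous; apply/derivable1_diffP.
  by case: (hg x).
have cm (u v : R -> R) : continuous u -> continuous v -> continuous (fun a => u a * v a).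
  by move=> cu cv a; apply: cvgM; [exact: cu|exact: cv].
have E : unit_int (fun a => 1 * (f a * dg a) + df a * g a) = f 1 * g 1 - f 0 * g 0.
  have dF (x : R) : is_derive x 1 (fun x => f x * g x) (1 * (f x * dg x) + df x * g x).
    by apply: is_derive_eq (is_deriveM (hf x) (hg x)) _; rewrite /GRing.scale /=; ring.
  apply: (unit_FTC _ dF) => a; apply: cvgD; last exact: (cm _ _ cdf cg).
  by apply: cvgM; [exact: cvg_cst|exact: (cm _ _ cf cdg)].
by rewrite -E unit_int_lin; [ring|exact: cm..].
Qed.

(* Iterated integration by parts against a function vanishing near the sides
   [a = 1] and [b = 1] of the unit square. *)
Lemma square_int_green (Pii Pij Pjj : quadr) (Y Ya Yb Yaa Yab Yba Ybb : R * R -> R) :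
  [/\ continuous Y, continuous Ya & continuous Yb] ->
  [/\ continuous Yaa, continuous Yab, continuous Yba & continuous Ybb] ->
  (forall a b : R, is_derive a 1 (fun a => Y (a, b)) (Ya (a, b))) ->
  (forall a b : R, is_derive b 1 (fun b => Y (a, b)) (Yb (a, b))) ->
  (forall a b : R, is_derive a 1 (fun a => Ya (a, b)) (Yaa (a, b))) ->
  (forall a b : R, is_derive b 1 (fun b => Ya (a, b)) (Yba (a, b))) ->
  (forall a b : R, is_derive a 1 (fun a => Yb (a, b)) (Yab (a, b))) ->
  (forall a b : R, is_derive b 1 (fun b => Yb (a, b)) (Ybb (a, b))) ->
  (forall a, 0 <= a <= 1 -> [/\ Y (a, 1) = 0, Ya (a, 1) = 0 & Yb (a, 1) = 0]) ->
  (forall b, 0 <= b <= 1 -> [/\ Y (1, b) = 0, Ya (1, b) = 0 & Yb (1, b) = 0]) ->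
  square_int (fun x => qv Pii x * Ybb x) + square_int (fun x => qv Pjj x * Yaa x)
  - square_int (fun x => qv Pij x * Yab x) - square_int (fun x => qv Pij x * Yba x) =
  (2 * q22 Pii + 2 * q11 Pjj - 2 * q12 Pij) * square_int Y
  + unit_int (fun a => qv (qd2 Pii) (a, 0) * Y (a, 0))
  - 2 * unit_int (fun a => qv (qd1 Pij) (a, 0) * Y (a, 0))
  - unit_int (fun a => qv Pii (a, 0) * Yb (a, 0))
  + unit_int (fun b => qv (qd1 Pjj) (0, b) * Y (0, b))
  - 2 * unit_int (fun b => qv (qd2 Pij) (0, b) * Y (0, b))
  - unit_int (fun b => qv Pjj (0, b) * Ya (0, b))
  - 2 * (qv Pij (0, 0) * Y (0, 0)).
Proof.
move=> [cY cYa cYb] [cYaa cYab cYba cYbb] da db daa dba dab dbb z1 z2.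
have c1 := continuous_section1; have c2 := continuous_section2.
have cst (k : quadr) f c : (forall x, qv k x = c) -> continuous f ->
    square_int (fun x => qv k x * f x) = c * square_int f.
  move=> h cf; under [in LHS]eq_fun do rewrite h -[_ * _]addr0.
  rewrite (@square_int_lin c f (fun=> 0)) //; last exact: cst_continuous2.
  by rewrite {2}/square_int Rintegral_cst ?mul0r ?addr0 //; exact: box_measurable.
(* Each second derivative is moved onto the polynomial in two steps. The two mixed terms are treated
   in opposite orders, so no symmetry of mixed derivatives is invoked. *)
rewrite (square_int_by_parts2 Pii cYb cYbb dbb); last by move=> a /z1[].
rewrite (square_int_by_parts2 (qd2 Pii) cY cYb db); last by move=> a /z1[].
rewrite (square_int_by_parts1 Pjj cYa cYaa daa); last by move=> a /z2[].
rewrite (square_int_by_parts1 (qd1 Pjj) cY cYa da); last by move=> a /z2[].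
rewrite (square_int_by_parts1 Pij cYb cYab dab); last by move=> a /z2[].
rewrite (square_int_by_parts2 (qd1 Pij) cY cYb db); last by move=> a /z1[].
rewrite (square_int_by_parts2 Pij cYa cYba dba); last by move=> a /z1[].
rewrite (square_int_by_parts1 (qd2 Pij) cY cYa da); last by move=> a /z2[].
have cPij := @continuous_qv Pij.
(* The derivatives of [Y] left on the sides [a = 0] and [b = 0] by the mixed terms are tangential;
   integrating them by parts produces the corner value twice. *)
have E1 : unit_int (fun b => qv Pij (0, b) * Yb (0, b)) = _ :=
  @unit_int_by_parts _ _ _ _ (c2 _ 0 _ (@continuous_qv (qd2 Pij))) (c2 _ 0 _ cYb)
  (fun b => is_derive_qv2 Pij 0 b) (db 0).
have E2 : unit_int (fun a => qv Pij (a, 0) * Ya (a, 0)) = _ :=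
  @unit_int_by_parts _ _ _ _ (c1 _ 0 _ (@continuous_qv (qd1 Pij))) (c1 _ 0 _ cYa)
  (fun a => is_derive_qv1 Pij a 0) (da ^~ 0).
rewrite E1 E2.
have i01 : ((0 : R) <= (0 : R)) && ((0 : R) <= (1 : R)).
  by rewrite lexx; exact: ler01.
have [-> _ _] := z1 0 i01; have [-> _ _] := z2 0 i01.
rewrite (cst _ _ (2 * q22 Pii)) //; last by move=> x; rewrite /qv /=; ring.
rewrite (cst _ _ (2 * q11 Pjj)) //; last by move=> x; rewrite /qv /=; ring.
rewrite (cst _ _ (q12 Pij)) //; last by move=> x; rewrite /qv /=; ring.
rewrite (cst _ _ (q12 Pij)) //; last by move=> x; rewrite /qv /=; ring.
ring.
Qed.

End Quadratic.

(** * Smooth functions in a frame and Green's formula on one piece *)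

Section SmoothGreen.
Variable R : realType.
Local Notation mu := (@lebesgue_measure R).
Local Notation mu2 := (mu \x mu)%E.
Implicit Types (phi : R * R -> R) (o p q v w : R * R).

Lemma smooth_partial i phi : smooth phi -> smooth (partial i phi).
Proof.
move=> h s x; have := h (rcons s i) x.
by rewrite -cats1 foldr_cat.
Qed.

Lemma smooth_differentiable phi x : smooth phi -> differentiable phi x.
Proof. by move=> h; exact: (h [::]). Qed.

Lemma smooth_continuous phi : smooth phi -> continuous phi.
Proof. by move=> h x; apply: differentiable_continuous; exact: smooth_differentiable. Qed.

(** Expressed through [partial], because smoothness is stated with iterated partial derivatives and
    thereby passes to [dirn v phi]. *)
Definition dirn v phi (x : R * R) : R :=
  v.1 * partial ord0 phi x + v.2 * partial ord_max phi x.

Lemma is_derive_dirn v phi x : smooth phi -> is_derive x v phi (dirn v phi x).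
Proof.
move=> /(smooth_differentiable x) df.
apply: DeriveDef; first exact: diff_derivable.
rewrite deriveE // /dirn /partial !deriveE //.
rewrite -[X in 'd phi x X](_ : v.1 *: (1, 0) + v.2 *: (0, 1) = v); last first.
  by apply: injective_projections; rewrite /= /GRing.scale /=; ring.
by rewrite linearD !linearZ.
Qed.

Lemma smooth_lin (k l : R) phi psi : smooth phi -> smooth psi ->
  smooth (fun x => k * phi x + l * psi x).
Proof.
move=> hf hg s.
suff -> : foldr (@partial R) (fun x => k * phi x + l * psi x) s =
    (k *: foldr (@partial R) phi s) + (l *: foldr (@partial R) psi s).
  by move=> x; apply: differentiableD; apply: differentiableZ; [exact: hf|exact: hg].
elim: s => //= i s ->; apply/funext => x; rewrite /partial deriveD; last 2 first.
- by apply: diff_derivable; apply: differentiableZ; exact: hf.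
- by apply: diff_derivable; apply: differentiableZ; exact: hg.
by rewrite !deriveZ //; apply: diff_derivable; [exact: hg|exact: hf].
Qed.

Lemma smooth_dirn v phi : smooth phi -> smooth (dirn v phi).
Proof. by move=> h; apply: smooth_lin; exact: smooth_partial. Qed.

Lemma partial_lin i (k l : R) phi psi x : smooth phi -> smooth psi ->
  partial i (fun x => k * phi x + l * psi x) x = k * partial i phi x + l * partial i psi x.
Proof.
move=> hf hg; rewrite /partial.
rewrite (_ : (fun _ => _) = (k *: phi) + (l *: psi)) // deriveD; last 2 first.
- by apply: diff_derivable; apply: differentiableZ; exact: smooth_differentiable.
- by apply: diff_derivable; apply: differentiableZ; exact: smooth_differentiable.
by rewrite !deriveZ //; apply: diff_derivable; exact: smooth_differentiable.
Qed.

Lemma partial_support (S : set (R * R)) i phi : closed S ->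
  (forall x, ~ S x -> phi x = 0) -> forall x, ~ S x -> partial i phi x = 0.
Proof.
move=> cS h x Sx; rewrite /partial.
have E : \near x, cst 0 x = phi x.
  have : nbhs x (~` S) by apply: open_nbhs_nbhs; split => //; exact: closed_openC.
  by apply: filterS => y /h ->.
by rewrite -(near_eq_derive _ E) derive_cst.
Qed.

Lemma dirn_support (S : set (R * R)) v phi : closed S ->
  (forall x, ~ S x -> phi x = 0) -> forall x, ~ S x -> dirn v phi x = 0.
Proof.
by move=> cS h x Sx; rewrite /dirn !(partial_support _ cS h) // !mulr0 addr0.
Qed.

Lemma is_derive_aff1 phi o p q (a b : R) : smooth phi ->
  is_derive a 1 (fun a => phi (aff o p q (a, b))) (dirn p phi (aff o p q (a, b))).
Proof.
move=> h; have E c : aff o p q (c, b) = c *: p + (o + b *: q).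
  by rewrite /aff /= addrCA addrA.
rewrite E; under eq_fun do rewrite E.
by apply/is_derive_line; exact: is_derive_dirn.
Qed.

Lemma is_derive_aff2' phi o p q (a b : R) : smooth phi ->
  is_derive b 1 (fun b => phi (aff o p q (a, b))) (dirn q phi (aff o p q (a, b))).
Proof.
move=> h; have E c : aff o p q (a, c) = c *: q + (o + a *: p).
  by rewrite /aff /= addrC.
rewrite E; under eq_fun do rewrite E.
by apply/is_derive_line; exact: is_derive_dirn.
Qed.

Definition tri o p q : set (R * R) := aff o p q @` @ref_triangle R.

Lemma triE o p q : crs p q != 0 -> tri o p q = lc o p q @^-1` @ref_triangle R.
Proof.
move=> h; apply/seteqP; split => [_ [y yT <-]|x xT] /=; first by rewrite affK.
by exists (lc o p q x) => //; rewrite lcK.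
Qed.

Lemma aff_preimage_tri o p q : crs p q != 0 -> aff o p q @^-1` tri o p q = @ref_triangle R.
Proof.
move=> h; rewrite triE //; apply/seteqP; split => x /=; by rewrite affK.
Qed.

Lemma tri_measurable o p q : crs p q != 0 ->
  measurable (tri o p q : set (measurableTypeR R * measurableTypeR R)).
Proof.
move=> h; rewrite triE // lcE.
set X := aff _ _ _; have c0 : crs (q.2 / crs p q, - p.2 / crs p q)
    (- q.1 / crs p q, p.1 / crs p q) != 0.
  rewrite (_ : crs _ _ = (crs p q)^-1) ?invr_eq0 //.
  by move: h; rewrite /crs /= => h; field.
have [_ mX _] := @scales_area_aff R (lc o p q 0) _ _ c0.
by rewrite -[X in measurable X]setTI; apply: mX => //; exact: ref_triangle_measurable.
Qed.

Lemma tri_box o p q : exists m M m' M', tri o p q `<=` box m M m' M'.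
Proof.
have : compact (aff o p q @` @box R 0 1 0 1).
  apply: continuous_compact; last exact: box_compact.
  by apply: continuous_subspaceT; exact: continuous_aff.
move=> /compact_bounded[N [_ /(_ (N + 1))]]; rewrite ltrDl ltr01 => /(_ isT) HN.
exists (- (N + 1)), (N + 1), (- (N + 1)), (N + 1) => _ [x /ref_triangle_box xb <-].
have : `|aff o p q x| <= N + 1 by apply: HN; exists x.
by rewrite prod_normE ge_max => /andP[x1 x2]; split; rewrite /= in_itv /= -ler_norml.
Qed.

(** Since [F] vanishes beyond the side opposite to [o], the reference triangle can be enlarged to
    the unit square, where the limits of integration are constant. *)
Lemma Rintegral_tri (F : R * R -> R) o p q : 0 < crs p q -> continuous F ->
  (forall x, 0 <= x.1 -> 0 <= x.2 -> 1 <= x.1 + x.2 -> F (aff o p q x) = 0) ->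
  \int[mu2]_(x in tri o p q) F x = crs p q * square_int (fun x => F (aff o p q x)).
Proof.
move=> c0 cF F0; have c0' : crs p q != 0 by rewrite gt_eqF.
have [m [M [m' [M' hb]]]] := tri_box o p q.
rewrite (Rintegral_scales_area (scales_area_aff o c0')) //; last 2 first.
- exact: tri_measurable.
- by apply: (continuous_integrable2 cF _ hb); exact: tri_measurable.
rewrite gtr0_norm // aff_preimage_tri // Rintegral_mkcond /square_int [in RHS]Rintegral_mkcond.
congr (_ * _); apply: eq_Rintegral => x _; rewrite /patch.
case: ifPn => [/set_mem/ref_triangle_box/mem_set->//|/negP xT].
case: ifPn => // /set_mem[/=]; rewrite !in_itv /= => /andP[x1 _] /andP[x2 _].
rewrite F0 //; rewrite leNgt; apply/negP => x12; apply: xT; apply/mem_set.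
by split => //; exact: ltW.
Qed.

(* [u11, u12, u22] are the entries of a symmetric matrix field *)
Definition qform (u11 u12 u22 : quadr R) v w : quadr R :=
  qlin (v.1 * w.1) u11 (qlin (v.1 * w.2 + v.2 * w.1) u12 (qlin (v.2 * w.2) u22 (Quadr 0 0 0 0 0 0))).

Lemma qv_qform u11 u12 u22 v w x : qv (qform u11 u12 u22 v w) x =
  v.1 * w.1 * qv u11 x + (v.1 * w.2 + v.2 * w.1) * qv u12 x + v.2 * w.2 * qv u22 x.
Proof. by rewrite /qform !qv_lin {4}/qv /=; ring. Qed.

Definition sven_pairing (u11 u12 u22 : quadr R) phi x : R :=
  qv u11 x * partial ord_max (partial ord_max phi) x
  + qv u22 x * partial ord0 (partial ord0 phi) x
  - qv u12 x * partial ord0 (partial ord_max phi) x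
  - qv u12 x * partial ord_max (partial ord0 phi) x.

Lemma dirn_dirn v w phi x : smooth phi -> dirn v (dirn w phi) x =
  v.1 * w.1 * partial ord0 (partial ord0 phi) x + v.1 * w.2 * partial ord0 (partial ord_max phi) x
  + v.2 * w.1 * partial ord_max (partial ord0 phi) x
  + v.2 * w.2 * partial ord_max (partial ord_max phi) x.
Proof.
move=> h; have hp i := smooth_partial i h.
rewrite {1}/dirn (_ : dirn w phi = fun x => w.1 * partial ord0 phi x + w.2 * partial ord_max phi x) //.
rewrite !partial_lin //.
move: (partial ord0 (partial ord0 phi) x) (partial ord0 (partial ord_max phi) x) => a b.
move: (partial ord_max (partial ord0 phi) x) (partial ord_max (partial ord_max phi) x) => c d.
by ring.
Qed.

(** The pairing contracts the field with the adjugate of the Hessian; passing to the frame [[p, q]]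
    multiplies this contraction by the square of the determinant [crs p q]. *)
Lemma sven_pairing_frame u11 u12 u22 phi p q x : smooth phi -> crs p q != 0 ->
  sven_pairing u11 u12 u22 phi x = (crs p q ^+ 2)^-1 *
  (qv (qform u11 u12 u22 p p) x * dirn q (dirn q phi) x
   + qv (qform u11 u12 u22 q q) x * dirn p (dirn p phi) x
   - qv (qform u11 u12 u22 p q) x * dirn p (dirn q phi) x
   - qv (qform u11 u12 u22 p q) x * dirn q (dirn p phi) x).
Proof.
move=> h c0; rewrite /sven_pairing !qv_qform !dirn_dirn //.
(* The two mixed derivatives [b] and [c] are kept as independent unknowns, so the identity is purely
   algebraic. *)
have H (a b c d m n k : R) (v w : R * R) : crs v w != 0 ->
  m * d + k * a - n * b - n * c = (crs v w ^+ 2)^-1 *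
  ((v.1 * v.1 * m + (v.1 * v.2 + v.2 * v.1) * n + v.2 * v.2 * k) *
     (w.1 * w.1 * a + w.1 * w.2 * b + w.2 * w.1 * c + w.2 * w.2 * d) +
   (w.1 * w.1 * m + (w.1 * w.2 + w.2 * w.1) * n + w.2 * w.2 * k) *
     (v.1 * v.1 * a + v.1 * v.2 * b + v.2 * v.1 * c + v.2 * v.2 * d) -
   (v.1 * w.1 * m + (v.1 * w.2 + v.2 * w.1) * n + v.2 * w.2 * k) *
     (v.1 * w.1 * a + v.1 * w.2 * b + v.2 * w.1 * c + v.2 * w.2 * d) -
   (v.1 * w.1 * m + (v.1 * w.2 + v.2 * w.1) * n + v.2 * w.2 * k) *
     (w.1 * v.1 * a + w.1 * v.2 * b + w.2 * v.1 * c + w.2 * v.2 * d)).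
  by move: v w => [v1 v2] [w1 w2]; rewrite /crs /= => k0; field; exact: k0.
exact: H.
Qed.

(* Contribution of the ray [o + R+ p] to the Green formula on the piece with
   frame [p, q]: [Ppp], [Ppq] are the components along the ray and [n] is the
   derivative of the former in the direction [q]. *)
Definition ray_term (f n dg : R -> R) o p q phi : R :=
  unit_int (fun a => n a * phi (o + a *: p)) - 2 * unit_int (fun a => dg a * phi (o + a *: p))
  - unit_int (fun a => f a * dirn q phi (o + a *: p)).

(** [square_int_green] in the coordinates of the frame. The change of variables gives one factor
    [crs p q], the pairing two in the denominator. The set [S] is closed so that derivatives of
    [phi] vanish off it as well. *)
Lemma piece_green (u11 u12 u22 : quadr R) phi (S : set (R * R)) o p q :
  0 < crs p q -> smooth phi -> closed S -> (forall x, ~ S x -> phi x = 0) ->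
  (forall x, 0 <= x.1 -> 0 <= x.2 -> 1 <= x.1 + x.2 -> ~ S (aff o p q x)) ->
  let P v w := qcomp (qform u11 u12 u22 v w) o p q in
  \int[mu2]_(x in tri o p q) sven_pairing u11 u12 u22 phi x =
  (2 * q22 (P p p) + 2 * q11 (P q q) - 2 * q12 (P p q)) / crs p q ^+ 2
    * \int[mu2]_(x in tri o p q) phi x
  + (crs p q)^-1 *
    (ray_term (fun a => qv (P p p) (a, 0)) (fun a => qv (qd2 (P p p)) (a, 0))
       (fun a => qv (qd1 (P p q)) (a, 0)) o p q phi
     + ray_term (fun b => qv (P q q) (0, b)) (fun b => qv (qd1 (P q q)) (0, b))
       (fun b => qv (qd2 (P p q)) (0, b)) o q p phi
     - 2 * (qv (P p q) (0, 0) * phi o)).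
Proof.
move=> c0 sphi cS phi0 hS P.
have c0' : crs p q != 0 by rewrite gt_eqF.
have sp := smooth_dirn p sphi; have sq := smooth_dirn q sphi.
have spp := smooth_dirn p sp; have sqq := smooth_dirn q sq.
have spq := smooth_dirn p sq; have sqp := smooth_dirn q sp.
have zp := fun x => @dirn_support S p phi cS phi0 x; have zq := fun x => @dirn_support S q phi cS phi0 x.
have co psi : smooth psi -> continuous (fun x => psi (aff o p q x)).
  by move=> /smooth_continuous; exact: continuous_comp_aff.
have cu (c : quadr R) psi : smooth psi -> continuous (fun x => qv c x * psi x).
  by move=> /smooth_continuous; apply: mul_continuous2; exact: continuous_qv.
have cuo (c : quadr R) psi : smooth psi ->
    continuous (fun x => qv (qcomp c o p q) x * psi (aff o p q x)).
  by move=> /co; apply: mul_continuous2; exact: continuous_qv.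
have sn i j : smooth (partial i (partial j phi)) by apply: smooth_partial; exact: smooth_partial.
have cs : continuous (sven_pairing u11 u12 u22 phi).
  have so := fun c i j => opp_continuous2 (cu c _ (sn i j)).
  exact: (add_continuous2 (add_continuous2 (add_continuous2 (cu u11 _ (sn ord_max ord_max))
    (cu u22 _ (sn ord0 ord0))) (so u12 ord0 ord_max)) (so u12 ord_max ord0)).
rewrite (Rintegral_tri c0 cs); last first.
  move=> x x1 x2 x12; have Sx := hS x x1 x2 x12.
  have z i := @partial_support S i phi cS phi0.
  have zz i j := @partial_support S i (partial j phi) cS (z j).
  by rewrite /sven_pairing !zz // !mulr0 !subr0 addr0.
rewrite (Rintegral_tri c0 (smooth_continuous sphi)); last first.
  by move=> x x1 x2 x12; apply: phi0; exact: hS.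
have -> : square_int (fun x => sven_pairing u11 u12 u22 phi (aff o p q x)) =
  (crs p q ^+ 2)^-1 *
  (square_int (fun x => qv (P p p) x * dirn q (dirn q phi) (aff o p q x))
   + square_int (fun x => qv (P q q) x * dirn p (dirn p phi) (aff o p q x))
   - square_int (fun x => qv (P p q) x * dirn p (dirn q phi) (aff o p q x))
   - square_int (fun x => qv (P p q) x * dirn q (dirn p phi) (aff o p q x))).
  have c1 := cuo (qform u11 u12 u22 p p) _ sqq.
  have c2 := cuo (qform u11 u12 u22 q q) _ spp.
  have c3 := cuo (qform u11 u12 u22 p q) _ spq.
  have c4 := cuo (qform u11 u12 u22 p q) _ sqp.
  rewrite -square_int_lin4 //; apply: (congr1 (@square_int R)); apply/funext => x.
  by rewrite (sven_pairing_frame _ _ _ _ sphi c0') -!qv_comp.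
have F := square_int_green (P p p) (P p q) (P q q)
  (And3 (co _ sphi) (co _ sp) (co _ sq)) (And4 (co _ spp) (co _ spq) (co _ sqp) (co _ sqq))
  (fun a b => is_derive_aff1 o p q a b sphi) (fun a b => is_derive_aff2' o p q a b sphi)
  (fun a b => is_derive_aff1 o p q a b sp) (fun a b => is_derive_aff2' o p q a b sp)
  (fun a b => is_derive_aff1 o p q a b sq) (fun a b => is_derive_aff2' o p q a b sq).
rewrite F.
- have E1 a : aff o p q (a, 0) = o + a *: p by rewrite /aff /= scale0r addr0.
  have E2 b : aff o p q (0, b) = o + b *: q by rewrite /aff /= scale0r addr0.
  have E0 : aff o p q (0, 0) = o by rewrite E1 scale0r addr0.
  have U1 f psi : unit_int (fun a => f a * psi (aff o p q (a, 0))) =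
      unit_int (fun a => f a * psi (o + a *: p)).
    by congr unit_int; apply/funext => a; rewrite E1.
  have U2 f psi : unit_int (fun b => f b * psi (aff o p q (0, b))) =
      unit_int (fun b => f b * psi (o + b *: q)).
    by congr unit_int; apply/funext => b; rewrite E2.
  rewrite (U1 (fun a => qv (qd2 (P p p)) (a, 0)) phi) (U1 (fun a => qv (qd1 (P p q)) (a, 0)) phi).
  rewrite (U1 (fun a => qv (P p p) (a, 0)) (dirn q phi)).
  rewrite (U2 (fun b => qv (qd1 (P q q)) (0, b)) phi) (U2 (fun b => qv (qd2 (P p q)) (0, b)) phi).
  rewrite (U2 (fun b => qv (P q q) (0, b)) (dirn p phi)) E0 /ray_term.
  have H (c g s x1 x2 x3 y1 y2 y3 z : R) : c != 0 ->
    c * (c ^- 2 * (g * s + x1 - 2 * x2 - x3 + y1 - 2 * y2 - y3 - 2 * z)) =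
    g / c ^+ 2 * (c * s) + c^-1 * (x1 - 2 * x2 - x3 + (y1 - 2 * y2 - y3) - 2 * z).
    by move=> ?; field.
  exact: H.
- move=> a /andP[a0 _]; have Sx := hS (a, 1) a0 ler01 (_ : _ <= a + 1).
  by rewrite phi0 ?zp ?zq //; apply: Sx; rewrite lerDr.
- move=> b /andP[b0 _]; have Sx := hS (1, b) ler01 b0 (_ : _ <= 1 + b).
  by rewrite phi0 ?zp ?zq //; apply: Sx; rewrite lerDl.
Qed.


(* The boundary terms of the two pieces [p, q] and [r, p] sharing the ray of [p]. *)
Lemma ray_sum (f df g1 dg1 g2 dg2 n1 n2 : R -> R) phi o p q (r : R * R) (al1 al2 be : R) :
  smooth phi -> al1 != 0 -> al2 != 0 ->
  be *: p + al1 *: q + al2 *: r = 0 -> phi (o + p) = 0 ->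
  (forall x : R, is_derive x 1 f (df x)) ->
  (forall x : R, is_derive x 1 g1 (dg1 x)) -> (forall x : R, is_derive x 1 g2 (dg2 x)) ->
  (forall x, be * f x + al1 * g1 x + al2 * g2 x = 0) ->
  [/\ continuous df, continuous dg1, continuous dg2, continuous n1 & continuous n2] ->
  al2^-1 * ray_term f n1 dg1 o p q phi + al1^-1 * ray_term f n2 dg2 o p r phi =
  (al1 * al2)^-1 *
   (unit_int (fun a => (al1 * n1 a + al2 * n2 a + be * df a) * phi (o + a *: p))
    - be * (f 0 * phi o)).
Proof.
move=> sphi a1 a2 lin phi1 hf h1 h2 hfg [cdf cdg1 cdg2 cn1 cn2].
have cm (u v : R -> R) : continuous u -> continuous v -> continuous (fun a => u a * v a).
  by move=> cu cv a; apply: cvgM; [exact: cu|exact: cv].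
have cl psi : smooth psi -> continuous (fun a : R => psi (o + a *: p)).
  move=> sp; rewrite (_ : (fun a => _) = (fun a => psi (aff o p 0 (a, 0)))).
    exact: (@continuous_section1 R 0 (fun x => psi (aff o p 0 x))
      (@continuous_comp_aff R psi o p 0 (smooth_continuous sp))).
  by apply/funext => a; rewrite /aff /= scaler0 addr0.
have cphi := cl _ sphi.
have cp v := cl _ (smooth_dirn v sphi).
have cf : continuous f.
  move=> x; apply: differentiable_continuous; apply/derivable1_diffP.
  by case: (hf x).
have dphi (x : R) : is_derive x 1 (fun a : R => phi (o + a *: p)) (dirn p phi (o + x *: p)).
  have := is_derive_aff1 o p 0 x 0 sphi.
  have E a : aff o p 0 (a, 0) = o + a *: p by rewrite /aff /= scaler0 addr0.
  by rewrite E; under eq_fun do rewrite E.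
have L k (u v w : R -> R) : continuous u -> continuous v -> (forall a, w a = k * u a + v a) ->
    unit_int w = k * unit_int u + unit_int v.
  move=> cu cv h; rewrite -unit_int_lin //; congr unit_int; exact/funext.
have Z (u : R -> R) : (forall a, u a = 0) -> unit_int u = 0.
  move=> h; rewrite (_ : u = fun=> 0); last exact/funext.
  by rewrite /unit_int Rintegral_cst // mul0r.
pose I (u : R -> R) := unit_int (fun a => u a * phi (o + a *: p)).
pose D v := unit_int (fun a => f a * dirn v phi (o + a *: p)).
have cst0 : continuous (fun _ : R => (0 : R)) by move=> x; exact: cvg_cst.
have L3 k1 k2 k3 (u1 u2 u3 w : R -> R) : continuous u1 -> continuous u2 -> continuous u3 ->
    (forall a, w a = k1 * u1 a + k2 * u2 a + k3 * u3 a) ->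
    unit_int w = k1 * unit_int u1 + k2 * unit_int u2 + k3 * unit_int u3.
  move=> c1 c2 c3 hw.
  have ck (k : R) (u : R -> R) : continuous u -> continuous (fun a : R => k * u a + 0).
    by move=> cu a; apply: cvgD; [apply: cvgM; [exact: cvg_cst|exact: cu]|exact: cvg_cst].
  have ck2 : continuous (fun a : R => k2 * u2 a + (k3 * u3 a + 0)).
    by move=> a; apply: cvgD; [apply: cvgM; [exact: cvg_cst|exact: c2]|exact: ck].
  rewrite (L k1 u1 _ w c1 ck2) => [|a]; last by rewrite hw; ring.
  rewrite unit_int_lin //; last exact: ck.
  by rewrite unit_int_lin // (Z (fun=> 0)) // addr0 addrA.
have E1 : I (fun a => al1 * n1 a + al2 * n2 a + be * df a) = al1 * I n1 + al2 * I n2 + be * I df.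
  by apply: L3; [exact: cm..|move=> a; ring].
have hder x : be * df x + al1 * dg1 x + al2 * dg2 x = 0.
  have d0 : is_derive x 1 (fun x => be * f x + al1 * g1 x + al2 * g2 x)
      (be * df x + al1 * dg1 x + al2 * dg2 x).
    have kd (k : R) (u : R -> R) (du : R) : is_derive x 1 u du -> is_derive x 1 (fun x => k * u x) (k * du).
      by move=> hu; have := is_deriveZ k hu.
    exact: is_deriveD (is_deriveD (kd _ _ _ (hf x)) (kd _ _ _ (h1 x))) (kd _ _ _ (h2 x)).
  rewrite -(derive_val (is_derive := d0)) (_ : (fun _ => _) = cst 0) ?derive_cst //.
  by apply/funext => y; rewrite hfg.
have E2 : be * I df + al1 * I dg1 + al2 * I dg2 = 0.
  rewrite -[RHS](Z (fun=> 0)) //; apply/esym; apply: L3; [exact: cm..|move=> a].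
  by rewrite -[LHS](mul0r (phi (o + a *: p))) -(hder a); ring.
(* Directional derivatives are linear in the direction, so the relation between [p], [q], [r] passes
   to the integrals [D]. *)
have E3 : be * D p + al1 * D q + al2 * D r = 0.
  rewrite -[RHS](Z (fun=> 0)) //; apply/esym; apply: L3; [by apply: cm => //; exact: cp..|move=> a].
  have := congr1 fst lin; have := congr1 snd lin; rewrite /= /GRing.scale /= => l2 l1.
  rewrite /dirn; move: (partial _ _ _) (partial _ _ _) (f a) => x y z.
  transitivity (z * ((be * p.1 + al1 * q.1 + al2 * r.1) * y
    + (be * p.2 + al1 * q.2 + al2 * r.2) * x)); last by ring.
  by rewrite l1 l2; ring.
(* The direction [p] is tangential to the ray: integrate by parts, with [phi] vanishing at the end
   [o + p]. *)
have E4 : D p = - (f 0 * phi o) - I df.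
  rewrite /D (@unit_int_by_parts _ f df (fun a => phi (o + a *: p)) _ cdf (cp p) hf dphi).
  by rewrite scale1r phi1 scale0r addr0 mulr0 sub0r.
rewrite /ray_term -/(I n1) -/(I n2) -/(I dg1) -/(I dg2) -/(D q) -/(D r) -/(I _) E1.
move: (I n1) (I n2) (I dg1) (I dg2) (I df) (D p) (D q) (D r) (f 0 * phi o) E2 E3 E4.
move=> x1 x2 y1 y2 z d e1 e2 w E2 E3 E4.
have -> : y1 = - (be * z + al2 * y2) / al1.
  by apply: (mulfI a1); rewrite [RHS]mulrC divfK //; move: E2; lra.
have -> : e1 = - (be * d + al2 * e2) / al1.
  by apply: (mulfI a1); rewrite [RHS]mulrC divfK //; move: E3; lra.
rewrite E4; field; exact/andP.
Qed.

End SmoothGreen.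

(** * Assembling the three pieces around the centre *)

Section Star.
Variable R : realType.
Local Notation mu := (@lebesgue_measure R).
Local Notation mu2 := (mu \x mu)%E.
Implicit Types (o p q r : R * R).

Definition symq : Type := (quadr R * quadr R * quadr R)%type.

(* the component [u v . w], as a polynomial in the coordinates of the frame [p, q] *)
Definition lq (u : symq) o p q v w : quadr R := qcomp (qform u.1.1 u.1.2 u.2 v w) o p q.

(** Second derivatives in the frame are read off the quadratic coefficients; the denominator is the
    factor by which sven changes under a change of frame. *)
Definition sven_const (u : symq) o p q : R :=
  (2 * q22 (lq u o p q p p) + 2 * q11 (lq u o p q q q) - 2 * q12 (lq u o p q p q)) / crs p q ^+ 2.

(* [u] lives on the piece [p, q] and [v] on the piece [r, p]. The components
   along the common ray agree, the other ones are compatible with the relation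
   [be p + al1 q + al2 r = 0]. *)
Definition ray_cond o p q r (u v : symq) : Prop :=
  (forall x, qv (lq u o p q p p) (x, 0) = qv (lq v o r p p p) (0, x)) /\
  (forall x, crs q r * qv (lq u o p q p p) (x, 0) + crs r p * qv (lq u o p q p q) (x, 0)
     + crs p q * qv (lq v o r p r p) (0, x) = 0).

(** Derivatives of the component along the ray, in the directions [q] on one side, [r] on the other,
    and [p]. The weights are those of the relation [crs q r *: p + crs r p *: q + crs p q *: r = 0],
    so the sum vanishes when the gradient of this component is continuous across the ray. *)
Definition jump o p q r (u v : symq) (x : R) : R :=
  crs r p * qv (qd2 (lq u o p q p p)) (x, 0) + crs p q * qv (qd1 (lq v o r p p p)) (0, x)
  + crs q r * qv (qd1 (lq u o p q p p)) (x, 0).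

Lemma piece_green_sym (u : symq) phi (S : set (R * R)) o p q :
  0 < crs p q -> smooth phi -> closed S -> (forall x, ~ S x -> phi x = 0) ->
  (forall x, 0 <= x.1 -> 0 <= x.2 -> 1 <= x.1 + x.2 -> ~ S (aff o p q x)) ->
  \int[mu2]_(x in tri o p q) sven_pairing u.1.1 u.1.2 u.2 phi x =
  sven_const u o p q * \int[mu2]_(x in tri o p q) phi x
  + (crs p q)^-1 *
    (ray_term (fun x => qv (lq u o p q p p) (x, 0)) (fun x => qv (qd2 (lq u o p q p p)) (x, 0))
       (fun x => qv (qd1 (lq u o p q p q)) (x, 0)) o p q phi
     + ray_term (fun x => qv (lq u o p q q q) (0, x)) (fun x => qv (qd1 (lq u o p q q q)) (0, x))
       (fun x => qv (qd2 (lq u o p q p q)) (0, x)) o q p phi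
     - 2 * (qv (lq u o p q p q) (0, 0) * phi o)).
Proof. exact: piece_green. Qed.

Lemma ray_green phi o p q r (u v : symq) : smooth phi -> crs r p != 0 -> crs p q != 0 ->
  phi (o + p) = 0 -> ray_cond o p q r u v ->
  (crs p q)^-1 * ray_term (fun x => qv (lq u o p q p p) (x, 0))
     (fun x => qv (qd2 (lq u o p q p p)) (x, 0)) (fun x => qv (qd1 (lq u o p q p q)) (x, 0)) o p q phi
  + (crs r p)^-1 * ray_term (fun x => qv (lq v o r p p p) (0, x))
     (fun x => qv (qd1 (lq v o r p p p)) (0, x)) (fun x => qv (qd2 (lq v o r p r p)) (0, x)) o p r phi =
  (crs r p * crs p q)^-1 * (unit_int (fun x => jump o p q r u v x * phi (o + x *: p))
    - crs q r * (qv (lq u o p q p p) (0, 0) * phi o)).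
Proof.
move=> sphi h1 h2 hp [z1 z2].
have lin : crs q r *: p + crs r p *: q + crs p q *: r = 0.
  by apply: injective_projections; rewrite /crs /= /GRing.scale /=; ring.
have -> : (fun x => qv (lq v o r p p p) (0, x)) = (fun x => qv (lq u o p q p p) (x, 0)).
  by apply/funext => x; rewrite z1.
have c1 k : continuous (fun x : R => qv k (x, 0)).
  exact: (@continuous_section1 R 0 (qv k) (@continuous_qv R k)).
have c2 k : continuous (fun x : R => qv k (0, x)).
  exact: (@continuous_section2 R 0 (qv k) (@continuous_qv R k)).
rewrite (@ray_sum R _ (fun x => qv (qd1 (lq u o p q p p)) (x, 0))
  (fun x => qv (lq u o p q p q) (x, 0)) (fun x => qv (qd1 (lq u o p q p q)) (x, 0))
  (fun x => qv (lq v o r p r p) (0, x)) (fun x => qv (qd2 (lq v o r p r p)) (0, x))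
  (fun x => qv (qd2 (lq u o p q p p)) (x, 0)) (fun x => qv (qd1 (lq v o r p p p)) (0, x))
  phi o p q r (crs r p) (crs p q) (crs q r) sphi h1 h2 lin hp
  (fun x => is_derive_qv1 (lq u o p q p p) x 0) (fun x => is_derive_qv1 (lq u o p q p q) x 0)
  (fun x => is_derive_qv2 (lq v o r p r p) 0 x) z2 (And5 (c1 _) (c1 _) (c2 _) (c1 _) (c2 _))).
by [].
Qed.

(** The terms at the centre cancel: the ray relations there express [fa], [fb], [fc] through the
    mixed values [x], [y], [z] of the three pieces. *)
Let star_algebra (al be ga sA sB sC r1 r2 r3 r4 r5 r6 x y z Ja Jb Jc fa fb fc w : R) :
  al != 0 -> be != 0 -> ga != 0 ->
  ga^-1 * r1 + be^-1 * r2 = (be * ga)^-1 * (Ja - al * (fa * w)) ->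
  al^-1 * r3 + ga^-1 * r4 = (ga * al)^-1 * (Jb - be * (fb * w)) ->
  be^-1 * r5 + al^-1 * r6 = (al * be)^-1 * (Jc - ga * (fc * w)) ->
  al * fa + be * x + ga * y = 0 -> be * fb + ga * z + al * x = 0 ->
  ga * fc + al * y + be * z = 0 ->
  sA + al^-1 * (r3 + r6 - 2 * (z * w)) + (sB + be^-1 * (r5 + r2 - 2 * (y * w)))
    + (sC + ga^-1 * (r1 + r4 - 2 * (x * w))) =
  sA + sB + sC + (be * ga)^-1 * Ja + (ga * al)^-1 * Jb + (al * be)^-1 * Jc.
Proof.
  move=> a0 b0 c0 e1 e2 e3 f1 f2 f3.
  transitivity (sA + sB + sC + (ga^-1 * r1 + be^-1 * r2) + (al^-1 * r3 + ga^-1 * r4)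
    + (be^-1 * r5 + al^-1 * r6) - 2 * (al^-1 * z + be^-1 * y + ga^-1 * x) * w); first by ring.
  rewrite e1 e2 e3.
  have : 2 * (al^-1 * z + be^-1 * y + ga^-1 * x) * w =
     - ((be * ga)^-1 * (al * (fa * w)) + (ga * al)^-1 * (be * (fb * w)) + (al * be)^-1 * (ga * (fc * w))).
    have -> : fa = - (be * x + ga * y) / al.
      by apply: (mulfI a0); rewrite [RHS]mulrC divfK //; move: f1; lra.
    have -> : fb = - (ga * z + al * x) / be.
      by apply: (mulfI b0); rewrite [RHS]mulrC divfK //; move: f2; lra.
    have -> : fc = - (al * y + be * z) / ga.
      by apply: (mulfI c0); rewrite [RHS]mulrC divfK //; move: f3; lra.
    by field; rewrite a0 b0 c0.
  by move=> ->; ring.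
Qed.

Lemma star_green o a b c (uA uB uC : symq) phi (S : set (R * R)) :
  0 < crs b c -> 0 < crs c a -> 0 < crs a b ->
  smooth phi -> closed S -> (forall x, ~ S x -> phi x = 0) ->
  (forall x, 0 <= x.1 -> 0 <= x.2 -> 1 <= x.1 + x.2 ->
     [/\ ~ S (aff o b c x), ~ S (aff o c a x) & ~ S (aff o a b x)]) ->
  ray_cond o a b c uC uB -> ray_cond o b c a uA uC -> ray_cond o c a b uB uA ->
  \int[mu2]_(x in tri o b c) sven_pairing uA.1.1 uA.1.2 uA.2 phi x
  + \int[mu2]_(x in tri o c a) sven_pairing uB.1.1 uB.1.2 uB.2 phi x
  + \int[mu2]_(x in tri o a b) sven_pairing uC.1.1 uC.1.2 uC.2 phi x =
  sven_const uA o b c * (\int[mu2]_(x in tri o b c) phi x)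
  + sven_const uB o c a * (\int[mu2]_(x in tri o c a) phi x)
  + sven_const uC o a b * (\int[mu2]_(x in tri o a b) phi x)
  + (crs c a * crs a b)^-1 * unit_int (fun x => jump o a b c uC uB x * phi (o + x *: a))
  + (crs a b * crs b c)^-1 * unit_int (fun x => jump o b c a uA uC x * phi (o + x *: b))
  + (crs b c * crs c a)^-1 * unit_int (fun x => jump o c a b uB uA x * phi (o + x *: c)).
Proof.
move=> A0 B0 C0 sphi cS phi0 hS za zb zc.
have [A0' B0' C0'] : [/\ crs b c != 0, crs c a != 0 & crs a b != 0] by rewrite !gt_eqF.
rewrite (piece_green_sym _ A0 sphi cS phi0) => [|x x1 x2 x12]; last by have [] := hS x x1 x2 x12.
rewrite (piece_green_sym _ B0 sphi cS phi0) => [|x x1 x2 x12]; last by have [] := hS x x1 x2 x12.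
rewrite (piece_green_sym _ C0 sphi cS phi0) => [|x x1 x2 x12]; last by have [] := hS x x1 x2 x12.
have end0 p q : (forall x, 0 <= x.1 -> 0 <= x.2 -> 1 <= x.1 + x.2 -> ~ S (aff o p q x)) ->
    phi (o + p) = 0.
  move=> h; apply: phi0.
  have := h (1, 0) ler01 (lexx _); rewrite /aff /= scale1r scale0r !addr0; exact.
have phia : phi (o + a) = 0 by apply: (end0 a b) => x x1 x2 x12; have [] := hS x x1 x2 x12.
have phib : phi (o + b) = 0 by apply: (end0 b c) => x x1 x2 x12; have [] := hS x x1 x2 x12.
have phic : phi (o + c) = 0 by apply: (end0 c a) => x x1 x2 x12; have [] := hS x x1 x2 x12.
have Ra := ray_green sphi B0' C0' phia za.
have Rb := ray_green sphi C0' A0' phib zb.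
have Rc := ray_green sphi A0' B0' phic zc.
have Ea := za.2 0; have Eb := zb.2 0; have Ec := zc.2 0.
have Eb' := zb.1 0; have Ec' := zc.1 0; have Ea' := za.1 0.
exact: star_algebra A0' B0' C0' Ra Rb Rc Ea Eb Ec.
Qed.

End Star.

(** * Test functions *)

Section StarGeometry.
Variable R : realType.
Local Notation mu := (@lebesgue_measure R).
Implicit Types (o p q r : R * R).

(* up to the factor [crs p q], the barycentric coordinate opposite to the side [o + p, o + q] *)
Definition lam o p q (x : R * R) : R := crs (q - p) (x - o - p).

(** The triangle as an intersection of three half-planes, convenient for measurability and for
    interior points. *)
Definition hull3 o a b c : set (R * R) :=
  [set x | [/\ 0 <= lam o b c x, 0 <= lam o c a x & 0 <= lam o a b x]].

Lemma lam_opp o p q x : lam o p q (aff o p q x) = crs p q * (1 - x.1 - x.2).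
Proof. by rewrite /lam /aff /crs /= /GRing.scale /=; ring. Qed.

Lemma lam_next o p q r x : lam o q r (aff o p q x) =
  x.1 * (crs r p + crs p q) + (1 - x.2) * crs q r.
Proof. by rewrite /lam /aff /crs /= /GRing.scale /=; ring. Qed.

Lemma lam_prev o p q r x : lam o r p (aff o p q x) =
  x.2 * (crs p q + crs q r) + (1 - x.1) * crs r p.
Proof. by rewrite /lam /aff /crs /= /GRing.scale /=; ring. Qed.

Lemma lam_aff2 o p q : exists l, lam o p q = aff2 l.
Proof.
exists (crs (q - p) (- o - p), (- (q - p).2, (q - p).1)).
by apply/funext => x; rewrite /lam /aff2 /dot /crs /=; ring.
Qed.

Lemma continuous_aff2 (l : R * (R * R)) : continuous (aff2 l).
Proof. by move=> x; apply: differentiable_continuous; exact: differentiable_aff2. Qed.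

Lemma continuous_lam o p q : continuous (lam o p q).
Proof. by have [l ->] := lam_aff2 o p q; exact: continuous_aff2. Qed.

Section Frame.
Variables o a b c : R * R.
Hypotheses (A0 : 0 < crs b c) (B0 : 0 < crs c a) (C0 : 0 < crs a b).

Lemma tri_sub_hull3 : tri o a b `<=` hull3 o a b c.
Proof.
move=> _ [x [x1 x2 x12] <-]; rewrite /hull3 /= lam_opp lam_next lam_prev.
have h1 : 0 <= 1 - x.1 by lra.
have h2 : 0 <= 1 - x.2 by lra.
have h3 : 0 <= 1 - x.1 - x.2 by lra.
have hA := ltW A0; have hB := ltW B0; have hC := ltW C0.
by split; [apply: addr_ge0; apply: mulr_ge0 => //; exact: addr_ge0
  | apply: addr_ge0; apply: mulr_ge0 => //; exact: addr_ge0 | exact: mulr_ge0].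
Qed.

Lemma cone_tri x : 0 <= lam o a b x -> 0 <= crs a (x - o) -> crs b (x - o) <= 0 ->
  tri o a b x.
Proof.
move=> hl h1 h2; have C0' : crs a b != 0 by rewrite gt_eqF.
rewrite triE //= /ref_triangle /lc /=; split.
- by rewrite divr_ge0 ?(ltW C0) // /crs; move: h2; rewrite /crs; lra.
- by rewrite divr_ge0 ?(ltW C0).
- rewrite -mulrDl ler_pdivrMr // mul1r; move: hl; rewrite /lam /crs /=; lra.
Qed.

(** Pushing such a point away from [o] by a factor [1 + k], with [k] small enough to stay in the
    ball, makes the barycentric coordinate of the side negative. *)
Lemma outer_not_interior x : 0 <= x.1 -> 0 <= x.2 -> 1 <= x.1 + x.2 ->
  ~ (hull3 o a b c)° (aff o a b x).
Proof.
move=> x1 x2 x12 /nbhs_ballP[e /= e0 he].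
set y := x.1 *: a + x.2 *: b.
have y0 : 0 < `|y| + 1 by rewrite ltr_wpDl.
pose k := e / 2 / (`|y| + 1).
have k0 : 0 < k by rewrite /k !divr_gt0.
have [_ _] : hull3 o a b c (aff o a b ((1 + k) * x.1, (1 + k) * x.2)).
  apply: he; rewrite -ball_normE /= (_ : _ - _ = - (k *: y)).
    have E : k * (`|y| + 1) = e / 2 by rewrite /k divfK // gt_eqF.
    rewrite normrN normrZ gtr0_norm //; move: E k0 e0; rewrite mulrDr mulr1.
    by move: (k * _) => z; lra.
  by rewrite /y /aff /=; apply: injective_projections; rewrite /= /GRing.scale /=; ring.
rewrite lam_opp /=; have : (1 + k) * x.1 + (1 + k) * x.2 > 1 by nra.
move: C0; nra.
Qed.

Lemma hull3_interior x : 0 < lam o b c x -> 0 < lam o c a x -> 0 < lam o a b x ->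
  (hull3 o a b c)° x.
Proof.
have H p q y : 0 < lam o p q y -> \forall z \near y, 0 < lam o p q z.
  move=> h; have cl : lam o p q z @[z --> y] --> lam o p q y by exact: continuous_lam.
  exact: (cvgr_gt _ cl _ h).
move=> /H h1 /H h2 /H h3; rewrite /interior; near=> z.
by split; apply: ltW; near: z.
Unshelve. all: by end_near. Qed.

End Frame.

Lemma hull3_rot o a b c : hull3 o a b c = hull3 o b c a.
Proof. by apply/seteqP; split => x [h1 h2 h3]; split. Qed.

(** By the relation [E] with positive weights, the signed areas [crs a (x - o)], [crs b (x - o)],
    [crs c (x - o)] cannot all have the same strict sign; their sign pattern selects the piece. *)
Lemma hull3_cover o a b c x : 0 < crs b c -> 0 < crs c a -> 0 < crs a b ->
  hull3 o a b c x -> [\/ tri o a b x, tri o b c x | tri o c a x].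
Proof.
move=> A0 B0 C0 [h1 h2 h3].
have E : crs b c * crs a (x - o) + crs c a * crs b (x - o) + crs a b * crs c (x - o) = 0.
  by rewrite /crs /=; ring.
have [ha|ha] := leP 0 (crs a (x - o)).
  have [hb|hb] := leP (crs b (x - o)) 0; first by constructor 1; exact: cone_tri.
  have [hc|hc] := leP (crs c (x - o)) 0; first by constructor 2; apply: cone_tri => //; exact: ltW.
  by exfalso; move: E; nra.
have [hc|hc] := leP 0 (crs c (x - o)); first by constructor 3; apply: cone_tri => //; exact: ltW.
have [hb|hb] := leP 0 (crs b (x - o)); first by constructor 2; apply: cone_tri => //; exact: ltW.
by exfalso; move: E; nra.
Qed.

Lemma hull3_measurable o a b c :
  measurable (hull3 o a b c : set (measurableTypeR R * measurableTypeR R)).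
Proof.
rewrite (_ : hull3 _ _ _ _ = [set x | 0 <= lam o b c x] `&` [set x | 0 <= lam o c a x]
  `&` [set x | 0 <= lam o a b x]); last first.
  by apply/seteqP; split => x; [case|case=> -[]].
by apply: measurableI; [apply: measurableI|]; apply: measurable_ge0; exact: continuous_lam.
Qed.

Definition compactly_in (T : set (R * R)) (phi : R * R -> R) : Prop :=
  [/\ smooth phi, compact (closure [set x | phi x != 0])
    & closure [set x | phi x != 0] `<=` T°].

Lemma bump_comp_aff f o p q : bump_alg f -> bump_alg (fun x : R * R => f (aff o p q x)).
Proof.
elim=> {f} [k l|k|f g _ hf _ hg|f g _ hf _ hg].
- rewrite (_ : (fun _ => _) = fun x => flat_exp k (aff2 (aff2 l o, (dot l.2 p, dot l.2 q)) x)).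
    exact: bump_flat.
  apply/funext => x; congr flat_exp.
  by rewrite /aff2 /aff /dot /= /GRing.scale /=; ring.
- exact: bump_cst.
- exact: bump_add.
- exact: bump_mul.
Qed.

Lemma frame_test_function (T : set (R * R)) f o p q (u v u' v' : R) :
  crs p q != 0 -> bump_alg f -> (forall x, f x != 0 -> box u v u' v' x) ->
  (forall x, box u v u' v' x -> T° (aff o p q x)) ->
  compactly_in T (fun x => f (lc o p q x)).
Proof.
move=> c0 bf fb bT; split.
- by apply: bump_smooth; rewrite lcE; exact: bump_comp_aff.
- have cP : compact (aff o p q @` box u v u' v').
    apply: continuous_compact; last exact: box_compact.
    by apply: continuous_subspaceT; exact: continuous_aff.
  apply: (subclosed_compact _ cP); first exact: closed_closure.
  rewrite (closure_id (aff o p q @` _)).1; last first.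
    by apply: compact_closed => //; exact: norm_hausdorff.
  apply: closure_subset => x /= /fb xb; exists (lc o p q x) => //; exact: lcK.
- have cP : closed (aff o p q @` box u v u' v').
    apply: compact_closed; first exact: norm_hausdorff.
    apply: continuous_compact; last exact: box_compact.
    by apply: continuous_subspaceT; exact: continuous_aff.
  apply: (@subset_trans _ (aff o p q @` box u v u' v')); last by move=> _ [x /bT xT <-].
  rewrite ((closure_id _).1 cP); apply: closure_subset => x /= /fb xb.
  by exists (lc o p q x) => //; exact: lcK.
Qed.

Definition flat (s : R) : R := flat_exp 1 s.

Lemma flat_ge0 s : 0 <= flat s.
Proof. by rewrite /flat /flat_exp; case: ifP => // _; rewrite hornerE mul1r expR_ge0. Qed.

Lemma flat_le1 s : flat s <= 1.
Proof.
rewrite /flat /flat_exp; case: ifP => // s0; rewrite hornerE mul1r.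
by rewrite -expR0 ler_expR oppr_le0 invr_ge0 ltW.
Qed.

Lemma flat_gt0 s : 0 < s -> 0 < flat s.
Proof. by move=> s0; rewrite /flat /flat_exp s0 hornerE mul1r expR_gt0. Qed.

Lemma flat_le0 s : s <= 0 -> flat s = 0.
Proof. by rewrite /flat /flat_exp ltNge => ->. Qed.

Lemma continuous_flat : continuous flat.
Proof.
move=> s; apply: differentiable_continuous; apply/derivable1_diffP.
by case: (is_derive_flat_exp 1 s).
Qed.

(* positive exactly on [(u, v)] *)
Definition hat (u v s : R) : R := flat (s - u) * flat (v - s).

Lemma hat_ge0 u v s : 0 <= hat u v s.
Proof. by rewrite mulr_ge0 // flat_ge0. Qed.

Lemma hat_gt0 u v s : u < s < v -> 0 < hat u v s.
Proof. by move=> /andP[h1 h2]; rewrite mulr_gt0 // flat_gt0 // subr_gt0. Qed.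

Lemma hat_neq0 u v s : hat u v s != 0 -> u <= s <= v.
Proof.
move=> h; apply/andP; split; rewrite leNgt; apply/negP => us; case/negP: h; apply/eqP; rewrite /hat.
  by rewrite flat_le0 ?mul0r // subr_le0 ltW.
by rewrite [X in _ * X]flat_le0 ?mulr0 // subr_le0 ltW.
Qed.

Lemma continuous_hat u v : continuous (hat u v).
Proof.
move=> s; apply: cvgM.
  apply: (@continuous_comp _ _ _ (fun s => s - u) flat); last exact: continuous_flat.
  by apply: cvgB; [exact: cvg_id|exact: cvg_cst].
apply: (@continuous_comp _ _ _ (fun s => v - s) flat); last exact: continuous_flat.
by apply: cvgB; [exact: cvg_cst|exact: cvg_id].
Qed.

Lemma unit_int_gt0 (f : R -> R) s0 : continuous f -> (forall x, 0 <= x <= 1 -> 0 <= f x) ->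
  0 < s0 < 1 -> 0 < f s0 -> 0 < unit_int f.
Proof.
move=> cf f0 /andP[s0p s0l] fs.
have : \forall x \near s0, f s0 / 2 < f x.
  by apply: (cvgr_gt (f s0) (cf s0)); rewrite ltr_pdivrMr // mulr_natr mulr2n ltrDl.
move=> /nbhs_ballP[e /= e0 he].
pose d := Num.min (e / 2) (Num.min s0 (1 - s0)).
have d0 : 0 < d by rewrite !lt_min divr_gt0 // s0p subr_gt0.
have de : d < e.
  by apply: le_lt_trans (_ : e / 2 < e); [rewrite ge_min lexx|rewrite ltr_pdivrMr // mulr_natr mulr2n ltrDl].
have ds : d <= s0 by rewrite /d !ge_min lexx orbT.
have ds' : d <= 1 - s0 by rewrite /d !ge_min lexx !orbT.
have sub : `[(s0 - d), (s0 + d)]%classic `<=` `[0, 1]%classic.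
  by move=> x /=; rewrite !in_itv /= => /andP[h1 h2]; apply/andP; split; lra.
have If := unit_integrable cf.
rewrite /unit_int /Rintegral fine_gt0 //; apply/andP; split; last first.
  by have /integral_fune_fin_num := If; rewrite fin_numE => /(_ _)/andP[] // _; rewrite -ltey.
have k0 : (0 < (f s0 / 2 * (d *+ 2))%:E)%E by rewrite lte_fin mulr_gt0 // ?divr_gt0 // mulrn_wgt0.
apply: (lt_le_trans k0).
have /integrableP[mf _] := If.
have H2 : (\int[mu]_(x in `[(s0 - d)%R, (s0 + d)%R]) (f x)%:E <=
    \int[mu]_(x in `[0%R, 1%R]) (f x)%:E)%E.
  apply: ge0_subset_integral => // x; rewrite /= in_itv /= => h; rewrite lee_fin; exact: f0.
have H1 : (\int[mu]_(x in `[(s0 - d)%R, (s0 + d)%R]) (f s0 / 2)%:E <=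
    \int[mu]_(x in `[(s0 - d)%R, (s0 + d)%R]) (f x)%:E)%E.
  apply: ge0_le_integral => //.
  - by move=> x _; rewrite lee_fin ltW // divr_gt0.
  - by apply: measurable_funS mf.
  - move=> x; rewrite /= in_itv /= => /andP[h1 h2]; rewrite lee_fin ltW // he //.
    by rewrite /ball /= ltr_norml; apply/andP; split; lra.
apply: le_trans (le_trans H1 H2).
rewrite integral_cst //= lebesgue_measure_itv /= lte_fin ifT; last by lra.
by rewrite -EFinB -EFinM lee_fin mulr2n opprD opprK addrACA subrr add0r.
Qed.

Lemma square_int_prod (f g : R -> R) : continuous f -> continuous g ->
  square_int (fun x => f x.1 * g x.2) = unit_int f * unit_int g.
Proof.
move=> cf cg.
have cfg : continuous (fun x : R * R => f x.1 * g x.2).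
  apply: mul_continuous2 => x.
    by apply: (@continuous_comp _ _ _ fst f); [exact: cvg_fst|exact: cf].
  by apply: (@continuous_comp _ _ _ snd g); [exact: cvg_snd|exact: cg].
transitivity (\int[mu]_x ((fun a => unit_int g * f a) \_ `[0, 1]%classic) x).
  apply: Rintegral_iterated1; first exact: box_measurable.
    exact: (continuous_integrable2 (m := 0) (M := 1) (m' := 0) (M' := 1) cfg (box_measurable _ _ _ _)).
  move=> a; rewrite patchE; case: ifPn => [|] a01; last first.
    rewrite (_ : (fun _ => _) = cst 0%E) ?integral0 //.
    apply/funext => y; rewrite patchE memNset // => -[/= ha _].
    by move/negP : a01; apply; rewrite inE.
  transitivity (\int[mu]_(y in `[0%R, 1%R]) ((f a)%:E * (g y)%:E))%E.
    rewrite [RHS]integral_mkcond; apply: eq_integral => y _.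
    rewrite /patch (_ : ((a, y) \in @unit_square R) = (y \in `[0, 1]%classic)); first by case: ifP.
    by move/set_mem : a01 => ?; apply/idP/idP => /set_mem h; apply/mem_set; [case: h|split].
  rewrite integralZl //; last exact: unit_integrable.
  have E : (\int[mu]_(y in `[0%R, 1%R]) (g y)%:E)%E = (unit_int g)%:E.
    by rewrite /unit_int /Rintegral fineK //; apply: integral_fune_fin_num => //; exact: unit_integrable.
  by rewrite E -EFinM mulrC.
rewrite -Rintegral_mkcond RintegralZl //; first by rewrite mulrC.
exact: unit_integrable.
Qed.

End StarGeometry.

Section TestFunctions.
Variable R : realType.
Local Notation mu := (@lebesgue_measure R).
Local Notation mu2 := (mu \x mu)%E.
Local Notation RR := (measurableTypeR R * measurableTypeR R)%type.
Implicit Types (o p q r : R * R).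

(** The signs of the value at [1/2] and of the slope tell on which half of [[0, 1]] the function has
    a constant sign; the interval around [s0] lies inside that half, away from its ends. *)
Lemma affine_sign_interval (j0 j1 : R) : ~ (j0 = 0 /\ j1 = 0) ->
  exists s0, (s0 = 1 / 4 \/ s0 = 3 / 4) /\
    ((forall x, s0 - 1 / 8 <= x <= s0 + 1 / 8 -> 0 <= j0 + j1 * x) /\ 0 < j0 + j1 * s0 \/
     (forall x, s0 - 1 / 8 <= x <= s0 + 1 / 8 -> j0 + j1 * x <= 0) /\ j0 + j1 * s0 < 0).
Proof.
move=> nz.
have [hm|hm|hm] := ltgtP 0 (j0 + j1 / 2); have [hj|hj|hj] := ltgtP 0 j1.
all: try (exists (3 / 4); split; [by right|left; split; [move=> x /andP[]; nra|nra]]; fail).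
all: try (exists (3 / 4); split; [by right|right; split; [move=> x /andP[]; nra|nra]]; fail).
all: try (exists (1 / 4); split; [by left|left; split; [move=> x /andP[]; nra|nra]]; fail).
all: try (exists (1 / 4); split; [by left|right; split; [move=> x /andP[]; nra|nra]]; fail).
Qed.

Variables o a b c : R * R.
Hypotheses (A0 : 0 < crs b c) (B0 : 0 < crs c a) (C0 : 0 < crs a b).
Let C0' : crs a b != 0 := lt0r_neq0 C0.
Local Notation T := (hull3 o a b c).

Lemma boxP (u v u' v' : R) x : box u v u' v' x <-> u <= x.1 <= v /\ u' <= x.2 <= v'.
Proof. by rewrite /box /setX /= !in_itv. Qed.

Definition bump2 (u v u' v' : R) (x : R * R) : R := hat u v x.1 * hat u' v' x.2.

(** These bumps shrink to the axis [x.2 = 0] as [k] grows, while their values on the axis stay the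
    same. *)
Lemma bump2_alg (u v k : R) : bump_alg (fun x : R * R => hat u v x.1 * (flat (1 - k * x.2) * flat (1 + k * x.2))).
Proof.
have H1 : bump_alg (fun x => flat_exp 1 (aff2 (- u, (1, 0)) x) * flat_exp 1 (aff2 (v, (-1, 0)) x)).
  by apply: bump_mul; exact: bump_flat.
have H2 : bump_alg (fun x => flat_exp 1 (aff2 (1 : R, (0, - k)) x) * flat_exp 1 (aff2 (1 : R, (0, k)) x)).
  by apply: bump_mul; exact: bump_flat.
have := bump_mul H1 H2; congr bump_alg; apply/funext => x.
rewrite /hat /flat /aff2 /dot /=.
by congr (flat_exp _ _ * flat_exp _ _ * (flat_exp _ _ * flat_exp _ _)); ring.
Qed.

Lemma bump2_alg' (u v u' v' : R) : bump_alg (bump2 u v u' v').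
Proof.
have H1 : bump_alg (fun x => flat_exp 1 (aff2 (- u, (1, 0)) x) * flat_exp 1 (aff2 (v, (-1, 0)) x)).
  by apply: bump_mul; exact: bump_flat.
have H2 : bump_alg (fun x => flat_exp 1 (aff2 (- u', (0, 1)) x) * flat_exp 1 (aff2 (v', (0, -1)) x)).
  by apply: bump_mul; exact: bump_flat.
have := bump_mul H1 H2; congr bump_alg; apply/funext => x.
rewrite /bump2 /hat /flat /aff2 /dot /=.
by congr (flat_exp _ _ * flat_exp _ _ * (flat_exp _ _ * flat_exp _ _)); ring.
Qed.

(** Here [x.2] may be negative: the point may lie on either side of the ray of [a]. The last
    hypothesis is the positivity of [lam o c a] in the coordinates of the frame. *)
Lemma frame_interior x : 0 < x.1 -> x.1 < 1 -> x.2 < 1 -> x.1 + x.2 < 1 ->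
  0 < x.2 * (crs a b + crs b c) + (1 - x.1) * crs c a -> T° (aff o a b x).
Proof.
move=> x1 x1' x2 x12 h; apply: (@hull3_interior R o a b c); rewrite ?lam_opp ?lam_next ?lam_prev //.
- rewrite ltr_wpDl //; last by rewrite mulr_gt0 // subr_gt0.
  by apply: mulr_ge0; [exact: ltW|apply: addr_ge0; exact: ltW].
- by rewrite mulr_gt0 //; lra.
Qed.

Lemma tri_interior_frame x : 0 < x.1 -> 0 < x.2 -> x.1 + x.2 < 1 -> (tri o a b)° (aff o a b x).
Proof.
move=> x1 x2 x12; rewrite /interior triE //.
have [l1 E1] : exists l, (fun x => (lc o a b x).1) = aff2 l.
  exists ((lc o a b 0).1, (b.2 / crs a b, - b.1 / crs a b)).
  by apply/funext => y; rewrite lcE /aff2 /aff /dot /= /GRing.scale /=; ring.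
have [l2 E2] : exists l, (fun x => (lc o a b x).2) = aff2 l.
  exists ((lc o a b 0).2, (- a.2 / crs a b, a.1 / crs a b)).
  by apply/funext => y; rewrite lcE /aff2 /aff /dot /= /GRing.scale /=; ring.
have c1 : (lc o a b y).1 @[y --> aff o a b x] --> (lc o a b (aff o a b x)).1.
  by rewrite (congr1 (fun f => f (aff o a b x)) E1) E1; exact: continuous_aff2.
have c2 : (lc o a b y).2 @[y --> aff o a b x] --> (lc o a b (aff o a b x)).2.
  by rewrite (congr1 (fun f => f (aff o a b x)) E2) E2; exact: continuous_aff2.
have n1 : \forall y \near aff o a b x, 0 < (lc o a b y).1.
  by apply: (cvgr_gt _ c1); rewrite affK.
have n2 : \forall y \near aff o a b x, 0 < (lc o a b y).2.
  by apply: (cvgr_gt _ c2); rewrite affK.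
have n3 : \forall y \near aff o a b x, (lc o a b y).1 + (lc o a b y).2 < 1.
  by apply: (cvgr_lt _ (cvgD c1 c2)); rewrite affK.
near=> y; split; last 1 first.
- by apply: ltW; near: y.
- by apply: ltW; near: y.
- by apply: ltW; near: y.
Unshelve. all: by end_near. Qed.

(** A bump inside a single piece reads off the constant there; this gives the uniqueness of the
    piecewise constant sven. In frame coordinates its support is in the square [[1/8, 1/4]^2]. *)
Lemma tri_test_function : exists phi, [/\ compactly_in T phi,
  forall x, phi x != 0 -> (tri o a b)° x & \int[mu2]_(x in T) phi x != 0].
Proof.
pose f := bump2 (8^-1) (4^-1) (8^-1) (4^-1).
have fb x : f x != 0 -> box (8^-1) (4^-1) (8^-1) (4^-1) x.
  rewrite /f /bump2 mulf_eq0 negb_or => /andP[/hat_neq0 h1 /hat_neq0 h2].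
  exact/boxP.
have cf : continuous f by move=> x; apply: differentiable_continuous; exact: bump_differentiable (bump2_alg' _ _ _ _) x.
pose phi x := f (lc o a b x).
have phit x : phi x != 0 -> (tri o a b)° x.
  move=> /fb/boxP[/andP[x1 x1'] /andP[x2 x2']].
  by rewrite -(lcK o C0' x); apply: tri_interior_frame; lra.
have cphi : compactly_in T phi.
  apply: (@frame_test_function R T f o a b _ _ _ _ C0' (bump2_alg' _ _ _ _) fb) => x.
  move=> /boxP[/andP[x1 x1'] /andP[x2 x2']]; apply: frame_interior; try lra.
  have hA := ltW A0; have hC := ltW C0.
  rewrite ltr_wpDl //; first by apply: mulr_ge0; [lra|exact: addr_ge0].
  by rewrite mulr_gt0 //; lra.
exists phi; split => //.
have E : \int[mu2]_(x in T) phi x = \int[mu2]_(x in tri o a b) phi x.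
  rewrite Rintegral_mkcond [in RHS]Rintegral_mkcond; apply: eq_Rintegral => x _.
  rewrite /patch; case: ifPn => xT; case: ifPn => // xt.
    apply/eqP/negPn/negP => /phit/interior_subset/mem_set h.
    by rewrite h in xt.
  case/negP: xT; apply/mem_set; apply: tri_sub_hull3 => //; exact/set_mem.
have [sphi _ _] := cphi.
rewrite E (Rintegral_tri C0 (smooth_continuous sphi)); last first.
  move=> x x1 x2 x12; rewrite /phi affK //; apply/eqP/negPn/negP.
  by move=> /fb/boxP[/andP[_ h1] /andP[_ h2]]; lra.
rewrite mulf_neq0 // (_ : (fun _ => _) = fun x => hat 8^-1 4^-1 x.1 * hat 8^-1 4^-1 x.2); last first.
  by apply/funext => x; rewrite /phi affK.
rewrite square_int_prod; [|exact: continuous_hat..].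
have : 0 < unit_int (hat (8^-1) (4^-1 : R)).
  apply: (@unit_int_gt0 _ _ (3 / 16)); [exact: continuous_hat|by move=> x _; exact: hat_ge0| |].
    by apply/andP; split; lra.
  by apply: hat_gt0; apply/andP; split; lra.
by move=> h; rewrite mulf_neq0 // gt_eqF.
Qed.

Lemma le1N (z : R) : 1 <= - z -> 1 + z <= 0.
Proof. by move=> ?; lra. Qed.

Lemma thin_box (u v rho s r : R) : 1 / 8 <= u -> v <= 7 / 8 -> rho <= 1 / 16 ->
  u <= s -> s <= v -> - rho <= r -> r <= rho -> [/\ 0 < s, s < 1, r < 1 & s + r < 1].
Proof. by move=> *; split; lra. Qed.

Lemma thin_box2 (m k rho s r : R) : 0 < m -> 0 < k -> rho * m <= k / 16 ->
  s <= 7 / 8 -> - rho <= r -> 0 < r * m + (1 - s) * k.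
Proof.
move=> m0 k0 h s1 r1.
have h1 : - rho * m <= r * m by rewrite ler_pM2r.
have h2 : 1 / 8 * k <= (1 - s) * k by rewrite ler_pM2r //; lra.
lra.
Qed.

Lemma line_measurable : measurable ([set x | (lc o a b x).2 = 0] : set RR).
Proof.
have [l2 E2] : exists l, (fun x => (lc o a b x).2) = aff2 l.
  exists ((lc o a b 0).2, (- a.2 / crs a b, a.1 / crs a b)).
  by apply/funext => y; rewrite lcE /aff2 /aff /dot /= /GRing.scale /=; ring.
have mf := continuous_measurable2 (@continuous_aff2 R l2).
have := mf measurableT _ (measurable_set1 0); rewrite setTI; congr measurable.
by apply/seteqP; split => x /=; rewrite -E2.
Qed.

(** The frame pulls the line of the ray back to the null set [x.2 = 0] and multiplies areas by a
    nonzero constant. *)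
Lemma line_negligible : mu2 [set x | (lc o a b x).2 = 0] = 0%E.
Proof.
have [k0 mX hX] := scales_area_aff o C0'.
have mN := line_measurable.
have E x : (lc o a b (aff o a b x)).2 = x.2 by rewrite affK.
have P : aff o a b @^-1` [set x | (lc o a b x).2 = 0] = setT `*` [set 0].
  apply/seteqP; split => x; first by move=> hx; split => //; rewrite -E.
  by move=> [_ hx]; rewrite /preimage /mkset E.
have Z : mu2 (setT `*` [set (0 : R)]) = 0%E.
  rewrite product_measure1E //; apply/eqP; rewrite mule_eq0; apply/orP; right; apply/eqP.
  exact: lebesgue_measure_set1.
have := hX _ mN; rewrite P Z => /esym/eqP; rewrite mule_eq0 => /orP[|/eqP//].
by rewrite eqe invr_eq0 gt_eqF.
Qed.

(* Test functions concentrating on the ray of [a] do not see [h] in the limit *)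
Lemma ray_detection (h : R * R -> R) (j0 j1 k1 k2 k3 : R) (Jb Jc : R -> R) : k1 != 0 ->
  mu2.-integrable T (EFin \o h) ->
  (forall phi, compactly_in T phi -> \int[mu2]_(x in T) (h x * phi x) =
     k1 * unit_int (fun x => (j0 + j1 * x) * phi (o + x *: a))
     + k2 * unit_int (fun x => Jb x * phi (o + x *: b))
     + k3 * unit_int (fun x => Jc x * phi (o + x *: c))) ->
  j0 = 0 /\ j1 = 0.
Proof.
move=> k10 ih hh.
have [//|] := pselect (j0 = 0 /\ j1 = 0) => nz; exfalso.
(* The bump along the ray is placed where the affine function has a constant sign, so its integral
   cannot cancel. *)
have [s0 [s01 J0]] := affine_sign_interval nz.
set u := s0 - 1 / 8; set v := s0 + 1 / 8.
have [u0 v1 uv] : [/\ 1 / 8 <= u, v <= 7 / 8 & u < s0 < v].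
  by rewrite /u /v; case: s01 => ->; split; rewrite -?(rwP andP); lra.
pose F x := (j0 + j1 * x) * (hat u v x * (flat 1 * flat 1)).
have cF k : continuous (fun x : R => k * F x).
  move=> x; apply: cvgM; first exact: cvg_cst.
  apply: cvgM; first by apply: cvgD; [exact: cvg_cst|apply: cvgM; [exact: cvg_cst|exact: cvg_id]].
  by apply: cvgM; [exact: continuous_hat|exact: cvg_cst].
have f1 : 0 < flat 1 * flat (1 : R) by rewrite mulr_gt0 // flat_gt0.
have s0i : 0 < s0 < 1 by case: s01 => ->; apply/andP; split; lra.
have hat0 x : ~~ (u <= x <= v) -> hat u v x = 0.
  by move=> hx; apply/eqP/negPn/negP => /hat_neq0; exact/negP.
have FI k : (forall x, u <= x <= v -> 0 <= k * (j0 + j1 * x)) -> 0 < k * (j0 + j1 * s0) ->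
    0 < unit_int (fun x => k * F x).
  move=> h1 h2; apply: (@unit_int_gt0 _ _ s0) => //.
    move=> x _; rewrite /F mulrA; have [hx|hx] := boolP (u <= x <= v).
      by rewrite mulr_ge0 ?h1 // mulr_ge0 ?hat_ge0 ?ltW.
    by rewrite hat0 // mul0r mulr0.
  by rewrite /F mulrA mulr_gt0 // mulr_gt0 ?hat_gt0.
have Ik k : unit_int (fun x => k * F x) = k * unit_int F.
  have cF1 : continuous F by rewrite (_ : F = fun x => 1 * F x) //; apply/funext => x; rewrite mul1r.
  transitivity (unit_int (fun x => k * F x + 0)).
    by congr unit_int; apply/funext => x; rewrite addr0.
  rewrite unit_int_lin //; last by move=> x; exact: cvg_cst.
  by rewrite [unit_int (fun=> 0)]/unit_int Rintegral_cst // mul0r addr0.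
have I0 : unit_int F != 0.
  case: J0 => -[h1 h2].
    have : 0 < 1 * unit_int F by rewrite -Ik; apply: FI => [x /h1|]; rewrite mul1r.
    by rewrite mul1r => H; rewrite gt_eqF.
  have : 0 < -1 * unit_int F.
    by rewrite -Ik; apply: FI => [x /h1|]; rewrite mulN1r ?oppr_ge0 ?oppr_gt0.
  by rewrite mulN1r oppr_gt0 => H; rewrite lt_eqF.
(* Half-width for which the box over [[u, v]] stays in the interior of [T] on both sides of the ray;
   the second bound keeps it off the side from [c] to [a]. *)
pose rho := Num.min (1 / 16) (crs c a / (16 * (crs a b + crs b c))).
have AC0 : 0 < crs a b + crs b c by rewrite addr_gt0.
have rho0 : 0 < rho by rewrite lt_min; apply/andP; split; rewrite divr_gt0 ?mulr_gt0.
have rho1 : rho <= 1 / 16 by rewrite ge_min lexx.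
have rho2 : rho * (crs a b + crs b c) <= crs c a / 16.
  have : rho <= crs c a / (16 * (crs a b + crs b c)) by rewrite ge_min lexx orbT.
  by rewrite invfM mulrA ler_pdivlMr.
(* This offset makes [n + N] exceed [1 / rho] for every [n], so all the test functions have their
   support in the box. *)
pose N := Num.bound rho^-1.
have hN n : rho^-1 < (n + N)%:R.
  have /archi_boundP : 0 <= rho^-1 by rewrite invr_ge0 ltW.
  by move=> /lt_le_trans; apply; rewrite ler_nat leq_addl.
have kp n : 0 < (n + N)%:R :> R by apply: lt_trans (hN n); rewrite invr_gt0.
pose f n (x : R * R) := hat u v x.1 * (flat (1 - (n + N)%:R * x.2) * flat (1 + (n + N)%:R * x.2)).
have flat_neq0 (x : R) : flat x != 0 -> 0 < x.
  by move=> hx; rewrite ltNge; apply/negP => /flat_le0; exact/eqP.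
have fb n x : f n x != 0 -> box u v (- rho) rho x.
  rewrite /f mulf_eq0 negb_or => /andP[/hat_neq0 h1].
  rewrite mulf_eq0 negb_or => /andP[/flat_neq0 h2 /flat_neq0 h3].
  apply/boxP; split => //; have := hN n; rewrite -[rho^-1]div1r ltr_pdivrMr // => hn.
  by apply/andP; split; rewrite leNgt; apply/negP => hx; have := kp n; nra.
pose phi n x := f n (lc o a b x).
have tphi n : compactly_in T (phi n).
  apply: (@frame_test_function R T (f n) o a b _ _ _ _ C0' (bump2_alg _ _ _) (fb n)) => x.
  move=> /boxP[/andP[x1 x1'] /andP[x2 x2']].
  have [h1 h2 h3 h4] := thin_box u0 v1 rho1 x1 x1' x2 x2'.
  apply: frame_interior => //.
  by apply: (thin_box2 AC0 B0 rho2) => //; exact: le_trans x1' v1.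
have phib n x : 0 <= phi n x <= 1.
  rewrite /phi /f !mulr_ge0 ?flat_ge0 //=.
  by rewrite mulr_ile1 ?mulr_ge0 ?flat_ge0 // mulr_ile1 ?flat_ge0 ?flat_le1.
(* On the ray of [a] all the test functions take the same values; the rays of [b] and [c] lie in the
   half-plane [x.1 <= 0], where they vanish. The pairing is thus independent of [n]. *)
have val n : \int[mu2]_(x in T) (h x * phi n x) = k1 * unit_int F.
  rewrite hh //.
  have -> : unit_int (fun x => (j0 + j1 * x) * phi n (o + x *: a)) = unit_int F.
    apply: eq_unit_int => x _; have -> : o + x *: a = aff o a b (x, 0).
      by rewrite /aff /= scale0r addr0.
    by rewrite /phi affK // /f /= mulr0 subr0 addr0.
  have Z (J : R -> R) p : (forall x, 0 <= x <= 1 -> (lc o a b (o + x *: p)).1 <= 0) ->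
      unit_int (fun x => J x * phi n (o + x *: p)) = 0.
    move=> hp; rewrite (@eq_unit_int _ _ (fun=> 0)) => [|x /hp hx].
      by rewrite /unit_int Rintegral_cst // mul0r.
    rewrite /phi /f hat0 ?mul0r ?mulr0 //; apply/negP => /andP[]; lra.
  rewrite !Z ?mulr0 ?addr0 // => x /andP[x0 _]; rewrite /lc /=.
    have -> : crs (o + x *: c - o) b = - (x * crs b c) by rewrite /crs /= /GRing.scale /=; ring.
    by rewrite mulNr oppr_le0 divr_ge0 ?mulr_ge0 ?(ltW A0) ?(ltW C0).
  have -> : crs (o + x *: b - o) b = 0 by rewrite /crs /= /GRing.scale /=; ring.
  by rewrite mul0r.
have /integrableP[mh _] := ih.
have mphi n : measurable_fun setT (phi n : RR -> R).
  by have [/smooth_continuous/continuous_measurable2] := tphi n.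
have mf n : measurable_fun T (fun x : RR => (h x * phi n x)%:E).
  apply/measurable_EFinP; apply: measurable_funM; first exact/measurable_EFinP.
  by apply: (@measurable_funS _ _ _ _ setT T) (mphi n) => //.
have mT := hull3_measurable o a b c.
have lef n x : (`|(h x * phi n x)%:E| <= `|(h x)%:E|)%E.
  rewrite lee_fin normrM ler_piMr // ger0_norm; first by have /andP[] := phib n x.
  by have /andP[] := phib n x.
(* Off the line of the ray, [phi n x] vanishes for large [n]. With the dominating function [|h|],
   the constant pairing must be 0, contradicting [k10] and [I0]. *)
have cv : {ae mu2, forall x, T x -> (h x * phi n x)%:E @[n --> \oo] --> (0 : \bar R)}.
  exists [set x | (lc o a b x).2 = 0]; split.
  - exact: line_measurable.
  - exact: line_negligible.
  - move=> x /= hx; apply: contrapT => x2; apply: hx => _.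
    apply: cvg_near_cst; near=> n.
    have hn : (Num.bound `|(lc o a b x).2|^-1 <= n)%N by near: n; exact: nbhs_infty_ge.
    have r0 : 0 < `|(lc o a b x).2| by rewrite normr_gt0; exact/eqP.
    have : 1 <= (n + N)%:R * `|(lc o a b x).2|.
      have /archi_boundP : 0 <= `|(lc o a b x).2|^-1 by rewrite invr_ge0.
      move=> /ltW h1; rewrite -ler_pdivrMr // div1r (le_trans h1) // ler_nat.
      by apply: leq_trans hn _; exact: leq_addr.
    rewrite /phi /f; case: (ltgtP 0 (lc o a b x).2) => [rp|rn|re]; last by case: x2.
      rewrite gtr0_norm // => h1; rewrite [flat (1 - _)]flat_le0 ?mul0r ?mulr0 //.
      by rewrite subr_le0.
    rewrite ltr0_norm // mulrN => h1; rewrite [flat (1 + _)]flat_le0 ?mulr0 //.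
    by move: h1; move: (_ * _) => z; exact: le1N.
have ig : mu2.-integrable T (fun x => `|(h x)%:E|)%E by exact: integrable_abse.
have dom : {ae mu2, forall x n, T x -> (`|(h x * phi n x)%:E| <= `|(h x)%:E|)%E}.
  by apply: aeW => x n _; exact: lef.
have [_ _] := @dominated_convergence _ _ _ mu2 T mT (fun n x => (h x * phi n x)%:E) (cst 0%E) _ mf (measurable_cst 0%E) cv ig dom.
rewrite integral0.
have -> : (fun n => \int[mu2]_(x in T) (h x * phi n x)%:E)%E = cst (k1 * unit_int F)%:E.
  apply/funext => n; rewrite /cst -(val n) /Rintegral fineK //; apply: integral_fune_fin_num => //.
  by apply: (le_integrable mT (mf n) _ ih) => x _; exact: lef.
move=> hc; have /eqP : (k1 * unit_int F)%:E = 0%E by apply: (cvg_unique _ (cvg_cst _) hc); exact: ereal_hausdorff.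
by rewrite eqe mulf_eq0 (negbTE k10) (negbTE I0).
Unshelve. all: by end_near. Qed.

End TestFunctions.

(** * The distribution sven *)

Section StarDistribution.
Variable R : realType.
Local Notation mu := (@lebesgue_measure R).
Local Notation mu2 := (mu \x mu)%E.
Local Notation RR := (measurableTypeR R * measurableTypeR R)%type.
Implicit Types (o a b c p q r : R * R) (u : symq R) (phi f : R * R -> R).

Definition star a b c : Prop := [/\ 0 < crs b c, 0 < crs c a & 0 < crs a b].

Lemma star_rot a b c : star a b c -> star b c a.
Proof. by case. Qed.

Definition star_pairing o a b c uA uB uC phi : R :=
  \int[mu2]_(x in tri o b c) sven_pairing uA.1.1 uA.1.2 uA.2 phi x
  + \int[mu2]_(x in tri o c a) sven_pairing uB.1.1 uB.1.2 uB.2 phi x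
  + \int[mu2]_(x in tri o a b) sven_pairing uC.1.1 uC.1.2 uC.2 phi x.

Lemma star_pairing_rot o a b c uA uB uC :
  star_pairing o b c a uB uC uA = star_pairing o a b c uA uB uC.
Proof. by apply/funext => phi; rewrite /star_pairing [LHS]addrC addrA. Qed.

Definition star_sven o a b c uA uB uC f : Prop :=
  mu2.-integrable (hull3 o a b c) (EFin \o f) /\
  forall phi, compactly_in (hull3 o a b c) phi ->
    \int[mu2]_(x in hull3 o a b c) (f x * phi x) = star_pairing o a b c uA uB uC phi.

Lemma star_sven_rot o a b c uA uB uC f :
  star_sven o a b c uA uB uC f -> star_sven o b c a uB uC uA f.
Proof. by rewrite /star_sven (star_pairing_rot o a b c) (hull3_rot o a b c). Qed.

(** On the rays the indicators overlap and the constants add up; only integrals and values inside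
    the pieces are ever read. *)
Definition pwcst o a b c (g1 g2 g3 : R) (x : R * R) : R :=
  g1 * \1_(tri o b c) x + g2 * \1_(tri o c a) x + g3 * \1_(tri o a b) x.

Lemma pwcst_rot o a b c g1 g2 g3 x : pwcst o b c a g2 g3 g1 x = pwcst o a b c g1 g2 g3 x.
Proof. by rewrite /pwcst [LHS]addrC addrA. Qed.

Definition ray_conds o a b c uA uB uC : Prop :=
  [/\ ray_cond o a b c uC uB, ray_cond o b c a uA uC & ray_cond o c a b uB uA].

Definition jumps0 o a b c uA uB uC : Prop :=
  [/\ forall x, jump o a b c uC uB x = 0, forall x, jump o b c a uA uC x = 0
    & forall x, jump o c a b uB uA x = 0].

Lemma box_sub (m M m' M' n N n' N' : R) : n <= m -> M <= N -> n' <= m' -> M' <= N' ->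
  box m M m' M' `<=` box n N n' N'.
Proof.
move=> h1 h2 h3 h4 x /boxP[/andP[x1 x2] /andP[x3 x4]]; apply/boxP.
by rewrite !(le_trans _ x1) // !(le_trans _ x3) // (le_trans x2) // (le_trans x4).
Qed.

Lemma interior_shift (S : set (R * R)) x p : S° x -> exists2 e : R, 0 < e & S (x - e *: p).
Proof.
move=> ix.
have cx : x - e *: p @[e --> (0 : R)] --> x.
  have : x - e *: p @[e --> (0 : R)] --> x - 0 *: p.
    by apply: cvgB; [exact: cvg_cst|apply: cvgZ; [exact: cvg_id|exact: cvg_cst]].
  by rewrite scale0r subr0.
have [d /= d0 hd] := cx _ ix.
exists (d / 2); first by rewrite divr_gt0.
by apply: hd => /=; rewrite sub0r normrN gtr0_norm ?divr_gt0 // ltr_pdivrMr // ltr_pMr // ltr1n.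
Qed.

Lemma tri_interior_coord o p q x : 0 < crs p q -> (tri o p q)° x ->
  crs p (x - o) > 0 /\ crs q (x - o) < 0.
Proof.
move=> c0 ix; split.
  have [e e0] := interior_shift q ix.
  rewrite triE ?gt_eqF // => -[/= _ + _]; rewrite /lc /=.
  have -> : crs p (x - e *: q - o) = crs p (x - o) - e * crs p q.
    by rewrite /crs /= /GRing.scale /=; ring.
  rewrite pmulr_lge0 ?invr_gt0 // subr_ge0; apply: lt_le_trans.
  by rewrite mulr_gt0.
have [e e0] := interior_shift p ix.
rewrite triE ?gt_eqF // => -[/= + _ _]; rewrite /lc /=.
have -> : crs (x - e *: p - o) q = - crs q (x - o) - e * crs p q.
  by rewrite /crs /= /GRing.scale /=; ring.
rewrite pmulr_lge0 ?invr_gt0 // subr_ge0 -oppr_gt0; apply: lt_le_trans.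
by rewrite mulr_gt0.
Qed.

Lemma abs4_bounds (m M m' M' N : R) : N = `|m| + `|M| + `|m'| + `|M'| ->
  [/\ - N <= m, M <= N, - N <= m' & M' <= N].
Proof.
move=> ->; have := ler_norm M; have := ler_norm M'; have := ler_norm (- m); have := ler_norm (- m').
have := normr_ge0 m; have := normr_ge0 M; have := normr_ge0 m'; have := normr_ge0 M'.
by rewrite !normrN => *; split; lra.
Qed.

Lemma abs3_bounds (m M m' N : R) : N = `|m| + `|M| + `|m'| ->
  [/\ m <= N, M <= N & m' <= N].
Proof.
move=> ->; have := ler_norm M; have := ler_norm m; have := ler_norm m'.
have := normr_ge0 m; have := normr_ge0 M; have := normr_ge0 m'.
by move=> *; split; lra.
Qed.

Section Frame.
Variables o a b c : R * R.
Hypothesis abc : star a b c.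
Let A0 : 0 < crs b c := let: And3 h _ _ := abc in h.
Let B0 : 0 < crs c a := let: And3 _ h _ := abc in h.
Let C0 : 0 < crs a b := let: And3 _ _ h := abc in h.
Local Notation T := (hull3 o a b c).

Lemma hull3_box : exists N : R, T `<=` box (- N) N (- N) N.
Proof.
have H p q : exists N : R, tri o p q `<=` box (- N) N (- N) N.
  have [m [M [m' [M' h]]]] := tri_box o p q.
  have [k1 k2 k3 k4] := abs4_bounds (erefl (`|m| + `|M| + `|m'| + `|M'|)).
  by exists (`|m| + `|M| + `|m'| + `|M'|) => x /h; exact: box_sub.
have [N1 h1] := H a b; have [N2 h2] := H b c; have [N3 h3] := H c a.
have [k1 k2 k3] := abs3_bounds (erefl (`|N1| + `|N2| + `|N3|)).
exists (`|N1| + `|N2| + `|N3|) => x /(hull3_cover A0 B0 C0)[/h1|/h2|/h3]; apply: box_sub => //; by rewrite lerN2.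
Qed.

Lemma continuous_bounded_hull3 phi : continuous phi -> [bounded phi x | x in T].
Proof.
move=> cphi; have [N hN] := hull3_box.
have : compact (phi @` box (- N) N (- N) N).
  by apply: continuous_compact; [exact: continuous_subspaceT|exact: box_compact].
move=> /compact_bounded[M [Mr hM]]; exists M; split => // y /hM h x /= /hN bx.
by apply: h; exists x.
Qed.

Lemma integrable_mul_test f phi : mu2.-integrable T (EFin \o f) -> continuous phi ->
  mu2.-integrable T (EFin \o (fun x => f x * phi x)).
Proof.
move=> fi cphi.
have := integrableMl (hull3_measurable o a b c) fi _ (continuous_bounded_hull3 cphi).
move=> /(_ _)/wrap[|//].
apply: measurable_funTS; exact: continuous_measurable2.
Qed.

Lemma tri_sub_T : [/\ tri o b c `<=` T, tri o c a `<=` T & tri o a b `<=` T].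
Proof.
split; last exact: tri_sub_hull3.
- by rewrite hull3_rot; exact: tri_sub_hull3.
- by rewrite -hull3_rot; exact: tri_sub_hull3.
Qed.

Lemma indic_integral (S : set RR) phi : measurable S -> S `<=` T -> continuous phi ->
  mu2.-integrable T (EFin \o (fun x => \1_S x * phi x)) /\
  \int[mu2]_(x in T) (\1_S x * phi x) = \int[mu2]_(x in S) phi x.
Proof.
move=> mS ST cphi; have mT := hull3_measurable o a b c.
have [N hN] := hull3_box.
have E : (EFin \o (fun x => \1_S x * phi x)) = ((EFin \o phi) \_ S).
  apply/funext => x; rewrite /patch /= indicE; case: (x \in S); first by rewrite mul1r.
  by rewrite mul0r.
split.
  rewrite E; apply/integrable_restrict => //.
  rewrite setIidr //; apply: (@continuous_integrable2 R phi S _ _ _ _ cphi mS) => x /ST; exact: hN.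
rewrite Rintegral_mkcond [in RHS]Rintegral_mkcond; apply: eq_Rintegral => x _.
rewrite /patch indicE; have [xS|xS] := boolP (x \in S).
  by rewrite (mem_set (ST _ (set_mem xS))) mul1r.
by rewrite mul0r; case: ifP.
Qed.

Lemma pwcst_integral g1 g2 g3 phi : continuous phi ->
  mu2.-integrable T (EFin \o (fun x => pwcst o a b c g1 g2 g3 x * phi x)) /\
  \int[mu2]_(x in T) (pwcst o a b c g1 g2 g3 x * phi x) =
    g1 * (\int[mu2]_(x in tri o b c) phi x) + g2 * (\int[mu2]_(x in tri o c a) phi x)
    + g3 * (\int[mu2]_(x in tri o a b) phi x).
Proof.
move=> cphi; have mT := hull3_measurable o a b c.
have [s1 s2 s3] := tri_sub_T.
have [i1 e1] := indic_integral (tri_measurable o (lt0r_neq0 A0)) s1 cphi.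
have [i2 e2] := indic_integral (tri_measurable o (lt0r_neq0 B0)) s2 cphi.
have [i3 e3] := indic_integral (tri_measurable o (lt0r_neq0 C0)) s3 cphi.
have j1 := integrableZl mT g1 i1.
have j2 := integrableZl mT g2 i2.
have j3 := integrableZl mT g3 i3.
have E x : pwcst o a b c g1 g2 g3 x * phi x = g1 * (\1_(tri o b c) x * phi x)
   + g2 * (\1_(tri o c a) x * phi x) + g3 * (\1_(tri o a b) x * phi x).
  by rewrite /pwcst !mulrDl !mulrA.
split.
  rewrite (_ : EFin \o _ = (fun x => (g1 * (\1_(tri o b c) x * phi x))%:E
    + (g2 * (\1_(tri o c a) x * phi x))%:E + (g3 * (\1_(tri o a b) x * phi x))%:E)%E); last first.
    by apply/funext => x; rewrite /= E !EFinD.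
  by apply: integrableD => //; apply: integrableD.
under eq_Rintegral do rewrite E.
rewrite RintegralD //; last first.
  rewrite (_ : EFin \o _ = (fun x => (g1 * (\1_(tri o b c) x * phi x))%:E
    + (g2 * (\1_(tri o c a) x * phi x))%:E)%E) //; exact: integrableD.
by rewrite RintegralD // !RintegralZl // e1 e2 e3.
Qed.

Lemma pwcst_integrable g1 g2 g3 : mu2.-integrable T (EFin \o pwcst o a b c g1 g2 g3).
Proof.
have [+ _] := @pwcst_integral g1 g2 g3 (fun=> 1) (fun x => cvg_cst _).
by congr integrable; apply/funext => x /=; rewrite mulr1.
Qed.

Lemma star_pairing_green uA uB uC phi : compactly_in T phi -> ray_conds o a b c uA uB uC ->
  star_pairing o a b c uA uB uC phi =
  \int[mu2]_(x in T) (pwcst o a b c (sven_const uA o b c) (sven_const uB o c a) (sven_const uC o a b) x * phi x)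
  + (crs c a * crs a b)^-1 * unit_int (fun x => jump o a b c uC uB x * phi (o + x *: a))
  + (crs a b * crs b c)^-1 * unit_int (fun x => jump o b c a uA uC x * phi (o + x *: b))
  + (crs b c * crs c a)^-1 * unit_int (fun x => jump o c a b uB uA x * phi (o + x *: c)).
Proof.
move=> [sphi _ suppT] [ra rb rc].
rewrite /star_pairing (star_green A0 B0 C0 sphi (@closed_closure _ [set x | phi x != 0])) //.
- by rewrite (pwcst_integral _ _ _ (smooth_continuous sphi)).2.
- move=> x hx; apply/eqP/negPn/negP => h; apply: hx; exact: subset_closure.
- move=> x x1 x2 x12; split => /suppT.
  + by rewrite hull3_rot; exact: outer_not_interior.
  + by rewrite -hull3_rot; exact: outer_not_interior.
  + exact: outer_not_interior.
Qed.

Lemma star_sven_exists uA uB uC : ray_conds o a b c uA uB uC -> jumps0 o a b c uA uB uC ->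
  star_sven o a b c uA uB uC
    (pwcst o a b c (sven_const uA o b c) (sven_const uB o c a) (sven_const uC o a b)).
Proof.
move=> rc [ja jb jc]; split; first exact: pwcst_integrable.
move=> phi cphi; rewrite star_pairing_green //.
have Z (J : R -> R) p : (forall x, J x = 0) -> unit_int (fun x => J x * phi (o + x *: p)) = 0.
  move=> hJ; rewrite (_ : (fun _ => _) = fun=> 0); last by apply/funext => x; rewrite hJ mul0r.
  by rewrite /unit_int Rintegral_cst // mul0r.
by rewrite !Z // !mulr0 !addr0.
Qed.

Lemma pwcst_interior g1 g2 g3 x : (tri o a b)° x -> pwcst o a b c g1 g2 g3 x = g3.
Proof.
move=> ix; have [x1 x2] := tri_interior_coord C0 ix.
rewrite /pwcst !indicE.
have -> : x \in tri o a b by apply/mem_set; exact: interior_subset ix.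
have -> : x \in tri o b c = false.
  apply/negP => /set_mem; rewrite triE ?gt_eqF // => -[/= _ + _].
  by rewrite /lc /= pmulr_lge0 ?invr_gt0 // leNgt x2.
have -> : x \in tri o c a = false.
  apply/negP => /set_mem; rewrite triE ?gt_eqF // => -[/= + _ _].
  rewrite /lc /= pmulr_lge0 ?invr_gt0 // (_ : crs (x - o) a = - crs a (x - o)) ?oppr_ge0 ?leNgt ?x1 //.
  by rewrite /crs; ring.
by rewrite !mulr0 !add0r mulr1.
Qed.

(** Both functions are tested with a bump supported in the piece [[a, b]] whose integral is
    nonzero. *)
Lemma star_sven_unique uA uB uC f f' k k' :
  star_sven o a b c uA uB uC f -> star_sven o a b c uA uB uC f' ->
  (forall x, (tri o a b)° x -> f x = k) -> (forall x, (tri o a b)° x -> f' x = k') -> k = k'.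
Proof.
move=> [_ hf] [_ hf'] fk fk'.
have [phi [cphi phit phi0]] := tri_test_function o A0 B0 C0.
have E (g : R * R -> R) l : (forall x, (tri o a b)° x -> g x = l) ->
    \int[mu2]_(x in T) (g x * phi x) = l * \int[mu2]_(x in T) phi x.
  move=> gl; have [sphi _ _] := cphi.
  rewrite -RintegralZl; last 2 first.
  - exact: hull3_measurable.
  - have := integrable_mul_test (pwcst_integrable 0 0 0) (smooth_continuous sphi).
    have [N hN] := hull3_box => _.
    apply: (continuous_integrable2 (smooth_continuous sphi) _ hN); exact: hull3_measurable.
  apply: eq_Rintegral => x _; have [->|/phit/gl->//] := eqVneq (phi x) 0.
  by rewrite !mulr0.
have := hf phi cphi; rewrite -(hf' phi cphi) (E _ _ fk) (E _ _ fk').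
by move=> /(mulIf phi0).
Qed.

(** By [star_pairing_green], the difference between [f] and the piecewise constant candidate pairs
    with test functions as the three ray integrals do, which is the situation of [ray_detection]. *)
Lemma star_sven_jump uA uB uC f : ray_conds o a b c uA uB uC ->
  star_sven o a b c uA uB uC f -> forall x, jump o a b c uC uB x = 0.
Proof.
move=> rc [fi hf].
pose g := pwcst o a b c (sven_const uA o b c) (sven_const uB o c a) (sven_const uC o a b).
(* The jump is built from first derivatives of quadratics, hence affine along the ray and given by
   its values at 0 and 1. *)
pose j0 := jump o a b c uC uB 0.
pose j1 := jump o a b c uC uB 1 - j0.
have E x : jump o a b c uC uB x = j0 + j1 * x.
  by rewrite /j1 /j0 /jump; do ?move: (lq _ _ _ _ _ _) => ?; do ?move: (crs _ _) => ?; rewrite /qv /=; ring.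
have gi : mu2.-integrable T (EFin \o g) by exact: pwcst_integrable.
have hi : mu2.-integrable T (EFin \o (fun x => f x - g x)).
  rewrite (_ : EFin \o _ = (fun x => (f x)%:E - (g x)%:E)%E) //.
  by apply: integrableB => //; exact: hull3_measurable.
have k0 : (crs c a * crs a b)^-1 != 0 by rewrite invr_eq0 mulf_neq0 // gt_eqF.
have [z0 z1] : j0 = 0 /\ j1 = 0; last by move=> x; rewrite E z0 z1 mul0r addr0.
apply: (ray_detection A0 B0 C0 k0 hi (j0 := j0) (j1 := j1)
  (k2 := (crs a b * crs b c)^-1) (k3 := (crs b c * crs c a)^-1)
  (Jb := jump o b c a uA uC) (Jc := jump o c a b uB uA)) => phi cphi.
have cp : continuous phi by case: cphi => /smooth_continuous.
transitivity (\int[mu2]_(x in T) (f x * phi x) - \int[mu2]_(x in T) (g x * phi x)).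
  rewrite -RintegralB; last 3 first.
  - exact: hull3_measurable.
  - exact: integrable_mul_test.
  - exact: integrable_mul_test.
  by apply: eq_Rintegral => x _; rewrite mulrBl.
rewrite hf // star_pairing_green // -/g.
have -> : unit_int (fun x => (j0 + j1 * x) * phi (o + x *: a)) =
    unit_int (fun x => jump o a b c uC uB x * phi (o + x *: a)).
  by congr unit_int; apply/funext => x; rewrite E.
set i1 := Rintegral _ _ _; set i2 := _ * _; set i3 := _ * _; set i4 := _ * _.
by move: i1 i2 i3 i4 => i1 i2 i3 i4; ring.
Qed.

End Frame.

Lemma ray_conds_rot o a b c uA uB uC : ray_conds o a b c uA uB uC -> ray_conds o b c a uB uC uA.
Proof. by case. Qed.

Lemma star_sven_jumps0 o a b c uA uB uC f : star a b c -> ray_conds o a b c uA uB uC ->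
  star_sven o a b c uA uB uC f -> jumps0 o a b c uA uB uC.
Proof.
move=> s r h.
have s' := star_rot s; have s'' := star_rot s'.
have r' := ray_conds_rot r; have r'' := ray_conds_rot r'.
have h' := star_sven_rot h; have h'' := star_sven_rot h'.
by split; [apply: (star_sven_jump s r h)|apply: (star_sven_jump s' r' h')|
  apply: (star_sven_jump s'' r'' h'')].
Qed.

End StarDistribution.

(** * Vector fields with continuous curl *)

Section StarVector.
Variable R : realType.
Implicit Types (o a b c p q r x v : R * R).

Lemma dotDr v p q : dot v (p + q) = dot v p + dot v q.
Proof. by rewrite /dot /=; ring. Qed.
Lemma dotZr k v p : dot v (k *: p) = k * dot v p.
Proof. by rewrite /dot /= /GRing.scale /=; ring. Qed.
Lemma dotNr v p : dot v (- p) = - dot v p.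
Proof. by rewrite /dot /=; ring. Qed.
Lemma dot0r v : dot v 0 = 0.
Proof. by rewrite /dot /= !mulr0 addr0. Qed.
Lemma dotBl v p q : dot (p - q) v = dot p v - dot q v.
Proof. by rewrite /dot /=; ring. Qed.

Lemma solve_dot p q (k l : R) : crs p q != 0 -> exists x, dot p x = k /\ dot q x = l.
Proof.
move=> c0; exists ((k * q.2 - l * p.2) / crs p q, (l * p.1 - k * q.1) / crs p q).
by rewrite /dot /=; split; rewrite !mulrA -mulrDl -[RHS](mulfK c0) /crs; congr (_ / _); ring.
Qed.

Lemma dot_eq0 p q x : crs p q != 0 -> dot p x = 0 -> dot q x = 0 -> x = 0.
Proof.
move=> c0 h1 h2; case: x h1 h2 => x1 x2; rewrite /dot /= => h1 h2.
have e1 : crs p q * x1 = 0.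
  transitivity (q.2 * (p.1 * x1 + p.2 * x2) - p.2 * (q.1 * x1 + q.2 * x2)).
    by rewrite /crs; ring.
  by rewrite h1 h2; ring.
have e2 : crs p q * x2 = 0.
  transitivity (p.1 * (q.1 * x1 + q.2 * x2) - q.1 * (p.1 * x1 + p.2 * x2)).
    by rewrite /crs; ring.
  by rewrite h1 h2; ring.
move: e1 e2 => /eqP; rewrite mulf_eq0 (negbTE c0) => /eqP -> /eqP.
by rewrite mulf_eq0 (negbTE c0) => /eqP ->.
Qed.

Definition vecq : Type := (quadr R * quadr R)%type.

Definition vq (v : vecq) x : R * R := (qv v.1 x, qv v.2 x).

Definition curlq (v : vecq) : quadr R := qlin (-1) (qd2 v.1) (qd1 v.2).

(* coefficient in the coordinates of the frame [p, q] *)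
Definition vco (k : quadr R -> R) (v : vecq) o p q : R * R :=
  (k (qcomp v.1 o p q), k (qcomp v.2 o p q)).

Lemma vq_local (v : vecq) o p q x : vq v (aff o p q x) =
  vco (@q0 R) v o p q + x.1 *: vco (@q1 R) v o p q + x.2 *: vco (@q2 R) v o p q
  + x.1 ^+ 2 *: vco (@q11 R) v o p q + (x.1 * x.2) *: vco (@q12 R) v o p q
  + x.2 ^+ 2 *: vco (@q22 R) v o p q.
Proof.
rewrite /vq -!qv_comp /vco; move: (qcomp v.1 o p q) (qcomp v.2 o p q) => f g.
by apply: injective_projections; rewrite /qv /= /GRing.scale /=; ring.
Qed.

(** Invariant form of the curl: [crs p q * curl v] is the derivative of [v . q] along [p] minus the
    derivative of [v . p] along [q]. *)
Lemma curl_local (v : vecq) o p q x : crs p q * qv (curlq v) (aff o p q x) =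
  dot q (vco (@q1 R) v o p q) - dot p (vco (@q2 R) v o p q)
  + x.1 * (2 * dot q (vco (@q11 R) v o p q) - dot p (vco (@q12 R) v o p q))
  + x.2 * (dot q (vco (@q12 R) v o p q) - 2 * dot p (vco (@q22 R) v o p q)).
Proof.
move: v => [[f0 f1 f2 f11 f12 f22] [g0 g1 g2 g11 g12 g22]].
move: o p q x => [r1 r2] [p1 p2] [s1 s2] [x1 x2].
by rewrite /curlq /vco /dot /crs /qv /aff /qlin /qcomp /qv /= /GRing.scale /=; ring.
Qed.

Definition qglob (d : quadr R) o p q : quadr R :=
  qcomp d (lc o p q 0) (q.2 / crs p q, - p.2 / crs p q) (- q.1 / crs p q, p.1 / crs p q).

Lemma qcomp_glob d o p q : crs p q != 0 -> qcomp (qglob d o p q) o p q = d.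
Proof.
move=> c0; apply: qv_inj; apply/funext => x.
by rewrite qv_comp /qglob qv_comp -lcE affK.
Qed.

Definition mkvec z e e' g h g' o p q : vecq :=
  (qglob (Quadr z.1 e.1 e'.1 g.1 h.1 g'.1) o p q, qglob (Quadr z.2 e.2 e'.2 g.2 h.2 g'.2) o p q).

Lemma vco_mkvec z e e' g h g' o p q : crs p q != 0 -> let v := mkvec z e e' g h g' o p q in
  [/\ vco (@q0 R) v o p q = z, vco (@q1 R) v o p q = e & vco (@q2 R) v o p q = e'] /\
  [/\ vco (@q11 R) v o p q = g, vco (@q12 R) v o p q = h & vco (@q22 R) v o p q = g'].
Proof.
move=> c0; cbv zeta; rewrite /vco /mkvec !qcomp_glob //=.
by move: z e e' g h g' => [? ?] [? ?] [? ?] [? ?] [? ?] [? ?].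
Qed.

Definition meet o p (f g : quadr R) : Prop :=
  forall s : R, 0 <= s <= 1 -> qv f (o + s *: p) = qv g (o + s *: p).

Definition vmeet o p (v w : vecq) : Prop :=
  forall s : R, 0 <= s <= 1 -> vq v (o + s *: p) = vq w (o + s *: p).

Definition A0star o a b c (vA vB vC : vecq) : Prop :=
  [/\ vmeet o a vC vB, vmeet o b vA vC & vmeet o c vB vA] /\
  [/\ meet o a (curlq vC) (curlq vB), meet o b (curlq vA) (curlq vC)
    & meet o c (curlq vB) (curlq vA)].

Lemma A0star_rot o a b c vA vB vC : A0star o a b c vA vB vC -> A0star o b c a vB vC vA.
Proof. by move=> [[? ? ?] [? ? ?]]. Qed.

Lemma aff_ray1 o p q (s : R) : o + s *: p = aff o p q (s, 0).
Proof. by rewrite /aff /= scale0r addr0. Qed.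
Lemma aff_ray2 o p q (s : R) : o + s *: p = aff o q p (0, s).
Proof. by rewrite /aff /= scale0r addr0. Qed.

(** The values at 0, 1/2 and 1 determine a quadratic. *)
Lemma quad3_eq0 (k0 k1 k2 l0 l1 l2 : R) :
  (forall s : R, 0 <= s <= 1 -> k0 + k1 * s + k2 * s ^+ 2 = l0 + l1 * s + l2 * s ^+ 2) ->
  [/\ k0 = l0, k1 = l1 & k2 = l2].
Proof.
move=> h; have h0 := h 0; have h1 := h 1; have h2 := h (2^-1).
have {}h0 := h0 (introT andP (conj (lexx _) ler01)).
have {}h1 := h1 (introT andP (conj ler01 (lexx _))).
have h22 : 0 <= (2^-1 : R) <= 1 by apply/andP; split; lra.
have {}h2 := h2 h22; rewrite !expr2 in h0 h1 h2.
by split; lra.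
Qed.

Lemma meet_coef o p q r (f g : quadr R) : meet o p f g ->
  [/\ q0 (qcomp f o p q) = q0 (qcomp g o r p), q1 (qcomp f o p q) = q2 (qcomp g o r p)
    & q11 (qcomp f o p q) = q22 (qcomp g o r p)].
Proof.
move=> h; apply: quad3_eq0 => s hs; have := h s hs.
rewrite {1}(aff_ray1 o p q) (aff_ray2 o p r) -!qv_comp.
rewrite /qv /= !mulr0 !mul0r !mulr0 !addr0 expr0n /= !mulr0 !addr0; exact.
Qed.

Lemma vmeet_coef o p q r (v w : vecq) : vmeet o p v w ->
  [/\ vco (@q0 R) v o p q = vco (@q0 R) w o r p, vco (@q1 R) v o p q = vco (@q2 R) w o r p
    & vco (@q11 R) v o p q = vco (@q22 R) w o r p].
Proof.
move=> h.
have [x0 x1 x2] : [/\ q0 (qcomp v.1 o p q) = q0 (qcomp w.1 o r p),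
    q1 (qcomp v.1 o p q) = q2 (qcomp w.1 o r p) & q11 (qcomp v.1 o p q) = q22 (qcomp w.1 o r p)].
  by apply: meet_coef => s hs; have [] := h s hs.
have [y0 y1 y2] : [/\ q0 (qcomp v.2 o p q) = q0 (qcomp w.2 o r p),
    q1 (qcomp v.2 o p q) = q2 (qcomp w.2 o r p) & q11 (qcomp v.2 o p q) = q22 (qcomp w.2 o r p)].
  by apply: meet_coef => s hs; have [] := h s hs.
by rewrite /vco x0 x1 x2 y0 y1 y2.
Qed.

Lemma A0star_curl o a b c vA vB vC : star a b c -> A0star o a b c vA vB vC ->
  exists (k l1 l2 l3 : R),
  [/\ forall s, 0 <= s <= 1 -> qv (curlq vC) (o + s *: a) = k + s * l1,
      forall s, 0 <= s <= 1 -> qv (curlq vA) (o + s *: b) = k + s * l2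
    & forall s, 0 <= s <= 1 -> qv (curlq vB) (o + s *: c) = k + s * l3].
Proof.
move=> abc [_ [ma mb mc]].
have E (f : quadr R) p : q11 f = 0 -> q12 f = 0 -> q22 f = 0 ->
    exists l, forall s, qv f (o + s *: p) = qv f o + s * l.
  move=> f1 f2 f3; exists (q1 f * p.1 + q2 f * p.2) => s.
  by rewrite /qv f1 f2 f3 /GRing.scale /= /GRing.scale /=; ring.
have Z (v : vecq) : [/\ q11 (curlq v) = 0, q12 (curlq v) = 0 & q22 (curlq v) = 0].
  by rewrite /curlq /=; split; ring.
have [l1 h1] : exists l, forall s, qv (curlq vC) (o + s *: a) = qv (curlq vC) o + s * l.
  by have [] := Z vC; exact: E.
have [l2 h2] : exists l, forall s, qv (curlq vA) (o + s *: b) = qv (curlq vA) o + s * l.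
  by have [] := Z vA; exact: E.
have [l3 h3] : exists l, forall s, qv (curlq vB) (o + s *: c) = qv (curlq vB) o + s * l.
  by have [] := Z vB; exact: E.
have i0 : 0 <= (0 : R) <= 1 by rewrite lexx ler01.
have := mb 0 i0; have := ma 0 i0; rewrite !scale0r !addr0 => e1 e2.
exists (qv (curlq vC) o), l1, l2, l3; split => s _; first exact: h1.
  by rewrite h2 e2.
by rewrite h3 -e1.
Qed.

Lemma affine_unit (k0 k1 l0 l1 : R) :
  (forall s : R, 0 <= s <= 1 -> k0 + k1 * s = l0 + l1 * s) -> k0 = l0 /\ k1 = l1.
Proof.
move=> h; have h0 := h 0 (introT andP (conj (lexx _) ler01)).
have h1 := h 1 (introT andP (conj ler01 (lexx _))).
by split; lra.
Qed.

(* [z], [e.], [g.], [h.] are the coefficients of the pieces in the star frames;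
   [k + s l.] is the curl along the rays. *)
Definition star_system a b c (e1 e2 e3 g1 g2 g3 h1 h2 h3 : R * R) (k l1 l2 l3 : R) : Prop :=
  [/\ dot b e1 - dot a e2 = crs a b * k, dot c e2 - dot b e3 = crs b c * k
    & dot a e3 - dot c e1 = crs c a * k] /\
  [/\ 2 * dot b g1 - dot a h3 = crs a b * l1, 2 * dot c g2 - dot b h1 = crs b c * l2
    & 2 * dot a g3 - dot c h2 = crs c a * l3] /\
  [/\ dot b h3 - 2 * dot a g2 = crs a b * l2, dot c h1 - 2 * dot b g3 = crs b c * l3
    & dot a h2 - 2 * dot c g1 = crs c a * l1].

Lemma A0star_coef o a b c vA vB vC : star a b c -> A0star o a b c vA vB vC ->
  exists z e1 e2 e3 g1 g2 g3 h1 h2 h3 k l1 l2 l3,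
  [/\ star_system a b c e1 e2 e3 g1 g2 g3 h1 h2 h3 k l1 l2 l3,
    (forall s, 0 <= s <= 1 -> qv (curlq vC) (o + s *: a) = k + s * l1) /\
    (forall s, 0 <= s <= 1 -> qv (curlq vA) (o + s *: b) = k + s * l2) /\
    (forall s, 0 <= s <= 1 -> qv (curlq vB) (o + s *: c) = k + s * l3),
    [/\ vco (@q0 R) vA o b c = z, vco (@q1 R) vA o b c = e2, vco (@q2 R) vA o b c = e3
      & [/\ vco (@q11 R) vA o b c = g2, vco (@q12 R) vA o b c = h1 & vco (@q22 R) vA o b c = g3]],
    [/\ vco (@q0 R) vB o c a = z, vco (@q1 R) vB o c a = e3, vco (@q2 R) vB o c a = e1
      & [/\ vco (@q11 R) vB o c a = g3, vco (@q12 R) vB o c a = h2 & vco (@q22 R) vB o c a = g1]]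
    & [/\ vco (@q0 R) vC o a b = z, vco (@q1 R) vC o a b = e1, vco (@q2 R) vC o a b = e2
      & [/\ vco (@q11 R) vC o a b = g1, vco (@q12 R) vC o a b = h3 & vco (@q22 R) vC o a b = g2]]].
Proof.
move=> abc As; have [[va vb vc] [ma mb mc]] := As.
have [k [l1 [l2 [l3 [k1 k2 k3]]]]] := A0star_curl abc As.
have [x0 x1 x2] := vmeet_coef b c va.
have [y0 y1 y2] := vmeet_coef c a vb.
have [z0 z1 z2] := vmeet_coef a b vc.
have k1' s (hs : 0 <= s <= 1) : qv (curlq vB) (o + s *: a) = k + s * l1.
  by rewrite -ma // k1.
have k2' s (hs : 0 <= s <= 1) : qv (curlq vC) (o + s *: b) = k + s * l2.
  by rewrite -mb // k2.
have k3' s (hs : 0 <= s <= 1) : qv (curlq vA) (o + s *: c) = k + s * l3.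
  by rewrite -mc // k3.
(* [curl_local] on the first axis, compared with [m + s n] coefficient by coefficient; [L2] does the
   same on the second axis. *)
have L1 (v : vecq) p q (m n : R) : (forall s, 0 <= s <= 1 -> qv (curlq v) (o + s *: p) = m + s * n) ->
    dot q (vco (@q1 R) v o p q) - dot p (vco (@q2 R) v o p q) = crs p q * m /\
    2 * dot q (vco (@q11 R) v o p q) - dot p (vco (@q12 R) v o p q) = crs p q * n.
  move=> h; apply: affine_unit => s hs; have := curl_local v o p q (s, 0).
  by rewrite -aff_ray1 h //= => e; rewrite -mulrA -mulrDr [n * s]mulrC e; ring.
have L2 (v : vecq) p q (m n : R) : (forall s, 0 <= s <= 1 -> qv (curlq v) (o + s *: q) = m + s * n) ->
    dot q (vco (@q12 R) v o p q) - 2 * dot p (vco (@q22 R) v o p q) = crs p q * n.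
  move=> h; have [_ //] : dot q (vco (@q1 R) v o p q) - dot p (vco (@q2 R) v o p q) = crs p q * m /\
    dot q (vco (@q12 R) v o p q) - 2 * dot p (vco (@q22 R) v o p q) = crs p q * n.
  apply: affine_unit => s hs; have := curl_local v o p q (0, s).
  by rewrite -aff_ray2 h //= => e; rewrite -mulrA -mulrDr [n * s]mulrC e; ring.
exists (vco (@q0 R) vC o a b), (vco (@q1 R) vC o a b), (vco (@q2 R) vC o a b), (vco (@q2 R) vA o b c).
exists (vco (@q11 R) vC o a b), (vco (@q22 R) vC o a b), (vco (@q22 R) vA o b c).
exists (vco (@q12 R) vA o b c), (vco (@q12 R) vB o c a), (vco (@q12 R) vC o a b), k, l1, l2, l3.
have [p1 p2] := L1 _ _ b _ _ k1; have [p3 p4] := L1 _ _ c _ _ k2; have [p5 p6] := L1 _ _ a _ _ k3.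
have p7 := L2 _ a _ _ _ k2'; have p8 := L2 _ b _ _ _ k3'; have p9 := L2 _ c _ _ _ k1'.
split; [split; [|split]| | | |].
all: try by split.
- by split; [exact: p1|rewrite -y1|rewrite x1 -z1].
all: try by split; [exact: p2|rewrite -y2|rewrite -z2].
all: try by split; [exact: p7|exact: p8|rewrite x2].
all: try by split; rewrite ?y0 ?y1 ?y2.
all: by split; rewrite -?x0 -?x1 -?x2 ?z1 ?z2.
Qed.

Lemma crs_edges a b c : crs (b - a) (c - a) = crs b c + crs c a + crs a b.
Proof. by rewrite /crs /=; ring. Qed.

Lemma star_area_gt0 a b c : star a b c -> 0 < crs b c + crs c a + crs a b.
Proof. by move=> [h1 h2 h3]; apply: addr_gt0 => //; exact: addr_gt0. Qed.

(* The two curl conditions along the ray of [a], added to those at the centre,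
   determine [2 z + e1]. *)
Lemma star_system_vertex a b c e1 e2 e3 g1 g2 g3 h1 h2 h3 k l1 l2 l3 z y VA VB VC mB mC :
  star_system a b c e1 e2 e3 g1 g2 g3 h1 h2 h3 k l1 l2 l3 ->
  z + e1 + g1 = VA -> z + e2 + g2 = VB -> z + e3 + g3 = VC ->
  z + 2^-1 *: (e1 + e2) + 4^-1 *: (g1 + g2 + h3) = mC ->
  z + 2^-1 *: (e3 + e1) + 4^-1 *: (g3 + g1 + h2) = mB -> y = 2 *: z + e1 ->
  dot (b - a) y = 2 * dot b VA - dot a (4 *: mC - VA - VB) - crs a b * (k + l1) /\
  dot (c - a) y = 2 * dot c VA - dot a (4 *: mB - VC - VA) + crs c a * (k + l1).
Proof.
move=> [[a1 a2 a3] [[b1 b2 b3] [c1 c2 c3]]] <- <- <- <- <- ->.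
by rewrite !dotBl !(dotDr, dotNr, dotZr); split; lra.
Qed.

(** On the ray of [a] the field is [z + s e1 + s^2 g1], so [2 *: z + e1] is twice its middle
    Bernstein coefficient. Vanishing data make it orthogonal to the independent vectors [b - a] and
    [c - a]. *)
Lemma star_system_vertex0 a b c e1 e2 e3 g1 g2 g3 h1 h2 h3 k l1 l2 l3 z : star a b c ->
  star_system a b c e1 e2 e3 g1 g2 g3 h1 h2 h3 k l1 l2 l3 ->
  z + e1 + g1 = 0 -> z + e2 + g2 = 0 -> z + e3 + g3 = 0 ->
  z + 2^-1 *: (e1 + e2) + 4^-1 *: (g1 + g2 + h3) = 0 ->
  z + 2^-1 *: (e3 + e1) + 4^-1 *: (g3 + g1 + h2) = 0 -> k + l1 = 0 -> 2 *: z + e1 = 0.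
Proof.
move=> abc sys v1 v2 v3 m3 m2 kl.
have [d1 d2] := star_system_vertex sys v1 v2 v3 m3 m2 erefl.
apply: (@dot_eq0 (b - a) (c - a)).
- by rewrite crs_edges gt_eqF // star_area_gt0.
- by rewrite d1 kl scaler0 !subr0 !dot0r !mulr0 !subr0.
- by rewrite d2 kl scaler0 !subr0 !dot0r !mulr0 !subr0 addr0.
Qed.

Lemma A0star_values o a b c vA vB vC z e1 e2 e3 g1 g2 g3 h1 h2 h3 :
  [/\ vco (@q0 R) vA o b c = z, vco (@q1 R) vA o b c = e2, vco (@q2 R) vA o b c = e3
      & [/\ vco (@q11 R) vA o b c = g2, vco (@q12 R) vA o b c = h1 & vco (@q22 R) vA o b c = g3]] ->
  [/\ vco (@q0 R) vB o c a = z, vco (@q1 R) vB o c a = e3, vco (@q2 R) vB o c a = e1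
      & [/\ vco (@q11 R) vB o c a = g3, vco (@q12 R) vB o c a = h2 & vco (@q22 R) vB o c a = g1]] ->
  [/\ vco (@q0 R) vC o a b = z, vco (@q1 R) vC o a b = e1, vco (@q2 R) vC o a b = e2
      & [/\ vco (@q11 R) vC o a b = g1, vco (@q12 R) vC o a b = h3 & vco (@q22 R) vC o a b = g2]] ->
  [/\ vq vC (o + a) = z + e1 + g1, vq vA (o + b) = z + e2 + g2 & vq vB (o + c) = z + e3 + g3] /\
  [/\ vq vA (o + 2^-1 *: (b + c)) = z + 2^-1 *: (e2 + e3) + 4^-1 *: (g2 + g3 + h1),
      vq vB (o + 2^-1 *: (c + a)) = z + 2^-1 *: (e3 + e1) + 4^-1 *: (g3 + g1 + h2)
    & vq vC (o + 2^-1 *: (a + b)) = z + 2^-1 *: (e1 + e2) + 4^-1 *: (g1 + g2 + h3)].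
Proof.
move=> [A1 A2 A3 [A4 A5 A6]] [B1 B2 B3 [B4 B5 B6]] [C1 C2 C3 [C4 C5 C6]].
have V p q : o + p = aff o p q (1, 0) by rewrite /aff /= scale0r addr0 scale1r.
have M p q : o + 2^-1 *: (p + q) = aff o p q (2^-1, 2^-1) by rewrite /aff /= scalerDr addrA.
rewrite (V a b) (V b c) (V c a) !M !vq_local A1 A2 A3 A4 A5 A6 B1 B2 B3 B4 B5 B6 C1 C2 C3 C4 C5 C6.
move=> {A1 A2 A3 A4 A5 A6 B1 B2 B3 B4 B5 B6 C1 C2 C3 C4 C5 C6}.
by split; split; apply: injective_projections; rewrite /= /GRing.scale /=; field.
Qed.

Lemma vecq_eq0 (v : vecq) o p q : crs p q != 0 ->
  vco (@q0 R) v o p q = 0 -> vco (@q1 R) v o p q = 0 -> vco (@q2 R) v o p q = 0 ->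
  vco (@q11 R) v o p q = 0 -> vco (@q12 R) v o p q = 0 -> vco (@q22 R) v o p q = 0 ->
  forall x, vq v x = 0.
Proof.
move=> c0 h0 h1 h2 h11 h12 h22 x.
by rewrite -[x](lcK o c0) vq_local h0 h1 h2 h11 h12 h22 !scaler0 !addr0.
Qed.

Lemma A0star_unique o a b c vA vB vC : star a b c -> A0star o a b c vA vB vC ->
  [/\ vq vC (o + a) = 0, vq vA (o + b) = 0 & vq vB (o + c) = 0] ->
  [/\ qv (curlq vC) (o + a) = 0, qv (curlq vA) (o + b) = 0 & qv (curlq vB) (o + c) = 0] ->
  [/\ vq vA (o + 2^-1 *: (b + c)) = 0, vq vB (o + 2^-1 *: (c + a)) = 0
    & vq vC (o + 2^-1 *: (a + b)) = 0] ->
  forall x, [/\ vq vA x = 0, vq vB x = 0 & vq vC x = 0].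
Proof.
move=> abc As [Va Vb Vc] [ka kb kc] [Ma Mb Mc]; have [A0 B0 C0] := abc.
have [z [e1 [e2 [e3 [g1 [g2 [g3 [h1 [h2 [h3 [k [l1 [l2 [l3 [sys [k1 [k2 k3]] sA sB sC]]]]]]]]]]]]]]] :=
  A0star_coef abc As.
have [[va vb vc] [ma mb mc]] := A0star_values sA sB sC.
have i1 : 0 <= (1 : R) <= 1 by rewrite ler01 lexx.
have := k1 1 i1; have := k2 1 i1; have := k3 1 i1.
rewrite !scale1r !mul1r ka kb kc => /esym kl3 /esym kl2 /esym kl1.
have ar := star_area_gt0 abc.
rewrite Va in va; rewrite Vb in vb; rewrite Vc in vc.
rewrite Ma in ma; rewrite Mb in mb; rewrite Mc in mc.
have y1 := star_system_vertex0 abc sys (esym va) (esym vb) (esym vc) (esym mc) (esym mb) kl1.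
have sys2 : star_system b c a e2 e3 e1 g2 g3 g1 h2 h3 h1 k l2 l3 l1 by case: sys => -[? ? ?] [[? ? ?] [? ? ?]].
have y2 := star_system_vertex0 (star_rot abc) sys2 (esym vb) (esym vc) (esym va) (esym ma) (esym mc) kl2.
have sys3 : star_system c a b e3 e1 e2 g3 g1 g2 h3 h1 h2 k l3 l1 l2 by case: sys => -[? ? ?] [[? ? ?] [? ? ?]].
have y3 := star_system_vertex0 (star_rot (star_rot abc)) sys3 (esym vc) (esym va) (esym vb) (esym mb) (esym ma) kl3.
have E e : 2 *: z + e = 0 -> e = - (2 *: z) by move/eqP; rewrite addrC addr_eq0 => /eqP.
have [[a1 a2 a3] _] := sys.
(* With every [e] equal to [- 2 z], the left sides of the three curl equations at the centre add up
   to 0, while the right sides add up to the total area factor times [k]. *)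
have k0 : k = 0.
  have : (crs b c + crs c a + crs a b) * k = 0.
    move: a1 a2 a3; rewrite (E _ y1) (E _ y2) (E _ y3) /dot /crs /= /GRing.scale /= => a1 a2 a3; lra.
  by move=> /eqP; rewrite mulf_eq0 gt_eqF // => /eqP.
(* With [k = 0], two of the centre equations say that [z] is orthogonal to [b - a] and to
   [c - a]. *)
have z0 : z = 0.
  apply: (@dot_eq0 (b - a) (c - a)); first by rewrite crs_edges gt_eqF.
  - move: a1; rewrite (E _ y1) (E _ y2) k0 /dot /= /GRing.scale /= => a1; lra.
  - move: a3; rewrite (E _ y1) (E _ y3) k0 /dot /= /GRing.scale /= => a3; lra.
have e0 e : 2 *: z + e = 0 -> e = 0 by rewrite z0 scaler0 add0r.
have [f1 f2 f3] : [/\ e1 = 0, e2 = 0 & e3 = 0] by split; exact: e0.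
move: va vb vc ma mb mc; rewrite z0 f1 f2 f3 !addr0 !scaler0 !add0r.
move=> /esym G1 /esym G2 /esym G3; rewrite G1 G2 G3 !add0r => ma mb mc.
have h0 h : 0 = 4^-1 *: h -> h = 0 :> R * R.
  by move/esym/eqP; rewrite scaler_eq0 invr_eq0 pnatr_eq0 => /eqP.
have [H1 H2 H3] : [/\ h1 = 0, h2 = 0 & h3 = 0] by split; exact: h0.
rewrite z0 f1 f2 f3 G1 G2 G3 H1 H2 H3 in sA sB sC.
have [u1 u2 u3 [u4 u5 u6]] := sA; have [v1 v2 v3 [v4 v5 v6]] := sB.
have [w1 w2 w3 [w4 w5 w6]] := sC.
move=> x; split.
- by apply: (@vecq_eq0 vA o b c); rewrite ?gt_eqF // ?u1 ?u2 ?u3 ?u4 ?u5 ?u6.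
- by apply: (@vecq_eq0 vB o c a); rewrite ?gt_eqF // ?v1 ?v2 ?v3 ?v4 ?v5 ?v6.
- by apply: (@vecq_eq0 vC o a b); rewrite ?gt_eqF // ?w1 ?w2 ?w3 ?w4 ?w5 ?w6.
Qed.


Lemma mkvec_curl o p q z e e' g h g' (k l l' : R) : crs p q != 0 ->
  dot q e - dot p e' = crs p q * k -> 2 * dot q g - dot p h = crs p q * l ->
  dot q h - 2 * dot p g' = crs p q * l' ->
  forall x, qv (curlq (mkvec z e e' g h g' o p q)) (aff o p q x) = k + x.1 * l + x.2 * l'.
Proof.
move=> c0 h1 h2 h3 x; apply: (mulfI c0); rewrite curl_local.
have [[_ -> ->] [-> -> ->]] := vco_mkvec z e e' g h g' o c0.
by rewrite h1 h2 h3; ring.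
Qed.

Lemma mkvec_value o p q z e e' g h g' x : crs p q != 0 ->
  vq (mkvec z e e' g h g' o p q) (aff o p q x) =
  z + x.1 *: e + x.2 *: e' + x.1 ^+ 2 *: g + (x.1 * x.2) *: h + x.2 ^+ 2 *: g'.
Proof.
move=> c0; rewrite vq_local.
by have [[-> -> ->] [-> -> ->]] := vco_mkvec z e e' g h g' o c0.
Qed.

(** Fifteen data for fifteen parameters: the vertex equations give the vectors [y = 2 z + e], then
    the centre equations give [k] and [z], and all other coefficients follow. *)
Lemma A0star_exists o a b c VA VB VC (kA kB kC : R) MA MB MC : star a b c ->
  exists vA vB vC, [/\ A0star o a b c vA vB vC,
    [/\ vq vC (o + a) = VA, vq vA (o + b) = VB & vq vB (o + c) = VC],
    [/\ qv (curlq vC) (o + a) = kA, qv (curlq vA) (o + b) = kB & qv (curlq vB) (o + c) = kC]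
  & [/\ vq vA (o + 2^-1 *: (b + c)) = MA, vq vB (o + 2^-1 *: (c + a)) = MB
    & vq vC (o + 2^-1 *: (a + b)) = MC]].
Proof.
move=> abc; have [A0 B0 C0] := abc; have ar := star_area_gt0 abc.
have [y1 [p1 n1]] : exists y, dot (b - a) y = 2 * dot b VA - dot a (4 *: MC - VA - VB) - crs a b * kA
    /\ dot (c - a) y = 2 * dot c VA - dot a (4 *: MB - VC - VA) + crs c a * kA.
  by apply: solve_dot; rewrite crs_edges gt_eqF.
have [y2 [p2 n2]] : exists y, dot (c - b) y = 2 * dot c VB - dot b (4 *: MA - VB - VC) - crs b c * kB
    /\ dot (a - b) y = 2 * dot a VB - dot b (4 *: MC - VA - VB) + crs a b * kB.
  by apply: solve_dot; rewrite crs_edges gt_eqF // (star_area_gt0 (star_rot abc)).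
have [y3 [p3 n3]] : exists y, dot (a - c) y = 2 * dot a VC - dot c (4 *: MB - VC - VA) - crs c a * kC
    /\ dot (b - c) y = 2 * dot b VC - dot c (4 *: MA - VB - VC) + crs b c * kC.
  by apply: solve_dot; rewrite crs_edges gt_eqF // (star_area_gt0 (star_rot (star_rot abc))).
(* Forced by the sum of the three centre equations, from which [z] disappears. *)
pose k := (dot b y1 - dot a y2 + dot c y2 - dot b y3 + dot a y3 - dot c y1) /
  (crs b c + crs c a + crs a b).
have hk : (crs b c + crs c a + crs a b) * k =
    dot b y1 - dot a y2 + dot c y2 - dot b y3 + dot a y3 - dot c y1.
  by rewrite /k mulrC divfK // gt_eqF.
(* Two of the centre equations determine [z]; the third one then holds by the choice of [k]. *)
have [z [z1 z2]] : exists z, dot (b - a) z = 2^-1 * (dot b y1 - dot a y2 - crs a b * k)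
    /\ dot (c - a) z = 2^-1 * (dot c y1 - dot a y3 + crs c a * k).
  by apply: solve_dot; rewrite crs_edges gt_eqF.
move: p1 n1 p2 n2 p3 n3 z1 z2; rewrite !dotBl !(dotDr, dotNr, dotZr) => p1 n1 p2 n2 p3 n3 z1 z2.
(* Linear coefficients from the definition of [y], pure squares from the vertex values, mixed
   coefficients from the midpoint values. *)
pose e y := y - 2 *: z; pose g V y := V + z - y.
pose h M V V' y y' := 4 *: M - V - V' + 2 *: z - y - y'.
pose vA := mkvec z (e y2) (e y3) (g VB y2) (h MA VB VC y2 y3) (g VC y3) o b c.
pose vB := mkvec z (e y3) (e y1) (g VC y3) (h MB VC VA y3 y1) (g VA y1) o c a.
pose vC := mkvec z (e y1) (e y2) (g VA y1) (h MC VA VB y1 y2) (g VB y2) o a b.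
have cA x : qv (curlq vA) (aff o b c x) = k + x.1 * (kB - k) + x.2 * (kC - k).
  by apply: mkvec_curl; rewrite ?gt_eqF // /e /g /h !(dotDr, dotNr, dotZr); lra.
have cB x : qv (curlq vB) (aff o c a x) = k + x.1 * (kC - k) + x.2 * (kA - k).
  by apply: mkvec_curl; rewrite ?gt_eqF // /e /g /h !(dotDr, dotNr, dotZr); lra.
have cC x : qv (curlq vC) (aff o a b x) = k + x.1 * (kA - k) + x.2 * (kB - k).
  by apply: mkvec_curl; rewrite ?gt_eqF // /e /g /h !(dotDr, dotNr, dotZr); lra.
have wA x : vq vA (aff o b c x) = _ := mkvec_value o z _ _ _ _ _ x (lt0r_neq0 A0).
have wB x : vq vB (aff o c a x) = _ := mkvec_value o z _ _ _ _ _ x (lt0r_neq0 B0).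
have wC x : vq vC (aff o a b x) = _ := mkvec_value o z _ _ _ _ _ x (lt0r_neq0 C0).
have V p q : o + p = aff o p q (1, 0) by rewrite /aff /= scale0r addr0 scale1r.
have Mid p q : o + 2^-1 *: (p + q) = aff o p q (2^-1, 2^-1) by rewrite /aff /= scalerDr addrA.
exists vA, vB, vC; split.
- split; split => s _.
  + by rewrite {1}(aff_ray1 o a b) (aff_ray2 o a c) wC wB; apply: injective_projections; rewrite /= /GRing.scale /=; ring.
  + by rewrite {1}(aff_ray1 o b c) (aff_ray2 o b a) wA wC; apply: injective_projections; rewrite /= /GRing.scale /=; ring.
  + by rewrite {1}(aff_ray1 o c a) (aff_ray2 o c b) wB wA; apply: injective_projections; rewrite /= /GRing.scale /=; ring.
  + by rewrite {1}(aff_ray1 o a b) (aff_ray2 o a c) cC cB /=; ring.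
  + by rewrite {1}(aff_ray1 o b c) (aff_ray2 o b a) cA cC /=; ring.
  + by rewrite {1}(aff_ray1 o c a) (aff_ray2 o c b) cB cA /=; ring.
- rewrite (V a b) (V b c) (V c a) wA wB wC.
  by split; apply: injective_projections; rewrite /e /g /= /GRing.scale /=; ring.
- by rewrite (V a b) (V b c) (V c a) cA cB cC /=; split; ring.
- rewrite !Mid wA wB wC.
  by split; apply: injective_projections; rewrite /e /g /h /= /GRing.scale /=; field.
Qed.

Definition defq (v : vecq) : symq R :=
  (qd1 v.1, qlin 2^-1 (qd2 v.1) (qlin 2^-1 (qd1 v.2) (Quadr 0 0 0 0 0 0)), qd2 v.2).

Lemma qd_comp1 (f : quadr R) o p q x :
  qv (qd1 (qcomp f o p q)) x = p.1 * qv (qd1 f) (aff o p q x) + p.2 * qv (qd2 f) (aff o p q x).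
Proof. by rewrite /qcomp /qd1 /qd2 /qv /aff /= /GRing.scale /=; ring. Qed.

Lemma qd_comp2 (f : quadr R) o p q x :
  qv (qd2 (qcomp f o p q)) x = q.1 * qv (qd1 f) (aff o p q x) + q.2 * qv (qd2 f) (aff o p q x).
Proof. by rewrite /qcomp /qd1 /qd2 /qv /aff /= /GRing.scale /=; ring. Qed.

Lemma qv0 x : qv (Quadr 0 0 0 0 0 0) x = 0 :> R.
Proof. by rewrite /qv /=; ring. Qed.

Lemma qv_lq_defq (v : vecq) o p q t w x : let D (y : R * R) (f : quadr R) :=
    y.1 * qv (qd1 f) (aff o p q x) + y.2 * qv (qd2 f) (aff o p q x) in
  qv (lq (defq v) o p q t w) x =
  2^-1 * (t.1 * D w v.1 + t.2 * D w v.2 + w.1 * D t v.1 + w.2 * D t v.2).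
Proof.
rewrite /lq qv_comp qv_qform /defq /= !qv_lin qv0.
move: (qv (qd1 v.1) _) (qv (qd2 v.1) _) (qv (qd1 v.2) _) (qv (qd2 v.2) _) => m1 m2 m3 m4.
by move: t w => [t1 t2] [w1 w2] /=; field.
Qed.

Lemma lq_defq (v : vecq) o p q :
  [/\ lq (defq v) o p q p p = Quadr (dot p (vco (@q1 R) v o p q)) (2 * dot p (vco (@q11 R) v o p q))
      (dot p (vco (@q12 R) v o p q)) 0 0 0,
    lq (defq v) o p q q q = Quadr (dot q (vco (@q2 R) v o p q)) (dot q (vco (@q12 R) v o p q))
      (2 * dot q (vco (@q22 R) v o p q)) 0 0 0
  & lq (defq v) o p q p q = Quadr
      (2^-1 * (dot p (vco (@q2 R) v o p q) + dot q (vco (@q1 R) v o p q)))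
      (2^-1 * (dot p (vco (@q12 R) v o p q) + 2 * dot q (vco (@q11 R) v o p q)))
      (2^-1 * (2 * dot p (vco (@q22 R) v o p q) + dot q (vco (@q12 R) v o p q))) 0 0 0].
Proof.
have E t w x := qv_lq_defq v o p q t w x.
split; apply: qv_inj; apply/funext => x; rewrite E /= -?(qd_comp1 _ o p q) -?(qd_comp2 _ o p q).
all: rewrite /vco /dot; move: (qcomp v.1 o p q) (qcomp v.2 o p q)
  => [f0 f1 f2 f11 f12 f22] [g0 g1 g2 g11 g12 g22].
all: by rewrite /qd1 /qd2 /qv /=; clear E; move: p q x => [p1 p2] [s1 s2] [x1 x2] /=; field.
Qed.

Lemma sven_const_defq (v : vecq) o p q : sven_const (defq v) o p q = 0.
Proof. by have [h1 h2 h3] := lq_defq v o p q; rewrite /sven_const h1 h2 h3 /= !mulr0 !addr0 subrr mul0r. Qed.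

Lemma crs_relation a b c e : crs b c * dot a e + crs c a * dot b e + crs a b * dot c e = 0.
Proof. by rewrite /crs /dot; ring. Qed.

Lemma ray_algebra (al be ga ae be' ce ae2 ae3 k : R) :
  al * ae + be * be' + ga * ce = 0 -> be' - ae2 = ga * k -> ae3 - ce = be * k ->
  al * ae + be * (2^-1 * (ae2 + be')) + ga * (2^-1 * (ce + ae3)) = 0.
Proof.
move=> h1 h2 h3; have -> : ae2 = be' - ga * k by rewrite -h2; ring.
have -> : ae3 = ce + be * k by rewrite -h3; ring.
by rewrite -h1; field.
Qed.

(** The tangential derivative of [v] is common to both pieces; the transversal derivatives entering
    [ray_cond] and [jump] are controlled by the curl, whose value and slope along the ray are common
    too. *)
Lemma defq_ray o a b c vA vB vC : star a b c -> A0star o a b c vA vB vC ->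
  ray_cond o a b c (defq vC) (defq vB) /\ (forall x : R, jump o a b c (defq vC) (defq vB) x = 0).
Proof.
move=> abc As.
have [z [e1 [e2 [e3 [g1 [g2 [g3 [h1 [h2 [h3 [k [l1 [l2 [l3 [sys _ sA sB sC]]]]]]]]]]]]]]] :=
  A0star_coef abc As.
have [[s1 _ s3] [[t1 _ _] [_ _ r3]]] := sys.
have [_ B2 B3 [B4 B5 B6]] := sB; have [_ C2 C3 [C4 C5 C6]] := sC.
have [Cpp Cqq Cpq] := lq_defq vC o a b; have [Bpp Bqq Bpq] := lq_defq vB o c a.
rewrite C2 C3 C4 C5 C6 in Cpp Cqq Cpq; rewrite B2 B3 B4 B5 B6 in Bpp Bqq Bpq.
have E := crs_relation a b c.
have K : crs b c * dot a e1 + crs c a * (2^-1 * (dot a e2 + dot b e1))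
   + crs a b * (2^-1 * (dot c e1 + dot a e3)) = 0 := ray_algebra (E e1) s1 s3.
have L : crs b c * (2 * dot a g1) + crs c a * (2^-1 * (dot a h3 + 2 * dot b g1))
   + crs a b * (2^-1 * (2 * dot c g1 + dot a h2)) = 0.
  apply: (ray_algebra (k := l1)) => //.
  by transitivity (2 * (crs b c * dot a g1 + crs c a * dot b g1 + crs a b * dot c g1));
    [ring|rewrite E mulr0].
split; first split => x.
- by rewrite Cpp Bqq /qv /=; ring.
- rewrite Cpp Cpq Bpq /qv /=; transitivity
    ((crs b c * dot a e1 + crs c a * (2^-1 * (dot a e2 + dot b e1))
      + crs a b * (2^-1 * (dot c e1 + dot a e3)))
    + x * (crs b c * (2 * dot a g1) + crs c a * (2^-1 * (dot a h3 + 2 * dot b g1))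
      + crs a b * (2^-1 * (2 * dot c g1 + dot a h2)))); first by ring.
  by rewrite K L mulr0 addr0.
move=> x; rewrite /jump Cpp Bqq /qv /=.
transitivity (crs b c * (2 * dot a g1) + crs c a * (2^-1 * (2 * dot a h3))
  + crs a b * (2^-1 * (2 * dot a h2))); first by field.
(* The slope [l1] of the curl enters from the two sides with opposite signs and cancels; what
   remains is [crs_relation] for [g1]. *)
have -> : dot a h3 = 2 * dot b g1 - crs a b * l1 by rewrite -t1; ring.
have -> : dot a h2 = 2 * dot c g1 + crs c a * l1 by rewrite -r3; ring.
transitivity (2 * (crs b c * dot a g1 + crs c a * dot b g1 + crs a b * dot c g1)); first by field.
by rewrite E mulr0.
Qed.

Lemma defq_star o a b c vA vB vC : star a b c -> A0star o a b c vA vB vC ->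
  ray_conds o a b c (defq vA) (defq vB) (defq vC) /\ jumps0 o a b c (defq vA) (defq vB) (defq vC).
Proof.
move=> s r; have s' := star_rot s; have s'' := star_rot s'.
have r' := A0star_rot r; have r'' := A0star_rot r'.
have [? ?] := defq_ray s r; have [? ?] := defq_ray s' r'; have [? ?] := defq_ray s'' r''.
by split.
Qed.

End StarVector.

(** * Tensor fields vanishing on the boundary *)

Section StarTensor.
Variable R : realType.
Implicit Types (o a b c p q r x v w : R * R) (u : symq R).

Definition sform : Type := (R * R * R)%type.

Definition sv (m : sform) v w : R :=
  m.1.1 * (v.1 * w.1) + m.1.2 * (v.1 * w.2 + v.2 * w.1) + m.2 * (v.2 * w.2).

Lemma sv_lin k (m n : sform) v w : sv (k *: m + n) v w = k * sv m v w + sv n v w.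
Proof. by rewrite /sv /= /GRing.scale /=; ring. Qed.

(** As [r] is a combination of [p] and [q], the value on [r] yields the mixed value on [(p, q)],
    after which [m] is known on a basis. *)
Lemma sform_eq0 (m : sform) p q r : crs p q != 0 -> crs q r != 0 -> crs r p != 0 ->
  sv m p p = 0 -> sv m q q = 0 -> sv m r r = 0 -> m = 0.
Proof.
move=> h1 h2 h3 mp mq mr.
have pq : sv m p q = 0.
  have : 2 * (crs q r * crs r p) * sv m p q =
      crs p q ^+ 2 * sv m r r - crs q r ^+ 2 * sv m p p - crs r p ^+ 2 * sv m q q.
    by rewrite /sv /crs; ring.
  rewrite mp mq mr !mulr0 !subr0 => /eqP.
  by rewrite !mulf_eq0 pnatr_eq0 (negbTE h2) (negbTE h3) => /eqP.
case: m mp mq pq {mr} => [[m1 m2] m3] mp mq pq.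
have e1 : crs p q ^+ 2 * m1 = q.2 ^+ 2 * sv (m1, m2, m3) p p - 2 * (p.2 * q.2) * sv (m1, m2, m3) p q
   + p.2 ^+ 2 * sv (m1, m2, m3) q q by rewrite /sv /crs /=; ring.
have e3 : crs p q ^+ 2 * m3 = q.1 ^+ 2 * sv (m1, m2, m3) p p - 2 * (p.1 * q.1) * sv (m1, m2, m3) p q
   + p.1 ^+ 2 * sv (m1, m2, m3) q q by rewrite /sv /crs /=; ring.
have e2 : crs p q ^+ 2 * m2 = - (q.1 * q.2) * sv (m1, m2, m3) p p
   + (p.1 * q.2 + p.2 * q.1) * sv (m1, m2, m3) p q
   - p.1 * p.2 * sv (m1, m2, m3) q q by rewrite /sv /crs /=; ring.
have z (k : R) : crs p q ^+ 2 * k = 0 -> k = 0.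
  by move/eqP; rewrite mulf_eq0 expf_eq0 (negbTE h1) => /eqP.
move: e1 e2 e3; rewrite mp mq pq !mulr0 !subr0 !addr0.
by move=> /z -> /z -> /z ->.
Qed.

Definition sco (k : quadr R -> R) u o p q : sform :=
  (k (qcomp u.1.1 o p q), k (qcomp u.1.2 o p q), k (qcomp u.2 o p q)).

Lemma lq_sco u o p q v w : lq u o p q v w =
  Quadr (sv (sco (@q0 R) u o p q) v w) (sv (sco (@q1 R) u o p q) v w)
    (sv (sco (@q2 R) u o p q) v w) (sv (sco (@q11 R) u o p q) v w)
    (sv (sco (@q12 R) u o p q) v w) (sv (sco (@q22 R) u o p q) v w).
Proof.
apply: qv_inj; apply/funext => x; rewrite /lq qv_comp qv_qform -!(qv_comp _ o p q) /sco /sv.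
move: (qcomp u.1.1 o p q) (qcomp u.1.2 o p q) (qcomp u.2 o p q) => f g h.
by rewrite /qv /=; ring.
Qed.

Definition smeet o p u u' : Prop :=
  [/\ meet o p u.1.1 u'.1.1, meet o p u.1.2 u'.1.2 & meet o p u.2 u'.2].

Lemma smeet_coef o p q r u u' : smeet o p u u' ->
  [/\ sco (@q0 R) u o p q = sco (@q0 R) u' o r p, sco (@q1 R) u o p q = sco (@q2 R) u' o r p
    & sco (@q11 R) u o p q = sco (@q22 R) u' o r p].
Proof.
move=> [h1 h2 h3]; have [a1 a2 a3] := meet_coef q r h1.
have [b1 b2 b3] := meet_coef q r h2; have [c1 c2 c3] := meet_coef q r h3.
by rewrite /sco a1 a2 a3 b1 b2 b3 c1 c2 c3.
Qed.

Definition szero u x : Prop := [/\ qv u.1.1 x = 0, qv u.1.2 x = 0 & qv u.2 x = 0].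

(* [u] vanishes on the side [o + p, o + q], where its inner derivative is
   constant, up to the factor [- crs p q]. *)
Definition side_cond o p q u (k : R) : Prop :=
  (forall s : R, 0 <= s <= 1 -> szero u (aff o p q (1 - s, s))) /\
  (forall s : R, 0 <= s <= 1 -> qv (qd1 (lq u o p q (q - p) (q - p))) (1 - s, s) = - (crs p q * k)).

Definition Wstar o a b c uA uB uC (k1 k2 k3 : R) : Prop :=
  [/\ smeet o a uC uB, smeet o b uA uC & smeet o c uB uA] /\
  [/\ side_cond o b c uA k1, side_cond o c a uB k2 & side_cond o a b uC k3].

Lemma Wstar_rot o a b c uA uB uC k1 k2 k3 :
  Wstar o a b c uA uB uC k1 k2 k3 -> Wstar o b c a uB uC uA k2 k3 k1.
Proof. by move=> [[? ? ?] [? ? ?]]. Qed.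

(** A quadratic vanishing on the side is [1 - x.1 - x.2] times an affine function. The values of
    that factor at the ends of the side are [z - g] and [z - g'], and they carry the normal
    derivative. *)
Lemma side_coef o p q u k : side_cond o p q u k -> let z := sco (@q0 R) u o p q in
  let g := sco (@q11 R) u o p q in let g' := sco (@q22 R) u o p q in
  [/\ sco (@q1 R) u o p q = - z - g, sco (@q2 R) u o p q = - z - g', sco (@q12 R) u o p q = g + g',
    sv (z - g) (q - p) (q - p) = crs p q * k & sv (z - g') (q - p) (q - p) = crs p q * k].
Proof.
move=> [hz hn] z g g'.
have S (f : quadr R) : (forall s : R, 0 <= s <= 1 -> qv f (1 - s, s) = 0) ->
    [/\ q1 f = - q0 f - q11 f, q2 f = - q0 f - q22 f & q12 f = q11 f + q22 f].
  move=> h; have [e0 e1 e2] : [/\ q0 f + q1 f + q11 f = 0, - q1 f + q2 f - 2 * q11 f + q12 f = 0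
      & q11 f - q12 f + q22 f = 0].
    by apply: quad3_eq0 => s /h; rewrite !mul0r !addr0 => <-; rewrite /qv /=; ring.
  by split; lra.
have C (f : quadr R) : (forall s : R, 0 <= s <= 1 -> qv f (aff o p q (1 - s, s)) = 0) ->
    [/\ q1 (qcomp f o p q) = - q0 (qcomp f o p q) - q11 (qcomp f o p q),
      q2 (qcomp f o p q) = - q0 (qcomp f o p q) - q22 (qcomp f o p q)
    & q12 (qcomp f o p q) = q11 (qcomp f o p q) + q22 (qcomp f o p q)].
  by move=> h; apply: S => s hs; rewrite qv_comp h.
have [a1 a2 a3] := C u.1.1 (fun s hs => let: And3 h _ _ := hz s hs in h).
have [b1 b2 b3] := C u.1.2 (fun s hs => let: And3 _ h _ := hz s hs in h).
have [c1 c2 c3] := C u.2 (fun s hs => let: And3 _ _ h := hz s hs in h).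
have E1 : sco (@q1 R) u o p q = - z - g by rewrite /sco a1 b1 c1.
have E2 : sco (@q2 R) u o p q = - z - g' by rewrite /sco a2 b2 c2.
have E3 : sco (@q12 R) u o p q = g + g' by rewrite /sco a3 b3 c3.
have [n1 n2] : sv (g - z) (q - p) (q - p) = - (crs p q * k) /\ sv (g' - g) (q - p) (q - p) = 0.
  apply: affine_unit => s hs; have := hn s hs; rewrite lq_sco E1 E3 -/z -/g -/g' => e.
  by rewrite mul0r addr0 -e /qv /sv /=; ring.
split=> //.
  by rewrite -[RHS]opprK -n1 /sv /=; ring.
by rewrite -[RHS]opprK -n1 -[in RHS](addr0 (sv _ _ _)) -n2 /sv /=; ring.
Qed.

Lemma Wstar_ray o a b c uA uB uC k1 k2 k3 : Wstar o a b c uA uB uC k1 k2 k3 ->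
  ray_cond o a b c uC uB.
Proof.
move=> [[ma _ _] _]; have [e0 e1 e2] := smeet_coef b c ma.
split => x; first by rewrite !lq_sco /qv /= e0 e1 e2; ring.
rewrite !lq_sco /qv /= e0 e1 e2.
move: (sco _ _ _ _ _) (sco (@q2 R) uB _ _ _) (sco (@q22 R) uB _ _ _) => f g h.
by rewrite /sv /crs; ring.
Qed.

Lemma Wstar_rays o a b c uA uB uC k1 k2 k3 : Wstar o a b c uA uB uC k1 k2 k3 ->
  ray_conds o a b c uA uB uC.
Proof.
move=> h; have h' := Wstar_rot h; have h'' := Wstar_rot h'.
by split; [exact: Wstar_ray h|exact: Wstar_ray h'|exact: Wstar_ray h''].
Qed.

(** The side conditions eliminate every coefficient except the value at the centre and the pure
    squares along the rays, so the jumps involve only four symmetric forms. *)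
Lemma Wstar_jump o a b c uA uB uC k1 k2 k3 : Wstar o a b c uA uB uC k1 k2 k3 ->
  let z := sco (@q0 R) uC o a b in let g1 := sco (@q11 R) uC o a b in
  let g2 := sco (@q11 R) uA o b c in let g3 := sco (@q11 R) uB o c a in
  forall x : R, jump o a b c uC uB x =
    - sv ((crs b c + crs c a + crs a b) *: z + crs b c *: g1 + crs c a *: g2 + crs a b *: g3) a a
    + x * sv ((crs b c + crs c a + crs a b) *: g1 + crs b c *: g1 + crs c a *: g2 + crs a b *: g3) a a.
Proof.
move=> [[ma mb mc] [sa sb sc]] z g1 g2 g3 x.
have [e0 e1 e2] := smeet_coef b c ma; have [f0 f1 f2] := smeet_coef c a mb.
have [_ _ _ _ _] := side_coef sa; have [B1 B2 B3 _ _] := side_coef sb.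
have [C1 C2 C3 _ _] := side_coef sc.
rewrite /jump !lq_sco /qv /= C1 C2 C3 B1 B3 -f2 -/g2 -/g3 -/z -/g1.
rewrite -e0 -e2 -/z -/g1.
by rewrite /sv /= /GRing.scale /=; ring.
Qed.

Lemma sco_eq0 u o p q : crs p q != 0 ->
  sco (@q0 R) u o p q = 0 -> sco (@q1 R) u o p q = 0 -> sco (@q2 R) u o p q = 0 ->
  sco (@q11 R) u o p q = 0 -> sco (@q12 R) u o p q = 0 -> sco (@q22 R) u o p q = 0 ->
  forall x, szero u x.
Proof.
move=> c0; rewrite /sco => h0 h1 h2 h3 h4 h5 x.
rewrite /szero -[x](lcK o c0) -!(qv_comp _ o p q); move: h0 h1 h2 h3 h4 h5.
move: (qcomp u.1.1 o p q) (qcomp u.1.2 o p q) (qcomp u.2 o p q) => f g h.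
move=> [a1 a2 a3] [b1 b2 b3] [c1 c2 c3] [d1 d2 d3] [e1 e2 e3] [f1 f2 f3].
by rewrite /qv a1 a2 a3 b1 b2 b3 c1 c2 c3 d1 d2 d3 e1 e2 e3 f1 f2 f3 !mul0r !addr0.
Qed.

Lemma crs_edges_neq0 a b c : star a b c ->
  [/\ crs a (b - a) != 0, crs (b - a) (c - a) != 0 & crs (c - a) a != 0].
Proof.
move=> abc; have := star_area_gt0 abc; have [h1 h2 h3] := abc => h.
split; first by rewrite (_ : crs a (b - a) = crs a b) ?gt_eqF // /crs /=; ring.
  by rewrite crs_edges gt_eqF.
by rewrite (_ : crs (c - a) a = crs c a) ?gt_eqF // /crs /=; ring.
Qed.

(** The difference of the two forms vanishes on three independent directions: on [a] by comparing
    the jump at 0 and at 1, on [b - a] and [c - a] by the side conditions with zero data. *)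
Lemma Wstar_vertex0 o a b c uA uB uC : star a b c -> Wstar o a b c uA uB uC 0 0 0 ->
  (forall x : R, jump o a b c uC uB x = 0) ->
  sco (@q0 R) uC o a b = sco (@q11 R) uC o a b.
Proof.
move=> abc Ws hj; have [[ma mb mc] [sa sb sc]] := Ws.
have J := Wstar_jump Ws.
have j0 := hj 0; have j1 := hj 1; rewrite !J mul0r addr0 mul1r in j0 j1.
have [h1 h2 h3] := crs_edges_neq0 abc.
have [e0 _ e2] := smeet_coef b c ma.
apply/eqP; rewrite -subr_eq0; apply/eqP; apply: (sform_eq0 h1 h2 h3).
- have : (crs b c + crs c a + crs a b) *
      sv (sco (@q0 R) uC o a b - sco (@q11 R) uC o a b) a a = 0.
    move/eqP: j0; rewrite oppr_eq0 => /eqP j0; move: j1; rewrite j0 oppr0 add0r => j1.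
    by rewrite -[RHS](subrr 0) -{1}j0 -j1 /sv /= /GRing.scale /=; ring.
  by move/eqP; rewrite mulf_eq0 gt_eqF ?star_area_gt0 // => /eqP.
- by have [_ _ _ -> _] := side_coef sc; rewrite mulr0.
- have [_ _ _ _] := side_coef sb; rewrite -e0 -e2 mulr0 => <-.
  by rewrite /sv /=; ring.
Qed.

Lemma Wstar_unique o a b c uA uB uC : star a b c -> Wstar o a b c uA uB uC 0 0 0 ->
  jumps0 o a b c uA uB uC -> forall x, [/\ szero uA x, szero uB x & szero uC x].
Proof.
move=> abc Ws [j1 j2 j3].
have abc' := star_rot abc; have abc'' := star_rot abc'.
have Ws' := Wstar_rot Ws; have Ws'' := Wstar_rot Ws'.
have y1 := Wstar_vertex0 abc Ws j1; have y2 := Wstar_vertex0 abc' Ws' j2.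
have y3 := Wstar_vertex0 abc'' Ws'' j3.
have [[ma mb mc] [sa sb sc]] := Ws.
have [e0 e1 e2] := smeet_coef b c ma; have [f0 f1 f2] := smeet_coef c a mb.
have [g0 g1 g2] := smeet_coef a b mc.
have ar := star_area_gt0 abc.
pose z := sco (@q0 R) uC o a b.
have zA : sco (@q0 R) uA o b c = z by rewrite f0.
have zB : sco (@q0 R) uB o c a = z by rewrite -e0.
have Z (t : R * R) (k1 k2 k3 : R) (g : sform) : 0 < k1 + k2 + k3 -> g = (k1 + k2 + k3) *: z + k1 *: z + k2 *: z + k3 *: z ->
    - sv g t t = 0 -> sv z t t = 0.
  move=> k0 -> /eqP; rewrite oppr_eq0.
  have -> : sv ((k1 + k2 + k3) *: z + k1 *: z + k2 *: z + k3 *: z) t t = 2 * (k1 + k2 + k3) * sv z t t.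
    by rewrite /sv /= /GRing.scale /=; ring.
  by rewrite !mulf_eq0 pnatr_eq0 (gt_eqF k0) => /eqP.
(* Now that each square coefficient equals [z], the jump at the centre along [t] is [- 2 A z(t, t)],
   with [A] the total area factor. *)
have z0 : z = 0.
  have [A0 B0 C0] := abc.
  apply: (@sform_eq0 _ a b c); rewrite ?gt_eqF //.
  - have := j1 0; rewrite (Wstar_jump Ws) mul0r addr0 -y1 -y2 -y3 zA zB -/z.
    by apply: Z ar _.
  - have := j2 0; rewrite (Wstar_jump Ws') mul0r addr0 -y1 -y2 -y3 zA zB -/z.
    by apply: Z (star_area_gt0 abc') _.
  - have := j3 0; rewrite (Wstar_jump Ws'') mul0r addr0 -y1 -y2 -y3 zA zB -/z.
    by apply: Z (star_area_gt0 abc'') _.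
have [A0 B0 C0] := abc.
rewrite zA z0 in y2; rewrite zB z0 in y3; rewrite -/z z0 in y1.
have [A1 A2 A3 _ _] := side_coef sa; have [B1 B2 B3 _ _] := side_coef sb.
have [C1 C2 C3 _ _] := side_coef sc.
have H u p q : crs p q != 0 -> sco (@q0 R) u o p q = 0 -> sco (@q11 R) u o p q = 0 ->
    sco (@q22 R) u o p q = 0 ->
    sco (@q1 R) u o p q = - sco (@q0 R) u o p q - sco (@q11 R) u o p q ->
    sco (@q2 R) u o p q = - sco (@q0 R) u o p q - sco (@q22 R) u o p q ->
    sco (@q12 R) u o p q = sco (@q11 R) u o p q + sco (@q22 R) u o p q ->
    forall x, szero u x.
  move=> c0 h0 h11 h22; rewrite h0 h11 h22 subr0 oppr0 addr0 => h1 h2 h12.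
  exact: sco_eq0 c0 h0 h1 h2 h11 h12 h22.
have zC : sco (@q0 R) uC o a b = 0 by [].
move=> x; split.
- by apply: (H uA b c) => //; rewrite ?gt_eqF ?zA ?z0 // -g2.
- by apply: (H uB c a) => //; rewrite ?gt_eqF ?zB ?z0 // -e2.
- by apply: (H uC a b) => //; rewrite ?gt_eqF // -f2.
Qed.

Lemma qcomp_lin k (f g : quadr R) o p q :
  qcomp (qlin k f g) o p q = qlin k (qcomp f o p q) (qcomp g o p q).
Proof. by apply: qv_inj; apply/funext => x; rewrite qv_lin !qv_comp qv_lin. Qed.

Definition slin (k : R) u u' : symq R :=
  (qlin k u.1.1 u'.1.1, qlin k u.1.2 u'.1.2, qlin k u.2 u'.2).

Lemma sco_slin (f : quadr R -> R) k u u' o p q : (forall g h, f (qlin k g h) = k * f g + f h) ->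
  sco f (slin k u u') o p q = k *: sco f u o p q + sco f u' o p q.
Proof. by move=> hf; rewrite /sco /slin /= !qcomp_lin !hf. Qed.

Lemma lq_slin k u u' o p q v w :
  lq (slin k u u') o p q v w = qlin k (lq u o p q v w) (lq u' o p q v w).
Proof. by rewrite !lq_sco !sco_slin // !sv_lin. Qed.

Lemma smeet_lin o p k u u' u1 u1' : smeet o p u u' -> smeet o p u1 u1' ->
  smeet o p (slin k u u1) (slin k u' u1').
Proof.
move=> [h1 h2 h3] [l1 l2 l3]; split => s hs; rewrite /slin /= !qv_lin.
- by rewrite h1 // l1.
- by rewrite h2 // l2.
- by rewrite h3 // l3.
Qed.

Lemma side_lin o p q k u u1 n m : side_cond o p q u n -> side_cond o p q u1 m ->
  side_cond o p q (slin k u u1) (k * n + m).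
Proof.
move=> [h1 h2] [l1 l2]; split => s hs.
  by have [a1 a2 a3] := h1 s hs; have [b1 b2 b3] := l1 s hs;
    split; rewrite /slin /= qv_lin ?a1 ?a2 ?a3 ?b1 ?b2 ?b3 mulr0 addr0.
rewrite lq_slin; transitivity (k * - (crs p q * n) + - (crs p q * m)); last by ring.
rewrite -(h2 s hs) -(l2 s hs) /qv /=; ring.
Qed.

Lemma Wstar_lin o a b c k uA uB uC wA wB wC (k1 k2 k3 l1 l2 l3 : R) :
  Wstar o a b c uA uB uC k1 k2 k3 -> Wstar o a b c wA wB wC l1 l2 l3 ->
  Wstar o a b c (slin k uA wA) (slin k uB wB) (slin k uC wC)
    (k * k1 + l1) (k * k2 + l2) (k * k3 + l3).
Proof.
move=> [[h1 h2 h3] [h4 h5 h6]] [[n1 n2 n3] [n4 n5 n6]].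
by split; split; (exact: smeet_lin || exact: side_lin).
Qed.

Lemma jump_lin o p q r k u u' u1 u1' (x : R) :
  jump o p q r (slin k u u1) (slin k u' u1') x = k * jump o p q r u u' x + jump o p q r u1 u1' x.
Proof.
rewrite /jump !lq_slin; do ?move: (lq _ _ _ _ _ _) => ?; do ?move: (crs _ _) => ?.
by rewrite /qv /=; ring.
Qed.

Lemma ray_cond_lin o p q r k u u' u1 u1' : ray_cond o p q r u u' -> ray_cond o p q r u1 u1' ->
  ray_cond o p q r (slin k u u1) (slin k u' u1').
Proof.
move=> [h1 h2] [l1 l2]; split => x; rewrite !lq_slin !qv_lin.
  by rewrite h1 l1.
have E (k' a a' b b' c c' d d' e : R) : a * b + a' * b' + e * d = 0 -> a * c + a' * c' + e * d' = 0 ->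
    a * (k' * b + c) + a' * (k' * b' + c') + e * (k' * d + d') = 0.
  by move=> h l; transitivity (k' * (a * b + a' * b' + e * d) + (a * c + a' * c' + e * d'));
    [ring|rewrite h l mulr0 addr0].
exact: E (h2 x) (l2 x).
Qed.

Lemma sven_const_lin k u u1 o p q :
  sven_const (slin k u u1) o p q = k * sven_const u o p q + sven_const u1 o p q.
Proof. by rewrite /sven_const !lq_slin /=; ring. Qed.

Lemma jumps0_lin o a b c k uA uB uC wA wB wC :
  jumps0 o a b c uA uB uC -> jumps0 o a b c wA wB wC ->
  jumps0 o a b c (slin k uA wA) (slin k uB wB) (slin k uC wC).
Proof.
move=> [h1 h2 h3] [l1 l2 l3].
by split => x; rewrite jump_lin ?h1 ?h2 ?h3 ?l1 ?l2 ?l3 mulr0 addr0.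
Qed.

Lemma ray_conds_lin o a b c k uA uB uC wA wB wC :
  ray_conds o a b c uA uB uC -> ray_conds o a b c wA wB wC ->
  ray_conds o a b c (slin k uA wA) (slin k uB wB) (slin k uC wC).
Proof. by move=> [? ? ?] [? ? ?]; split; exact: ray_cond_lin. Qed.

(* value at the vertex [a] of the factor of the field vanishing on the sides:
   [v, v |-> crs a v * m v], with the linear form [m] fixed by the side data *)
Definition Yform a b c (k2 k3 : R) : sform :=
  let n := (k2 * (b - a).2 - k3 * (a - c).2, k3 * (a - c).1 - k2 * (b - a).1) in
  (crs b c + crs c a + crs a b)^-1 *:
    (- a.2 * n.1, 2^-1 * (a.1 * n.1 - a.2 * n.2), a.1 * n.2).

Lemma sv_Yform a b c k2 k3 v w :
  let m x := k2 * crs x (b - a) - k3 * crs x (a - c) in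
  sv (Yform a b c k2 k3) v w =
  (crs b c + crs c a + crs a b)^-1 * (2^-1 * (crs a v * m w + crs a w * m v)).
Proof.
move=> m; rewrite /sv /Yform; move: (_ ^-1) => k.
by rewrite /m /crs /= /GRing.scale /=; field.
Qed.

(** The value at the centre. Since [g = Z - Y] on each ray, the jumps at the centre vanish when
    [2 A Z] is the sum of the forms [Y] weighted by the areas of the opposite pieces. *)
Definition Zform a b c (k1 k2 k3 : R) : sform :=
  (2 * (crs b c + crs c a + crs a b))^-1 *:
    (crs b c *: Yform a b c k2 k3 + crs c a *: Yform b c a k3 k1 + crs a b *: Yform c a b k1 k2).

Lemma Zform_rot a b c k1 k2 k3 : Zform b c a k2 k3 k1 = Zform a b c k1 k2 k3.
Proof.
rewrite /Zform; congr (_ *: _); last by rewrite [LHS]addrC addrA.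
by congr (_^-1 ); ring.
Qed.

(** The expansion of [w (w z + x.1 y + x.2 y')] with [w = 1 - x.1 - x.2]: a field vanishing on the
    side, whose affine factor has the values [z], [y], [y'] at the three vertices of the piece. *)
Definition mksym (z y y' : sform) o p q : symq R :=
  let f z y y' := qglob (Quadr z (y - 2 * z) (y' - 2 * z) (z - y) (2 * z - y - y') (z - y')) o p q in
  (f z.1.1 y.1.1 y'.1.1, f z.1.2 y.1.2 y'.1.2, f z.2 y.2 y'.2).

Lemma sco_mksym (z y y' : sform) o p q : crs p q != 0 -> let u := mksym z y y' o p q in
  [/\ sco (@q0 R) u o p q = z, sco (@q1 R) u o p q = y - 2 *: z, sco (@q2 R) u o p q = y' - 2 *: z &
  [/\ sco (@q11 R) u o p q = z - y, sco (@q12 R) u o p q = 2 *: z - y - y'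
    & sco (@q22 R) u o p q = z - y']].
Proof.
move=> c0; cbv zeta; rewrite /sco /mksym !qcomp_glob //=.
by move: z y y' => [[? ?] ?] [[? ?] ?] [[? ?] ?].
Qed.

Lemma qv_mksym (z y y' : sform) o p q x : crs p q != 0 -> let u := mksym z y y' o p q in
  let w := 1 - x.1 - x.2 in let g z y y' := w * (w * z + x.1 * y + x.2 * y') in
  [/\ qv u.1.1 (aff o p q x) = g z.1.1 y.1.1 y'.1.1, qv u.1.2 (aff o p q x) = g z.1.2 y.1.2 y'.1.2
    & qv u.2 (aff o p q x) = g z.2 y.2 y'.2].
Proof.
move=> c0; cbv zeta; rewrite -!(qv_comp _ o p q) /mksym !qcomp_glob //= /qv /=.
by split; ring.
Qed.

Lemma mksym_side z y y' o p q k : crs p q != 0 ->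
  sv y (q - p) (q - p) = crs p q * k -> sv y' (q - p) (q - p) = crs p q * k ->
  side_cond o p q (mksym z y y' o p q) k.
Proof.
move=> c0 hy hy'; split => s hs.
  have [h1 h2 h3] := qv_mksym z y y' o (1 - s, s) c0; rewrite /szero h1 h2 h3 /=.
  by split; ring.
have [h0 h1 h2 [h11 h12 h22]] := sco_mksym z y y' o c0.
rewrite lq_sco h1 h11 h12 -hy.
transitivity ((s - 1) * sv y (q - p) (q - p) - s * sv y' (q - p) (q - p)).
  by rewrite /qv /sv /= /GRing.scale /=; ring.
by rewrite hy' -hy; ring.
Qed.

Lemma mksym_meet z y1 y2 y3 o p q r : crs p q != 0 -> crs r p != 0 ->
  smeet o p (mksym z y1 y2 o p q) (mksym z y3 y1 o r p).
Proof.
move=> c1 c2; split => s _; rewrite {1}(aff_ray1 o p q) (aff_ray2 o p r).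
all: have [h1 h2 h3] := qv_mksym z y1 y2 o (s, 0) c1.
all: have [l1 l2 l3] := qv_mksym z y3 y1 o (0, s) c2.
all: by rewrite ?h1 ?h2 ?h3 ?l1 ?l2 ?l3 /=; ring.
Qed.

Lemma crsBr x p q : crs x (p - q) = crs x p - crs x q.
Proof. by rewrite /crs /=; ring. Qed.

Lemma crsC p q : crs p q = - crs q p.
Proof. by rewrite /crs; ring. Qed.

Lemma crspp p : crs p p = 0.
Proof. by rewrite /crs; ring. Qed.

Lemma svBB m p q : sv m (p - q) (p - q) = sv m p p - 2 * sv m p q + sv m q q.
Proof. by rewrite /sv /=; ring. Qed.

(** The value on [a] serves the slope of the jump, the next two values are the side conditions of
    the two pieces at this vertex, and the last three are needed to compute sven. *)
Lemma Yform_star a b c k2 k3 : star a b c -> let Y := sv (Yform a b c k2 k3) in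
  let x := crs b c in let y := crs c a in let z := crs a b in let A := x + y + z in
  [/\ Y a a = 0, Y (b - a) (b - a) = z * k3, Y (a - c) (a - c) = y * k2 &
  [/\ Y (c - b) (c - b) = (y + z) * (k2 + k3),
      Y b b - Y a b = z * (k3 * (z + x) + 2^-1 * (k2 * z + k3 * y)) / A
    & Y c c - Y c a = y * (k2 * (x + y) + 2^-1 * (k2 * z + k3 * y)) / A]].
Proof.
move=> abc Y x y z A; rewrite /Y !svBB !sv_Yform !crsBr !crspp.
rewrite (crsC b a) (crsC a c) (crsC c b) -/x -/y -/z -/A.
have : A != 0 by rewrite gt_eqF // star_area_gt0.
rewrite /A; move: x y z {A} => x y z A0.
by split; [field|field|field|split; field].
Qed.

(** The definition of [Z] as a weighted sum gives the first identity; the second then only asks for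
    [Y1(a, a) = 0]. *)
Lemma Zform_jump a b c k1 k2 k3 : star a b c ->
  let Z := Zform a b c k1 k2 k3 in let A := crs b c + crs c a + crs a b in
  let Y1 := Yform a b c k2 k3 in let Y2 := Yform b c a k3 k1 in let Y3 := Yform c a b k1 k2 in
  sv (A *: Z + crs b c *: (Z - Y1) + crs c a *: (Z - Y2) + crs a b *: (Z - Y3)) a a = 0 /\
  sv (A *: (Z - Y1) + crs b c *: (Z - Y1) + crs c a *: (Z - Y2) + crs a b *: (Z - Y3)) a a = 0.
Proof.
move=> abc Z A Y1 Y2 Y3.
have A0 : A != 0 by rewrite gt_eqF // star_area_gt0.
have [Yaa _ _ _] := Yform_star k2 k3 abc.
have hZ : 2 * A * sv Z a a = crs b c * sv Y1 a a + crs c a * sv Y2 a a + crs a b * sv Y3 a a.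
  rewrite /Z /Zform -/A -/Y1 -/Y2 -/Y3; move: A A0 Y1 Y2 Y3 => A' A0 Y1 Y2 Y3.
  by rewrite /sv /= /GRing.scale /=; field.
have E m1 m2 m3 (l k n : R) M : sv (A *: M + k *: m1 + l *: m2 + n *: m3) a a =
   A * sv M a a + k * sv m1 a a + l * sv m2 a a + n * sv m3 a a.
  by rewrite /sv /= /GRing.scale /=; ring.
have B m n : sv (m - n) a a = sv m a a - sv n a a by rewrite /sv /=; ring.
rewrite !E !B; move: hZ; rewrite -/Y1 in Yaa; rewrite Yaa /A.
move: (sv Z a a) (sv Y2 a a) (sv Y3 a a) => p q r h.
by split; rewrite -[RHS](subrr (2 * (crs b c + crs c a + crs a b) * p)) {2}h; ring.
Qed.

Lemma Zform_side a b c k1 k2 k3 : star a b c -> let d := b - a in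
  let S := k1 + k2 + k3 in let A := crs b c + crs c a + crs a b in
  sv (Zform a b c k1 k2 k3) d d = crs a b * (A - crs a b) * S / (2 * A).
Proof.
move=> abc d S A.
have A0 : A != 0 by rewrite gt_eqF // star_area_gt0.
have [_ Ya _ _] := Yform_star k2 k3 abc.
have [_ _ Yb _] := Yform_star k3 k1 (star_rot abc).
have [_ _ _ [Yc _ _]] := Yform_star k1 k2 (star_rot (star_rot abc)).
rewrite /Zform -/A; move: Ya Yb Yc; rewrite -/d.
move: (Yform _ _ _ _ _) (Yform b _ _ _ _) (Yform c _ _ _ _) => Y1 Y2 Y3 h1 h2 h3.
have -> : sv ((2 * A)^-1 *: (crs b c *: Y1 + crs c a *: Y2 + crs a b *: Y3)) d d =
   (2 * A)^-1 * (crs b c * sv Y1 d d + crs c a * sv Y2 d d + crs a b * sv Y3 d d).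
  by rewrite /sv /= /GRing.scale /=; ring.
rewrite h1 h2 h3 /S; move: A0; rewrite /A; move: (crs b c) (crs c a) (crs a b) => x y z A0.
by field.
Qed.

Definition Wpiece a b c k1 k2 k3 o : symq R :=
  mksym (Zform a b c k1 k2 k3) (Yform a b c k2 k3) (Yform b c a k3 k1) o a b.

Lemma Wpiece_side o a b c k1 k2 k3 : star a b c -> side_cond o a b (Wpiece a b c k1 k2 k3 o) k3.
Proof.
move=> abc; have [_ Ya _ _] := Yform_star k2 k3 abc.
have [_ _ Yb _] := Yform_star k3 k1 (star_rot abc).
have [_ _ C0] := abc.
by apply: mksym_side => //; rewrite gt_eqF.
Qed.

Lemma Wpiece_meet o a b c k1 k2 k3 : star a b c ->
  smeet o a (Wpiece a b c k1 k2 k3 o) (Wpiece c a b k3 k1 k2 o).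
Proof.
move=> abc; rewrite /Wpiece -(Zform_rot c a b).
by have [? ? ?] := abc; apply: mksym_meet; rewrite gt_eqF.
Qed.

Lemma Wpiece_algebra (x y z A k1 k2 k3 : R) : A != 0 -> z != 0 -> A = x + y + z ->
  z * (2 * (z * (A - z) * (k1 + k2 + k3) / (2 * A)
    - z * (k3 * (y + z) + 2^-1 * (k3 * x + k1 * z)) / A
    - z * (k3 * (z + x) + 2^-1 * (k2 * z + k3 * y)) / A) / z ^+ 2) =
  (k1 + k2 + k3) * (1 - 2 * z / A) - 3 * k3.
Proof.
move=> A0 z0 EA; have -> : x = A - y - z by rewrite EA; ring.
by field; rewrite A0 z0.
Qed.

Lemma sven_const_Wpiece o a b c k1 k2 k3 : star a b c ->
  let S := k1 + k2 + k3 in let A := crs b c + crs c a + crs a b in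
  crs a b * sven_const (Wpiece a b c k1 k2 k3 o) o a b = S * (1 - 2 * crs a b / A) - 3 * k3.
Proof.
move=> abc S A; have [x0 y0 z0] := abc.
have A0 : A != 0 by rewrite gt_eqF // star_area_gt0.
have [_ _ _ [_ Yb _]] := Yform_star k2 k3 abc.
have [_ _ _ [_ _ Ya]] := Yform_star k3 k1 (star_rot abc).
have Zd := Zform_side k1 k2 k3 abc; cbv zeta in Zd; rewrite svBB in Zd.
rewrite /sven_const !lq_sco /=.
have [_ _ _ [-> -> ->]] := sco_mksym (Zform a b c k1 k2 k3) (Yform a b c k2 k3) (Yform b c a k3 k1) o (lt0r_neq0 z0).
move: Zd Ya Yb.
move: (Zform _ _ _ _ _ _) (Yform a _ _ _ _) (Yform b _ _ _ _) => Z Y Y'.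
(* Grouped so that only [Z] on [b - a] and the differences computed in [Yform_star] occur. *)
have -> : 2 * sv (Z - Y') a a + 2 * sv (Z - Y) b b - 2 * sv (2 *: Z - Y - Y') a b =
   2 * ((sv Z b b - 2 * sv Z b a + sv Z a a) - (sv Y' a a - sv Y' a b) - (sv Y b b - sv Y a b)).
  by rewrite /sv /= /GRing.scale /=; ring.
move=> -> -> ->; have -> : crs c a + crs a b + crs b c = A by rewrite /A; ring.
by rewrite -/A; apply: Wpiece_algebra => //; exact: lt0r_neq0.
Qed.

Lemma Wstar_exists o a b c (k1 k2 k3 : R) : star a b c ->
  exists uA uB uC, [/\ Wstar o a b c uA uB uC k1 k2 k3, jumps0 o a b c uA uB uC &
    let S := k1 + k2 + k3 in let A := crs b c + crs c a + crs a b in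
    [/\ crs b c * sven_const uA o b c = S * (1 - 2 * crs b c / A) - 3 * k1,
        crs c a * sven_const uB o c a = S * (1 - 2 * crs c a / A) - 3 * k2
      & crs a b * sven_const uC o a b = S * (1 - 2 * crs a b / A) - 3 * k3]].
Proof.
move=> abc; have abc' := star_rot abc; have abc'' := star_rot abc'.
exists (Wpiece b c a k2 k3 k1 o), (Wpiece c a b k3 k1 k2 o), (Wpiece a b c k1 k2 k3 o).
have Ws : Wstar o a b c (Wpiece b c a k2 k3 k1 o) (Wpiece c a b k3 k1 k2 o) (Wpiece a b c k1 k2 k3 o) k1 k2 k3.
  by split; split; (exact: Wpiece_meet || exact: Wpiece_side).
have J x1 x2 x3 l1 l2 l3 uA uB : star x1 x2 x3 ->
    Wstar o x1 x2 x3 uA uB (Wpiece x1 x2 x3 l1 l2 l3 o) l1 l2 l3 ->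
    uA = Wpiece x2 x3 x1 l2 l3 l1 o -> uB = Wpiece x3 x1 x2 l3 l1 l2 o ->
    forall x : R, jump o x1 x2 x3 (Wpiece x1 x2 x3 l1 l2 l3 o) uB x = 0.
  move=> st ws eA eB x; rewrite (Wstar_jump ws) eA eB.
  have [c1 c2 c3] := st.
  have [-> _ _ [-> _ _]] := sco_mksym (Zform x1 x2 x3 l1 l2 l3) (Yform x1 x2 x3 l2 l3) (Yform x2 x3 x1 l3 l1) o (lt0r_neq0 c3).
  have [_ _ _ [-> _ _]] := sco_mksym (Zform x2 x3 x1 l2 l3 l1) (Yform x2 x3 x1 l3 l1) (Yform x3 x1 x2 l1 l2) o (lt0r_neq0 c1).
  have [_ _ _ [-> _ _]] := sco_mksym (Zform x3 x1 x2 l3 l1 l2) (Yform x3 x1 x2 l1 l2) (Yform x1 x2 x3 l2 l3) o (lt0r_neq0 c2).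
  rewrite (Zform_rot x1 x2 x3) -(Zform_rot x3 x1 x2).
  by have [-> ->] := Zform_jump l1 l2 l3 st; rewrite mulr0 addr0 oppr0.
split => //.
  split.
  - exact: (J _ _ _ _ _ _ _ _ abc Ws).
  - exact: (J _ _ _ _ _ _ _ _ abc' (Wstar_rot Ws)).
  - exact: (J _ _ _ _ _ _ _ _ abc'' (Wstar_rot (Wstar_rot Ws))).
move=> S A; have S1 := sven_const_Wpiece o k1 k2 k3 abc.
have S2 := sven_const_Wpiece o k2 k3 k1 abc'; have S3 := sven_const_Wpiece o k3 k1 k2 abc''.
have [-> ->] : S = k2 + k3 + k1 /\ A = crs c a + crs a b + crs b c.
  by rewrite /S /A; split; ring.
rewrite S2; split => //.
  have [-> ->] : k2 + k3 + k1 = k3 + k1 + k2 /\ crs c a + crs a b + crs b c = crs a b + crs b c + crs c a.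
    by split; ring.
  exact: S3.
have [-> ->] : k2 + k3 + k1 = k1 + k2 + k3 /\ crs c a + crs a b + crs b c = crs b c + crs c a + crs a b.
  by split; ring.
exact: S1.
Qed.

(** The explicit element with the same side data differs from the given one by an element with zero
    data, which vanishes by [Wstar_unique]. *)
Lemma Wstar_sven o a b c uA uB uC (k1 k2 k3 : R) : star a b c ->
  Wstar o a b c uA uB uC k1 k2 k3 -> jumps0 o a b c uA uB uC ->
  let S := k1 + k2 + k3 in let A := crs b c + crs c a + crs a b in
  [/\ crs b c * sven_const uA o b c = S * (1 - 2 * crs b c / A) - 3 * k1,
      crs c a * sven_const uB o c a = S * (1 - 2 * crs c a / A) - 3 * k2
    & crs a b * sven_const uC o a b = S * (1 - 2 * crs a b / A) - 3 * k3].
Proof.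
move=> abc Ws js S A.
have [wA [wB [wC [Ww jw [s1 s2 s3]]]]] := Wstar_exists o k1 k2 k3 abc.
have Wd : Wstar o a b c (slin (-1) wA uA) (slin (-1) wB uB) (slin (-1) wC uC) 0 0 0.
  have := Wstar_lin (-1) Ww Ws; have E (k : R) : -1 * k + k = 0 by ring.
  by rewrite !E.
have jd := jumps0_lin (-1) jw js.
have Z := Wstar_unique abc Wd jd.
have SC u p q : (forall x, szero u x) -> sven_const u o p q = 0.
  move=> h; have z (f : quadr R) : (forall x, qv f x = 0) -> f = Quadr 0 0 0 0 0 0 := @qv_eq0 R f.
  have L v w : lq u o p q v w = Quadr 0 0 0 0 0 0.
    apply: z => x; rewrite /lq qv_comp qv_qform; have [-> -> ->] := h (aff o p q x).
    by rewrite !mulr0 !addr0.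
  by rewrite /sven_const !L /= !mulr0 !addr0 subrr mul0r.
have E u u1 p q : (forall x, szero (slin (-1) u1 u) x) -> sven_const u o p q = sven_const u1 o p q.
  move=> h; have := SC _ p q h; rewrite sven_const_lin mulN1r addrC => /eqP.
  by rewrite subr_eq0 => /eqP.
rewrite -s1 -s2 -s3; split; congr (_ * _); apply: E => x; by have [] := Z x.
Qed.

End StarTensor.

(** * Polynomial fields *)

Section Fields.
Variable R : realType.
Implicit Types (o p q x v w : R * R) (u : symq R).

Definition qp (Y : lmodType R) (y0 y1 y2 y11 y12 y22 : Y) (x : R * R) : Y :=
  y0 + x.1 *: y1 + x.2 *: y2 + x.1 ^+ 2 *: y11 + (x.1 * x.2) *: y12 + x.2 ^+ 2 *: y22.

Lemma poly2P (Y : lmodType R) (f : R * R -> Y) :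
  @poly2 R 2 Y f <-> exists y0 y1 y2 y11 y12 y22, f = qp y0 y1 y2 y11 y12 y22.
Proof.
have E (c : nat -> nat -> Y) (x : R * R) :
    \sum_(i < 3) \sum_(j < 3 | (i + j <= 2)%N) (x.1 ^+ i * x.2 ^+ j) *: c i j =
    qp (c 0 0) (c 1 0) (c 0 1) (c 2 0) (c 1 1) (c 0 2) x.
  under eq_bigr do rewrite big_mkcond /=.
  rewrite !big_ord_recl !big_ord0 /= !expr0 !expr1 !mul1r !mulr1 scale1r /qp /bump /=.
  rewrite !addr0 -!addrA; congr (_ + _).
  have P (v1 v2 v3 v4 v5 : Y) : v1 + (v2 + (v3 + (v4 + v5))) = v3 + (v1 + (v5 + (v4 + v2))).
    by rewrite !addrA [LHS](ACl (3*1*5*4*2)).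
  exact: P.
split=> [[c ->]|[y0 [y1 [y2 [y11 [y12 [y22 ->]]]]]]].
  exists (c 0 0), (c 1 0), (c 0 1), (c 2 0), (c 1 1), (c 0 2).
  by apply/funext => x; rewrite E.
exists (fun i j => match i, j with 0, 0 => y0 | 1, 0 => y1 | 0, 1 => y2 | 2, 0 => y11 | 1, 1 => y12
  | _, _ => y22 end)%N.
by apply/funext => x; rewrite (E (fun i j => match i, j with 0, 0 => y0 | 1, 0 => y1 | 0, 1 => y2
  | 2, 0 => y11 | 1, 1 => y12 | _, _ => y22 end)%N).
Qed.

Lemma poly0P (Y : lmodType R) (f : R * R -> Y) : @poly2 R 0 Y f <-> exists y, f = fun=> y.
Proof.
have E (c : nat -> nat -> Y) (x : R * R) :
    \sum_(i < 1) \sum_(j < 1 | (i + j <= 0)%N) (x.1 ^+ i * x.2 ^+ j) *: c i j = c 0 0.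
  under eq_bigr do rewrite big_mkcond /=.
  by rewrite !big_ord_recl !big_ord0 /= !expr0 mulr1 scale1r !addr0.
split=> [[c ->]|[y ->]]; first by exists (c 0 0)%N; apply/funext => x; rewrite E.
by exists (fun _ _ => y); apply/funext => x; rewrite E.
Qed.

Lemma poly2_vq (f : R * R -> R * R) : @poly2 R 2 (R * R)%type f <-> exists v : vecq R, f = vq v.
Proof.
split=> [/poly2P[y0 [y1 [y2 [y11 [y12 [y22 ->]]]]]]|[v ->]].
  exists (Quadr y0.1 y1.1 y2.1 y11.1 y12.1 y22.1, Quadr y0.2 y1.2 y2.2 y11.2 y12.2 y22.2).
  by apply/funext => x; apply: injective_projections; rewrite /qp /vq /qv /= /GRing.scale /=; ring.
apply/poly2P; case: v => [[a0 a1 a2 a11 a12 a22] [b0 b1 b2 b11 b12 b22]].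
exists (a0, b0), (a1, b1), (a2, b2), (a11, b11), (a12, b12), (a22, b22).
by apply/funext => x; apply: injective_projections; rewrite /qp /vq /qv /= /GRing.scale /=; ring.
Qed.

Definition mx3 (m : R * R * R) : 'M[R]_2 :=
  \matrix_(i, j) if i == j then (if i == ord0 then m.1.1 else m.2) else m.1.2.

Definition mq (u : symq R) x : 'M[R]_2 := mx3 (qv u.1.1 x, qv u.1.2 x, qv u.2 x).

Lemma mx3_inj : injective mx3.
Proof.
move=> [[a b] c] [[a' b'] c'] /matrixP h.
by have := h ord0 ord0; have := h ord0 ord_max; have := h ord_max ord_max; rewrite !mxE /= => -> -> ->.
Qed.

Lemma sym2P (m : 'M[R]_2) : m^T = m -> m = mx3 (m ord0 ord0, m ord0 ord_max, m ord_max ord_max).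
Proof.
move=> h; apply/matrixP => i j; rewrite mxE.
have lift0 (k : 'I_2) : k = ord0 \/ k = ord_max.
  by case: k => -[|[|//]] hk; [left|right]; exact/val_inj.
have [-> |->] := lift0 i; have [->|->] := lift0 j => //=.
by rewrite -[in LHS]h mxE.
Qed.

Lemma poly2_mq (f : R * R -> 'M[R]_2) :
  @poly2 R 2 'M[R]_2 f /\ (forall x, (f x)^T = f x) <-> exists u, f = mq u.
Proof.
split=> [[/poly2P[y0 [y1 [y2 [y11 [y12 [y22 ->]]]]]] h]|[u ->]]; last first.
  split; last by move=> x; apply/matrixP => i j; rewrite !mxE eq_sym; case: eqP => // ->.
  apply/poly2P; case: u => [[[a0 a1 a2 a11 a12 a22] [b0 b1 b2 b11 b12 b22]] [c0 c1 c2 c11 c12 c22]].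
  exists (mx3 (a0, b0, c0)), (mx3 (a1, b1, c1)), (mx3 (a2, b2, c2)), (mx3 (a11, b11, c11)),
    (mx3 (a12, b12, c12)), (mx3 (a22, b22, c22)).
  apply/funext => x; apply/matrixP => i j; rewrite /qp !mxE /qv /=.
  by case: ifP => _; [case: ifP => _|]; ring.
pose Q i j := Quadr (y0 i j) (y1 i j) (y2 i j) (y11 i j) (y12 i j) (y22 i j).
exists (Q ord0 ord0, Q ord0 ord_max, Q ord_max ord_max).
apply/funext => x; rewrite {1}(sym2P (h x)) /mq; congr mx3.
by rewrite /qp !mxE /qv /=; congr (_, _, _); ring.
Qed.

Lemma derive_qv (f : quadr R) x w : 'D_w (qv f) x = qv (qd1 f) x * w.1 + qv (qd2 f) x * w.2.
Proof. exact: (derive_val (is_derive := is_derive_qv f x w)). Qed.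

Lemma partial0_qv (f : quadr R) x : partial ord0 (qv f) x = qv (qd1 f) x.
Proof. by rewrite /partial /= derive_qv /= mulr1 mulr0 addr0. Qed.

Lemma partial1_qv (f : quadr R) x : partial ord_max (qv f) x = qv (qd2 f) x.
Proof. by rewrite /partial /= derive_qv /= mulr1 mulr0 add0r. Qed.

Lemma def_vq (v : vecq R) x : def (vq v) x = mq (defq v) x.
Proof.
apply/matrixP => i j; rewrite !mxE /coordi /=.
have lift0 (k : 'I_2) : k = ord0 \/ k = ord_max.
  by case: k => -[|[|//]] hk; [left|right]; exact/val_inj.
have [-> |->] := lift0 i; have [->|->] := lift0 j => /=.
all: rewrite ?(partial0_qv v.1) ?(partial0_qv v.2) ?(partial1_qv v.1) ?(partial1_qv v.2) ?qv_lin ?qv0.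
all: by move: (qv _ x) => m; try (move: (qv _ x) => n); field.
Qed.

Lemma curlT_vq (v : vecq R) : curlT (vq v) = qv (curlq v).
Proof.
apply/funext => x; rewrite /curlT (partial0_qv v.2) (partial1_qv v.1) /curlq qv_lin; ring.
Qed.

Definition dotq w (v : vecq R) : quadr R :=
  qlin w.1 v.1 (qlin w.2 v.2 (Quadr 0 0 0 0 0 0)).

Lemma qv_dotq w (v : vecq R) x : qv (dotq w v) x = dot (vq v x) w.
Proof. by rewrite /dotq !qv_lin qv0 /dot /=; ring. Qed.

Lemma derive_dot (v : vecq R) w y x :
  'D_y (fun x => dot (vq v x) w) x = qv (qd1 (dotq w v)) x * y.1 + qv (qd2 (dotq w v)) x * y.2.
Proof. by rewrite -derive_qv; congr ('D_y _ x); apply/funext => z; rewrite qv_dotq. Qed.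

Lemma apply_mq u v w x : dot (apply_mx (mq u x) v) w = qv (qform u.1.1 u.1.2 u.2 v w) x.
Proof. by rewrite qv_qform /dot /apply_mx !mxE /=; ring. Qed.

Lemma mq_lin k u u' x : mq (slin k u u') x = k *: mq u x + mq u' x.
Proof.
apply/matrixP => i j; rewrite !mxE /= !qv_lin.
by case: ifP => _ //; case: ifP.
Qed.

Lemma vq_lin k (v v' : vecq R) x :
  vq (qlin k v.1 v'.1, qlin k v.2 v'.2) x = k *: vq v x + vq v' x.
Proof. by rewrite /vq /= !qv_lin. Qed.

Lemma mq_inj u u' : mq u = mq u' -> u = u'.
Proof.
move=> h; have E x : (qv u.1.1 x, qv u.1.2 x, qv u.2 x) = (qv u'.1.1 x, qv u'.1.2 x, qv u'.2 x).
  by apply: mx3_inj; have := congr1 (fun f => f x) h.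
case: u u' E {h} => [[f g] h] [[f' g'] h'] /= E.
by congr (_, _, _); apply: qv_inj; apply/funext => x; have [] := E x.
Qed.

Lemma continuous_vq (v : vecq R) : continuous (vq v : R * R -> R * R).
Proof. by move=> x; apply: (@cvg_pair _ _ _ (nbhs x) (nbhs (qv v.1 x)) (nbhs (qv v.2 x))); exact: continuous_qv. Qed.

Lemma continuous_mq u : continuous (mq u : R * R -> 'M[R]_2).
Proof.
have -> : mq u = fun x => qv u.1.1 x *: mx3 (1, 0, 0) + qv u.1.2 x *: mx3 (0, 1, 0)
    + qv u.2 x *: mx3 (0, 0, 1).
  apply/funext => x; apply/matrixP => i j; rewrite !mxE /=.
  by case: ifP => _; [case: ifP => _|]; ring.
by move=> x; apply: cvgD; [apply: cvgD|]; apply: cvgZ; (exact: continuous_qv || exact: cvg_cst).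
Qed.

Lemma tri_closed o p q : crs p q != 0 -> closed (tri o p q).
Proof.
move=> c0; apply: compact_closed; first exact: norm_hausdorff.
have -> : tri o p q = aff o p q @` @ref_triangle R by [].
apply: continuous_compact; first by apply: continuous_subspaceT; exact: continuous_aff.
apply: (subclosed_compact _ (@box_compact R 0 1 0 1)); last exact: ref_triangle_box.
have cl (f : R * R -> R) : continuous f -> closed [set x | 0 <= f x].
  move=> cf; rewrite (_ : [set x | 0 <= f x] = f @^-1` [set y | 0 <= y]) //.
  by apply: preimage_closed; [move=> x _; exact: cf|exact: closed_ge].
have h : @ref_triangle R = [set x | 0 <= x.1] `&` [set x | 0 <= x.2] `&` [set x | 0 <= 1 - (x.1 + x.2)].
  by apply/seteqP; split => x; [case=> ? ? ?; split; rewrite /= ?subr_ge0|case=> -[? ?] /=; rewrite subr_ge0].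
rewrite h; apply: closedI; first apply: closedI.
- by apply: cl; exact: fst_continuous2.
- by apply: cl; exact: snd_continuous2.
- apply: cl => x; apply: cvgB; first exact: cvg_cst.
  by apply: cvgD; [exact: fst_continuous2|exact: snd_continuous2].
Qed.

(** Adjacent pieces lie on opposite sides of the line of their common ray, which forces
    [crs (x - o) b = 0]. *)
Lemma tri_ray o a b c x : 0 < crs b c -> 0 < crs a b -> tri o a b x -> tri o b c x ->
  exists2 s, 0 <= s <= 1 & x = o + s *: b.
Proof.
move=> A0 C0; rewrite !triE ?gt_eqF // => -[/= h1 h2 h3] [/= l1 l2 l3].
have z : crs (x - o) b = 0.
  apply/eqP; rewrite eq_le; apply/andP; split.
    move: l2; rewrite /lc /= pmulr_lge0 ?invr_gt0 // => l2.
    by rewrite crsC oppr_le0.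
  by move: h1; rewrite /lc /= pmulr_lge0 ?invr_gt0.
exists (lc o a b x).2.
  by rewrite h2; move: h3; rewrite /lc /= z mul0r add0r.
by rewrite -{1}(lcK o (lt0r_neq0 C0) x) /aff {1}/lc /= z mul0r scale0r addr0.
Qed.

(** Pasting along closed sets: two pieces meet only in their common ray, where the given functions
    agree. *)
Lemma glue (Y : topologicalType) o a b c (fA fB fC : R * R -> Y) : star a b c ->
  continuous fA -> continuous fB -> continuous fC ->
  (forall s, 0 <= s <= 1 -> fC (o + s *: a) = fB (o + s *: a)) ->
  (forall s, 0 <= s <= 1 -> fA (o + s *: b) = fC (o + s *: b)) ->
  (forall s, 0 <= s <= 1 -> fB (o + s *: c) = fA (o + s *: c)) ->
  exists f, [/\ {within hull3 o a b c, continuous f}, forall x, tri o b c x -> f x = fA x,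
    forall x, tri o c a x -> f x = fB x & forall x, tri o a b x -> f x = fC x].
Proof.
move=> [A0 B0 C0] cA cB cC ha hb hc.
pose f x := if x \in tri o a b then fC x else if x \in tri o b c then fA x else fB x.
have eC x : tri o a b x -> f x = fC x by move=> h; rewrite /f mem_set.
have eA x : tri o b c x -> f x = fA x.
  move=> h; rewrite /f [in X in if _ then _ else X]mem_set //.
  case: ifPn => // /set_mem h'; have [s hs ->] := tri_ray A0 C0 h' h.
  by rewrite hb.
have eB x : tri o c a x -> f x = fB x.
  move=> h; rewrite /f; case: ifPn => [/set_mem h'|_].
    by have [s hs ->] := tri_ray C0 B0 h h'; rewrite ha.
  case: ifPn => [/set_mem h'|//].
  by have [s hs ->] := tri_ray B0 A0 h' h; rewrite hc.
exists f; split => //.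
have -> : hull3 o a b c = (tri o a b `|` tri o b c) `|` tri o c a.
  apply/seteqP; split => x; first by move=> /(hull3_cover A0 B0 C0)[]; [left; left|left; right|right].
  by move=> [[]|]; [exact: tri_sub_hull3|rewrite hull3_rot; exact: tri_sub_hull3|
    rewrite -hull3_rot; exact: tri_sub_hull3].
apply: withinU_continuous; first by apply: closedU; apply: tri_closed; rewrite gt_eqF.
- by apply: tri_closed; rewrite gt_eqF.
- apply: withinU_continuous; try by apply: tri_closed; rewrite gt_eqF.
  + apply: (@subspace_eq_continuous _ _ _ fC); last exact: continuous_subspaceT.
    by move=> x /set_mem /eC.
  + apply: (@subspace_eq_continuous _ _ _ fA); last exact: continuous_subspaceT.
    by move=> x /set_mem /eA.
- apply: (@subspace_eq_continuous _ _ _ fB); last exact: continuous_subspaceT.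
  by move=> x /set_mem /eB.
Qed.

End Fields.

(** * Triangles and edges of the mesh *)

Section MeshFrame.
Variables (R : realType) (K : ct_mesh R).
Local Notation vert := (vert K).
Local Notation edge := (edge K).
Local Notation triangle := (triangle K).
Local Notation pos := (@pos R K).
Implicit Types (A B C : vert) (e : edge) (t : triangle).

Lemma big_set3 (V : nmodType) (I : finType) (x y z : I) (F : I -> V) :
  x != y -> y != z -> z != x -> \sum_(i in [set x; y; z]%SET) F i = F x + F y + F z.
Proof.
move=> xy yz zx; rewrite finset.setUC big_setU1; last by rewrite !finset.inE negb_or zx eq_sym yz.
by rewrite big_setU1 ?finset.inE // big_set1 addrC.
Qed.

Lemma big_set2 (V : nmodType) (I : finType) (x y : I) (F : I -> V) :
  x != y -> \sum_(i in [set x; y]%SET) F i = F x + F y.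
Proof. by move=> xy; rewrite big_setU1 ?finset.inE // big_set1. Qed.

(** A counterclockwise labelling of the vertices around the centre, each edge being named after the
    opposite vertex. Rotating a labelling gives another one, so each fact is proved for [eA]
    only. *)
Definition tframe t A B C (eA eB eC : edge) : Prop :=
  [/\ val t = [set A; B; C]%SET, star (pos A - center t) (pos B - center t) (pos C - center t)
    & [/\ val eA = [set B; C]%SET, val eB = [set C; A]%SET & val eC = [set A; B]%SET]].

Lemma tframe_rot t A B C eA eB eC :
  tframe t A B C eA eB eC -> tframe t B C A eB eC eA.
Proof.
move=> [h s [hA hB hC]]; split; [|exact: star_rot|by []].
rewrite h; apply/setP => v; rewrite !finset.inE.
by case: (v == A); case: (v == B); case: (v == C).
Qed.

Lemma tframe_neq t A B C eA eB eC : tframe t A B C eA eB eC -> [/\ A != B, B != C & C != A].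
Proof.
move=> [_ [h1 h2 h3] _]; split; apply/eqP => E.
- by rewrite E crspp ltxx in h3.
- by rewrite E crspp ltxx in h1.
- by rewrite E crspp ltxx in h2.
Qed.

Lemma independent_crs (x y z : vert) : x != y -> y != z -> z != x ->
  affinely_independent pos [set x; y; z]%SET -> crs (pos y - pos x) (pos z - pos x) != 0.
Proof.
move=> xy yz zx ind; apply/eqP => c0.
have H (k l : R) : k *: (pos y - pos x) + l *: (pos z - pos x) = 0 -> k = 0 /\ l = 0.
  move=> h; pose w v := if v == y then k else if v == z then l else - k - l.
  have wx : w x = - k - l by rewrite /w (negbTE xy) eq_sym (negbTE zx).
  have wy : w y = k by rewrite /w eqxx.
  have wz : w z = l by rewrite /w eq_sym (negbTE yz) eqxx.
  have w1 : \sum_(i in [set x; y; z]%SET) w i = 0.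
    by rewrite big_set3 // wx wy wz; ring.
  have w2 : \sum_(i in [set x; y; z]%SET) w i *: pos i = 0.
    rewrite big_set3 // wx wy wz -h.
    by apply: injective_projections; rewrite /= /GRing.scale /=; ring.
  have := ind w w1 w2 y; have := ind w w1 w2 z; rewrite wy wz !finset.inE !eqxx !orbT.
  by move=> -> // ->.
move: c0 H; move: (pos y - pos x) (pos z - pos x) => [p1 p2] [s1 s2].
rewrite /crs /= => c0 H.
(* A zero determinant makes [s1 p - p1 s] and [s2 p - p2 s] vanish, and independence then kills all
   the coordinates. *)
have [q1 p1'] : s1 = 0 /\ - p1 = 0.
  apply: H; apply: injective_projections; rewrite /= /GRing.scale /=; first by ring.
  by rewrite -[RHS]oppr0 -c0; ring.
have [q2 p2'] : s2 = 0 /\ - p2 = 0.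
  apply: H; apply: injective_projections; rewrite /= /GRing.scale /=; last by ring.
  by rewrite -c0; ring.
have [/eqP] : (1 : R) = 0 /\ (0 : R) = 0; last by rewrite oner_eq0.
have p10 : p1 = 0 by rewrite -[p1]opprK p1' oppr0.
have p20 : p2 = 0 by rewrite -[p2]opprK p2' oppr0.
by apply: H; rewrite p10 p20; apply: injective_projections; rewrite /= /GRing.scale /=; ring.
Qed.

Lemma hull_set3 (x y z : vert) p : x != y -> y != z -> z != x -> hull pos [set x; y; z]%SET p <->
  exists k l m : R, [/\ 0 <= k, 0 <= l, 0 <= m & k + l + m = 1 /\ p = k *: pos x + l *: pos y + m *: pos z].
Proof.
move=> xy yz zx; split=> [[w [w0 w1 ->]]|[k [l [m [k0 l0 m0 [s ->]]]]]].
  exists (w x), (w y), (w z); split => //; split; first by rewrite -w1 big_set3.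
  by rewrite big_set3.
pose w v := if v == x then k else if v == y then l else m.
have wx : w x = k by rewrite /w eqxx.
have wy : w y = l by rewrite /w eq_sym (negbTE xy) eqxx.
have wz : w z = m by rewrite /w (negbTE zx) eq_sym (negbTE yz).
exists w; split; [|by rewrite big_set3 // wx wy wz|by rewrite big_set3 // wx wy wz].
by move=> v; rewrite /w; case: ifP => // _; case: ifP.
Qed.

Lemma hull_set2 (x y : vert) p : x != y -> hull pos [set x; y]%SET p <->
  exists2 s : R, 0 <= s <= 1 & p = (1 - s) *: pos x + s *: pos y.
Proof.
move=> xy; split=> [[w [w0 w1 ->]]|[s /andP[s0 s1] ->]].
  move: w1; rewrite !big_set2 // => w1.
  exists (w y); first by rewrite w0 -w1 lerDr w0.
  by rewrite (_ : 1 - w y = w x) // -w1; ring.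
exists (fun v => if v == x then 1 - s else s); split.
- by move=> v; case: ifP => _; rewrite ?subr_ge0.
- by rewrite big_set2 // eqxx eq_sym (negbTE xy); ring.
- by rewrite big_set2 // eqxx eq_sym (negbTE xy).
Qed.

(** The centre is interior, so it can be moved a little away from [x], parallel to the edge from [x]
    to [y], without leaving the triangle. Its coordinate at [x] thus exceeds a nonnegative number by
    [d > 0]. *)
Lemma center_star t (x y z : vert) : val t = [set x; y; z]%SET -> x != y -> y != z -> z != x ->
  0 < crs (pos y - pos x) (pos z - pos x) ->
  0 < crs (pos y - center t) (pos z - center t).
Proof.
move=> ht xy yz zx ar.
have [d d0] := interior_shift (pos x - pos y) (@center_in R K t).
rewrite ht => /(hull_set3 _ xy yz zx)[k [l [m [k0 l0 m0 [s E]]]]].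
have h : crs (pos y - (center t - d *: (pos x - pos y))) (pos z - (center t - d *: (pos x - pos y))) =
    crs (pos y - center t) (pos z - center t) - d * crs (pos y - pos x) (pos z - pos x).
  by rewrite /crs /= /GRing.scale /=; ring.
have h' : crs (pos y - (center t - d *: (pos x - pos y))) (pos z - (center t - d *: (pos x - pos y))) =
    k * crs (pos y - pos x) (pos z - pos x).
  rewrite E; have -> : l = 1 - k - m by rewrite -s; ring.
  by rewrite /crs /= /GRing.scale /=; ring.
have -> : crs (pos y - center t) (pos z - center t) =
   k * crs (pos y - pos x) (pos z - pos x) + d * crs (pos y - pos x) (pos z - pos x).
  by rewrite -h' h subrK.
by rewrite ltr_wpDl ?mulr_ge0 ?(ltW ar) ?mulr_gt0.
Qed.

Lemma edge_exists (s : {set vert}) (x y : vert) : s \in simplices K -> x \in s -> y \in s -> x != y ->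
  exists e : edge, val e = [set x; y]%SET.
Proof.
move=> sK xs ys xy.
have h : ([set x; y]%SET \in simplices K) && (#|[set x; y]%SET| == 2)%N.
  rewrite cards2 xy eqxx andbT; apply: (simplices_sub sK).
    by apply/fintype.subsetP => v; rewrite !finset.inE => /orP[] /eqP ->.
  by apply/set0Pn; exists x; rewrite !finset.inE eqxx.
by exists (exist (fun e : {set vert} => (e \in simplices K) && (#|e| == 2)%N) _ h).
Qed.

Lemma tframe_exists t : exists A B C eA eB eC, tframe t A B C eA eB eC.
Proof.
have /andP[tK /eqP t3] := valP t.
have /card_gt2P[x [y [z [[xt yt zt] [xy yz zx]]]]] : (2 < #|val t|)%N by rewrite t3.
have E (x' y' z' : vert) : x' \in val t -> y' \in val t -> z' \in val t ->
    x' != y' -> y' != z' -> z' != x' -> val t = [set x'; y'; z']%SET.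
  move=> {xt yt zt xy yz zx} xt yt zt xy yz zx.
  apply/esym/eqP; rewrite eqEcard t3; apply/andP; split.
    by apply/fintype.subsetP => v; rewrite !finset.inE => /orP[/orP[]|] /eqP ->.
  by rewrite finset.setUC cardsU1 cards2 !finset.inE negb_or zx eq_sym yz xy.
have H (x' y' z' : vert) : x' \in val t -> y' \in val t -> z' \in val t ->
    x' != y' -> y' != z' -> z' != x' -> 0 < crs (pos y' - pos x') (pos z' - pos x') ->
    exists A B C eA eB eC, tframe t A B C eA eB eC.
  move=> {xt yt zt xy yz zx} xt yt zt xy yz zx ar.
  have [e1 h1] := edge_exists tK yt zt yz; have [e2 h2] := edge_exists tK zt xt zx.
  have [e3 h3] := edge_exists tK xt yt xy.
  exists x', y', z', e1, e2, e3; split => //; first exact: E.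
  split.
  - by apply: (center_star (E _ _ _ xt yt zt xy yz zx)).
  - apply: (center_star (E _ _ _ yt zt xt yz zx xy)) => //.
    by rewrite (_ : crs _ _ = crs (pos y' - pos x') (pos z' - pos x')) // /crs /=; ring.
  - apply: (center_star (E _ _ _ zt xt yt zx xy yz)) => //.
    by rewrite (_ : crs _ _ = crs (pos y' - pos x') (pos z' - pos x')) // /crs /=; ring.
have c0 : crs (pos y - pos x) (pos z - pos x) != 0.
  apply: independent_crs => //; rewrite -E //; exact: simplices_indep.
(* A clockwise triple becomes counterclockwise when two vertices are exchanged. *)
have [c1|c1|c1] := ltgtP 0 (crs (pos y - pos x) (pos z - pos x)).
- exact: (H x y z).
- apply: (H x z y) => //; try by rewrite eq_sym.
  by rewrite crsC oppr_gt0.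
- by rewrite -c1 eqxx in c0.
Qed.

Lemma tail_eq e (x y : vert) : val e = [set x; y]%SET -> x != y -> head e = y -> tail e = x.
Proof.
move=> he xy hy; rewrite /tail hy; case: pickP => [v|/(_ x)] /=.
  by rewrite he !finset.inE => /andP[/orP[/eqP->//|/eqP->]]; rewrite eqxx.
by rewrite he !finset.inE eqxx xy.
Qed.

Lemma edge_ends e : [/\ val e = [set tail e; head e]%SET & tail e != head e].
Proof.
have /andP[_ /cards2P[x [y [xy E]]]] := valP e.
have := head_in e; rewrite E !finset.inE => /orP[] /eqP h.
  have yx : y != x by rewrite eq_sym.
  have E' : val e = [set y; x]%SET by rewrite E finset.setUC.
  by rewrite (tail_eq E' yx h) h finset.setUC.
by rewrite (tail_eq E xy h) h.
Qed.

Lemma len_gt0 e : 0 < len e.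
Proof.
have [E th] := edge_ends e; have /andP[eK _] := valP e.
have ne : pos (head e) != pos (tail e).
  apply/eqP => h; have := simplices_indep eK; rewrite E => ind.
  have := ind (fun v => if v == tail e then 1 else -1).
  rewrite !big_set2 // eqxx eq_sym (negbTE th) subrr => /(_ erefl).
  rewrite scale1r scaleN1r h subrr => /(_ erefl (tail e)).
  by rewrite !finset.inE eqxx => /(_ isT)/eqP; rewrite oner_eq0.
rewrite /len sqrtr_gt0 lt_neqAle eq_sym; apply/andP; split; last first.
  by rewrite /dot addr_ge0 // -expr2 sqr_ge0.
apply: contra ne; rewrite /dot paddr_eq0 -?expr2 ?sqr_ge0 // !sqrf_eq0 => /andP[/eqP h1 /eqP h2].
by rewrite -subr_eq0; apply/eqP; apply: injective_projections.
Qed.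

Lemma len_sqr e : dot (pos (head e) - pos (tail e)) (pos (head e) - pos (tail e)) = len e ^+ 2.
Proof. by rewrite /len sqr_sqrtr // /dot addr_ge0 // -expr2 sqr_ge0. Qed.

Lemma head_tail e : pos (head e) = pos (tail e) + len e *: tau e.
Proof. by rewrite /tau scalerA divff ?gt_eqF ?len_gt0 // scale1r addrC subrK. Qed.

Lemma dot_tau e : dot (tau e) (tau e) = 1.
Proof.
rewrite /tau dotZr; have -> : dot ((len e)^-1 *: (pos (head e) - pos (tail e))) (pos (head e) - pos (tail e)) =
   (len e)^-1 * len e ^+ 2 by rewrite -len_sqr /dot /= /GRing.scale /=; ring.
by have := len_gt0 e; move: (len e) => l l0; field; rewrite gt_eqF.
Qed.

Lemma ecoord_tail e : ecoord e (tail e) = 0.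
Proof. by rewrite /ecoord subrr /dot /= !mul0r addr0. Qed.

Lemma ecoord_head e : ecoord e (head e) = len e.
Proof.
rewrite /ecoord head_tail -[RHS]mulr1 -(dot_tau e).
by rewrite /dot /= /GRing.scale /=; ring.
Qed.

Section Frame.
Variables (t : triangle) (A B C : vert) (eA eB eC : edge).
Hypothesis F : tframe t A B C eA eB eC.
Local Notation o := (center t).
Local Notation a := (pos A - o).
Local Notation b := (pos B - o).
Local Notation c := (pos C - o).

Lemma tframe_star : star a b c. Proof. by case: F. Qed.

Lemma tframe_edges_neq : [/\ eA != eB, eB != eC & eC != eA].
Proof.
have [ab bc ca] := tframe_neq F; have [_ _ [hA hB hC]] := F.
have N (x y : vert) (e1 e2 : edge) : x \in val e1 -> x \notin val e2 -> e1 != e2.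
  by move=> h1 h2; apply/eqP => E; rewrite E (negbTE h2) in h1.
split; [apply: (N B B)|apply: (N C C)|apply: (N A A)]; rewrite ?hA ?hB ?hC !finset.inE ?eqxx ?orbT //.
all: by rewrite negb_or ?ab ?bc ?ca // 1?eq_sym ?ab ?bc ?ca // eq_sym ?ab ?bc ?ca.
Qed.

Lemma tedge_frame e : tedge t e = (e \in [set eA; eB; eC]%SET).
Proof.
have [ab bc ca] := tframe_neq F; have [ht _ [hA hB hC]] := F.
rewrite /tedge !finset.inE; apply/idP/idP; last first.
  move=> /orP[/orP[]|] /eqP ->; rewrite ?hA ?hB ?hC ht; apply/fintype.subsetP => v;
  by rewrite !finset.inE => /orP[] ->; rewrite ?orbT.
have [E th] := edge_ends e.
move=> /fintype.subsetP sub.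
have := sub (tail e); have := sub (head e); rewrite ht E !finset.inE !eqxx !orbT => /(_ isT) hh /(_ isT) tt.
have V (e' : edge) : val e' = [set tail e; head e]%SET -> e == e'.
  by move=> h; apply/eqP/val_inj; rewrite h.
case/orP: hh => [/orP[]|] /eqP hh; case/orP: tt => [/orP[]|] /eqP tt; rewrite hh tt ?eqxx // in th V.
all: first [by rewrite (V eA) ?orbT // hA|by rewrite (V eA) ?orbT // hA finset.setUC
  |by rewrite (V eB) ?orbT // hB|by rewrite (V eB) ?orbT // hB finset.setUC
  |by rewrite (V eC) ?orbT // hC|by rewrite (V eC) ?orbT // hC finset.setUC].
Qed.

Lemma tedge_sum (V : nmodType) (G : edge -> V) :
  \sum_(e | tedge t e) G e = G eA + G eB + G eC.
Proof.
have [n1 n2 n3] := tframe_edges_neq; rewrite -big_set3 //.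
by apply: eq_bigl => e; rewrite tedge_frame.
Qed.

Lemma hull_frame : hull pos (val t) = hull3 o a b c.
Proof.
have [ab bc ca] := tframe_neq F; have [ht s _] := F.
have ar := star_area_gt0 s; rewrite -crs_edges in ar.
have E : crs (b - a) (c - a) = crs (pos B - pos A) (pos C - pos A) by rewrite /crs /=; ring.
rewrite E in ar; rewrite ht; apply/seteqP; split => x.
  move=> /(hull_set3 _ ab bc ca)[k [l [m [k0 l0 m0 [s1 ->]]]]].
  have -> : k = 1 - l - m by rewrite -s1; ring.
  have k1 : 0 <= 1 - l - m by rewrite -s1 (_ : _ - l - m = k) //; ring.
  split; rewrite /lam.
  - have -> : crs (c - b) ((1 - l - m) *: pos A + l *: pos B + m *: pos C - o - b) =
       (1 - l - m) * crs (pos B - pos A) (pos C - pos A) by rewrite /crs /= /GRing.scale /=; ring.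
    by apply: mulr_ge0 => //; exact: ltW.
  - have -> : crs (a - c) ((1 - l - m) *: pos A + l *: pos B + m *: pos C - o - c) =
       l * crs (pos B - pos A) (pos C - pos A) by rewrite /crs /= /GRing.scale /=; ring.
    by apply: mulr_ge0 => //; exact: ltW.
  - have -> : crs (b - a) ((1 - l - m) *: pos A + l *: pos B + m *: pos C - o - a) =
       m * crs (pos B - pos A) (pos C - pos A) by rewrite /crs /= /GRing.scale /=; ring.
    by apply: mulr_ge0 => //; exact: ltW.
move=> [l1 l2 l3]; apply/(hull_set3 _ ab bc ca).
pose S := crs (pos B - pos A) (pos C - pos A).
(* Barycentric coordinates as quotients of areas. *)
exists (lam o b c x / S), (lam o c a x / S), (lam o a b x / S).
have Sge : 0 <= S := ltW ar.
split; [exact: divr_ge0..|].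
have S0 : S != 0 by rewrite gt_eqF.
split.
  rewrite -!mulrDl -[RHS](divff S0); congr (_ / _); rewrite /lam /S /crs /=; ring.
apply: (scalerI S0); rewrite !scalerDr !scalerA ![S * (_ / S)]mulrC !divfK //.
by apply: injective_projections; rewrite /lam /S /crs /= /GRing.scale /=; ring.
Qed.

Lemma side_point (s : R) : (1 - s) *: pos B + s *: pos C = aff o b c (1 - s, s).
Proof. by rewrite /aff; apply: injective_projections; rewrite /= /GRing.scale /=; ring. Qed.

Lemma hull_side x : hull pos (val eA) x <-> exists2 s : R, 0 <= s <= 1 & x = aff o b c (1 - s, s).
Proof.
have [_ bc _] := tframe_neq F; have [_ _ [-> _ _]] := F.
apply: (iff_trans (hull_set2 _ bc)).
by split => -[s hs ->]; exists s; rewrite // side_point.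
Qed.

Lemma subtriangle_frame : subtriangle t eA = tri o b c.
Proof.
apply/seteqP; split => x.
  move=> [k [y [/andP[k0 k1] /hull_side[s /andP[s0 s1] ->] ->]]].
  exists ((1 - k) * (1 - s), (1 - k) * s).
    split => /=; [by rewrite mulr_ge0 ?subr_ge0|by rewrite mulr_ge0 ?subr_ge0|].
    by rewrite -mulrDr subrK mulr1 gerBl.
  by rewrite /aff; apply: injective_projections; rewrite /= /GRing.scale /=; ring.
move=> [[x1 x2] [/= h1 h2 h3] <-].
(* At the centre the projection onto the side is undefined; any point of the side will do. *)
have [h0|h0] := eqVneq (x1 + x2) 0.
  have [-> ->] : x1 = 0 /\ x2 = 0 by split; lra.
  exists 1, (aff o b c (1 - 0, 0)); split; first by rewrite ler01 lexx.
    by apply/hull_side; exists 0; rewrite ?lexx ?ler01.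
  by rewrite /aff; apply: injective_projections; rewrite /= /GRing.scale /=; ring.
have hp : 0 < x1 + x2 by rewrite lt_neqAle eq_sym h0 addr_ge0.
exists (1 - (x1 + x2)), (aff o b c (1 - x2 / (x1 + x2), x2 / (x1 + x2))); split.
- by rewrite subr_ge0 h3 gerBl ltW.
- apply/hull_side; exists (x2 / (x1 + x2)) => //.
  by apply/andP; split; [rewrite divr_ge0 // ltW|rewrite ler_pdivrMr // mul1r lerDr].
- by rewrite /aff; apply: injective_projections; rewrite /= /GRing.scale /=; field.
Qed.

(** Only the vertex [A] is off the edge, so the orientation test reduces to the sign of one area,
    which is positive exactly when the edge runs from [B] to [C]. *)
Lemma side_orient :
  [/\ head eA = C, tail eA = B & mesh_orient (inr t) (inl (inr eA)) = 1] \/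
  [/\ head eA = B, tail eA = C & mesh_orient (inr t) (inl (inr eA)) = -1].
Proof.
have [ab bc ca] := tframe_neq F; have [ht s [hA _ _]] := F.
have ar := star_area_gt0 s; rewrite -crs_edges in ar.
have E : crs (b - a) (c - a) = crs (pos B - pos A) (pos C - pos A) by rewrite /crs /=; ring.
rewrite E in ar.
have tA : tedge t eA by rewrite tedge_frame !finset.inE eqxx.
have O : [forall v in val t, (v \in val eA) || (0 < dot (nu eA) (pos v - pos (tail eA)))] =
    (0 < dot (nu eA) (pos A - pos (tail eA))).
  apply/idP/idP => [/forallP/(_ A)|h].
    by rewrite ht hA !finset.inE eqxx (negbTE ab) eq_sym (negbTE ca).
  apply/forallP => v; apply/implyP; rewrite ht hA !finset.inE => /orP[/orP[/eqP->|->//]|->].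
    by rewrite h orbT.
  by rewrite orbT.
have D (y : R * R) : dot (nu eA) y = (len eA)^-1 * crs (pos (head eA) - pos (tail eA)) y.
  by rewrite /nu /rot /tau /dot /crs /= /GRing.scale /=; ring.
have lp : 0 < (len eA)^-1 by rewrite invr_gt0 len_gt0.
have := head_in eA; rewrite hA !finset.inE => /orP[] /eqP hd.
  right; have cb : C != B by rewrite eq_sym.
  have hA' : val eA = [set C; B]%SET by rewrite hA finset.setUC.
  have tl := tail_eq hA' cb hd; split => //; rewrite /= tA O D hd tl pmulr_rgt0 //.
  case: ifP => // h; have := lt_trans ar (_ : _ < 0); rewrite ltxx => /(_ _)/wrap[|//].
  by rewrite -oppr_gt0 (_ : - _ = crs (pos B - pos C) (pos A - pos C)) // /crs /=; ring.
left; have tl := tail_eq hA bc hd; split => //; rewrite /= tA O D hd tl pmulr_rgt0 //.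
by rewrite (_ : crs _ _ = crs (pos B - pos A) (pos C - pos A)) ?ar // /crs /=; ring.
Qed.

End Frame.
End MeshFrame.

(** * Fields on the split of a mesh triangle, in a frame *)

Section MeshFields.
Variables (R : realType) (K : ct_mesh R).
Local Notation mu := (@lebesgue_measure R).
Local Notation mu2 := (mu \x mu)%E.
Local Notation vert := (vert K).
Local Notation edge := (edge K).
Local Notation triangle := (triangle K).
Local Notation pos := (@pos R K).
Implicit Types (A B C : vert) (e eA eB eC : edge) (t : triangle).

Definition pw3 (Y : zmodType) eA eB eC (fA fB fC : R * R -> Y) : edge -> R * R -> Y :=
  fun e => if e == eA then fA else if e == eB then fB else if e == eC then fC else 0.

Definition zq : quadr R := Quadr 0 0 0 0 0 0.

Lemma vq_zero : vq (zq, zq) = 0.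
Proof. by apply/funext => x; rewrite /vq /= !qv0. Qed.

Lemma mq_zero : mq (zq, zq, zq) = 0.
Proof.
apply/funext => x; apply/matrixP => i j; rewrite !mxE /= !qv0.
by case: ifP => // _; case: ifP.
Qed.

Lemma def_zero : def (0 : R * R -> R * R) = 0.
Proof.
rewrite -vq_zero; apply/funext => x; rewrite def_vq -[RHS](congr1 (fun f => f x) mq_zero).
by congr (mq _ x); rewrite /defq /qlin /qd1 /qd2 /zq /=; congr (_, _, _); congr Quadr; ring.
Qed.

Lemma mq_szero (u : symq R) x : mq u x = 0 <-> szero u x.
Proof.
split=> [h|[h1 h2 h3]]; last first.
  by apply/matrixP => i j; rewrite !mxE /= h1 h2 h3; case: ifP => // _; case: ifP.
have := h; move/matrixP => h'; have := h' ord0 ord0; have := h' ord0 ord_max.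
by have := h' ord_max ord_max; rewrite !mxE.
Qed.

(* By the formulas for sven on W, its values determine the side data. *)
Lemma sven_side_data (al be ga D k1 k2 k3 : R) : D != 0 -> D = al + be + ga ->
  let S := k1 + k2 + k3 in
  S * (1 - 2 * al / D) - 3 * k1 = 0 -> S * (1 - 2 * be / D) - 3 * k2 = 0 ->
  S * (1 - 2 * ga / D) - 3 * k3 = 0 -> [/\ k1 = 0, k2 = 0 & k3 = 0].
Proof.
move=> D0 ED S h1 h2 h3.
have S0 : S = 0.
  have : - (2 * S) = 0.
    transitivity ((S * (1 - 2 * al / D) - 3 * k1) + (S * (1 - 2 * be / D) - 3 * k2)
      + (S * (1 - 2 * ga / D) - 3 * k3)); last by rewrite h1 h2 h3 !addr0.
    have -> : ga = D - al - be by rewrite ED; ring.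
    by rewrite /S; field.
  by move/eqP; rewrite oppr_eq0 mulf_eq0 pnatr_eq0 => /eqP.
move: h1 h2 h3; rewrite S0 !mul0r !sub0r => /eqP + /eqP + /eqP.
by rewrite !oppr_eq0 !mulf_eq0 pnatr_eq0 /= => /eqP -> /eqP -> /eqP ->.
Qed.

Lemma mq_eq0 (u : symq R) : (forall x, szero u x) -> mq u = 0.
Proof. by move=> h; apply/funext => x; exact: (mq_szero u x).2. Qed.

Section Frame.
Variables (t : triangle) (A B C : vert) (eA eB eC : edge).
Hypothesis F : tframe t A B C eA eB eC.
Local Notation o := (center t).
Local Notation a := (pos A - o).
Local Notation b := (pos B - o).
Local Notation c := (pos C - o).

Lemma tedges : [/\ tedge t eA, tedge t eB & tedge t eC].
Proof. by split; rewrite (tedge_frame F) !finset.inE eqxx ?orbT. Qed.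

Lemma tedgeP e : tedge t e -> [\/ e = eA, e = eB | e = eC].
Proof.
rewrite (tedge_frame F) !finset.inE => /orP[/orP[]|] /eqP ->;
by [constructor 1|constructor 2|constructor 3].
Qed.

Lemma pw3E (Y : zmodType) (fA fB fC : R * R -> Y) : let u := pw3 eA eB eC fA fB fC in
  [/\ u eA = fA, u eB = fB & u eC = fC].
Proof.
have [n1 n2 n3] := tframe_edges_neq F; rewrite /pw3 !eqxx (eq_sym eB) (negbTE n1).
by rewrite (negbTE n3) (eq_sym eC eB) (negbTE n2).
Qed.

Lemma pw3_out (Y : zmodType) (fA fB fC : R * R -> Y) e : ~~ tedge t e -> pw3 eA eB eC fA fB fC e = 0.
Proof.
rewrite (tedge_frame F) !finset.inE !negb_or /pw3 => /andP[/andP[h1 h2] h3].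
by rewrite (negbTE h1) (negbTE h2) (negbTE h3).
Qed.

Lemma pw3_eta (Y : zmodType) (u : edge -> R * R -> Y) :
  (forall e, ~~ tedge t e -> u e = 0) -> u = pw3 eA eB eC (u eA) (u eB) (u eC).
Proof.
move=> h; apply/funext => e; have [/tedgeP he|he] := boolP (tedge t e); last by rewrite h ?pw3_out.
by have [h1 h2 h3] := pw3E (u eA) (u eB) (u eC); case: he => ->.
Qed.

Lemma pw3_lin (Y : lmodType R) (k : R) (fA fB fC gA gB gC : R * R -> Y) :
  k *: pw3 eA eB eC fA fB fC + pw3 eA eB eC gA gB gC =
  pw3 eA eB eC (k *: fA + gA) (k *: fB + gB) (k *: fC + gC).
Proof.
apply/funext => e; apply/funext => x.
transitivity (k *: pw3 eA eB eC fA fB fC e x + pw3 eA eB eC gA gB gC e x) => //.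
by rewrite /pw3; do 3 (case: ifP => // _); rewrite scaler0 addr0.
Qed.

Lemma pw3_inj (Y : zmodType) (fA fB fC gA gB gC : R * R -> Y) :
  pw3 eA eB eC fA fB fC = pw3 eA eB eC gA gB gC -> [/\ fA = gA, fB = gB & fC = gC].
Proof.
move=> h; have [f1 f2 f3] := pw3E fA fB fC; have [g1 g2 g3] := pw3E gA gB gC.
by split; [rewrite -f1 h g1|rewrite -f2 h g2|rewrite -f3 h g3].
Qed.

Let FB := tframe_rot F.
Let FC := tframe_rot FB.

Lemma subtriangles : [/\ subtriangle t eA = tri o b c, subtriangle t eB = tri o c a
  & subtriangle t eC = tri o a b].
Proof. by rewrite (subtriangle_frame F) (subtriangle_frame FB) (subtriangle_frame FC). Qed.

Lemma tri_ray1 (p q : R * R) (s : R) : 0 <= s <= 1 -> tri o p q (o + s *: p).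
Proof.
move=> /andP[s0 s1]; exists (s, 0) => /=; first by split; rewrite ?addr0.
by rewrite (aff_ray1 o p q).
Qed.

Lemma tri_ray2 (p q : R * R) (s : R) : 0 <= s <= 1 -> tri o q p (o + s *: p).
Proof.
move=> /andP[s0 s1]; exists (0, s) => /=; first by split; rewrite ?add0r.
by rewrite (aff_ray2 o p q).
Qed.

Lemma pwcontinuous_rays (Y : topologicalType) (u : edge -> R * R -> Y) : pwcontinuous t u ->
  [/\ forall s, 0 <= s <= 1 -> u eC (o + s *: a) = u eB (o + s *: a),
      forall s, 0 <= s <= 1 -> u eA (o + s *: b) = u eC (o + s *: b)
    & forall s, 0 <= s <= 1 -> u eB (o + s *: c) = u eA (o + s *: c)].
Proof.
move=> [f [_ hf]]; have [tA tB tC] := tedges; have [sA sB sC] := subtriangles.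
have hA x : tri o b c x -> u eA x = f x by rewrite -sA => /hf->.
have hB x : tri o c a x -> u eB x = f x by rewrite -sB => /hf->.
have hC x : tri o a b x -> u eC x = f x by rewrite -sC => /hf->.
by split=> s hs; rewrite ?hA ?hB ?hC //; (exact: tri_ray1 || exact: tri_ray2).
Qed.

Lemma pwcontinuous_glue (Y : topologicalType) (u : edge -> R * R -> Y) :
  continuous (u eA) -> continuous (u eB) -> continuous (u eC) ->
  (forall s, 0 <= s <= 1 -> u eC (o + s *: a) = u eB (o + s *: a)) ->
  (forall s, 0 <= s <= 1 -> u eA (o + s *: b) = u eC (o + s *: b)) ->
  (forall s, 0 <= s <= 1 -> u eB (o + s *: c) = u eA (o + s *: c)) -> pwcontinuous t u.
Proof.
move=> cA cB cC ha hb hc; have [f [cf fA fB fC]] := glue (tframe_star F) cA cB cC ha hb hc.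
exists f; split; first by rewrite (hull_frame F).
have [sA sB sC] := subtriangles.
by move=> e /tedgeP[] -> x; [rewrite sA; exact: fA|rewrite sB; exact: fB|rewrite sC; exact: fC].
Qed.

Lemma A0TP (u : edge -> R * R -> R * R) : A0T t u <->
  exists vA vB vC, A0star o a b c vA vB vC /\ u = pw3 eA eB eC (vq vA) (vq vB) (vq vC).
Proof.
have [tA tB tC] := tedges.
split=> [[[hp h0] cu ck]|[vA [vB [vC [[[ha hb hc] [ka kb kc]] ->]]]]].
  have /poly2_vq[vA EA] := hp _ tA; have /poly2_vq[vB EB] := hp _ tB.
  have /poly2_vq[vC EC] := hp _ tC.
  exists vA, vB, vC; split; last by rewrite (pw3_eta h0) EA EB EC.
  have [ha hb hc] := pwcontinuous_rays cu; have [ka kb kc] := pwcontinuous_rays ck.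
  rewrite EA EB EC in ha hb hc; rewrite EA EB EC !curlT_vq in ka kb kc.
  by split.
have [eA' eB' eC'] := pw3E (vq vA) (vq vB) (vq vC).
split.
- split; last exact: pw3_out.
  by move=> e /tedgeP[] ->; rewrite ?eA' ?eB' ?eC'; apply/poly2_vq; [exists vA|exists vB|exists vC].
- by apply: pwcontinuous_glue; rewrite ?eA' ?eB' ?eC' //; exact: continuous_vq.
- by apply: pwcontinuous_glue; rewrite ?eA' ?eB' ?eC' ?curlT_vq //; exact: continuous_qv.
Qed.

Lemma test_functionE phi : test_function t phi <-> compactly_in (hull3 o a b c) phi.
Proof. by rewrite /test_function (hull_frame F). Qed.

Lemma pwint_frame (g : edge -> R * R -> R) : pwint t g =
  \int[mu2]_(x in tri o b c) g eA x + \int[mu2]_(x in tri o c a) g eB x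
  + \int[mu2]_(x in tri o a b) g eC x.
Proof. by have [sA sB sC] := subtriangles; rewrite /pwint (tedge_sum F) /lebesgue2 sA sB sC. Qed.

Lemma is_svenE uA uB uC f : is_sven t (pw3 eA eB eC (mq uA) (mq uB) (mq uC)) f <->
  star_sven o a b c uA uB uC f.
Proof.
have [eA' eB' eC'] := pw3E (mq uA) (mq uB) (mq uC).
rewrite /is_sven /star_sven (hull_frame F).
have E phi : pwint t (fun e x =>
      pw3 eA eB eC (mq uA) (mq uB) (mq uC) e x ord0 ord0 * partial ord_max (partial ord_max phi) x
      + pw3 eA eB eC (mq uA) (mq uB) (mq uC) e x ord_max ord_max * partial ord0 (partial ord0 phi) x
      - pw3 eA eB eC (mq uA) (mq uB) (mq uC) e x ord_max ord0 * partial ord0 (partial ord_max phi) x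
      - pw3 eA eB eC (mq uA) (mq uB) (mq uC) e x ord0 ord_max * partial ord_max (partial ord0 phi) x) =
    star_pairing o a b c uA uB uC phi.
  rewrite pwint_frame eA' eB' eC' /star_pairing.
  by congr (_ + _ + _); apply: eq_Rintegral => x _; rewrite !mxE.
by split => -[h1 h2]; split => // phi /test_functionE/h2; rewrite E.
Qed.

Lemma A2TP (g : edge -> R * R -> R) : A2T t g <->
  exists g1 g2 g3 : R, g = pw3 eA eB eC (fun=> g1) (fun=> g2) (fun=> g3).
Proof.
have [tA tB tC] := tedges; split=> [[hp h0]|[g1 [g2 [g3 ->]]]].
  have /poly0P[g1 E1] := hp _ tA; have /poly0P[g2 E2] := hp _ tB; have /poly0P[g3 E3] := hp _ tC.
  by exists g1, g2, g3; rewrite (pw3_eta h0) E1 E2 E3.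
have [eA' eB' eC'] := pw3E (fun=> g1) (fun=> g2) (fun=> g3).
split; last exact: pw3_out.
by move=> e /tedgeP[] ->; rewrite ?eA' ?eB' ?eC'; apply/poly0P; [exists g1|exists g2|exists g3].
Qed.

(** The explicit field is admissible for [xget], so the default is not returned; any admissible
    field agrees with it on each of the three pieces by [star_sven_unique]. *)
Lemma svenT_frame uA uB uC : ray_conds o a b c uA uB uC -> jumps0 o a b c uA uB uC ->
  svenT t (pw3 eA eB eC (mq uA) (mq uB) (mq uC)) =
  pw3 eA eB eC (fun=> sven_const uA o b c) (fun=> sven_const uB o c a) (fun=> sven_const uC o a b).
Proof.
move=> rc js; have st := tframe_star F; have [sA sB sC] := subtriangles.
have [tA tB tC] := tedges.
set g0 := pw3 _ _ _ (fun=> sven_const uA o b c) _ _.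
have [g0A g0B g0C] : [/\ g0 eA = _, g0 eB = _ & g0 eC = _] := pw3E _ _ _.
set f0 := pwcst o a b c (sven_const uA o b c) (sven_const uB o c a) (sven_const uC o a b).
have s0 : star_sven o a b c uA uB uC f0 := star_sven_exists st rc js.
have fC x : (tri o a b)° x -> f0 x = sven_const uC o a b.
  exact: pwcst_interior.
have fA x : (tri o b c)° x -> f0 x = sven_const uA o b c.
  by move=> h; rewrite /f0 -pwcst_rot; apply: pwcst_interior => //; exact: star_rot.
have fB x : (tri o c a)° x -> f0 x = sven_const uB o c a.
  move=> h; rewrite /f0 -pwcst_rot -pwcst_rot; apply: pwcst_interior => //.
  by apply: star_rot; exact: star_rot.
rewrite /svenT; case: xgetP => [g _ [/A2TP[g1 [g2 [g3 Eg]]] [f /is_svenE hf fg]]|/(_ g0)[]].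
  have [gA gB gC] := pw3E (fun=> g1) (fun=> g2) (fun=> g3); rewrite -Eg in gA gB gC.
  have h1 : g1 = sven_const uA o b c.
    apply: (star_sven_unique (star_rot st) (star_sven_rot hf) (star_sven_rot s0)) fA.
    by move=> x; rewrite -sA => /(fg _ tA) ->; rewrite gA.
  have h2 : g2 = sven_const uB o c a.
    apply: (star_sven_unique (star_rot (star_rot st)) (star_sven_rot (star_sven_rot hf))
      (star_sven_rot (star_sven_rot s0))) fB.
    by move=> x; rewrite -sB => /(fg _ tB) ->; rewrite gB.
  have h3 : g3 = sven_const uC o a b.
    apply: (star_sven_unique st hf s0) fC.
    by move=> x; rewrite -sC => /(fg _ tC) ->; rewrite gC.
  by rewrite Eg /g0 h1 h2 h3.
split; first by apply/A2TP; do 3 eexists.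
exists f0; first exact/is_svenE.
by move=> e /tedgeP[] -> x; [rewrite sA g0A; exact: fA|rewrite sB g0B; exact: fB|rewrite sC g0C; exact: fC].
Qed.

Definition osgn e : R := (mesh_orient (inr t) (inl (inr e)))%:~R.

(* Along a side where it vanishes, the field has no tangential derivative, so
   that the normal derivative is a multiple of the derivative towards the centre. *)
Lemma side_normal (u : symq R) : (forall s : R, 0 <= s <= 1 -> szero u (aff o b c (1 - s, s))) ->
  forall s : R, 'D_(nu eA) (mx_tt eA (mq u)) (aff o b c (1 - s, s)) =
    - (osgn eA / (len eA * crs b c) * qv (qd1 (lq u o b c (c - b) (c - b))) (1 - s, s)).
Proof.
move=> hz s; have [A0 _ _] := tframe_star F; have A0' := lt0r_neq0 A0.
set Q := qform u.1.1 u.1.2 u.2 (tau eA) (tau eA).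
have -> : mx_tt eA (mq u) = qv Q by apply/funext => x; rewrite /mx_tt apply_mq.
rewrite derive_qv.
(* [Q] vanishes on the side, so its derivative along [c - b] does too: the derivatives along [b] and
   [c] coincide there. *)
have tang : qv (qd1 (qcomp Q o b c)) (1 - s, s) = qv (qd2 (qcomp Q o b c)) (1 - s, s).
  have [h0 h1 h2] : [/\ q0 (qcomp Q o b c) + q1 (qcomp Q o b c) + q11 (qcomp Q o b c) = 0,
      - q1 (qcomp Q o b c) + q2 (qcomp Q o b c) - 2 * q11 (qcomp Q o b c) + q12 (qcomp Q o b c) = 0
      & q11 (qcomp Q o b c) - q12 (qcomp Q o b c) + q22 (qcomp Q o b c) = 0].
    apply: quad3_eq0 => r hr; rewrite !mul0r !addr0.
    transitivity (qv (qcomp Q o b c) (1 - r, r)); first by move: (qcomp _ _ _ _) => h; rewrite /qv /=; ring.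
    by rewrite qv_comp /Q qv_qform; have [-> -> ->] := hz r hr; rewrite !mulr0 !addr0.
  apply/eqP; rewrite -subr_eq0; apply/eqP; move: h1 h2; move: (qcomp Q o b c) => [k0 k1 k2 k11 k12 k22] /=.
  rewrite /qv /= => h1 h2.
  transitivity (- (- k1 + k2 - 2 * k11 + k12) - 2 * s * (k11 - k12 + k22)); first by ring.
  by rewrite h1 h2 oppr0 mulr0 subr0.
have [d [hd dl]] : exists d : R, c - b = d *: tau eA /\ d = osgn eA * len eA.
  rewrite /osgn; case: (side_orient F) => -[hh ht ->]; have E := head_tail eA; rewrite hh ht in E.
    exists (len eA); split; last by rewrite mulr1z mul1r.
    by rewrite E; apply: injective_projections; rewrite /= /GRing.scale /=; ring.
  exists (- len eA); split; last by rewrite mulrNz mulr1z mulN1r.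
  by rewrite E; apply: injective_projections; rewrite /= /GRing.scale /=; ring.
have sg : osgn eA * osgn eA = 1.
  by rewrite /osgn; case: (side_orient F) => -[_ _ ->]; rewrite ?mulrNz mulr1z ?mulrNN mulr1.
have Lq : lq u o b c (c - b) (c - b) = qlin (d ^+ 2) (qcomp Q o b c) zq.
  apply: qv_inj; apply/funext => x; rewrite qv_lin /lq !qv_comp /Q !qv_qform qv0 hd.
  by rewrite /= /GRing.scale /=; ring.
have E1 : qv (qd1 (lq u o b c (c - b) (c - b))) (1 - s, s) = d ^+ 2 * qv (qd1 (qcomp Q o b c)) (1 - s, s).
  by rewrite Lq; move: (qcomp _ _ _ _) => h; rewrite /qlin /qv /=; ring.
rewrite E1; move: tang; rewrite qd_comp1 qd_comp2.
move: (qv (qd1 Q) _) (qv (qd2 Q) _) => P1 P2 tang.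
have tt := dot_tau eA; have l0 := lt0r_neq0 (len_gt0 eA).
(* Expand the normal as [crs b c *: nu = crs nu c *: b - crs nu b *: c]. As the derivatives along
   [b] and [c] agree, only [crs nu (c - b) = - d] matters. *)
have key : crs b c * (P1 * (nu eA).1 + P2 * (nu eA).2) = - d * (b.1 * P1 + b.2 * P2).
  transitivity (crs (nu eA) c * (b.1 * P1 + b.2 * P2) - crs (nu eA) b * (c.1 * P1 + c.2 * P2)).
    by rewrite /crs; ring.
  rewrite -tang -mulrBl -crsBr hd; congr (_ * _).
  transitivity (- d * dot (tau eA) (tau eA)); last by rewrite tt mulr1.
  by rewrite /nu /rot /crs /dot /= /GRing.scale /=; ring.
apply: (mulfI A0'); rewrite key dl.
move: (b.1 * P1 + _) (osgn eA) sg (len eA) l0 (crs b c) A0' => m g sg l l0 k k0.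
transitivity (- (g * g) * g * l * m); last by field; rewrite l0 k0.
by rewrite sg; ring.
Qed.

Lemma side_condE (u : symq R) (r : R) :
  (forall x, hull pos (val eA) x -> mq u x = 0) ->
  (forall x, hull pos (val eA) x -> 'D_(nu eA) (mx_tt eA (mq u)) x = r) ->
  side_cond o b c u (osgn eA * len eA * r).
Proof.
move=> hz hn; have [A0 _ _] := tframe_star F; have A0' := lt0r_neq0 A0.
have hs s : 0 <= s <= 1 -> hull pos (val eA) (aff o b c (1 - s, s)).
  by move=> h; apply/(hull_side F); exists s.
have z s : 0 <= s <= 1 -> szero u (aff o b c (1 - s, s)).
  by move=> /hs/hz/mq_szero.
split => // s h; have := hn _ (hs s h); rewrite (side_normal z) => <-.
have sg : osgn eA * osgn eA = 1.
  by rewrite /osgn; case: (side_orient F) => -[_ _ ->]; rewrite ?mulrNz mulr1z ?mulrNN mulr1.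
have l0 := lt0r_neq0 (len_gt0 eA); move: (qv _ _) (osgn eA) sg (len eA) l0 (crs b c) A0' => m g sg l l0 k k0.
transitivity (g * g * m); first by rewrite sg mul1r.
by field; rewrite l0 k0.
Qed.

Lemma side_cond_normal (u : symq R) (k : R) : side_cond o b c u k ->
  (forall x, hull pos (val eA) x -> mq u x = 0) /\
  (forall x, hull pos (val eA) x -> 'D_(nu eA) (mx_tt eA (mq u)) x = osgn eA * k / len eA).
Proof.
move=> [hz hn]; have [A0 _ _] := tframe_star F; have A0' := lt0r_neq0 A0.
split => x /(hull_side F)[s hs ->]; first by apply/mq_szero; exact: hz.
rewrite (side_normal hz) hn //; have l0 := lt0r_neq0 (len_gt0 eA).
by move: (osgn eA) (len eA) l0 (crs b c) A0' => g l l0 m m0; field; rewrite l0 m0.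
Qed.

End Frame.

Section Frame.
Variables (t : triangle) (A B C : vert) (eA eB eC : edge).
Hypothesis F : tframe t A B C eA eB eC.
Local Notation o := (center t).
Local Notation a := (pos A - o).
Local Notation b := (pos B - o).
Local Notation c := (pos C - o).
Let FB := tframe_rot F.
Let FC := tframe_rot FB.

Lemma smeet_mq (p : R * R) (u u' : symq R) :
  (forall s, 0 <= s <= 1 -> mq u (o + s *: p) = mq u' (o + s *: p)) <-> smeet o p u u'.
Proof.
split=> [h|[h1 h2 h3] s hs]; last by rewrite /mq h1 // h2 // h3.
by split => s /h /mx3_inj[].
Qed.

(** The distributional condition in [W] is the vanishing of the jumps: [star_sven_jumps0] proves one
    direction, [star_sven_exists] the other. *)
Lemma WP (w : edge -> R * R -> 'M[R]_2) : W t w <->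
  exists uA uB uC, (exists k1 k2 k3, Wstar o a b c uA uB uC k1 k2 k3) /\
    jumps0 o a b c uA uB uC /\ w = pw3 eA eB eC (mq uA) (mq uB) (mq uC).
Proof.
have [tA tB tC] := tedges F; have st := tframe_star F.
split=> [[[[hp h0] sw cw] [[f hf] hz hn]]|[uA [uB [uC [[k1 [k2 [k3 Ws]]] [js ->]]]]]].
  have [uA EA] : exists u, w eA = mq u by apply/poly2_mq; split; [exact: hp|exact: sw].
  have [uB EB] : exists u, w eB = mq u by apply/poly2_mq; split; [exact: hp|exact: sw].
  have [uC EC] : exists u, w eC = mq u by apply/poly2_mq; split; [exact: hp|exact: sw].
  exists uA, uB, uC; have E : w = pw3 eA eB eC (mq uA) (mq uB) (mq uC) by rewrite (pw3_eta F h0) EA EB EC.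
  have [ha hb hc] := pwcontinuous_rays F cw; rewrite EA EB EC in ha hb hc.
  have [rA nA] := hn _ tA; have [rB nB] := hn _ tB; have [rC nC] := hn _ tC.
  have zA := hz _ tA; have zB := hz _ tB; have zC := hz _ tC.
  rewrite EA in nA zA; rewrite EB in nB zB; rewrite EC in nC zC.
  have Ws : Wstar o a b c uA uB uC (osgn t eA * len eA * rA) (osgn t eB * len eB * rB) (osgn t eC * len eC * rC).
    split; first by split; apply/smeet_mq.
    by split; [exact: (side_condE F)|exact: (side_condE FB)|exact: (side_condE FC)].
  split; first by do 3 eexists; exact: Ws.
  split => //; rewrite E in hf; move/(is_svenE F): hf => hf.
  exact: star_sven_jumps0 st (Wstar_rays Ws) hf.
have [eA' eB' eC'] := pw3E F (mq uA) (mq uB) (mq uC).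
have [[ha hb hc] [sa sb sc]] := Ws.
have Sym (u : symq R) x : (mq u x)^T = mq u x.
  by have [_ h] : @poly2 R 2 'M[R]_2 (mq u) /\ (forall x, (mq u x)^T = mq u x) by apply/poly2_mq; exists u.
have Pol (u : symq R) : @poly2 R 2 'M[R]_2 (mq u).
  by have [h _] : @poly2 R 2 'M[R]_2 (mq u) /\ (forall x, (mq u x)^T = mq u x) by apply/poly2_mq; exists u.
have [zA nA] := side_cond_normal F sa; have [zB nB] := side_cond_normal FB sb.
have [zC nC] := side_cond_normal FC sc.
split; split.
- split; last exact: (pw3_out F).
  by move=> e /(tedgeP F)[] ->; rewrite ?eA' ?eB' ?eC'.
- move=> e x; have [/(tedgeP F)[] ->|he] := boolP (tedge t e); rewrite ?eA' ?eB' ?eC' //.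
  by rewrite (pw3_out F _ _ _ he) [LHS]trmx0.
- apply: (pwcontinuous_glue F); rewrite ?eA' ?eB' ?eC'; try exact: continuous_mq.
  + exact/smeet_mq.
  + exact/smeet_mq.
  + exact/smeet_mq.
- have h := star_sven_exists st (Wstar_rays Ws) js.
  by eexists; apply/(is_svenE F); exact: h.
- by move=> e /(tedgeP F)[] ->; rewrite ?eA' ?eB' ?eC'.
- move=> e /(tedgeP F)[] ->; rewrite ?eA' ?eB' ?eC'.
  + by exists (osgn t eA * k1 / len eA).
  + by exists (osgn t eB * k2 / len eB).
  + by exists (osgn t eC * k3 / len eC).
Qed.

Lemma defT_pw3 (vA vB vC : vecq R) : defT (pw3 eA eB eC (vq vA) (vq vB) (vq vC)) =
  pw3 eA eB eC (mq (defq vA)) (mq (defq vB)) (mq (defq vC)).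
Proof.
apply/funext => e; rewrite /defT /pw3.
by do 3 (case: ifP => _; first by apply/funext => x; rewrite def_vq); exact: def_zero.
Qed.

Lemma A1TP (u : edge -> R * R -> 'M[R]_2) : A1T t u <->
  exists vA vB vC wA wB wC, [/\ A0star o a b c vA vB vC,
    exists k1 k2 k3, Wstar o a b c wA wB wC k1 k2 k3, jumps0 o a b c wA wB wC
    & u = pw3 eA eB eC (mq (slin 1 (defq vA) wA)) (mq (slin 1 (defq vB) wB)) (mq (slin 1 (defq vC) wC))].
Proof.
have E (vA vB vC : vecq R) (wA wB wC : symq R) :
    defT (pw3 eA eB eC (vq vA) (vq vB) (vq vC)) + pw3 eA eB eC (mq wA) (mq wB) (mq wC) =
    pw3 eA eB eC (mq (slin 1 (defq vA) wA)) (mq (slin 1 (defq vB) wB)) (mq (slin 1 (defq vC) wC)).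
  rewrite defT_pw3 -[X in X + _]scale1r pw3_lin.
  by congr pw3; apply/funext => x; rewrite mq_lin.
split=> [[v [w [/(A0TP F)[vA [vB [vC [hv ->]]]] /WP[wA [wB [wC [hw [js ->]]]]] ->]]]|].
  by exists vA, vB, vC, wA, wB, wC; split => //; rewrite E.
move=> [vA [vB [vC [wA [wB [wC [hv hw js ->]]]]]]].
exists (pw3 eA eB eC (vq vA) (vq vB) (vq vC)), (pw3 eA eB eC (mq wA) (mq wB) (mq wC)).
split; [|by apply/WP; exists wA, wB, wC|by rewrite E].
by apply/(A0TP F); exists vA, vB, vC.
Qed.

Lemma A1T_star (vA vB vC : vecq R) (wA wB wC : symq R) (k1 k2 k3 : R) : A0star o a b c vA vB vC ->
  Wstar o a b c wA wB wC k1 k2 k3 -> jumps0 o a b c wA wB wC ->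
  [/\ ray_conds o a b c (slin 1 (defq vA) wA) (slin 1 (defq vB) wB) (slin 1 (defq vC) wC),
    jumps0 o a b c (slin 1 (defq vA) wA) (slin 1 (defq vB) wB) (slin 1 (defq vC) wC),
    sven_const (slin 1 (defq vA) wA) o b c = sven_const wA o b c &
    sven_const (slin 1 (defq vB) wB) o c a = sven_const wB o c a /\
    sven_const (slin 1 (defq vC) wC) o a b = sven_const wC o a b].
Proof.
move=> hv hw js; have [rv jv] := defq_star (tframe_star F) hv.
rewrite !sven_const_lin !sven_const_defq !mulr0 !add0r.
split; [|exact: jumps0_lin|by []|by []].
by apply: ray_conds_lin => //; exact: Wstar_rays hw.
Qed.

Lemma A1T_rays u : A1T t u -> exists uA uB uC, [/\ ray_conds o a b c uA uB uC,
  jumps0 o a b c uA uB uC & u = pw3 eA eB eC (mq uA) (mq uB) (mq uC)].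
Proof.
move=> /A1TP[vA [vB [vC [wA [wB [wC [hv [k1 [k2 [k3 hw]]] js ->]]]]]]].
by have [rc jc _ _] := A1T_star hv hw js; do 3 eexists; split; [exact: rc|exact: jc|].
Qed.

Lemma W_sven_inj uA uB uC (k1 k2 k3 : R) : Wstar o a b c uA uB uC k1 k2 k3 ->
  jumps0 o a b c uA uB uC ->
  sven_const uA o b c = 0 -> sven_const uB o c a = 0 -> sven_const uC o a b = 0 ->
  pw3 eA eB eC (mq uA) (mq uB) (mq uC) = 0.
Proof.
move=> hw js s1 s2 s3; have st := tframe_star F.
have [] := Wstar_sven st hw js; rewrite s1 s2 s3 !mulr0 => /esym h1 /esym h2 /esym h3.
have A0 := lt0r_neq0 (star_area_gt0 st).
have [E1 E2 E3] := sven_side_data A0 erefl h1 h2 h3.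
rewrite E1 E2 E3 in hw; have Z := Wstar_unique st hw js.
rewrite !mq_eq0; try by move=> x; have [] := Z x.
by apply/funext => e; rewrite /pw3; do 3 case: ifP => // _.
Qed.

(** [sven] annihilates [def v] and is injective on [W], so the sum defining [A^1(T)] is direct. *)
Lemma def_W_trivial : [set defT v | v in A0T t] `&` W t = [set 0].
Proof.
have [tA tB tC] := tedges F; have st := tframe_star F.
apply/seteqP; split=> [w [[v /(A0TP F)[vA [vB [vC [hv ->]]]] <-] /WP[uA [uB [uC [[k1 [k2 [k3 hw]]] [js E]]]]]]|w ->].
  rewrite defT_pw3 in E *; have [/mq_inj EA /mq_inj EB /mq_inj EC] := pw3_inj F E.
  rewrite E; apply: (W_sven_inj hw js).
  - by rewrite -EA sven_const_defq.
  - by rewrite -EB sven_const_defq.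
  - by rewrite -EC sven_const_defq.
have Z (Y : zmodType) : pw3 eA eB eC (0 : R * R -> Y) 0 0 = 0.
  by apply/funext => e; rewrite /pw3; do 3 case: ifP => // _.
split.
  exists 0; last by apply/funext => e; rewrite /defT; exact: def_zero.
  apply/(A0TP F); exists (zq, zq), (zq, zq), (zq, zq); split; last by rewrite vq_zero Z.
  by split; split.
have [uA [uB [uC [hw js _]]]] := Wstar_exists o 0 0 0 st.
have E : (0 : edge -> R * R -> 'M[R]_2) = pw3 eA eB eC (mq uA) (mq uB) (mq uC).
  apply/esym; have Zu := Wstar_unique st hw js.
  by rewrite !mq_eq0 ?Z; try by move=> x; have [] := Zu x.
by apply/WP; exists uA, uB, uC; split; [exists 0, 0, 0|split].
Qed.

End Frame.
End MeshFields.

(** * The complex on an edge *)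

Section EdgeSpaces.
Variables (R : realType) (K : ct_mesh R).
Local Notation vert := (vert K).
Local Notation edge := (edge K).
Local Notation efield := ((R -> R) * (R -> R) * (R -> R))%type.
Implicit Types (e : edge) (u : efield).

(** One shape for all the degrees in use on an edge; lower degrees are padded with zeros. *)
Definition ql (k0 k1 k2 s : R) : R := k0 + k1 * s + k2 * s ^+ 2.

Lemma poly1_2P f : @poly1 R 2 f <-> exists k0 k1 k2, f = ql k0 k1 k2.
Proof.
split=> [[p [sp ->]]|[k0 [k1 [k2 ->]]]].
  exists p`_0, p`_1, p`_2; apply/funext => s.
  by rewrite (horner_coef_wide _ sp) !big_ord_recl big_ord0 /= expr0 mulr1 expr1 addr0 addrA.
exists (Poly [:: k0; k1; k2]); split; first exact: size_Poly.
by apply/funext => s; rewrite horner_Poly /= /ql; ring.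
Qed.

Lemma poly1_1P f : @poly1 R 1 f <-> exists k0 k1, f = ql k0 k1 0.
Proof.
split=> [[p [sp ->]]|[k0 [k1 ->]]].
  exists p`_0, p`_1; apply/funext => s.
  by rewrite (horner_coef_wide _ sp) !big_ord_recl big_ord0 /= expr0 mulr1 expr1 /ql mul0r !addr0.
exists (Poly [:: k0; k1]); split; first exact: size_Poly.
by apply/funext => s; rewrite horner_Poly /= /ql; ring.
Qed.

Lemma poly1_0P f : @poly1 R 0 f <-> exists k0, f = ql k0 0 0.
Proof.
split=> [[p [sp ->]]|[k0 ->]].
  exists p`_0; apply/funext => s.
  by rewrite (horner_coef_wide _ sp) !big_ord_recl big_ord0 /= expr0 mulr1 /ql !mul0r !addr0.
exists (Poly [:: k0]); split; first exact: size_Poly.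
by apply/funext => s; rewrite horner_Poly /= /ql; ring.
Qed.

Lemma derive1_ql k0 k1 k2 : derive1 (ql k0 k1 k2) = ql k1 (2 * k2) 0.
Proof.
apply/funext => s; rewrite derive1E.
have h : is_derive s (1 : R) (ql k0 k1 k2) (ql k1 (2 * k2) 0 s).
  apply: (@is_derive_expand _ _ _ _ _ _ k2 0) => x.
  by rewrite /ql /= /GRing.scale /=; ring.
exact: (derive_val (is_derive := h)).
Qed.

Lemma aff1_ql (m : R * R) : aff1 m = ql m.1 m.2 0.
Proof. by apply/funext => s; rewrite /aff1 /ql; ring. Qed.

Lemma ql_eq k0 k1 k2 l0 l1 l2 : k0 = l0 -> k1 = l1 -> k2 = l2 -> ql k0 k1 k2 = ql l0 l1 l2.
Proof. by move=> -> -> ->. Qed.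

Lemma ql_inj k0 k1 k2 l0 l1 l2 : ql k0 k1 k2 = ql l0 l1 l2 -> [/\ k0 = l0, k1 = l1 & k2 = l2].
Proof. by move=> h; apply: quad3_eq0 => s _; have := congr1 (fun f => f s) h. Qed.

Lemma ql_lin k k0 k1 k2 l0 l1 l2 :
  k *: ql k0 k1 k2 + ql l0 l1 l2 = ql (k * k0 + l0) (k * k1 + l1) (k * k2 + l2).
Proof. by apply/funext => s; rewrite !fctE /ql /= /GRing.scale /=; ring. Qed.

Lemma ql_zero : ql 0 0 0 = 0.
Proof. by apply/funext => s; rewrite /ql !mul0r !addr0. Qed.

Lemma eint_ql e k0 k1 k2 : eint e (ql k0 k1 k2) =
  k0 * len e + k1 * len e ^+ 2 / 2 + k2 * len e ^+ 3 / 3.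
Proof.
have := @integral_quadratic R k0 k1 k2 (len e) (ltW (len_gt0 e)).
by rewrite /eint /Rintegral /ql => ->.
Qed.

Lemma A0EP u : A0E u <-> exists p0 p1 p2 q0 q1 q2 r0 r1,
  u = (ql p0 p1 p2, ql q0 q1 q2, ql r0 r1 0).
Proof.
split=> [[/poly1_2P[p0 [p1 [p2 E1]]] /poly1_2P[q0 [q1 [q2 E2]]] /poly1_1P[r0 [r1 E3]]]|].
  by exists p0, p1, p2, q0, q1, q2, r0, r1; rewrite -E1 -E2 -E3; case: u {E1 E2 E3} => [[]].
move=> [p0 [p1 [p2 [q0 [q1 [q2 [r0 [r1 ->]]]]]]]]; split.
- by apply/poly1_2P; exists p0, p1, p2.
- by apply/poly1_2P; exists q0, q1, q2.
- by apply/poly1_1P; exists r0, r1.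
Qed.

Lemma A1EP u : A1E u <-> exists p0 p1 q0 q1 r0, u = (ql p0 p1 0, ql q0 q1 0, ql r0 0 0).
Proof.
split=> [[/poly1_1P[p0 [p1 E1]] /poly1_1P[q0 [q1 E2]] /poly1_0P[r0 E3]]|].
  by exists p0, p1, q0, q1, r0; rewrite -E1 -E2 -E3; case: u {E1 E2 E3} => [[]].
move=> [p0 [p1 [q0 [q1 [r0 ->]]]]]; split.
- by apply/poly1_1P; exists p0, p1.
- by apply/poly1_1P; exists q0, q1.
- by apply/poly1_0P; exists r0.
Qed.

Lemma difE_ql p0 p1 p2 q0 q1 q2 r0 r1 : difE (ql p0 p1 p2, ql q0 q1 q2, ql r0 r1 0) =
  (ql p1 (2 * p2) 0, ql (2^-1 * (r0 + q1)) (2^-1 * (r1 + 2 * q2)) 0, ql r1 0 0).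
Proof.
rewrite /difE /= !derive1_ql; congr (_, _, _).
  by apply/funext => s; rewrite /ql; ring.
by congr ql; ring.
Qed.

Lemma pairE_ql e p0 p1 q0 q1 r0 (m : R * R * R) :
  pairE e (ql p0 p1 0, ql q0 q1 0, ql r0 0 0) m =
  len e * (p0 * m.2 + (q1 - r0) * m.1.1 - q0 * m.1.2)
  + len e ^+ 2 / 2 * (p1 * m.2 - r0 * m.1.2).
Proof.
rewrite /pairE /= derive1_ql aff1_ql derive1_ql.
transitivity (eint e (ql (p0 * m.2 + (q1 - r0) * m.1.1 - q0 * m.1.2) (p1 * m.2 - r0 * m.1.2) 0)).
  by congr (eint e _); apply/funext => s; rewrite /ql; ring.
by rewrite eint_ql; ring.
Qed.

Lemma tau_nu e : [/\ dot (tau e) (tau e) = 1, dot (nu e) (nu e) = 1, dot (tau e) (nu e) = 0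
  & dot (nu e) (tau e) = 0].
Proof.
have h := dot_tau e; split => //.
- by rewrite -h /nu /rot /dot /=; ring.
- by rewrite /nu /rot /dot /=; ring.
- by rewrite /nu /rot /dot /=; ring.
Qed.

Lemma pairV_edge (v : vert) e p0 p1 p2 q0 q1 q2 r0 r1 (m : R * R * R) :
  let s := ecoord e v in
  pairV (res0VE v e (ql p0 p1 p2, ql q0 q1 q2, ql r0 r1 0)) (sVE v e m) =
  ql p0 p1 p2 s * m.2 - ql q0 q1 q2 s * m.1.2
  + 2^-1 * (ql q1 (2 * q2) 0 s - ql r0 r1 0 s) * (m.1.1 + m.1.2 * s).
Proof.
move=> s; rewrite /pairV /res0VE /sVE /= derive1_ql -/s /aff1.
have [tt nn tn nt] := tau_nu e; congr (_ + _).
set f := ql p0 p1 p2 s; set g := ql q0 q1 q2 s.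
transitivity (f * m.2 * dot (tau e) (tau e) - g * m.1.2 * dot (nu e) (nu e)
   + (g * m.2 - f * m.1.2) * dot (tau e) (nu e)); last by rewrite tt nn tn; ring.
by rewrite /dot /= /GRing.scale /=; ring.
Qed.

(** For [u = (f, g, h)] and [m = (phi, psi)], the integrand of the pairing with [difE u] is the
    derivative of [f psi - g phi' + 1/2 (g' - h) phi], which is the pairing at a vertex after
    restriction. *)
Lemma ev_difE e u m : A0E u -> pairE e (difE u) m =
  pairV (res0VE (head e) e u) (sVE (head e) e m) - pairV (res0VE (tail e) e u) (sVE (tail e) e m).
Proof.
move=> /A0EP[p0 [p1 [p2 [q0 [q1 [q2 [r0 [r1 ->]]]]]]]].
rewrite difE_ql pairE_ql !pairV_edge /= ecoord_head ecoord_tail.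
by move: (len e) => L; rewrite /ql; field.
Qed.

Lemma pair0 (V W : zmodType) (x : V) (y : W) : (x, y) = 0 :> V * W -> x = 0 /\ y = 0.
Proof. by case. Qed.

Lemma tau_nu_free e (f g : R) : f *: tau e + g *: nu e = 0 -> f = 0 /\ g = 0.
Proof.
move=> h; have [tt nn tn nt] := tau_nu e; split.
  transitivity (dot (f *: tau e + g *: nu e) (tau e)); last by rewrite h /dot /= !mul0r addr0.
  transitivity (f * dot (tau e) (tau e) + g * dot (nu e) (tau e)); first by rewrite tt nt; ring.
  by rewrite /dot /= /GRing.scale /=; ring.
transitivity (dot (f *: tau e + g *: nu e) (nu e)); last by rewrite h /dot /= !mul0r addr0.
transitivity (f * dot (tau e) (nu e) + g * dot (nu e) (nu e)); first by rewrite nn tn; ring.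
by rewrite /dot /= /GRing.scale /=; ring.
Qed.

Section Chi.
Variables (e : edge) (chi : R * R).
Hypotheses (chi_neq0 : chi != 0) (chi_mean0 : eint e (aff1 chi) = 0).

(** The first moment of [chi] on the edge: mean zero means [chi.1 = - chi.2 * len e / 2], and
    [1/3 - 1/4 = 1/12]. *)
Definition kappa : R := chi.2 * len e ^+ 3 / 12.

Lemma chi_moment k0 k1 : eint e (fun s => ql k0 k1 0 s * aff1 chi s) = k1 * kappa.
Proof.
have E : chi.1 = - (chi.2 * len e / 2).
  move: chi_mean0; rewrite aff1_ql eint_ql mul0r mul0r addr0 => h.
  apply: (mulIf (lt0r_neq0 (len_gt0 e))); apply/eqP; rewrite -subr_eq0 -h; apply/eqP.
  by field.
transitivity (eint e (ql (k0 * chi.1) (k0 * chi.2 + k1 * chi.1) (k1 * chi.2))).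
  by congr (eint e _); apply/funext => s; rewrite aff1_ql /ql; ring.
by rewrite eint_ql E /kappa; field.
Qed.

Lemma kappa_neq0 : kappa != 0.
Proof.
have L0 := lt0r_neq0 (len_gt0 e).
rewrite /kappa mulf_neq0 ?invr_eq0 ?pnatr_eq0 // mulf_neq0 ?expf_neq0 //.
apply: contra chi_neq0 => /eqP c2; move: chi_mean0.
rewrite aff1_ql eint_ql c2 !mul0r !addr0 => /eqP; rewrite mulf_eq0 (negbTE L0) orbF => /eqP c1.
by apply/eqP; apply: injective_projections.
Qed.

Lemma A0E_exists (x y : R * R * R) (d1 d2 : R) : exists2 u, A0E u &
  [/\ res0VE (tail e) e u = x, res0VE (head e) e u = y,
    eint e (fun s => derive1 u.1.1 s * aff1 chi s) = d1
  & eint e (fun s => 2^-1 * (u.2 s + derive1 u.1.2 s) * aff1 chi s) = d2].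
Proof.
have L0 := lt0r_neq0 (len_gt0 e); have k0 := kappa_neq0.
have [tt nn tn nt] := tau_nu e.
set p0 := dot x.1 (tau e); set q0 := dot x.1 (nu e).
(* The moments prescribe the slopes [2 p2] and [(r1 + 2 q2) / 2], the rotations at the two ends
   prescribe [2 q2 - r1], and the remaining coefficients interpolate the end values. *)
set p2 := d1 / (2 * kappa); set p1 := (dot y.1 (tau e) - p0 - p2 * len e ^+ 2) / len e.
set q2 := 2^-1 * (d2 / kappa + (y.2 - x.2) / len e); set r1 := d2 / kappa - (y.2 - x.2) / len e.
set q1 := (dot y.1 (nu e) - q0 - q2 * len e ^+ 2) / len e; set r0 := q1 - 2 * x.2.
exists (ql p0 p1 p2, ql q0 q1 q2, ql r0 r1 0).
  by apply/A0EP; exists p0, p1, p2, q0, q1, q2, r0, r1.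
have D (w : R * R) : dot w (tau e) *: tau e + dot w (nu e) *: nu e = w.
  rewrite -[RHS]scale1r -tt; apply: injective_projections.
    by rewrite /nu /rot /dot /= /GRing.scale /=; ring.
  by rewrite /nu /rot /dot /= /GRing.scale /=; ring.
rewrite /res0VE /= !derive1_ql ecoord_head ecoord_tail; split.
- apply: injective_projections => /=.
    by rewrite /ql !mulr0 expr0n /= !mulr0 !addr0 D.
  by rewrite /ql /r0; field.
- apply: injective_projections => /=; last first.
    by rewrite /ql /r0 /q2 /r1; move: (q1) (x.2) (y.2) (kappa) (len e) L0 k0 => *; field; apply/andP.
  transitivity (dot y.1 (tau e) *: tau e + dot y.1 (nu e) *: nu e); last exact: D.
  by congr (_ *: _ + _ *: _); rewrite /ql ?/p1 ?/q1 divfK //; ring.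
- by rewrite chi_moment /p2; field.
- transitivity (eint e (fun s => ql (2^-1 * (r0 + q1)) (2^-1 * (r1 + 2 * q2)) 0 s * aff1 chi s)).
    by congr (eint e _); apply/funext => s; rewrite /ql; ring.
  by rewrite chi_moment /q2 /r1; field; rewrite L0 k0.
Qed.

Lemma A0E_unique u : A0E u -> res0VE (tail e) e u = 0 -> res0VE (head e) e u = 0 ->
  eint e (fun s => derive1 u.1.1 s * aff1 chi s) = 0 ->
  eint e (fun s => 2^-1 * (u.2 s + derive1 u.1.2 s) * aff1 chi s) = 0 -> u = 0.
Proof.
move=> /A0EP[p0 [p1 [p2 [q0 [q1 [q2 [r0 [r1 ->]]]]]]]].
have L0 := lt0r_neq0 (len_gt0 e); have k0 := kappa_neq0.
have [tt nn tn nt] := tau_nu e.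
have D := @tau_nu_free e.
rewrite /res0VE /= !derive1_ql ecoord_head ecoord_tail chi_moment.
move=> /pair0[/D[a1 a2] a3] /pair0[/D[b1 b2] b3] /eqP; rewrite mulf_eq0 (negbTE k0) orbF => /eqP c1.
have -> : eint e (fun s => 2^-1 * (ql r0 r1 0 s + ql q1 (2 * q2) 0 s) * aff1 chi s) =
   eint e (fun s => ql (2^-1 * (r0 + q1)) (2^-1 * (r1 + 2 * q2)) 0 s * aff1 chi s).
  by congr (eint e _); apply/funext => s; rewrite /ql; ring.
rewrite chi_moment => /eqP; rewrite mulf_eq0 (negbTE k0) orbF => /eqP c2.
rewrite /ql !mulr0 expr0n /= !mulr0 !addr0 in a1 a2 a3.
have p20 : p2 = 0 by lra.
rewrite /ql a1 p20 mul0r add0r addr0 in b1.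
have p10 : p1 = 0 by move/eqP: b1; rewrite mulf_eq0 (negbTE L0) orbF => /eqP.
have q20 : q2 = 0.
  have h : 2 * q2 * len e - r1 * len e = 0.
    by move: a3 b3; rewrite /ql; move: (len e) => L; lra.
  have : (2 * q2 - r1) * len e = 0 by rewrite mulrBl.
  by move/eqP; rewrite mulf_eq0 (negbTE L0) orbF => /eqP h'; lra.
have r10 : r1 = 0 by lra.
rewrite /ql a2 q20 mul0r add0r addr0 in b2.
have q10 : q1 = 0 by move/eqP: b2; rewrite mulf_eq0 (negbTE L0) orbF => /eqP.
have r00 : r0 = 0 by lra.
by rewrite a1 a2 p10 p20 q10 q20 r00 r10 ql_zero.
Qed.

Lemma A1E_exists (g : R * R * R) (d1 d2 : R) : exists2 u, A1E u &
  [/\ forall m, pairE e u m = g.1.1 * m.1.1 + g.1.2 * m.1.2 + g.2 * m.2,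
    eint e (fun s => u.1.1 s * aff1 chi s) = d1 & eint e (fun s => u.1.2 s * aff1 chi s) = d2].
Proof.
have L0 := lt0r_neq0 (len_gt0 e); have k0 := kappa_neq0.
(* The moments fix the slopes [p1] and [q1]; the coefficients of [pairE_ql] in [m] then give [r0],
   [q0] and [p0] in turn. *)
set p1 := d1 / kappa; set q1 := d2 / kappa; set r0 := q1 - g.1.1 / len e.
set q0 := - (g.1.2 + r0 * len e ^+ 2 / 2) / len e; set p0 := (g.2 - len e ^+ 2 / 2 * p1) / len e.
exists (ql p0 p1 0, ql q0 q1 0, ql r0 0 0); first by apply/A1EP; exists p0, p1, q0, q1, r0.
split; [|by rewrite chi_moment /p1 divfK|by rewrite chi_moment /q1 divfK].
move=> m; rewrite pairE_ql /p0 /q0; have -> : q1 - r0 = g.1.1 / len e by rewrite /r0; ring.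
by move: (len e) L0 (r0) (p1) => L L0 r p; field.
Qed.

Lemma A1E_unique u : A1E u -> (forall m, pairE e u m = 0) ->
  eint e (fun s => u.1.1 s * aff1 chi s) = 0 -> eint e (fun s => u.1.2 s * aff1 chi s) = 0 -> u = 0.
Proof.
move=> /A1EP[p0 [p1 [q0 [q1 [r0 ->]]]]] hm; rewrite !chi_moment.
have L0 := lt0r_neq0 (len_gt0 e); have k0 := kappa_neq0.
move=> /eqP; rewrite mulf_eq0 (negbTE k0) orbF => /eqP p10.
move=> /eqP; rewrite mulf_eq0 (negbTE k0) orbF => /eqP q10.
have Z x : len e * x = 0 -> x = 0 by move/eqP; rewrite mulf_eq0 (negbTE L0) => /eqP.
rewrite p10 q10 in hm *.
have p00 : p0 = 0 by apply: Z; rewrite -(hm ((0, 0), 1)) pairE_ql /=; ring.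
have r00 : r0 = 0 by apply: Z; rewrite -[RHS]oppr0 -(hm ((1, 0), 0)) pairE_ql /=; ring.
rewrite p00 r00 in hm *.
have q00 : q0 = 0 by apply: Z; rewrite -[RHS]oppr0 -(hm ((0, 1), 0)) pairE_ql /=; ring.
by rewrite q00 ql_zero.
Qed.

End Chi.

Lemma difE_kernel e u : A0E u -> difE u = 0 -> res0VE (tail e) e u = 0 -> u = 0.
Proof.
move=> /A0EP[p0 [p1 [p2 [q0 [q1 [q2 [r0 [r1 ->]]]]]]]]; rewrite difE_ql.
move=> /pair0[/pair0[]]; rewrite -ql_zero => /ql_inj[h1 h2 _] /ql_inj[h3 h4 _] /ql_inj[h5 _ _].
rewrite /res0VE /= !derive1_ql ecoord_tail => /pair0[/tau_nu_free[a1 a2] a3].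
rewrite /ql !mulr0 expr0n /= !mulr0 !addr0 in a1 a2 a3.
have [-> -> -> -> ->] : [/\ p2 = 0, q1 = 0, q2 = 0, r0 = 0 & r1 = 0] by split; lra.
by rewrite a1 a2 h1 ql_zero.
Qed.

Lemma difE_surj u : A1E u -> exists2 v, A0E v & difE v = u.
Proof.
move=> /A1EP[p0 [p1 [q0 [q1 [r0 ->]]]]].
exists (ql 0 p0 (p1 / 2), ql 0 (2 * q0) (q1 - r0 / 2), ql 0 r0 0).
  by apply/A0EP; do 8 eexists.
by rewrite difE_ql; congr (_, _, _); congr ql; field.
Qed.

End EdgeSpaces.

(** * Restrictions of polynomial fields to edges and vertices *)

Section Restrictions.
Variables (R : realType) (K : ct_mesh R).
Local Notation mu := (@lebesgue_measure R).
Local Notation mu2 := (mu \x mu)%E.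
Local Notation vert := (vert K).
Local Notation edge := (edge K).
Local Notation triangle := (triangle K).
Local Notation pos := (@pos R K).
Implicit Types (A B C V : vert) (e eA eB eC : edge) (t : triangle).

Lemma tframe_vertex t V : V \in val t -> exists B C eA eB eC, tframe t V B C eA eB eC.
Proof.
have [A [B [C [eA [eB [eC F]]]]]] := tframe_exists t; have [-> _ _] := F.
rewrite !finset.inE => /orP[/orP[]|] /eqP ->.
- by exists B, C, eA, eB, eC.
- by exists C, A, eB, eC, eA; exact: tframe_rot.
- by exists A, B, eC, eA, eB; do 2 apply: tframe_rot.
Qed.

(** A degenerate frame: [qv_comp] holds for any frame, so the substitution formulas also apply along
    an edge. *)
Lemma epoint_aff e (s : R) : epoint e s = aff (pos (tail e)) (tau e) 0 (s, 0).
Proof. by rewrite /epoint /aff /= scaler0 addr0. Qed.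

Lemma qv_epoint e (f : quadr R) : (fun s => qv f (epoint e s)) =
  let g := qcomp f (pos (tail e)) (tau e) 0 in ql (q0 g) (q1 g) (q11 g).
Proof.
apply/funext => s; rewrite epoint_aff -qv_comp.
by move: (qcomp _ _ _ _) => g; rewrite /qv /ql /=; ring.
Qed.

Definition dirq (w : R * R) (f : quadr R) : quadr R := qlin w.1 (qd1 f) (qlin w.2 (qd2 f) (zq R)).

Lemma qv_dirq w f x : qv (dirq w f) x = qv (qd1 f) x * w.1 + qv (qd2 f) x * w.2.
Proof. by rewrite /dirq !qv_lin qv0; ring. Qed.

Lemma dirq_qlin N k (f g : quadr R) : dirq N (qlin k f g) = qlin k (dirq N f) (dirq N g).
Proof.
case: f g N => [f0 f1 f2 f11 f12 f22] [g0 g1 g2 g11 g12 g22] [N1 N2].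
by rewrite /dirq /qlin /qd1 /qd2 /=; congr Quadr; ring.
Qed.

Lemma derive1_epoint e (f : quadr R) :
  derive1 (fun s => qv f (epoint e s)) = fun s => qv (dirq (tau e) f) (epoint e s).
Proof.
rewrite qv_epoint derive1_ql; apply/funext => s.
rewrite qv_dirq epoint_aff [X in _ = X](_ : _ = qv (qd1 (qcomp f (pos (tail e)) (tau e) 0)) (s, 0)).
  by rewrite /ql /qv /=; ring.
by rewrite qd_comp1; ring.
Qed.

Lemma res0ET_vq e (u : edge -> R * R -> R * R) v : u e = vq v ->
  res0ET e u = (fun s => qv (dotq (tau e) v) (epoint e s), fun s => qv (dotq (nu e) v) (epoint e s),
    fun s => qv (dirq (nu e) (dotq (tau e) v)) (epoint e s)).
Proof.
move=> E; rewrite /res0ET E; congr (_, _, _); apply/funext => s; rewrite ?qv_dotq //.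
by rewrite qv_dirq derive_dot.
Qed.

Lemma res1ET_mq e (u : edge -> R * R -> 'M[R]_2) w : u e = mq w ->
  res1ET e u = (fun s => qv (qform w.1.1 w.1.2 w.2 (tau e) (tau e)) (epoint e s),
    fun s => qv (qform w.1.1 w.1.2 w.2 (tau e) (nu e)) (epoint e s),
    fun s => qv (dirq (nu e) (qform w.1.1 w.1.2 w.2 (tau e) (tau e))) (epoint e s)).
Proof.
move=> E; rewrite /res1ET E; congr (_, _, _); apply/funext => s.
- by rewrite /mx_tt apply_mq.
- by rewrite /mx_tn apply_mq.
have -> : mx_tt e (mq w) = qv (qform w.1.1 w.1.2 w.2 (tau e) (tau e)).
  by apply/funext => x; rewrite /mx_tt apply_mq.
by rewrite qv_dirq derive_qv.
Qed.

Lemma res0ET_A0E e (u : edge -> R * R -> R * R) v : u e = vq v -> A0E (res0ET e u).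
Proof.
move=> /res0ET_vq ->; rewrite !qv_epoint; apply/A0EP; do 8 eexists; congr (_, _, _).
apply: ql_eq; [reflexivity|reflexivity|].
by rewrite /dirq /qcomp /=; ring.
Qed.

Lemma qv_lin2 k (f g : quadr R) x : qv (qlin k f (qlin k g (zq R))) x = k * (qv f x + qv g x).
Proof. by rewrite !qv_lin qv0; ring. Qed.

Lemma qform_def_tau (v : vecq R) (p w : R * R) :
  qform (defq v).1.1 (defq v).1.2 (defq v).2 p w =
  qlin 2^-1 (dirq p (dotq w v)) (qlin 2^-1 (dirq w (dotq p v)) (zq R)).
Proof.
apply: qv_inj; apply/funext => x; rewrite qv_lin2 !qv_dirq qv_qform /= !qv_lin qv0.
(* The first derivatives of [v] are written out and then generalized, which leaves an identity in
   four unknowns. *)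
rewrite [qv (qd1 v.1) x](_ : _ = q1 v.1 + 2 * q11 v.1 * x.1 + q12 v.1 * x.2); last by rewrite /qv /=; ring.
rewrite [qv (qd2 v.1) x](_ : _ = q2 v.1 + q12 v.1 * x.1 + 2 * q22 v.1 * x.2); last by rewrite /qv /=; ring.
rewrite [qv (qd1 v.2) x](_ : _ = q1 v.2 + 2 * q11 v.2 * x.1 + q12 v.2 * x.2); last by rewrite /qv /=; ring.
rewrite [qv (qd2 v.2) x](_ : _ = q2 v.2 + q12 v.2 * x.1 + 2 * q22 v.2 * x.2); last by rewrite /qv /=; ring.
rewrite [qv (qd1 (dotq _ _)) x](_ : _ = w.1 * (q1 v.1 + 2 * q11 v.1 * x.1 + q12 v.1 * x.2)
  + w.2 * (q1 v.2 + 2 * q11 v.2 * x.1 + q12 v.2 * x.2)); last by rewrite /qv /=; ring.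
rewrite [qv (qd2 (dotq w _)) x](_ : _ = w.1 * (q2 v.1 + q12 v.1 * x.1 + 2 * q22 v.1 * x.2)
  + w.2 * (q2 v.2 + q12 v.2 * x.1 + 2 * q22 v.2 * x.2)); last by rewrite /qv /=; ring.
rewrite [qv (qd1 (dotq p _)) x](_ : _ = p.1 * (q1 v.1 + 2 * q11 v.1 * x.1 + q12 v.1 * x.2)
  + p.2 * (q1 v.2 + 2 * q11 v.2 * x.1 + q12 v.2 * x.2)); last by rewrite /qv /=; ring.
rewrite [qv (qd2 (dotq p _)) x](_ : _ = p.1 * (q2 v.1 + q12 v.1 * x.1 + 2 * q22 v.1 * x.2)
  + p.2 * (q2 v.2 + q12 v.2 * x.1 + 2 * q22 v.2 * x.2)); last by rewrite /qv /=; ring.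
move: (q1 v.1 + _ + _) (q2 v.1 + _ + _) (q1 v.2 + _ + _) (q2 v.2 + _ + _) => m1 m2 m3 m4.
by move: p w => [p1 p2] [w1 w2] /=; field.
Qed.

Lemma dirq_comm (p w : R * R) (f : quadr R) : dirq p (dirq w f) = dirq w (dirq p f).
Proof. by rewrite /dirq /qlin /qd1 /qd2 /=; congr Quadr; ring. Qed.

(** The first two components are entries of the symmetric gradient in the frame [(tau, nu)]; the
    third one uses that directional derivatives commute. *)
Lemma res1_def e (u : edge -> R * R -> R * R) (w : edge -> R * R -> 'M[R]_2) v :
  u e = vq v -> w e = mq (defq v) -> res1ET e w = difE (res0ET e u).
Proof.
move=> Eu Ew; rewrite (res1ET_mq Ew) (res0ET_vq Eu) /difE /= !derive1_epoint !qform_def_tau.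
congr (_, _, _); apply/funext => s.
- by rewrite qv_lin2; field.
- by rewrite qv_lin2 addrC.
rewrite dirq_comm; rewrite (_ : dirq (nu e) (qlin _ _ _) = dirq (nu e) (dirq (tau e) (dotq (tau e) v))).
  by rewrite dirq_comm.
by congr dirq; apply: qv_inj; apply/funext => x; rewrite qv_lin2; field.
Qed.

Lemma epoint_ends e V : V \in val e -> epoint e (ecoord e V) = pos V.
Proof.
have [E _] := edge_ends e; rewrite E !finset.inE => /orP[] /eqP ->.
  by rewrite ecoord_tail /epoint scale0r addr0.
by rewrite ecoord_head /epoint -head_tail.
Qed.

(** In the orthonormal frame of the edge the curl is the [tau] derivative of [v . nu] minus the [nu]
    derivative of [v . tau]. The result no longer depends on the edge. *)
Lemma res0VE_vq V e (u : edge -> R * R -> R * R) v : V \in val e -> u e = vq v ->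
  res0VE V e (res0ET e u) = (vq v (pos V), 2^-1 * qv (curlq v) (pos V)).
Proof.
move=> Ve /res0ET_vq ->; rewrite /res0VE /= derive1_epoint epoint_ends // !qv_dotq.
have [tt nn tn nt] := tau_nu e; congr (_, _).
  rewrite -[RHS]scale1r -tt; apply: injective_projections.
    by rewrite /nu /rot /dot /= /GRing.scale /=; ring.
  by rewrite /nu /rot /dot /= /GRing.scale /=; ring.
congr (_ * _); rewrite !qv_dirq /curlq qv_lin.
transitivity (dot (tau e) (tau e) * (qv (qd1 v.2) (pos V) - qv (qd2 v.1) (pos V))); last by rewrite tt; ring.
rewrite /dotq /nu; clear tt nn tn nt.
by move: (tau e) (pos V) => [t1 t2] x; rewrite /rot /dot /qv /=; ring.
Qed.

Section Frame.
Variables (t : triangle) (A B C : vert) (eA eB eC : edge).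
Hypothesis F : tframe t A B C eA eB eC.
Local Notation o := (center t).
Local Notation a := (pos A - o).
Local Notation b := (pos B - o).
Local Notation c := (pos C - o).

(** [res0VT] reads an unspecified piece; the two candidates at [A] agree by the matching conditions
    at the end of the ray of [a]. *)
Lemma res0VT_frame vA vB vC : A0star o a b c vA vB vC ->
  let u := pw3 eA eB eC (vq vA) (vq vB) (vq vC) in
  [/\ res0VT A t u = (vq vC (pos A), 2^-1 * qv (curlq vC) (pos A)),
    vq vB (pos A) = vq vC (pos A) & qv (curlq vB) (pos A) = qv (curlq vC) (pos A)].
Proof.
move=> [[ha _ _] [ka _ _]] u.
have [uA uB uC] : [/\ u eA = _, u eB = _ & u eC = _] := pw3E F (vq vA) (vq vB) (vq vC).
have i1 : 0 <= (1 : R) <= 1 by rewrite ler01 lexx.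
have := ka 1 i1; have := ha 1 i1; rewrite scale1r addrC subrK => h1 k1.
split => //; rewrite /res0VT; case: pickP => [e /andP[/(tedgeP F) he Ae]|].
  have [ab bc ca] := tframe_neq F; have [_ _ [hA hB hC]] := F.
  case: he Ae => ->; rewrite ?hA ?hB ?hC !finset.inE.
  - by rewrite (negbTE ab) eq_sym (negbTE ca).
  - by move=> _; rewrite uB curlT_vq h1 k1.
  - by move=> _; rewrite uC curlT_vq.
have [_ _ tC] := tedges F; move=> /(_ eC); rewrite tC.
by have [_ _ [_ _ ->]] := F; rewrite !finset.inE eqxx.
Qed.

(** Restrictions to an edge are functions on the whole line, whereas [side_cond] only speaks of
    [0 <= s <= 1]; polynomials make up the difference. *)
Lemma side_all (u : symq R) (k : R) : side_cond o b c u k ->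
  (forall s : R, szero u (aff o b c (1 - s, s))) /\
  (forall s : R, qv (qd1 (lq u o b c (c - b) (c - b))) (1 - s, s) = - (crs b c * k)).
Proof.
move=> [hz hn].
have Z (f : quadr R) : (forall s : R, 0 <= s <= 1 -> qv f (aff o b c (1 - s, s)) = 0) ->
    forall s : R, qv f (aff o b c (1 - s, s)) = 0.
  move=> h s; rewrite -qv_comp; move: (fun s hs => etrans (qv_comp f o b c (1 - s, s)) (h s hs)).
  move: (qcomp f o b c) => g {}h.
  have [h0 h1 h2] : [/\ q0 g + q1 g + q11 g = 0, - q1 g + q2 g - 2 * q11 g + q12 g = 0
      & q11 g - q12 g + q22 g = 0].
    by apply: quad3_eq0 => r /h; rewrite !mul0r !addr0 => <-; rewrite /qv /=; ring.
  transitivity ((q0 g + q1 g + q11 g) + s * (- q1 g + q2 g - 2 * q11 g + q12 g)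
    + s ^+ 2 * (q11 g - q12 g + q22 g)); first by rewrite /qv /=; ring.
  by rewrite h0 h1 h2 !mulr0 !addr0.
split=> s; first by split; apply: Z => r hr; have [] := hz r hr.
move: hn; move: (lq u o b c (c - b) (c - b)) (- (crs b c * k)) => g m hn.
have [h0 h1] : q1 g + 2 * q11 g = m /\ - (2 * q11 g) + q12 g = 0.
  by apply: affine_unit => r /hn; rewrite mul0r addr0 => <-; rewrite /qv /=; ring.
transitivity ((q1 g + 2 * q11 g) + s * (- (2 * q11 g) + q12 g)); first by rewrite /qv /=; ring.
by rewrite h0 h1 mulr0 addr0.
Qed.

Lemma epoint_side (s : R) : exists r : R, epoint eA s = aff o b c (1 - r, r).
Proof.
have l0 := lt0r_neq0 (len_gt0 eA).
have Es : s *: tau eA = (s / len eA) *: (len eA *: tau eA) by rewrite scalerA divfK.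
case: (side_orient F) => -[hh ht _]; have := head_tail eA; rewrite hh ht => E.
  exists (s / len eA); rewrite /epoint ht -side_point E Es; move: (_ *: tau eA) => T.
  by apply: injective_projections; rewrite /= /GRing.scale /=; ring.
exists (1 - s / len eA); rewrite /epoint ht -side_point E Es; move: (_ *: tau eA) => T.
by apply: injective_projections; rewrite /= /GRing.scale /=; ring.
Qed.

(** The part in [W] vanishes on the side, so only its constant normal derivative survives in the
    trace. *)
Lemma res1_A1T (vA vB vC : vecq R) (wA wB wC : symq R) (k1 k2 k3 : R) :
  Wstar o a b c wA wB wC k1 k2 k3 ->
  res1ET eA (pw3 eA eB eC (mq (slin 1 (defq vA) wA)) (mq (slin 1 (defq vB) wB)) (mq (slin 1 (defq vC) wC))) =
  difE (res0ET eA (pw3 eA eB eC (vq vA) (vq vB) (vq vC)))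
    + (ql 0 0 0, ql 0 0 0, ql (osgn t eA * k1 / len eA) 0 0).
Proof.
move=> [_ [sa _ _]]; have [za na] := side_all sa.
have [eu _ _] := pw3E F (mq (slin 1 (defq vA) wA)) (mq (slin 1 (defq vB) wB)) (mq (slin 1 (defq vC) wC)).
have [ev _ _] := pw3E F (vq vA) (vq vB) (vq vC).
have [ed _ _] := pw3E F (mq (defq vA)) (mq (defq vB)) (mq (defq vC)).
rewrite -(res1_def ev ed) (res1ET_mq eu) (res1ET_mq ed).
have Q p w : qform (slin 1 (defq vA) wA).1.1 (slin 1 (defq vA) wA).1.2 (slin 1 (defq vA) wA).2 p w =
    qlin 1 (qform (defq vA).1.1 (defq vA).1.2 (defq vA).2 p w) (qform wA.1.1 wA.1.2 wA.2 p w).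
  apply: qv_inj; apply/funext => x; rewrite qv_lin !qv_qform /= !qv_lin.
  by move: (qv _ _) (qv _ _) (qv _ _) => f1 f2 f3; ring.
have Zq p w s : qv (qform wA.1.1 wA.1.2 wA.2 p w) (epoint eA s) = 0.
  have [r ->] := epoint_side s; rewrite qv_qform; have [-> -> ->] := za r.
  by rewrite !mulr0 !addr0.
have [A0 _ _] := tframe_star F; have A0' := lt0r_neq0 A0; have l0 := lt0r_neq0 (len_gt0 eA).
have N s : qv (dirq (nu eA) (qform wA.1.1 wA.1.2 wA.2 (tau eA) (tau eA))) (epoint eA s) =
    osgn t eA * k1 / len eA.
  have [r ->] := epoint_side s.
  have := side_normal F (fun s _ => za s) r; rewrite na qv_dirq.
  have -> : mx_tt eA (mq wA) = qv (qform wA.1.1 wA.1.2 wA.2 (tau eA) (tau eA)).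
    by apply/funext => x; rewrite /mx_tt apply_mq.
  rewrite derive_qv => ->; move: (osgn _ _) (len eA) l0 (crs b c) A0' => g l l0 k k0.
  by field; rewrite l0 k0.
rewrite !Q; congr (_, _, _); apply/funext => s; rewrite /= !fctE.
- by rewrite qv_lin Zq mul1r /ql !mul0r !addr0.
- by rewrite qv_lin Zq mul1r /ql !mul0r !addr0.
by rewrite -(N s) dirq_qlin qv_lin mul1r /ql !mul0r !addr0.
Qed.

End Frame.

Lemma integral_aff2 o (p q : R * R) (phi : R * (R * R)) : 0 < crs p q ->
  \int[mu2]_(x in tri o p q) aff2 phi x =
  crs p q * (aff2 phi o / 2 + dot phi.2 p / 6 + dot phi.2 q / 6).
Proof.
move=> c0; have c0' := lt0r_neq0 c0; have [m [M [m' [M' hb]]]] := tri_box o p q.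
rewrite (Rintegral_scales_area (scales_area_aff o c0')) //; last 2 first.
- exact: tri_measurable.
- by apply: (continuous_integrable2 (@continuous_aff2 R phi) _ hb); exact: tri_measurable.
rewrite gtr0_norm // aff_preimage_tri //; congr (_ * _).
rewrite -Rintegral_ref_triangle; apply: eq_Rintegral => x _.
by rewrite /aff2 /dot /aff /= /GRing.scale /=; ring.
Qed.

End Restrictions.

(** * The complex on a triangle *)

Section TriangleSpaces.
Variables (R : realType) (K : ct_mesh R).
Local Notation mu := (@lebesgue_measure R).
Local Notation mu2 := (mu \x mu)%E.
Local Notation vert := (vert K).
Local Notation edge := (edge K).
Local Notation triangle := (triangle K).
Local Notation pos := (@pos R K).
Local Notation efield := ((R -> R) * (R -> R) * (R -> R))%type.
Local Notation R3 := ((R * R) * R)%type.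
Implicit Types (A B C V : vert) (e eA eB eC : edge) (t : triangle).

Lemma A0E_lin (k : R) (u u' : efield) : A0E u -> A0E u' -> A0E (k *: u + u').
Proof.
move=> /A0EP[p0 [p1 [p2 [q0 [q1 [q2 [r0 [r1 ->]]]]]]]] /A0EP[x0 [x1 [x2 [y0 [y1 [y2 [z0 [z1 ->]]]]]]]].
apply/A0EP; do 8 eexists; rewrite /=.
have -> : k *: (ql p0 p1 p2, ql q0 q1 q2, ql r0 r1 0) + (ql x0 x1 x2, ql y0 y1 y2, ql z0 z1 0) =
  (k *: ql p0 p1 p2 + ql x0 x1 x2, k *: ql q0 q1 q2 + ql y0 y1 y2, k *: ql r0 r1 0 + ql z0 z1 0) by [].
by rewrite !ql_lin mulr0 addr0.
Qed.

Lemma A1E_lin (k : R) (u u' : efield) : A1E u -> A1E u' -> A1E (k *: u + u').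
Proof.
move=> /A1EP[p0 [p1 [q0 [q1 [r0 ->]]]]] /A1EP[x0 [x1 [y0 [y1 [z0 ->]]]]].
apply/A1EP; do 5 eexists; rewrite /=.
have -> : k *: (ql p0 p1 0, ql q0 q1 0, ql r0 0 0) + (ql x0 x1 0, ql y0 y1 0, ql z0 0 0) =
  (k *: ql p0 p1 0 + ql x0 x1 0, k *: ql q0 q1 0 + ql y0 y1 0, k *: ql r0 0 0 + ql z0 0 0) by [].
by rewrite !ql_lin !mulr0 !addr0.
Qed.

Lemma res0VE_lin V e (k : R) u u' : A0E u -> A0E u' ->
  res0VE V e (k *: u + u') = k *: res0VE V e u + res0VE V e u'.
Proof.
move=> /A0EP[p0 [p1 [p2 [q0 [q1 [q2 [r0 [r1 ->]]]]]]]] /A0EP[x0 [x1 [x2 [y0 [y1 [y2 [z0 [z1 ->]]]]]]]].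
have -> : k *: (ql p0 p1 p2, ql q0 q1 q2, ql r0 r1 0) + (ql x0 x1 x2, ql y0 y1 y2, ql z0 z1 0) =
  (k *: ql p0 p1 p2 + ql x0 x1 x2, k *: ql q0 q1 q2 + ql y0 y1 y2, k *: ql r0 r1 0 + ql z0 z1 0) by [].
rewrite !ql_lin /res0VE /= !derive1_ql; apply: injective_projections => /=.
  by move: (tau e) (nu e) => T N; rewrite /ql; apply: injective_projections; rewrite /= /GRing.scale /=; ring.
by rewrite /ql /GRing.scale /=; ring.
Qed.

Lemma difE_lin (k : R) u u' : A0E u -> A0E u' -> difE (k *: u + u') = k *: difE u + difE u'.
Proof.
move=> /A0EP[p0 [p1 [p2 [q0 [q1 [q2 [r0 [r1 ->]]]]]]]] /A0EP[x0 [x1 [x2 [y0 [y1 [y2 [z0 [z1 ->]]]]]]]].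
have -> : k *: (ql p0 p1 p2, ql q0 q1 q2, ql r0 r1 0) + (ql x0 x1 x2, ql y0 y1 y2, ql z0 z1 0) =
  (k *: ql p0 p1 p2 + ql x0 x1 x2, k *: ql q0 q1 q2 + ql y0 y1 y2, k *: ql r0 r1 0 + ql z0 z1 0) by [].
rewrite !ql_lin mulr0 addr0 !difE_ql.
have E (f g h f' g' h' : R -> R) : k *: (f, g, h) + (f', g', h') =
  (k *: f + f', k *: g + g', k *: h + h') by [].
by rewrite E !ql_lin; congr (_, _, _); congr ql; ring.
Qed.

Lemma pairE_lin e (k : R) u u' m : A1E u -> A1E u' ->
  pairE e (k *: u + u') m = k * pairE e u m + pairE e u' m.
Proof.
move=> /A1EP[p0 [p1 [q0 [q1 [r0 ->]]]]] /A1EP[x0 [x1 [y0 [y1 [z0 ->]]]]].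
have -> : k *: (ql p0 p1 0, ql q0 q1 0, ql r0 0 0) + (ql x0 x1 0, ql y0 y1 0, ql z0 0 0) =
  (k *: ql p0 p1 0 + ql x0 x1 0, k *: ql q0 q1 0 + ql y0 y1 0, k *: ql r0 0 0 + ql z0 0 0) by [].
by rewrite !ql_lin !mulr0 !addr0 !pairE_ql; ring.
Qed.

Lemma pairE_linear e u : A1E u -> forall (k : R) (m m' : R3),
  pairE e u (k *: m + m') = k * pairE e u m + pairE e u m'.
Proof.
move=> /A1EP[p0 [p1 [q0 [q1 [r0 ->]]]]] k m m'.
by rewrite !pairE_ql /= /GRing.scale /= /GRing.scale /=; ring.
Qed.

Lemma difE_A1E (u : efield) : A0E u -> A1E (difE u).
Proof.
move=> /A0EP[p0 [p1 [p2 [q0 [q1 [q2 [r0 [r1 ->]]]]]]]].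
by rewrite difE_ql; apply/A1EP; do 5 eexists.
Qed.

(** Midpoint values in place of the moments with [chi]: this matches the description of [A^0(T)] by
    its values at vertices and midpoints. *)
Lemma A0E_ext e u u' : A0E u -> A0E u' ->
  res0VE (tail e) e u = res0VE (tail e) e u' -> res0VE (head e) e u = res0VE (head e) e u' ->
  u.1.1 (len e / 2) = u'.1.1 (len e / 2) -> u.1.2 (len e / 2) = u'.1.2 (len e / 2) -> u = u'.
Proof.
move=> hu hu' h1 h2 h3 h4; apply/eqP; rewrite -subr_eq0 addrC -scaleN1r; apply/eqP.
have hd := A0E_lin (-1) hu' hu.
have d1 : res0VE (tail e) e (-1 *: u' + u) = 0 by rewrite res0VE_lin // h1 scaleN1r addNr.
have d2 : res0VE (head e) e (-1 *: u' + u) = 0 by rewrite res0VE_lin // h2 scaleN1r addNr.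
have d3 : (-1 *: u' + u).1.1 (len e / 2) = 0.
  transitivity (-1 * u'.1.1 (len e / 2) + u.1.1 (len e / 2)); first by [].
  by rewrite h3; ring.
have d4 : (-1 *: u' + u).1.2 (len e / 2) = 0.
  transitivity (-1 * u'.1.2 (len e / 2) + u.1.2 (len e / 2)); first by [].
  by rewrite h4; ring.
move: hd d1 d2 d3 d4; move: (-1 *: u' + u) => d.
move=> /A0EP[p0 [p1 [p2 [q0 [q1 [q2 [r0 [r1 ->]]]]]]]] /=.
have L0 := lt0r_neq0 (len_gt0 e).
rewrite /res0VE /= !derive1_ql ecoord_head ecoord_tail.
move=> /pair0[/tau_nu_free[a1 a2] a3] /pair0[/tau_nu_free[b1 b2] b3] c1 c2.
rewrite /ql !mulr0 expr0n /= !mulr0 !addr0 in a1 a2 a3.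
have S k1 k2 : ql 0 k1 k2 (len e) = 0 -> ql 0 k1 k2 (len e / 2) = 0 -> k1 = 0 /\ k2 = 0.
  rewrite /ql !add0r => e1 e2.
  have e3 : len e ^+ 2 * k2 = 0.
    transitivity (2 * (k1 * len e + k2 * len e ^+ 2) - 4 * (k1 * (len e / 2) + k2 * (len e / 2) ^+ 2)).
      by field.
    by rewrite e1 e2 !mulr0 subr0.
  have k20 : k2 = 0 by move/eqP: e3; rewrite mulf_eq0 expf_eq0 (negbTE L0) => /eqP.
  by split => //; move/eqP: e1; rewrite k20 mul0r addr0 mulf_eq0 (negbTE L0) orbF => /eqP.
rewrite a1 in b1 c1; rewrite a2 in b2 c2.
have [p10 p20] := S _ _ b1 c1; have [q10 q20] := S _ _ b2 c2.
have r00 : r0 = 0 by lra.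
have r10 : r1 = 0.
  move/eqP: b3; rewrite q10 q20 r00 /ql !(mulr0, mul0r, addr0, add0r, sub0r) mulf_eq0 invr_eq0 pnatr_eq0 /=.
  by rewrite oppr_eq0 mulf_eq0 (negbTE L0) orbF => /eqP.
by rewrite a1 a2 p10 p20 q10 q20 r00 r10 ql_zero.
Qed.

Lemma midpoint_frame t A B C eA eB eC : tframe t A B C eA eB eC ->
  epoint eA (len eA / 2) = center t + 2^-1 *: ((pos B - center t) + (pos C - center t)).
Proof.
move=> F; have l0 := lt0r_neq0 (len_gt0 eA).
have -> : epoint eA (len eA / 2) = pos (tail eA) + 2^-1 *: (len eA *: tau eA).
  by rewrite /epoint; move: (tau eA) => T; rewrite scalerA [2^-1 * _]mulrC.
have -> : len eA *: tau eA = pos (head eA) - pos (tail eA) by rewrite [pos (head _)]head_tail addrC addKr.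
by case: (side_orient F) => -[-> -> _]; apply: injective_projections; rewrite /= /GRing.scale /=; field.
Qed.

Lemma A0T_edge t (u : edge -> R * R -> R * R) e : A0T t u -> tedge t e -> exists v, u e = vq v.
Proof. by move=> [[h _] _ _] /h/poly2_vq. Qed.

Lemma res0VT_edge t u e V : A0T t u -> tedge t e -> V \in val e ->
  res0VT V t u = res0VE V e (res0ET e u).
Proof.
move=> hu te Ve; have Vt : V \in val t by apply: (fintype.subsetP te).
have [B [C [eA [eB [eC F]]]]] := tframe_vertex Vt.
have := hu => /(A0TP F)[vA [vB [vC [hv Eu]]]].
have [r h1 h2] := res0VT_frame F hv; rewrite -Eu in r; rewrite r.
have [uA uB uC] := pw3E F (vq vA) (vq vB) (vq vC); rewrite -Eu in uA uB uC.
have [VB BC CV] := tframe_neq F; have [_ _ [hA hB hC]] := F.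
case: (tedgeP F te) Ve => ->.
- by rewrite hA !finset.inE (negbTE VB) eq_sym (negbTE CV).
- by move=> Ve; rewrite (res0VE_vq Ve uB) h1 h2.
- by move=> Ve; rewrite (res0VE_vq Ve uC).
Qed.

Lemma A0T_eq0 t u : A0T t u -> (forall e, tedge t e -> res0ET e u = 0) -> u = 0.
Proof.
move=> hu he; have [A [B [C [eA [eB [eC F]]]]]] := tframe_exists t.
have FB := tframe_rot F; have FC := tframe_rot FB.
have := hu => /(A0TP F)[vA [vB [vC [hv Eu]]]].
have [uA uB uC] := pw3E F (vq vA) (vq vB) (vq vC); rewrite -Eu in uA uB uC.
have [tA tB tC] := tedges F.
have [_ _ [sA sB sC]] := F.
have H e v : tedge t e -> u e = vq v -> forall s, vq v (epoint e s) = 0.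
  move=> te E s; have [tt nn tn nt] := tau_nu e.
  have := he _ te; rewrite (res0ET_vq E) => /pair0[/pair0[h1 h2] _].
  have := congr1 (fun f => f s) h1; have := congr1 (fun f => f s) h2; rewrite !qv_dotq => k2 k1.
  apply: (@dot_eq0 _ (tau e) (nu e)).
  - have -> : crs (tau e) (nu e) = 1; last exact: oner_neq0.
    by rewrite -[RHS]tt /nu; move: (tau e) => T; rewrite /rot /crs /dot /=; ring.
  - by rewrite -[RHS]k1 /dot; ring.
  - by rewrite -[RHS]k2 /dot; ring.
have Vx e V v : tedge t e -> V \in val e -> u e = vq v ->
    vq v (pos V) = 0 /\ qv (curlq v) (pos V) = 0.
  move=> te Ve E; have := res0VE_vq Ve E.
  have -> : res0VE V e (res0ET e u) = 0.
    rewrite he // /res0VE /=; have -> : (0 : R -> R) = ql 0 0 0 by rewrite ql_zero.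
    rewrite derive1_ql /ql; apply: injective_projections => /=; last by ring.
    by rewrite !mul0r !addr0 !scale0r addr0.
  move=> /esym/pair0[-> /eqP]; rewrite mulf_eq0 invr_eq0 pnatr_eq0 => /eqP ->; by split.
have P V : pos V = center t + (pos V - center t) by rewrite addrC subrK.
have [a1 a2] : vq vC (pos A) = 0 /\ qv (curlq vC) (pos A) = 0.
  by apply: Vx tC _ uC; rewrite sC !finset.inE eqxx.
have [b1 b2] : vq vA (pos B) = 0 /\ qv (curlq vA) (pos B) = 0.
  by apply: Vx tA _ uA; rewrite sA !finset.inE eqxx.
have [c1 c2] : vq vB (pos C) = 0 /\ qv (curlq vB) (pos C) = 0.
  by apply: Vx tB _ uB; rewrite sB !finset.inE eqxx.
rewrite P in a1 a2; rewrite P in b1 b2; rewrite P in c1 c2.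
have Z := A0star_unique (tframe_star F) hv (And3 a1 b1 c1) (And3 a2 b2 c2).
have {}Z : forall x, [/\ vq vA x = 0, vq vB x = 0 & vq vC x = 0].
  apply: Z; split.
  - by rewrite -(midpoint_frame F) (H _ _ tA uA).
  - by rewrite -(midpoint_frame FB) (H _ _ tB uB).
  - by rewrite -(midpoint_frame FC) (H _ _ tC uC).
rewrite Eu; apply/funext => e; rewrite /pw3.
by do 3 (case: ifP => _; first by apply/funext => x; have [] := Z x).
Qed.

Lemma pw3_rot t A B C eA eB eC (Y : zmodType) (fA fB fC : R * R -> Y) :
  tframe t A B C eA eB eC -> pw3 eA eB eC fA fB fC = pw3 eB eC eA fB fC fA.
Proof.
move=> F; have FB := tframe_rot F.
rewrite (pw3_eta FB (u := pw3 eA eB eC fA fB fC)); last by move=> e; exact: (pw3_out F).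
by have [-> -> ->] := pw3E F fA fB fC.
Qed.

(** The field is built from the vertex data and from the midpoint values of the traces; [A0E_ext]
    then recovers the whole trace on each edge. *)
Lemma A0T_extend t (f : edge -> efield) (x : vert -> R3) :
  (forall e, tedge t e -> A0E (f e)) ->
  (forall e V, tedge t e -> V \in val e -> res0VE V e (f e) = x V) ->
  exists2 u, A0T t u & (forall e, tedge t e -> res0ET e u = f e) /\
    (forall V, V \in val t -> res0VT V t u = x V).
Proof.
move=> hf hx; have [A [B [C [eA [eB [eC F]]]]]] := tframe_exists t.
have FB := tframe_rot F; have FC := tframe_rot FB.
pose M e := (f e).1.1 (len e / 2) *: tau e + (f e).1.2 (len e / 2) *: nu e.
(* The scalar part of [A^0(V)] is half the curl, hence the factors 2. *)
have [vA [vB [vC [hv [a1 b1 c1] [a2 b2 c2] [mA mB mC]]]]] :=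
  A0star_exists (center t) (x A).1 (x B).1 (x C).1 (2 * (x A).2) (2 * (x B).2) (2 * (x C).2)
    (M eA) (M eB) (M eC) (tframe_star F).
have P V : center t + (pos V - center t) = pos V by rewrite addrC subrK.
rewrite !P in a1 b1 c1 a2 b2 c2.
rewrite -(midpoint_frame F) in mA; rewrite -(midpoint_frame FB) in mB; rewrite -(midpoint_frame FC) in mC.
set u := pw3 eA eB eC (vq vA) (vq vB) (vq vC).
have hu : A0T t u by apply/(A0TP F); exists vA, vB, vC.
have [uA uB uC] : [/\ u eA = _, u eB = _ & u eC = _] := pw3E F (vq vA) (vq vB) (vq vC).
have E1 : u = pw3 eB eC eA (vq vB) (vq vC) (vq vA) := pw3_rot _ _ _ F.
have E2 : u = pw3 eC eA eB (vq vC) (vq vA) (vq vB) := etrans E1 (pw3_rot _ _ _ FB).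
have V0 V : V \in val t -> res0VT V t u = x V.
  have Hx (y : R3) (w : R * R) (k : R) : w = y.1 -> k = 2 * y.2 -> (w, 2^-1 * k) = y.
    by move=> -> ->; apply: injective_projections => //=; field.
  have [-> _ _] := F; rewrite !finset.inE => /orP[/orP[]|] /eqP ->.
  - by have [-> _ _] := res0VT_frame F hv; exact: Hx.
  - by have [r _ _] := res0VT_frame FB (A0star_rot hv); rewrite -E1 in r; rewrite r; exact: Hx.
  - have [r _ _] := res0VT_frame FC (A0star_rot (A0star_rot hv)).
    by rewrite -E2 in r; rewrite r; exact: Hx.
exists u => //; split => // e te.
have [E th] := edge_ends e.
have ve : tail e \in val e by rewrite E !finset.inE eqxx.
have se := fintype.subsetP te.
have [v Ev] := A0T_edge hu te.
have mid : vq v (epoint e (len e / 2)) = M e.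
  by case: (tedgeP F te) Ev => ->; rewrite ?uA ?uB ?uC => <-.
have [tt nn tn nt] := tau_nu e.
apply: (@A0E_ext e) (hf _ te) _ _ _ _; first exact: res0ET_A0E Ev.
- by rewrite -(res0VT_edge hu te ve) V0 ?hx // se.
- by rewrite -(res0VT_edge hu te (head_in e)) V0 ?hx ?se ?head_in.
- rewrite (res0ET_vq Ev) /= qv_dotq mid /M; move: ((f e).1.1 _) ((f e).1.2 _) => k l.
  transitivity (k * dot (tau e) (tau e) + l * dot (nu e) (tau e)); last by rewrite tt nt; ring.
  by move: (tau e) (nu e) => T N; rewrite /dot /= /GRing.scale /=; ring.
- rewrite (res0ET_vq Ev) /= qv_dotq mid /M; move: ((f e).1.1 _) ((f e).1.2 _) => k l.
  transitivity (k * dot (tau e) (nu e) + l * dot (nu e) (nu e)); last by rewrite nn tn; ring.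
  by move: (tau e) (nu e) => T N; rewrite /dot /= /GRing.scale /=; ring.
Qed.


Definition osum t (psi : edge -> R) : R := \sum_(e | tedge t e) osgn t e * psi e.

Lemma osum_frame t A B C eA eB eC psi : tframe t A B C eA eB eC ->
  osum t psi = osgn t eA * psi eA + osgn t eB * psi eB + osgn t eC * psi eC.
Proof. by move=> F; rewrite /osum (tedge_sum F). Qed.

Lemma osgn_sqr t A B C eA eB eC : tframe t A B C eA eB eC -> osgn t eA * osgn t eA = 1.
Proof. by move=> F; rewrite /osgn; case: (side_orient F) => -[_ _ ->]; rewrite ?mulrNz mulr1z ?mulrNN mulr1. Qed.

(* The composite restriction of M(T) to a vertex does not depend on the edge. *)
Definition sVT V (phi : R * (R * R)) : R3 := (- rot phi.2, aff2 phi (pos V)).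

Lemma sVE_sET V e phi : V \in val e -> sVE V e (sET e phi) = sVT V phi.
Proof.
move=> Ve; rewrite /sVE /sET /sVT /=; congr (_, _).
  have [tt _ _ _] := tau_nu e; rewrite -[RHS]scale1r -tt /nu.
  move: (tau e) => T; apply: injective_projections; rewrite /rot /dot /= /GRing.scale /=; ring.
rewrite -(epoint_ends Ve) /aff1 /aff2 /epoint; move: (tau e) (ecoord e V) => T s.
by rewrite /dot /= /GRing.scale /=; ring.
Qed.

Definition sVT_inv V (m : R3) : R * (R * R) := (m.2 - dot (rot m.1) (pos V), rot m.1).

Lemma sVTK V : cancel (sVT V) (sVT_inv V).
Proof.
move=> [m1 [m2 m3]]; rewrite /sVT /sVT_inv /aff2 /rot /dot /=.
by congr (_, (_, _)); ring.
Qed.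

(** Together with [sVE_inv] below, this explicit inverse gives the bijectivity of the transport
    maps. *)
Definition sET_inv e (m : R3) : R * (R * R) :=
  let l := m.1.2 *: tau e + m.2 *: nu e in (m.1.1 - dot l (pos (tail e)), l).

Lemma sET_invK e : cancel (sET_inv e) (sET e).
Proof.
move=> [[m1 m2] m3]; rewrite /sET /sET_inv /aff2 /=.
have [tt nn tn nt] := tau_nu e; congr ((_, _), _); first by ring.
  transitivity (m2 * dot (tau e) (tau e) + m3 * dot (nu e) (tau e)); last by rewrite tt nt; ring.
  by move: (tau e) (nu e) => T N; rewrite /dot /= /GRing.scale /=; ring.
transitivity (m2 * dot (tau e) (nu e) + m3 * dot (nu e) (nu e)); last by rewrite tn nn; ring.
by move: (tau e) (nu e) => T N; rewrite /dot /= /GRing.scale /=; ring.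
Qed.

Lemma sETK e : cancel (sET e) (sET_inv e).
Proof.
move=> [m1 [m2 m3]]; rewrite /sET /sET_inv /aff2 /=; have [tt _ _ _] := tau_nu e.
have E : dot (m2, m3) (tau e) *: tau e + dot (m2, m3) (nu e) *: nu e = (m2, m3).
  rewrite -[RHS]scale1r -tt /nu; move: (tau e) => T.
  by apply: injective_projections; rewrite /rot /dot /= /GRing.scale /=; ring.
by rewrite E addrK.
Qed.

Definition sVE_inv V e (m : R3) : R3 :=
  let f := - dot m.1 (nu e) in ((m.2 - f * ecoord e V, f), dot m.1 (tau e)).

Lemma sVE_invK V e : cancel (sVE_inv V e) (sVE V e).
Proof.
move=> [m1 m2]; rewrite /sVE /sVE_inv /aff1 /= subrK; congr (_, _).
have [tt _ _ _] := tau_nu e; rewrite -[RHS]scale1r -tt /nu; move: (tau e) => T.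
by apply: injective_projections; rewrite /rot /dot /= /GRing.scale /=; ring.
Qed.

Lemma sVEK V e : cancel (sVE V e) (sVE_inv V e).
Proof.
move=> [[m1 m2] m3]; rewrite /sVE /sVE_inv /aff1 /=; have [tt nn tn nt] := tau_nu e.
have E1 : dot (m3 *: tau e - m2 *: nu e) (nu e) = - m2.
  transitivity (m3 * dot (tau e) (nu e) - m2 * dot (nu e) (nu e)); last by rewrite tn nn; ring.
  by move: (tau e) (nu e) => T N; rewrite /dot /= /GRing.scale /=; ring.
have E2 : dot (m3 *: tau e - m2 *: nu e) (tau e) = m3.
  transitivity (m3 * dot (tau e) (tau e) - m2 * dot (nu e) (tau e)); last by rewrite tt nt; ring.
  by move: (tau e) (nu e) => T N; rewrite /dot /= /GRing.scale /=; ring.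
by rewrite E1 E2 opprK addrK.
Qed.

Lemma pairV_rep (f : R3 -> R) : (forall (k : R) m m', f (k *: m + m') = k * f m + f m') ->
  exists x, forall m, f m = pairV x m.
Proof.
move=> lf; exists ((f ((1, 0), 0), f ((0, 1), 0)), f ((0, 0), 1)) => m.
have f0 : f 0 = 0 
  by have := lf (-1) 0 0; rewrite scaleN1r addNr mulN1r addNr.
have E : m = m.1.1 *: ((1, 0), 0) + (m.1.2 *: ((0, 1), 0) + (m.2 *: ((0, 0), 1) + 0)).
  by case: m => [[m1 m2] m3]; apply: injective_projections; [apply: injective_projections|];
    rewrite /= /GRing.scale /= /GRing.scale /=; ring.
by rewrite {1}E !lf f0 /pairV /dot /=; ring.
Qed.

Lemma pairV_linear x (k : R) (m m' : R3) : pairV x (k *: m + m') = k * pairV x m + pairV x m'.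
Proof. by rewrite /pairV /dot /= /GRing.scale /= /GRing.scale /=; ring. Qed.

Lemma pairV_lin (k : R) (x x' m : R3) : pairV (k *: x + x') m = k * pairV x m + pairV x' m.
Proof. by rewrite /pairV /dot /= /GRing.scale /= /GRing.scale /=; ring. Qed.

Lemma pairV_inj (x y : R3) : (forall m, pairV x m = pairV y m) -> x = y.
Proof.
move: x y => [[x1 x2] x3] [[y1 y2] y3] h.
have := h ((1, 0), 0); have := h ((0, 1), 0); have := h ((0, 0), 1).
by rewrite /pairV /dot /= !mulr0 !mulr1 !addr0 !add0r => -> -> ->.
Qed.

(** The coboundary, on [e], of the vertex cochain represented by [x]; by [ev_difE] it is also the
    pairing of [difE u] when [x] gives the end values of [u]. *)
Definition cobE e (x : vert -> R3) (m : R3) : R :=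
  pairV (x (head e)) (sVE (head e) e m) - pairV (x (tail e)) (sVE (tail e) e m).

Lemma cobE_frame t A B C eA eB eC x phi : tframe t A B C eA eB eC ->
  osgn t eA * cobE eA x (sET eA phi) = pairV (x C) (sVT C phi) - pairV (x B) (sVT B phi).
Proof.
move=> F; have [_ _ [hA _ _]] := F.
have Bi : B \in val eA by rewrite hA !finset.inE eqxx.
have Ci : C \in val eA by rewrite hA !finset.inE eqxx orbT.
rewrite /osgn /cobE; case: (side_orient F) => -[-> -> ->]; rewrite ?mulrNz mulr1z ?mul1r ?mulN1r ?opprB.
all: by rewrite !sVE_sET.
Qed.

(** With its sign, each edge contributes the difference of its end values in counterclockwise order,
    and the sum telescopes. *)
Lemma osum_cobE t x phi : osum t (fun e => cobE e x (sET e phi)) = 0.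
Proof.
have [A [B [C [eA [eB [eC F]]]]]] := tframe_exists t.
have FB := tframe_rot F; have FC := tframe_rot FB.
by rewrite (osum_frame _ F) (cobE_frame _ _ F) (cobE_frame _ _ FB) (cobE_frame _ _ FC); ring.
Qed.

(** The potential is 0 at [A] and is integrated along the two edges through [A], after pulling
    [M(V)] back to [M(T)] by [sVT_inv]. On the third edge the vanishing of the oriented sum gives
    the claim. *)
Lemma cochain_exact t (psi : edge -> R3 -> R) :
  (forall e, tedge t e -> forall (k : R) m m', psi e (k *: m + m') = k * psi e m + psi e m') ->
  (forall phi, osum t (fun e => psi e (sET e phi)) = 0) ->
  exists x, forall e, tedge t e -> forall m, psi e m = cobE e x m.
Proof.
move=> lp cp; have [A [B [C [eA [eB [eC F]]]]]] := tframe_exists t.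
have FB := tframe_rot F; have FC := tframe_rot FB.
have lin e V (k : R) m m' : tedge t e -> osgn t e * psi e (sET e (sVT_inv V (k *: m + m'))) =
    k * (osgn t e * psi e (sET e (sVT_inv V m))) + osgn t e * psi e (sET e (sVT_inv V m')).
  move=> te; have -> : sET e (sVT_inv V (k *: m + m')) = k *: sET e (sVT_inv V m) + sET e (sVT_inv V m').
    rewrite /sET /sVT_inv /aff2 /=; move: (tau e) (nu e) (pos (tail e)) (pos V) => T N p v.
    case: m m' => [[m1 m2] m3] [[n1 n2] n3]; apply: injective_projections; [apply: injective_projections|];
    by rewrite /rot /dot /= /GRing.scale /= ?/GRing.scale /=; ring.
  by rewrite (lp _ te); ring.
have [tA tB tC] := tedges F.
have [xB hB] := pairV_rep (fun k m m' => lin eC B k m m' tC).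
have [xC hC] := pairV_rep (fun k m m' => lin eB C k m m' tB).
have [ab bc ca] := tframe_neq F.
pose x V := if V == B then xB else if V == C then - xC else 0.
have xA0 : x A = 0 by rewrite /x (negbTE ab) eq_sym (negbTE ca).
have xB0 : x B = xB by rewrite /x eqxx.
have xC0 : x C = - xC by rewrite /x eq_sym (negbTE bc) eqxx.
have pN y m : pairV (- y) m = - pairV y m by rewrite /pairV /dot /=; ring.
have p0 m : pairV (0 : R3) m = 0 by rewrite /pairV /dot /=; ring.
have fB phi : pairV xB (sVT B phi) = osgn t eC * psi eC (sET eC phi) by rewrite -hB sVTK.
have fC phi : pairV xC (sVT C phi) = osgn t eB * psi eB (sET eB phi) by rewrite -hC sVTK.
have key e : osgn t e * osgn t e = 1 ->
    (forall phi, osgn t e * psi e (sET e phi) = osgn t e * cobE e x (sET e phi)) ->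
    forall m, psi e m = cobE e x m.
  move=> sg h m; have := h (sET_inv e m); rewrite sET_invK => /(congr1 (fun r => osgn t e * r)).
  by rewrite !mulrA sg !mul1r.
exists x => e /(tedgeP F)[] ->; apply: key.
- exact: osgn_sqr F.
- move=> phi; rewrite (cobE_frame _ _ F) xB0 xC0 pN fB fC.
  have := cp phi; rewrite (osum_frame _ F); move: (_ * psi eA _) (_ * psi eB _) (_ * psi eC _) => r1 r2 r3 h.
  by transitivity (r1 - (r1 + r2 + r3)); [rewrite h subr0|ring].
- exact: osgn_sqr FB.
- by move=> phi; rewrite (cobE_frame _ _ FB) xA0 xC0 pN p0 fC; ring.
- exact: osgn_sqr FC.
- by move=> phi; rewrite (cobE_frame _ _ FC) xA0 xB0 p0 fB; ring.
Qed.

Lemma pairT_frame t A B C eA eB eC (g1 g2 g3 : R) phi : tframe t A B C eA eB eC ->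
  let o := center t in let a := pos A - o in let b := pos B - o in let c := pos C - o in
  pairT t (pw3 eA eB eC (fun=> g1) (fun=> g2) (fun=> g3)) phi =
  crs b c * g1 * (aff2 phi o / 2 + dot phi.2 b / 6 + dot phi.2 c / 6)
  + crs c a * g2 * (aff2 phi o / 2 + dot phi.2 c / 6 + dot phi.2 a / 6)
  + crs a b * g3 * (aff2 phi o / 2 + dot phi.2 a / 6 + dot phi.2 b / 6).
Proof.
move=> F o a b c; have [A0 B0 C0] := tframe_star F.
rewrite /pairT (pwint_frame F).
have [-> -> ->] := pw3E F (fun=> g1) (fun=> g2) (fun=> g3).
have E (k : R) p q : 0 < crs p q -> \int[mu2]_(x in tri o p q) (k * aff2 phi x) =
    crs p q * k * (aff2 phi o / 2 + dot phi.2 p / 6 + dot phi.2 q / 6).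
  move=> c0; rewrite RintegralZl ?integral_aff2 //; first by rewrite mulrA [k * _]mulrC.
    by apply: tri_measurable; rewrite gt_eqF.
  have [m [M [m' [M' hb]]]] := tri_box o p q.
  apply: (continuous_integrable2 (@continuous_aff2 R phi) _ hb).
  by apply: tri_measurable; rewrite gt_eqF.
by rewrite !E.
Qed.

End TriangleSpaces.

(** * Linearity, Green's formula and exactness on a triangle *)

Section TriangleComplex.
Variables (R : realType) (K : ct_mesh R).
Local Notation vert := (vert K).
Local Notation edge := (edge K).
Local Notation triangle := (triangle K).
Local Notation pos := (@pos R K).
Local Notation efield := ((R -> R) * (R -> R) * (R -> R))%type.
Local Notation R3 := ((R * R) * R)%type.
Local Notation vfield := (edge -> R * R -> R * R).
Local Notation mfield := (edge -> R * R -> 'M[R]_2).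
Local Notation sfield := (edge -> R * R -> R).
Implicit Types (A B C V : vert) (e eA eB eC : edge) (t : triangle).

Definition vlin (k : R) (v v' : vecq R) : vecq R := (qlin k v.1 v'.1, qlin k v.2 v'.2).

Lemma vq_vlin k v v' : vq (vlin k v v') = k *: vq v + vq v'.
Proof. by apply/funext => x; rewrite vq_lin. Qed.

Lemma mq_slin k (u u' : symq R) : mq (slin k u u') = k *: mq u + mq u'.
Proof. by apply/funext => x; rewrite mq_lin. Qed.

Lemma curlq_vlin k v v' x : qv (curlq (vlin k v v')) x = k * qv (curlq v) x + qv (curlq v') x.
Proof. by rewrite /curlq /vlin /qlin /qd1 /qd2 /qv /=; ring. Qed.

Lemma defq_vlin k v v' : defq (vlin k v v') = slin k (defq v) (defq v').
Proof. by rewrite /defq /slin /vlin /qlin /qd1 /qd2 /=; congr (_, _, _); congr Quadr; ring. Qed.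

Lemma A0star_lin o a b c k (vA vB vC wA wB wC : vecq R) :
  A0star o a b c vA vB vC -> A0star o a b c wA wB wC ->
  A0star o a b c (vlin k vA wA) (vlin k vB wB) (vlin k vC wC).
Proof.
move=> [[h1 h2 h3] [k1 k2 k3]] [[l1 l2 l3] [m1 m2 m3]].
split; split => s hs; rewrite ?vq_lin ?curlq_vlin.
- by rewrite h1 // l1.
- by rewrite h2 // l2.
- by rewrite h3 // l3.
- by rewrite k1 // m1.
- by rewrite k2 // m2.
- by rewrite k3 // m3.
Qed.

Lemma A0T_lin t (k : R) (u u' : vfield) : A0T t u -> A0T t u' -> A0T t (k *: u + u').
Proof.
have [A [B [C [eA [eB [eC F]]]]]] := tframe_exists t.
move=> /(A0TP F)[vA [vB [vC [hv ->]]]] /(A0TP F)[wA [wB [wC [hw ->]]]].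
apply/(A0TP F); exists (vlin k vA wA), (vlin k vB wB), (vlin k vC wC).
by split; [exact: A0star_lin|rewrite pw3_lin !vq_vlin].
Qed.

Lemma A0T0 t : A0T t 0.
Proof.
have [A [B [C [eA [eB [eC F]]]]]] := tframe_exists t.
have : [set (0 : mfield)] 0 by [].
rewrite -(def_W_trivial F) => -[[u hu _] _].
by have := A0T_lin (-1) hu hu; rewrite scaleN1r addNr.
Qed.

Lemma W_lin t (k : R) (w w' : mfield) : W t w -> W t w' -> W t (k *: w + w').
Proof.
have [A [B [C [eA [eB [eC F]]]]]] := tframe_exists t.
move=> /(WP F)[uA [uB [uC [[k1 [k2 [k3 hu]]] [ju ->]]]]] /(WP F)[wA [wB [wC [[l1 [l2 [l3 hw]]] [jw ->]]]]].
apply/(WP F); exists (slin k uA wA), (slin k uB wB), (slin k uC wC); split; last split.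
- by do 3 eexists; exact: Wstar_lin hu hw.
- exact: jumps0_lin.
- by rewrite pw3_lin !mq_slin.
Qed.

Lemma W0 t : W t 0.
Proof.
have [A [B [C [eA [eB [eC F]]]]]] := tframe_exists t.
have : [set (0 : mfield)] 0 by [].
by rewrite -(def_W_trivial F) => -[].
Qed.

Lemma defT_lin t (k : R) (u u' : vfield) : A0T t u -> A0T t u' ->
  defT (k *: u + u') = k *: defT u + defT u'.
Proof.
have [A [B [C [eA [eB [eC F]]]]]] := tframe_exists t.
move=> /(A0TP F)[vA [vB [vC [hv ->]]]] /(A0TP F)[wA [wB [wC [hw ->]]]].
by rewrite pw3_lin -!vq_vlin !defT_pw3 pw3_lin !defq_vlin !mq_slin.
Qed.

Lemma defT0 : defT (0 : vfield) = 0.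
Proof. by apply/funext => e; rewrite /defT def_zero. Qed.

Lemma A1T_lin t (k : R) (u u' : mfield) : A1T t u -> A1T t u' -> A1T t (k *: u + u').
Proof.
move=> [v [w [hv hw ->]]] [v' [w' [hv' hw' ->]]]; exists (k *: v + v'), (k *: w + w').
split; [exact: A0T_lin|exact: W_lin|].
by rewrite (defT_lin _ hv hv') scalerDr addrACA.
Qed.

Lemma A1T_def t v : A0T t v -> A1T t (defT v).
Proof. by move=> hv; exists v, 0; split; rewrite ?addr0 //; exact: W0. Qed.

Lemma A1T_W t w : W t w -> A1T t w.
Proof. by move=> hw; exists 0, w; split; rewrite ?defT0 ?add0r //; exact: A0T0. Qed.

Lemma A2T_lin t (k : R) (g g' : sfield) : A2T t g -> A2T t g' -> A2T t (k *: g + g').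
Proof.
have [A [B [C [eA [eB [eC F]]]]]] := tframe_exists t.
move=> /(A2TP F)[g1 [g2 [g3 ->]]] /(A2TP F)[h1 [h2 [h3 ->]]].
rewrite pw3_lin; apply/(A2TP F); exists (k * g1 + h1), (k * g2 + h2), (k * g3 + h3).
by [].
Qed.

Lemma A2T0 t : A2T t 0.
Proof.
have [A [B [C [eA [eB [eC F]]]]]] := tframe_exists t.
have h : A2T t (pw3 eA eB eC (fun=> 0) (fun=> 0) (fun=> 0)) by apply/(A2TP F); do 3 eexists.
by have := A2T_lin (-1) h h; rewrite scaleN1r addNr.
Qed.

Lemma svenT_A2T t u : A1T t u -> A2T t (svenT t u).
Proof.
have [A [B [C [eA [eB [eC F]]]]]] := tframe_exists t.
move=> /(A1T_rays F)[uA [uB [uC [rc jc ->]]]].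
by rewrite (svenT_frame F rc jc); apply/(A2TP F); do 3 eexists.
Qed.

Lemma svenT_lin t (k : R) (u u' : mfield) : A1T t u -> A1T t u' ->
  svenT t (k *: u + u') = k *: svenT t u + svenT t u'.
Proof.
have [A [B [C [eA [eB [eC F]]]]]] := tframe_exists t.
move=> /(A1T_rays F)[uA [uB [uC [rc jc ->]]]] /(A1T_rays F)[wA [wB [wC [rw jw ->]]]].
rewrite pw3_lin -!mq_slin (svenT_frame F rc jc) (svenT_frame F rw jw).
rewrite (svenT_frame F (ray_conds_lin k rc rw) (jumps0_lin k jc jw)) pw3_lin.
by rewrite !sven_const_lin.
Qed.

Lemma svenT_defT t v : A0T t v -> svenT t (defT v) = 0.
Proof.
have [A [B [C [eA [eB [eC F]]]]]] := tframe_exists t.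
move=> /(A0TP F)[vA [vB [vC [hv ->]]]]; rewrite defT_pw3.
have [rc jc] := defq_star (tframe_star F) hv.
rewrite (svenT_frame F rc jc) !sven_const_defq; apply/funext => e; rewrite /pw3.
by do 3 case: ifP => // _.
Qed.

Lemma dotq_vlin T k v v' : dotq T (vlin k v v') = qlin k (dotq T v) (dotq T v').
Proof.
apply: qv_inj; apply/funext => x; rewrite qv_lin !qv_dotq vq_vlin.
by move: (vq v) (vq v') => f f'; rewrite /dot /= /GRing.scale /=; ring.
Qed.

Lemma res0ET_lin t e (k : R) (u u' : vfield) : tedge t e -> A0T t u -> A0T t u' ->
  res0ET e (k *: u + u') = k *: res0ET e u + res0ET e u'.
Proof.
move=> te hu hu'; have [v Ev] := A0T_edge hu te; have [v' Ev'] := A0T_edge hu' te.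
have Es : (k *: u + u') e = vq (vlin k v v') by rewrite vq_vlin -Ev -Ev'.
rewrite (res0ET_vq Ev) (res0ET_vq Ev') (res0ET_vq Es).
have S (f g h f' g' h' : R -> R) : k *: (f, g, h) + (f', g', h') =
  (k *: f + f', k *: g + g', k *: h + h') by [].
rewrite S; congr (_, _, _); apply/funext => s; rewrite !fctE /GRing.scale /=.
- by rewrite dotq_vlin qv_lin.
- by rewrite dotq_vlin qv_lin.
- by rewrite dotq_vlin dirq_qlin qv_lin.
Qed.

Lemma A1T_edge t u e : A1T t u -> tedge t e -> exists w, u e = mq w.
Proof.
have [A [B [C [eA [eB [eC F]]]]]] := tframe_exists t.
move=> /(A1T_rays F)[uA [uB [uC [rc jc ->]]]].
have [E1 E2 E3] := pw3E F (mq uA) (mq uB) (mq uC).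
by move=> /(tedgeP F)[] ->; rewrite ?E1 ?E2 ?E3; eexists.
Qed.

Lemma res1ET_lin t e (k : R) (u u' : mfield) : tedge t e -> A1T t u -> A1T t u' ->
  res1ET e (k *: u + u') = k *: res1ET e u + res1ET e u'.
Proof.
move=> te hu hu'; have [v Ev] := A1T_edge hu te; have [v' Ev'] := A1T_edge hu' te.
have Es : (k *: u + u') e = mq (slin k v v') by rewrite mq_slin -Ev -Ev'.
rewrite (res1ET_mq Ev) (res1ET_mq Ev') (res1ET_mq Es).
have S (f g h f' g' h' : R -> R) : k *: (f, g, h) + (f', g', h') =
  (k *: f + f', k *: g + g', k *: h + h') by [].
rewrite S; move: (epoint e) (tau e) (nu e) => P T N.
congr (_, _, _); apply/funext => s; rewrite !fctE /GRing.scale /=.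
- by rewrite !qv_qform /slin /= !qv_lin; ring.
- by rewrite !qv_qform /slin /= !qv_lin; ring.
rewrite [qform (slin _ _ _).1.1 _ _ _ _](_ : _ = qlin k (qform v.1.1 v.1.2 v.2 T T)
  (qform v'.1.1 v'.1.2 v'.2 T T)); first by rewrite dirq_qlin qv_lin.
by apply: qv_inj; apply/funext => y; rewrite qv_lin !qv_qform /slin /= !qv_lin; ring.
Qed.

Lemma res1ET0 t e : tedge t e -> res1ET e (0 : mfield) = 0.
Proof.
move=> te; have h := A1T_W (W0 t).
by have := res1ET_lin (-1) te h h; rewrite !scaleN1r !addNr.
Qed.

Lemma res0ET_dif t e v : tedge t e -> A0T t v -> res1ET e (defT v) = difE (res0ET e v).
Proof.
move=> te hv; have [w Ew] := A0T_edge hv te; apply: (res1_def Ew).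
by rewrite /defT Ew; apply/funext => x; rewrite def_vq.
Qed.

Lemma res0ET_fe t e v : tedge t e -> A0T t v -> A0E (res0ET e v).
Proof. by move=> te hv; have [w Ew] := A0T_edge hv te; exact: res0ET_A0E Ew. Qed.

Lemma vertex_edge t V : V \in val t -> exists e, tedge t e && (V \in val e).
Proof.
move=> /tframe_vertex[B [C [eA [eB [eC F]]]]]; exists eC.
by have [_ _ ->] := tedges F; have [_ _ [_ _ ->]] := F; rewrite !finset.inE eqxx.
Qed.

Lemma res0VT_lin t V (k : R) (u u' : vfield) : V \in val t -> A0T t u -> A0T t u' ->
  res0VT V t (k *: u + u') = k *: res0VT V t u + res0VT V t u'.
Proof.
move=> /vertex_edge[e /andP[te Ve]] hu hu'.
rewrite (res0VT_edge (A0T_lin k hu hu') te Ve) (res0VT_edge hu te Ve) (res0VT_edge hu' te Ve).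
by rewrite (res0ET_lin k te hu hu') (res0VE_lin _ _ _ (res0ET_fe te hu) (res0ET_fe te hu')).
Qed.

Lemma A1T_frame t A B C eA eB eC u : tframe t A B C eA eB eC -> A1T t u ->
  exists v w k1 k2 k3, [/\ A0T t v, W t w, u = defT v + w,
    let o := center t in let a := pos A - o in let b := pos B - o in let c := pos C - o in
    let S := k1 + k2 + k3 in let D := crs b c + crs c a + crs a b in
    exists g1 g2 g3 : R,
    [/\ svenT t u = pw3 eA eB eC (fun=> g1) (fun=> g2) (fun=> g3),
        crs b c * g1 = S * (1 - 2 * crs b c / D) - 3 * k1,
        crs c a * g2 = S * (1 - 2 * crs c a / D) - 3 * k2
      & crs a b * g3 = S * (1 - 2 * crs a b / D) - 3 * k3] &
    [/\ res1ET eA w = (0, 0, ql (osgn t eA * k1 / len eA) 0 0),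
        res1ET eB w = (0, 0, ql (osgn t eB * k2 / len eB) 0 0)
      & res1ET eC w = (0, 0, ql (osgn t eC * k3 / len eC) 0 0)]].
Proof.
move=> F [v [w [hv hw E]]]; have FB := tframe_rot F; have FC := tframe_rot FB.
have := hw => /(WP F)[uA [uB [uC [[k1 [k2 [k3 Ws]]] [js Ew]]]]].
exists v, w, k1, k2, k3; split => //.
  move=> o a b c S D; have [s1 s2 s3] := Wstar_sven (tframe_star F) Ws js.
  do 3 eexists; split; [|exact: s1|exact: s2|exact: s3].
  rewrite E -[defT v]scale1r svenT_lin ?svenT_defT //; last 2 first.
  - exact: A1T_def.
  - exact: A1T_W.
  by rewrite scaler0 add0r Ew (svenT_frame F (Wstar_rays Ws) js).
(* [res1_A1T] is applied with a zero [def] part, to isolate the trace of the component in [W]. *)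
pose z : vecq R := (zq R, zq R).
have E0 : mq (defq z) = 0.
  by apply/funext => x; rewrite -def_vq vq_zero def_zero.
have P0 : pw3 eA eB eC (vq z) (vq z) (vq z) = 0.
  by rewrite vq_zero; apply/funext => e; rewrite /pw3; do 3 case: ifP => // _.
have R0 e : tedge t e -> difE (res0ET e (pw3 eA eB eC (vq z) (vq z) (vq z))) = 0.
  by move=> te; rewrite P0 -(res0ET_dif te (A0T0 t)) defT0 (res1ET0 te).
have X A' B' C' e1 e2 e3 (x1 x2 x3 : symq R) l1 l2 l3 : tframe t A' B' C' e1 e2 e3 ->
   pw3 e1 e2 e3 (vq z) (vq z) (vq z) = pw3 eA eB eC (vq z) (vq z) (vq z) ->
   Wstar (center t) (pos A' - center t) (pos B' - center t) (pos C' - center t) x1 x2 x3 l1 l2 l3 ->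
   res1ET e1 (pw3 e1 e2 e3 (mq x1) (mq x2) (mq x3)) = (0, 0, ql (osgn t e1 * l1 / len e1) 0 0).
  move=> G hp hx; have [te _ _] := tedges G; have := res1_A1T G z z z hx.
  by rewrite !mq_slin !E0 !scaler0 !add0r hp (R0 _ te) add0r !ql_zero => ->.
have w2 := pw3_rot (mq uA) (mq uB) (mq uC) F; have w3 := pw3_rot (mq uB) (mq uC) (mq uA) FB.
have z2 := pw3_rot (vq z) (vq z) (vq z) F; have z3 := pw3_rot (vq z) (vq z) (vq z) FB.
have Ws2 := Wstar_rot Ws; have Ws3 := Wstar_rot Ws2.
have x2 := X _ _ _ _ _ _ _ _ _ _ _ _ FB (esym z2) Ws2.
have x3 := X _ _ _ _ _ _ _ _ _ _ _ _ FC (esym (etrans z2 z3)) Ws3.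
rewrite Ew; split; [exact: X F erefl Ws|by rewrite w2|by rewrite w2 w3].
Qed.

Lemma pairT_lin t (k : R) (g g' : sfield) phi : A2T t g -> A2T t g' ->
  pairT t (k *: g + g') phi = k * pairT t g phi + pairT t g' phi.
Proof.
have [A [B [C [eA [eB [eC F]]]]]] := tframe_exists t.
move=> /(A2TP F)[g1 [g2 [g3 ->]]] /(A2TP F)[h1 [h2 [h3 ->]]]; rewrite pw3_lin.
rewrite (pairT_frame g1 g2 g3 phi F) (pairT_frame h1 h2 h3 phi F).
have := pairT_frame (k * g1 + h1) (k * g2 + h2) (k * g3 + h3) phi F => /= ->.
by move: (aff2 _ _) (dot _ (_ A - _)) (dot _ (_ B - _)) (dot _ (_ C - _)) (crs _ _) (crs _ _) (crs _ _) => *; ring.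
Qed.

(* [Gk] is twice the integral of the field over the piece [k]. *)
Lemma pairT_moments t A B C eA eB eC (g1 g2 g3 : R) phi : tframe t A B C eA eB eC ->
  let o := center t in let a := pos A - o in let b := pos B - o in let c := pos C - o in
  let G1 := crs b c * g1 in let G2 := crs c a * g2 in let G3 := crs a b * g3 in
  let S := G1 + G2 + G3 in
  pairT t (pw3 eA eB eC (fun=> g1) (fun=> g2) (fun=> g3)) phi =
  S / 2 * phi.1 + dot phi.2 (S / 2 *: o + 6^-1 *: (S *: (a + b + c) - (G1 *: a + G2 *: b + G3 *: c))).
Proof.
move=> F o a b c G1 G2 G3 S; rewrite (pairT_frame g1 g2 g3 phi F) -/o -/a -/b -/c -/G1 -/G2 -/G3.
rewrite /S {S}; move: G1 G2 G3 => x1 x2 x3; rewrite /aff2; move: phi o a b c => [p [m n]] [z1 z2] [y1 y2] [v1 v2] [w1 w2].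
by rewrite /dot /= /GRing.scale /=; field.
Qed.

Lemma pairT_linear t g (k : R) (phi phi' : R * (R * R)) : A2T t g ->
  pairT t g (k *: phi + phi') = k * pairT t g phi + pairT t g phi'.
Proof.
have [A [B [C [eA [eB [eC F]]]]]] := tframe_exists t.
move=> /(A2TP F)[g1 [g2 [g3 ->]]]; rewrite !(pairT_moments _ _ _ _ F) /=.
move: (_ + _ + _) (_ + _ *: _) => S v.
by rewrite /dot /= /GRing.scale /= /GRing.scale /=; ring.
Qed.

(** Three constants face a three-dimensional space of affine functions, and the moment formula can
    be inverted explicitly. *)
Lemma pairT_rep t (l : R * (R * R) -> R) :
  (forall (k : R) phi phi', l (k *: phi + phi') = k * l phi + l phi') ->
  exists2 g, A2T t g & forall phi, pairT t g phi = l phi.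
Proof.
move=> ll; have [A [B [C [eA [eB [eC F]]]]]] := tframe_exists t.
set o := center t; set a := pos A - o; set b := pos B - o; set c := pos C - o.
have [A0 B0 C0] : star a b c := tframe_star F.
have ar : crs (a - c) (b - c) != 0.
  have -> : crs (a - c) (b - c) = crs b c + crs c a + crs a b by rewrite /crs /=; ring.
  by rewrite gt_eqF // (star_area_gt0 (tframe_star F)).
have l0 : l 0 = 0 by have := ll (-1) 0 0; rewrite scaleN1r addNr mulN1r addNr.
pose k := l (1, 0); pose v : R * R := (l (0, (1, 0)), l (0, (0, 1))).
have El phi : l phi = k * phi.1 + dot phi.2 v.
  have E : phi = phi.1 *: (1, 0) + (phi.2.1 *: (0, (1, 0)) + (phi.2.2 *: (0, (0, 1)) + 0)).
    by case: phi => [p [m n]]; apply: injective_projections; [|apply: injective_projections];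
      rewrite /= /GRing.scale /= ?/GRing.scale /=; ring.
  by rewrite {1}E !ll l0 /k /v /dot /=; ring.
(* By [pairT_moments], constants determine the total [S] and gradients determine
   [w = G1 a + G2 b + G3 c]. Cramer's rule in the basis [a - c], [b - c] then yields [G1] and
   [G2]. *)
pose S := 2 * k; pose w := S *: (a + b + c) - 6 *: (v - k *: o).
pose G1 := crs (w - S *: c) (b - c) / crs (a - c) (b - c).
pose G2 := crs (a - c) (w - S *: c) / crs (a - c) (b - c).
pose G3 := S - G1 - G2.
have Gw : G1 *: a + G2 *: b + G3 *: c = w.
  have cramer : crs (a - c) (b - c) *: (w - S *: c) =
      crs (w - S *: c) (b - c) *: (a - c) + crs (a - c) (w - S *: c) *: (b - c).
    by move: (w - _) (a - c) (b - c) => x y z; apply: injective_projections; rewrite /crs /= /GRing.scale /=; ring.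
  have : w - S *: c = G1 *: (a - c) + G2 *: (b - c).
    rewrite -[LHS]scale1r -(mulVf ar) -scalerA cramer scalerDr !scalerA /G1 /G2.
    by rewrite ![_^-1 * _]mulrC.
  move=> /(congr1 (fun x => x + S *: c)); rewrite subrK => ->.
  have X (x y z : R * R) (r1 r2 r : R) : r1 *: x + r2 *: y + (r - r1 - r2) *: z =
      r1 *: (x - z) + r2 *: (y - z) + r *: z.
    by apply: injective_projections; rewrite /= /GRing.scale /=; ring.
  exact: X.
exists (pw3 eA eB eC (fun=> G1 / crs b c) (fun=> G2 / crs c a) (fun=> G3 / crs a b)).
  by apply/(A2TP F); do 3 eexists.
move=> phi; rewrite (pairT_moments _ _ _ _ F) -/o -/a -/b -/c.
have D (x y : R) : 0 < y -> y * (x / y) = x by move=> y0; rewrite mulrC divfK // gt_eqF.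
rewrite /= !D // Gw El; have -> : G1 + G2 + G3 = S by rewrite /G3; ring.
rewrite /w /S; move: (a + b + c) => z; congr (_ * _ + dot _ _); first by field.
by apply: injective_projections; rewrite /= /GRing.scale /=; field.
Qed.

(** Zero moments give [G1 + G2 + G3 = 0] and [G1 a + G2 b + G3 c = 0]; affine independence of [a],
    [b], [c] does the rest. *)
Lemma pairT_eq0 t g : A2T t g -> (forall phi, pairT t g phi = 0) -> g = 0.
Proof.
have [A [B [C [eA [eB [eC F]]]]]] := tframe_exists t.
move=> /(A2TP F)[g1 [g2 [g3 ->]]] h.
have {h} h phi := etrans (esym (pairT_moments g1 g2 g3 phi F)) (h phi).
move: h => /=; set o := center t; set a := pos A - o; set b := pos B - o; set c := pos C - o.
have [A0 B0 C0] : star a b c := tframe_star F.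
have ar : crs (a - c) (b - c) != 0.
  have -> : crs (a - c) (b - c) = crs b c + crs c a + crs a b by rewrite /crs /=; ring.
  by rewrite gt_eqF // (star_area_gt0 (tframe_star F)).
set G1 := crs b c * g1; set G2 := crs c a * g2; set G3 := crs a b * g3 => h.
have S0 : G1 + G2 + G3 = 0.
  have := h (2, 0); rewrite /dot /= !mul0r !addr0 => <-; by field.
have w0 : G1 *: a + G2 *: b + G3 *: c = 0.
  move: h; rewrite S0; set w := _ + G3 *: c => h.
  have w1 : w.1 = 0 by have := h (0, (-6, 0)); rewrite /dot /= /GRing.scale /= => <-; field.
  have w2 : w.2 = 0 by have := h (0, (0, -6)); rewrite /dot /= /GRing.scale /= => <-; field.
  exact: injective_projections.
have X1 (x y z : R * R) (k1 k2 k3 : R) : k1 * crs (x - z) (y - z) =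
    crs (k1 *: x + k2 *: y + k3 *: z - (k1 + k2 + k3) *: z) (y - z).
  by rewrite /crs /= /GRing.scale /=; ring.
have X2 (x y z : R * R) (k1 k2 k3 : R) : k2 * crs (x - z) (y - z) =
    crs (x - z) (k1 *: x + k2 *: y + k3 *: z - (k1 + k2 + k3) *: z).
  by rewrite /crs /= /GRing.scale /=; ring.
have G10 : G1 = 0.
  apply: (mulIf ar); rewrite mul0r.
  by rewrite (X1 a b c G1 G2 G3) w0 S0 scale0r subr0 /crs /= !mul0r subr0.
have G20 : G2 = 0.
  apply: (mulIf ar); rewrite mul0r.
  by rewrite (X2 a b c G1 G2 G3) w0 S0 scale0r subr0 /crs /= !mulr0 subr0.
have G30 : G3 = 0 by move: S0; rewrite G10 G20 !add0r.
have Z (x y : R) : 0 < x -> x * y = 0 -> y = 0.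
  by move=> x0 /eqP; rewrite mulf_eq0 gt_eqF //= => /eqP.
rewrite (Z _ _ A0 G10) (Z _ _ B0 G20) (Z _ _ C0 G30).
by apply/funext => e; rewrite /pw3; do 3 case: ifP => // _.
Qed.

(** The [def] part contributes a coboundary to each edge, hence nothing to the oriented sum. The
    part in [W] contributes the integrals of [phi] against constants, to be compared with the
    explicit values of sven. *)
Lemma ev_sven t u phi : A1T t u ->
  pairT t (svenT t u) phi = osum t (fun e => pairE e (res1ET e u) (sET e phi)).
Proof.
have [A [B [C [eA [eB [eC F]]]]]] := tframe_exists t.
have FB := tframe_rot F; have FC := tframe_rot FB; have [tA tB tC] := tedges F.
move=> /(A1T_frame F)[v [w [k1 [k2 [k3 [hv hw -> [g1 [g2 [g3 [-> s1 s2 s3]]]] [w1 w2 w3]]]]]]].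
have Ad := A1T_def hv; have Aw := A1T_W hw.
have zE (r : R) : A1E (0, 0, ql r 0 0) by apply/A1EP; exists 0, 0, 0, 0, r; rewrite ql_zero.
pose x V := res0VT V t v.
have D e' : tedge t e' -> pairE e' (difE (res0ET e' v)) (sET e' phi) = cobE e' x (sET e' phi).
  move=> te'; rewrite (ev_difE e' _ (res0ET_fe te' hv)) /cobE /x.
  have [E _] := edge_ends e'.
  by rewrite !(res0VT_edge hv te') // E !finset.inE eqxx ?orbT.
have X A' B' C' e1 e2 e3 (k : R) : tframe t A' B' C' e1 e2 e3 ->
    res1ET e1 w = (0, 0, ql (osgn t e1 * k / len e1) 0 0) ->
    osgn t e1 * pairE e1 (res1ET e1 (defT v + w)) (sET e1 phi) =
    osgn t e1 * cobE e1 x (sET e1 phi) - k / 2 * (aff2 phi (pos B') + aff2 phi (pos C')).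
  move=> G hr; have [te1 _ _] := tedges G.
  have -> : defT v + w = 1 *: defT v + w by rewrite scale1r.
  rewrite (res1ET_lin 1 te1 Ad Aw) hr pairE_lin //; last first.
    by rewrite (res0ET_dif te1 hv); exact: difE_A1E (res0ET_fe te1 hv).
  rewrite (res0ET_dif te1 hv) D // mul1r mulrDr; congr (_ + _).
  rewrite -[X in (X, X, _)]ql_zero pairE_ql /sET /=.
  have l0 := lt0r_neq0 (len_gt0 e1); have sg := osgn_sqr G.
  have E : aff2 phi (pos (head e1)) = aff2 phi (pos (tail e1)) + len e1 * dot phi.2 (tau e1).
    by rewrite head_tail /aff2; move: (tau e1) => T; rewrite /dot /= /GRing.scale /=; ring.
  have -> : aff2 phi (pos B') + aff2 phi (pos C') = aff2 phi (pos (head e1)) + aff2 phi (pos (tail e1)).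
    by case: (side_orient G) => -[-> -> _]; rewrite // addrC.
  rewrite E; move: (aff2 _ _) (dot _ _) (dot _ _) (len e1) l0 (osgn t e1) sg => p q r L L0 s ss.
  transitivity (- (s * s) * (k / 2) * (p + L * q + p)); first by field.
  by rewrite ss; ring.
rewrite (osum_frame _ F) (X _ _ _ _ _ _ _ F w1) (X _ _ _ _ _ _ _ FB w2) (X _ _ _ _ _ _ _ FC w3).
transitivity (osum t (fun e => cobE e x (sET e phi)) - k1 / 2 * (aff2 phi (pos B) + aff2 phi (pos C))
  - k2 / 2 * (aff2 phi (pos C) + aff2 phi (pos A)) - k3 / 2 * (aff2 phi (pos A) + aff2 phi (pos B))); last first.
  by rewrite (osum_frame _ F); ring.
rewrite osum_cobE add0r (pairT_frame g1 g2 g3 phi F).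
have Ep V : aff2 phi (pos V) = aff2 phi (center t) + dot phi.2 (pos V - center t).
  by rewrite /aff2 /dot /=; ring.
rewrite s1 s2 s3 !Ep; have := crs_relation (pos A - center t) (pos B - center t) (pos C - center t) phi.2.
have D0 := lt0r_neq0 (star_area_gt0 (tframe_star F)).
move: (crs _ _) (crs _ _) (crs _ _) D0 => ga be al D0.
have dC (p q : R * R) : dot p q = dot q p by rewrite /dot; ring.
rewrite !(dC _ phi.2); move: (dot _ (pos A - _)) (dot _ (pos B - _)) (dot _ (pos C - _)) (aff2 phi _).
(* The two sides differ by a multiple of the linear relation between [a], [b] and [c], paired with
   the gradient of [phi]. *)
move=> p q r f h; apply/eqP; rewrite -subr_eq0; apply/eqP.
transitivity ((k1 + k2 + k3) / (3 * (al + be + ga)) * (al * p + be * q + ga * r)); last by rewrite h mulr0.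
by field.
Qed.

Lemma res1ET_fe t e u : tedge t e -> A1T t u -> A1E (res1ET e u).
Proof.
move=> te hu; have [A [B [C [eA [eB [eC F]]]]]] := tframe_exists t.
have [v [w [k1 [k2 [k3 [hv hw -> _ [w1 w2 w3]]]]]]] := A1T_frame F hu.
have hA : A1E (res1ET e w).
  have zE (r : R) : A1E (0, 0, ql r 0 0) by apply/A1EP; exists 0, 0, 0, 0, r; rewrite ql_zero.
  by case: (tedgeP F te) => ->; rewrite ?w1 ?w2 ?w3; exact: zE.
rewrite -[defT v]scale1r (res1ET_lin 1 te (A1T_def hv) (A1T_W hw)).
by apply: A1E_lin => //; rewrite (res0ET_dif te hv); exact: difE_A1E (res0ET_fe te hv).
Qed.

Lemma W_sven_surj t g : A2T t g -> exists2 w, W t w & svenT t w = g.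
Proof.
have [A [B [C [eA [eB [eC F]]]]]] := tframe_exists t.
move=> /(A2TP F)[g1 [g2 [g3 ->]]].
set o := center t; set a := pos A - o; set b := pos B - o; set c := pos C - o.
have [A0 B0 C0] : star a b c := tframe_star F.
have D0 := lt0r_neq0 (star_area_gt0 (tframe_star F)); rewrite -/o -/a -/b -/c in D0.
pose D := crs b c + crs c a + crs a b.
(* The sum of the three side constants is forced: adding the formulas for sven gives
   [3 S - 2 S - 3 S = - 2 S]. *)
pose S := - (crs b c * g1 + crs c a * g2 + crs a b * g3) / 2.
pose kk (al g : R) := (S * (1 - 2 * al / D) - al * g) / 3.
have [uA [uB [uC [Ws js [s1 s2 s3]]]]] :=
  Wstar_exists o (kk (crs b c) g1) (kk (crs c a) g2) (kk (crs a b) g3) (tframe_star F).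
have ES : kk (crs b c) g1 + kk (crs c a) g2 + kk (crs a b) g3 = S.
  rewrite /kk /S /D; move: (crs b c) (crs c a) (crs a b) D0 => al be ga D0.
  by field.
rewrite -/o -/a -/b -/c -/D ES in s1 s2 s3.
have Z (al r k : R) : 0 < al -> al * k = S * (1 - 2 * al / D) - 3 * kk al r -> k = r.
  move=> al0 h; apply: (mulfI (lt0r_neq0 al0)); rewrite h /kk.
  by move: (S * _) => m; field.
exists (pw3 eA eB eC (mq uA) (mq uB) (mq uC)).
  by apply/(WP F); exists uA, uB, uC; split; [do 3 eexists; exact: Ws|split].
by rewrite (svenT_frame F (Wstar_rays Ws) js) (Z _ _ _ A0 s1) (Z _ _ _ B0 s2) (Z _ _ _ C0 s3).
Qed.

Lemma sven_kernel t u : A1T t u -> svenT t u = 0 -> exists2 v, A0T t v & u = defT v.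
Proof.
move=> [v [w [hv hw ->]]] h; exists v => //.
have {}h : svenT t w = 0.
  rewrite -h -[X in _ = svenT t (X + _)]scale1r svenT_lin ?svenT_defT ?scaler0 ?add0r //.
    exact: A1T_def.
  exact: A1T_W.
have [A [B [C [eA [eB [eC F]]]]]] := tframe_exists t.
move: hw h => /(WP F)[uA [uB [uC [[k1 [k2 [k3 Ws]]] [js ->]]]]].
rewrite (svenT_frame F (Wstar_rays Ws) js) => h.
have Z3 : pw3 eA eB eC (fun=> 0 : R) (fun=> 0) (fun=> 0) = 0.
  by apply/funext => e; rewrite /pw3; do 3 case: ifP => // _.
rewrite -Z3 in h; have [z1 z2 z3] := pw3_inj F h.
have z (x : R) : (fun _ : R * R => x) = (fun=> 0) -> x = 0 by move=> /(congr1 (fun f => f 0)).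
by rewrite (W_sven_inj F Ws js (z _ z1) (z _ z2) (z _ z3)) addr0.
Qed.

Lemma difE_kernel_end e V u : V \in val e -> A0E u -> difE u = 0 -> res0VE V e u = 0 -> u = 0.
Proof.
move=> Ve hu du hV; apply: (@difE_kernel _ _ e) => //.
apply: pairV_inj => m; have p0 m' : pairV (0 : R3) m' = 0 by rewrite /pairV /dot /=; ring.
have [E _] := edge_ends e; move: Ve hV; rewrite E !finset.inE => /orP[] /eqP -> hV; first by rewrite hV.
have := ev_difE e (sVE_inv (tail e) e m) hu; rewrite du hV !p0 sVE_invK.
have -> : (0 : efield) = (ql 0 0 0, ql 0 0 0, ql 0 0 0) by rewrite ql_zero.
by rewrite pairE_ql => h; move/eqP: h; rewrite !(mul0r, mulr0, subr0, addr0) sub0r eq_sym oppr_eq0 => /eqP.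
Qed.

(** The rigid motion [x |-> y.1 + y.2 *: rot (x - pos A)], with value [y.1] and half curl [y.2] at
    [A]. *)
Definition rigid t (A : vert) (y : R3) : vecq R :=
  (Quadr (y.1.1 + y.2 * (pos A).2) 0 (- y.2) 0 0 0, Quadr (y.1.2 - y.2 * (pos A).1) y.2 0 0 0 0).

Lemma A1T_unique t u : A1T t u -> (forall e, tedge t e -> res1ET e u = 0) -> u = 0.
Proof.
move=> hu h; have [A [B [C [eA [eB [eC F]]]]]] := tframe_exists t.
have [tA tB tC] := tedges F; have [hval _ [sA sB sC]] := F.
have s0 : svenT t u = 0.
  apply: (pairT_eq0 (svenT_A2T hu)) => phi; rewrite ev_sven // /osum big1 // => e te.
  have -> : res1ET e u = (ql 0 0 0, ql 0 0 0, ql 0 0 0) by rewrite h // ql_zero.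
  by rewrite pairE_ql; ring.
have [v hv Eu] := sven_kernel hu s0.
pose r := rigid t A (res0VT A t v); pose z := pw3 eA eB eC (vq r) (vq r) (vq r).
have hz : A0T t z.
  by apply/(A0TP F); exists r, r, r; split => //; split; split.
have dz : defT z = 0.
  have r0 : mq (defq r) = 0.
    apply: mq_eq0 => x; rewrite /r /rigid; move: (res0VT A t v) (pos A) => y p.
    by split; rewrite /defq /qlin /qd1 /qd2 /qv /=; field.
  by rewrite /z defT_pw3 r0; apply/funext => e; rewrite /pw3; do 3 case: ifP => // _.
have At : A \in val t by rewrite hval !finset.inE eqxx.
have AC : A \in val eC by rewrite sC !finset.inE eqxx.
have zA : res0VT A t z = res0VT A t v.
  have [_ _ zC] := pw3E F (vq r) (vq r) (vq r).
  rewrite (res0VT_edge hz tC AC) (res0VE_vq AC zC) /r /rigid.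
  move: (res0VT A t v) (pos A) => y p; rewrite /vq /curlq /qlin /qd1 /qd2 /qv /=.
  by apply: injective_projections; [apply: injective_projections|]; rewrite /=; field.
pose d := -1 *: z + v; have hd : A0T t d by exact: A0T_lin.
have dd : defT d = u by rewrite (defT_lin _ hz hv) dz scaler0 add0r -Eu.
have dA : res0VT A t d = 0 by rewrite (res0VT_lin _ At hz hv) zA scaleN1r addNr.
(* Vanishing propagates along the boundary: from [A] to the edges [eC] and [eB], then through [B] to
   [eA]. *)
have step e V : tedge t e -> V \in val e -> res0VT V t d = 0 -> res0ET e d = 0.
  move=> te Ve hV; apply: (difE_kernel_end Ve (res0ET_fe te hd)).
    by rewrite -(res0ET_dif te hd) dd h.
  by rewrite -(res0VT_edge hd te Ve).
have AB : A \in val eB by rewrite sB !finset.inE eqxx orbT.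
have BC : B \in val eC by rewrite sC !finset.inE eqxx orbT.
have BA : B \in val eA by rewrite sA !finset.inE eqxx.
have dC := step _ _ tC AC dA; have dB := step _ _ tB AB dA.
have vB : res0VT B t d = 0.
  rewrite (res0VT_edge hd tC BC) dC.
  have h0 : A0E (0 : efield) by rewrite -dC; exact: res0ET_fe tC hd.
  by have := res0VE_lin B eC (-1) h0 h0; rewrite !scaleN1r !addNr.
have dA' := step _ _ tA BA vB.
have d0 : d = 0 by apply: (A0T_eq0 hd) => e /(tedgeP F)[] ->.
by rewrite -dd d0 defT0.
Qed.

(** A concrete mean-zero function, so that flabbiness and exactness can use the edge lemmas without
    reference to the given [chi]. *)
Definition chi0 e : R * R := (- (len e / 2), 1).

Lemma chi0_neq0 e : chi0 e != 0.
Proof. by apply/eqP => -[_ /eqP]; rewrite oner_eq0. Qed.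

Lemma chi0_mean0 e : eint e (aff1 (chi0 e)) = 0.
Proof. by rewrite aff1_ql eint_ql /=; field. Qed.

Lemma chi_lin e (c : R * R) (k : R) u u' : eint e (aff1 c) = 0 -> A1E u -> A1E u' ->
  eint e (fun s => (k *: u + u').1.1 s * aff1 c s) =
    k * eint e (fun s => u.1.1 s * aff1 c s) + eint e (fun s => u'.1.1 s * aff1 c s) /\
  eint e (fun s => (k *: u + u').1.2 s * aff1 c s) =
    k * eint e (fun s => u.1.2 s * aff1 c s) + eint e (fun s => u'.1.2 s * aff1 c s).
Proof.
move=> hc /A1EP[p0 [p1 [q0 [q1 [r0 ->]]]]] /A1EP[x0 [x1 [y0 [y1 [z0 ->]]]]].
have -> : k *: (ql p0 p1 0, ql q0 q1 0, ql r0 0 0) + (ql x0 x1 0, ql y0 y1 0, ql z0 0 0) =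
  (k *: ql p0 p1 0 + ql x0 x1 0, k *: ql q0 q1 0 + ql y0 y1 0, k *: ql r0 0 0 + ql z0 0 0) by [].
by rewrite !ql_lin mulr0 addr0 /= !(chi_moment hc); split; ring.
Qed.

(** [A0E_exists] prescribes the end values, hence all pairings of [difE u], together with its two
    moments; by [A1E_unique] nothing else is left of [f]. *)
Lemma A0E_potential e (f : efield) (x : vert -> R3) : A1E f ->
  (forall m, pairE e f m = cobE e x m) ->
  exists2 u, A0E u & difE u = f /\ (forall V, V \in val e -> res0VE V e u = x V).
Proof.
move=> hf hx; have [u hu [ht hd c1 c2]] :=
  A0E_exists (chi0_neq0 e) (chi0_mean0 e) (x (tail e)) (x (head e))
    (eint e (fun s => f.1.1 s * aff1 (chi0 e) s)) (eint e (fun s => f.1.2 s * aff1 (chi0 e) s)).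
have hA := difE_A1E hu.
exists u => //; split; last first.
  by move=> V; have [-> _] := edge_ends e; rewrite !finset.inE => /orP[] /eqP ->.
have [l1 l2] := chi_lin (-1) (chi0_mean0 e) hf hA.
apply/eqP; rewrite -subr_eq0 addrC -scaleN1r; apply/eqP.
apply: (A1E_unique (chi0_neq0 e) (chi0_mean0 e) (A1E_lin (-1) hf hA)).
- move=> m; rewrite (pairE_lin _ _ _ hf hA) (ev_difE _ _ hu) ht hd hx // mulN1r.
  by rewrite /cobE addNr.
- by rewrite l1 c1 mulN1r addNr.
- by rewrite l2 c2 mulN1r addNr.
Qed.

Lemma A0T_potential t (f : edge -> efield) (x : vert -> R3) :
  (forall e, tedge t e -> A1E (f e)) ->
  (forall e, tedge t e -> forall m, pairE e (f e) m = cobE e x m) ->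
  exists2 u, A0T t u & (forall e, tedge t e -> difE (res0ET e u) = f e) /\
    (forall V, V \in val t -> res0VT V t u = x V).
Proof.
move=> hf hx.
have /choice[h hh] : forall e, exists u, tedge t e ->
    A0E u /\ (difE u = f e /\ forall V, V \in val e -> res0VE V e u = x V).
  move=> e; have [te|_] := boolP (tedge t e); last by exists 0.
  by have [u hu H] := A0E_potential (hf _ te) (hx _ te); exists u.
have [u hu [u1 u2]] := @A0T_extend _ _ t h x (fun e te => (hh e te).1)
  (fun e V te Ve => (hh e te).2.2 V Ve).
by exists u => //; split => // e te; rewrite u1 // (hh e te).2.1.
Qed.

Lemma A0T_constant t (x : vert -> R3) : (forall e, tedge t e -> forall m, cobE e x m = 0) ->
  exists2 u, A0T t u & defT u = 0 /\ (forall V, V \in val t -> res0VT V t u = x V).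
Proof.
move=> hx; have E0 : (0 : efield) = (ql 0 0 0, ql 0 0 0, ql 0 0 0) by rewrite ql_zero.
have [u hu [u1 u2]] : exists2 u, A0T t u & (forall e, tedge t e -> difE (res0ET e u) = 0) /\
    (forall V, V \in val t -> res0VT V t u = x V).
  apply: (A0T_potential (f := fun=> 0)) => e te.
    by apply/A1EP; exists 0, 0, 0, 0, 0; rewrite E0.
  by move=> m; rewrite E0 pairE_ql hx //; ring.
exists u => //; split => //; apply: (A1T_unique (A1T_def hu)) => e te.
by rewrite (res0ET_dif te hu) u1.
Qed.

Lemma A1T_extend t (f : edge -> efield) : (forall e, tedge t e -> A1E (f e)) ->
  exists2 u, A1T t u & forall e, tedge t e -> res1ET e u = f e.
Proof.
move=> hf; have sl e (k : R) (phi phi' : R * (R * R)) : sET e (k *: phi + phi') = k *: sET e phi + sET e phi'.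
  rewrite /sET /aff2; move: (tau e) (nu e) (pos _) => T N p.
  by apply: injective_projections; [apply: injective_projections|];
    rewrite /dot /= /GRing.scale /= ?/GRing.scale /=; ring.
(* By Green's formula, [g] is what sven of the desired extension has to be. *)
have [g hg Eg] : exists2 g, A2T t g & forall phi, pairT t g phi = osum t (fun e => pairE e (f e) (sET e phi)).
  apply: pairT_rep => k phi phi'; rewrite /osum mulr_sumr -big_split; apply: eq_bigr => e te /=.
  by rewrite sl (pairE_linear e (hf _ te)); ring.
have [w hw Ew] := W_sven_surj hg.
have hw1 := A1T_W hw.
have hr e : tedge t e -> A1E (res1ET e w) by move=> te; exact: res1ET_fe te hw1.
pose f' e := -1 *: res1ET e w + f e.
have hf' e : tedge t e -> A1E (f' e) by move=> te; apply: A1E_lin; [exact: hr|exact: hf].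
(* Once the trace of [w] is subtracted, the oriented sum of the pairings vanishes on [M(T)], so they
   form an exact cochain. *)
have [x hx] : exists x, forall e, tedge t e -> forall m, pairE e (f' e) m = cobE e x m.
  apply: (@cochain_exact _ _ t (fun e m => pairE e (f' e) m)).
    by move=> e te k m m'; rewrite (pairE_linear e (hf' _ te)).
  move=> phi; have := ev_sven phi hw1; rewrite Ew Eg /osum => h.
  apply/eqP; rewrite -[X in _ == X](subrr (osum t (fun e => pairE e (f e) (sET e phi)))) {2}/osum h /osum -sumrB.
  apply/eqP; apply: eq_bigr => e te; by rewrite /f' (pairE_lin _ _ _ (hr _ te) (hf _ te)); ring.
have [u hu [u1 _]] := A0T_potential hf' hx.
exists (1 *: defT u + w); first by apply: A1T_lin => //; exact: A1T_def.
move=> e te; rewrite (res1ET_lin 1 te (A1T_def hu) hw1) (res0ET_dif te hu) u1 // /f' scaleN1r scale1r.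
by rewrite addrAC addNr add0r.
Qed.

Lemma A0E0 : A0E (0 : efield).
Proof. by apply/A0EP; do 8 exists 0; rewrite ql_zero. Qed.

Lemma A1E0 : A1E (0 : efield).
Proof. by apply/A1EP; do 5 exists 0; rewrite ql_zero. Qed.

Lemma A0T_kernel t u : A0T t u -> defT u = 0 ->
  (forall V, V \in val t -> res0VT V t u = 0) -> u = 0.
Proof.
move=> hu du hV; apply: (A0T_eq0 hu) => e te.
have he := head_in e; apply: (difE_kernel_end he (res0ET_fe te hu)).
  by rewrite -(res0ET_dif te hu) du (res1ET0 te).
by rewrite -(res0VT_edge hu te he) hV // (fintype.subsetP te).
Qed.

End TriangleComplex.

(** * The finite element system *)

Section MeshSystem.
Variables (R : realType) (K : ct_mesh R).
Local Notation vert := (vert K).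
Local Notation edge := (edge K).
Local Notation triangle := (triangle K).
Local Notation cell := (mesh_cell K).
Local Notation efield := ((R -> R) * (R -> R) * (R -> R))%type.
Local Notation R3 := ((R * R) * R)%type.
Local Notation sub := (@subcell (mesh_complex K)).
Implicit Types (V : vert) (e : edge) (t : triangle) (c : cell).

Lemma card_cell c : #|cell_vert c| = (mesh_dim c).+1.
Proof.
case: c => [[v|e]|t] /=; first by rewrite cards1.
  by have /andP[_ /eqP] := valP e.
by have /andP[_ /eqP] := valP t.
Qed.

Lemma sub_dim c' c : cell_vert c' \subset cell_vert c -> (mesh_dim c' <= mesh_dim c)%N.
Proof. by move=> /subset_leq_card; rewrite !card_cell. Qed.

Lemma sub_eq c' c : cell_vert c' \subset cell_vert c -> mesh_dim c' = mesh_dim c -> c' = c.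
Proof.
move=> s d; have E : cell_vert c' = cell_vert c.
  by apply/eqP; rewrite eqEcard s !card_cell d leqnn.
case: c' c s d E => [[v'|e']|t'] [[v|e]|t] //= _ _.
- by move=> /finset.set1_inj ->.
- by move=> /val_inj ->.
- by move=> /val_inj ->.
Qed.

Lemma subV c V : sub c (inl (inl V)) -> c = inl (inl V).
Proof. by move=> s; apply: (sub_eq s); have := sub_dim s; rewrite /= leqn0 => /eqP. Qed.

Lemma subE c e : sub c (inl (inr e)) ->
  (exists2 V, c = inl (inl V) & V \in val e) \/ c = inl (inr e).
Proof.
case: c => [[V|e']|t] s; have := sub_dim s => // _.
  by left; exists V => //; move: s; rewrite /subcell /= finset.sub1set.
by right; exact: (sub_eq s).
Qed.

Lemma subT c t : sub c (inr t) -> [\/ exists2 V, c = inl (inl V) & V \in val t,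
  exists2 e, c = inl (inr e) & tedge t e | c = inr t].
Proof.
case: c => [[V|e]|t'] s.
- by constructor 1; exists V => //; move: s; rewrite /subcell /= finset.sub1set.
- by constructor 2; exists e.
- by constructor 3; exact: (sub_eq s).
Qed.

(** [linfun] accepts any function but represents it faithfully only when it is linear; every
    transport and evaluation map needs this check. *)
Lemma linfun_lin (U V : vectType R) (f : U -> V) : linear f -> linfun f =1 f.
Proof.
move=> lf; pose F : {linear U -> V} := HB.pack f (GRing.isLinear.Build R U V _ f lf).
exact: (@lfunE _ _ _ F).
Qed.

Lemma lfun_lin (U : vectType R) (l l' : 'Hom(U, R)) (k : R) x : (k *: l + l') x = k * l x + l' x.
Proof. by rewrite add_lfunE scale_lfunE. Qed.

Lemma sET_lin e : linear (sET e).
Proof.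
move=> k phi phi'; rewrite /sET /aff2; move: (tau e) (nu e) (pos _) => T N p.
by apply: injective_projections; [apply: injective_projections|];
  rewrite /dot /= /GRing.scale /= ?/GRing.scale /=; ring.
Qed.

Lemma sVE_lin V e : linear (sVE V e).
Proof.
move=> k m m'; rewrite /sVE /aff1; move: (tau e) (nu e) (ecoord e V) => T N s.
by apply: injective_projections; [apply: injective_projections|];
  rewrite /= /GRing.scale /= ?/GRing.scale /=; ring.
Qed.

Lemma sET_inv_lin e : linear (sET_inv e).
Proof.
move=> k m m'; rewrite /sET_inv; move: (tau e) (nu e) (pos _) => T N p.
by apply: injective_projections; [|apply: injective_projections];
  rewrite /dot /= /GRing.scale /= ?/GRing.scale /=; ring.
Qed.

Lemma sVE_inv_lin V e : linear (sVE_inv V e).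
Proof.
move=> k m m'; rewrite /sVE_inv; move: (tau e) (nu e) (ecoord e V) => T N s.
by apply: injective_projections; [apply: injective_projections|];
  rewrite /dot /= /GRing.scale /= ?/GRing.scale /=; ring.
Qed.

Lemma smap_lin c' c : linear (@smap R K c' c).
Proof.
case: c' c => [[v'|e']|t'] [[v|e]|t] /=; try by move=> k x y; rewrite scaler0 addr0.
  exact: sVE_lin.
exact: sET_lin.
Qed.

Lemma transportE c c' (l : 'Hom(M c', R)) m :
  @transport R (mesh_complex K) (mesh_bundle K) c c' l m = l (smap c' m).
Proof. by rewrite /= comp_lfunE (linfun_lin (@smap_lin c' c)). Qed.

Lemma faceE (c' c : cell) : @face (mesh_complex K) c' c ->
  (exists V e, [/\ c' = inl (inl V), c = inl (inr e) & V \in val e]) \/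
  (exists e t, [/\ c' = inl (inr e), c = inr t & tedge t e]).
Proof.
rewrite /face /=; case: c' c => [[v'|e']|t'] [[v|e]|t] //= /andP[s //] _.
  by left; exists v', e; split => //; rewrite -finset.sub1set.
by right; exists e', t.
Qed.

(** Both paths from a vertex to a triangle dualize the same map [sVT], and the inverses of [sET] and
    [sVE] dualize to inverses of the transport maps. *)
Lemma mesh_flat : flat_bundle (mesh_bundle K).
Proof.
split=> [c c' f|c c0 c1 c2 f0 f1 g0 g1 l]; last first.
  apply/lfunP => m; rewrite !transportE.
  move: f0 f1 g0 g1 l m => /faceE[[V [e [-> -> Ve]]]|[e [t [-> -> te]]]].
    by move=> _ /faceE[[? [? [_ //]]]|[? [? [_ //]]]].
  move=> /faceE[[? [? [_ //]]]|[e' [t' [-> /esym[->] te']]]].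
  move=> /faceE[[V [? [-> /esym[->] Ve]]]|[? [? [_ //]]]].
  move=> /faceE[[V' [? [[<-] /esym[->] Ve']]]|[? [? [_ //]]]] l m.
  by rewrite /= !sVE_sET.
split.
  by move=> k l l'; apply/lfunP => m; rewrite transportE !lfun_lin !transportE.
have H (s : M c' -> M c) : linear s -> cancel s (@smap R K c' c) -> cancel (@smap R K c' c) s ->
    bijective (@transport R (mesh_complex K) (mesh_bundle K) c c').
  move=> ls h1 h2; exists (fun l : 'Hom(M c, R) => (l \o linfun s)%VF) => l; apply/lfunP => m.
    by rewrite comp_lfunE (linfun_lin ls) transportE h1.
  by rewrite transportE comp_lfunE (linfun_lin ls) h2.
case: (faceE f) H => [[V [e [-> -> Ve]]]|[e [t [-> -> te]]]] H.
  by apply: (H (sVE_inv V e)); [exact: sVE_inv_lin|exact: sVE_invK|exact: sVEK].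
by apply: (H (sET_inv e)); [exact: sET_inv_lin|exact: sET_invK|exact: sETK].
Qed.

Lemma sum_faceE (U : zmodType) e (F : cell -> U) :
  \sum_(c' | @face (mesh_complex K) c' (inl (inr e))) F c' =
  F (inl (inl (tail e))) + F (inl (inl (head e))).
Proof.
have [E th] := edge_ends e.
rewrite (bigD1 (inl (inl (tail e)))) /=; last by rewrite /face /= finset.sub1set E !finset.inE eqxx.
rewrite (bigD1 (inl (inl (head e)))) /=; last first.
  rewrite /face /= finset.sub1set E !finset.inE eqxx orbT /=.
  by apply/eqP => -[h]; rewrite h eqxx in th.
rewrite big1 ?addr0 // => c /andP[/andP[/faceE[[V [e' [-> [<-] Ve]]]|[? [? [_ //]]]] h1 h2]].
move: Ve; rewrite E !finset.inE => /orP[] /eqP h; move: h1 h2; by rewrite h eqxx.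
Qed.

Lemma sum_faceT (U : zmodType) t (F : cell -> U) :
  \sum_(c' | @face (mesh_complex K) c' (inr t)) F c' = \sum_(e | tedge t e) F (inl (inr e)).
Proof.
rewrite !big_sumType /= [X in X + _ + _]big_pred0 ?add0r; last by move=> V; rewrite /face /= andbF.
rewrite [X in _ + X]big_pred0 ?addr0; last by move=> t'; rewrite /face /= andbF.
by apply: eq_bigl => e; rewrite /face /= andbT.
Qed.

Lemma mesh_fe_subspace k c : subspace (@mesh_fe R K k c).
Proof.
have Z (U : lmodType R) : @subspace R U [set 0] by split => // a x y -> ->; rewrite scaler0 addr0.
case: c k => [[V|e]|t] [|[|[|k]]] /=; try exact: Z.
- by [].
- by split; [exact: A0E0|exact: A0E_lin].
- by split; [exact: A1E0|exact: A1E_lin].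
- by split; [exact: A0T0|exact: A0T_lin].
- by split; [exact: A1T_W (W0 t)|exact: A1T_lin].
- by split; [exact: A2T0|exact: A2T_lin].
Qed.

Lemma mesh_evV V (u : R3) m : @mesh_ev R K 0 (inl (inl V)) u m = pairV u m.
Proof. by rewrite /= linfun_lin // => k x y; exact: pairV_linear. Qed.

Lemma mesh_evE e (u : efield) m : A1E u -> @mesh_ev R K 1 (inl (inr e)) u m = pairE e u m.
Proof. by move=> hu; rewrite /= linfun_lin // => k x y; exact: pairE_linear. Qed.

Lemma mesh_evT t (g : edge -> R * R -> R) m : A2T t g -> @mesh_ev R K 2 (inr t) g m = pairT t g m.
Proof. by move=> hg; rewrite /= linfun_lin // => k x y; exact: pairT_linear. Qed.

Lemma lfun_mulz (U : vectType R) (l : 'Hom(U, R)) (n : int) x : (l *~ n) x = n%:~R * l x.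
Proof. by rewrite -scaler_int scale_lfunE. Qed.

End MeshSystem.

Section MeshFES.
Variables (R : realType) (K : ct_mesh R).
Local Notation vert := (vert K).
Local Notation edge := (edge K).
Local Notation triangle := (triangle K).
Local Notation cell := (mesh_cell K).
Implicit Types (V : vert) (e : edge) (t : triangle) (c : cell).

Lemma mesh_ev_dif k c : mesh_dim c = k.+1 -> forall u, mesh_fe u ->
  @mesh_ev R K k.+1 c (mesh_dif u) = \sum_(c' | @face (mesh_complex K) c' c)
    @transport R _ (mesh_bundle K) c c' (mesh_ev (mesh_res c' u)) *~ mesh_orient c c'.
Proof.
case: c => [[V|e]|t] // [<-] u hu; apply/lfunP => m.
  rewrite sum_faceE add_lfunE !lfun_mulz !transportE.
  have [E th] := edge_ends e; have et : tail e \in sval e by rewrite E !finset.inE eqxx.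
  rewrite /mesh_orient eqxx (negbTE th) et (mulrNz 1) mulr1z mulN1r mul1r.
  by rewrite [LHS](mesh_evE _ (difE_A1E hu)) (ev_difE _ _ hu) !mesh_evV addrC.
rewrite sum_faceT sum_lfunE [LHS](mesh_evT _ (svenT_A2T hu)) (ev_sven _ hu).
apply: eq_bigr => e te; rewrite lfun_mulz transportE.
by rewrite [X in _ = _ * X](mesh_evE _ (res1ET_fe te hu)).
Qed.

Lemma mesh_is_fes : is_fes (mesh_fes K).
Proof.
split; rewrite /=.
- exact: mesh_fe_subspace.
- have Z (U U' : lmodType R) (A : set U) : linear_on A (fun=> 0 : U').
    by move=> a x y _ _; rewrite scaler0 addr0.
  case=> [|[|k]] [[V|e]|t] /=; try exact: Z.
  + by move=> a x y; exact: difE_lin.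
  + by move=> a x y; exact: defT_lin.
  + by move=> a x y; exact: svenT_lin.
- case=> [|[|[|k]]] [[V|e]|t] //=.
  + by move=> u; exact: difE_A1E.
  + by move=> u; exact: A1T_def.
  + by move=> u; exact: svenT_A2T.
- by case=> [|[|k]] [[V|e]|t] //= u; exact: svenT_defT.
- have Z (U U' : lmodType R) (A : set U) : linear_on A (fun=> 0 : U').
    by move=> a x y _ _; rewrite scaler0 addr0.
  case=> [|[|[|k]]] c' [[V|e]|t].
  all: try by move=> /subV ->.
  all: try by move=> /subE[[V -> Ve]|->] //; exact: Z.
  all: try by move=> /subT[[V -> Ve]|[e -> te]|->] //; exact: Z.
  + by move=> /subE[[V -> Ve]|->] //= a x y; exact: res0VE_lin.
  + move=> /subT[[V -> Ve]|[e -> te]|->] //= a x y; first exact: res0VT_lin.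
    exact: res0ET_lin te.
  + move=> /subT[[V -> Ve]|[e -> te]|->] //=; first exact: Z.
    by move=> a x y; exact: res1ET_lin te.
- case=> [|[|[|k]]] c' [[V|e]|t].
  all: try by move=> /subV ->.
  all: try by move=> /subE[[V -> Ve]|->].
  all: try by move=> /subT[[V -> Ve]|[e -> te]|->].
  + by move=> /subT[[V -> Ve]|[e -> te]|->] //= u; exact: res0ET_fe te.
  + by move=> /subT[[V -> Ve]|[e -> te]|->] //= u; exact: res1ET_fe te.
- case=> [|[|[|k]]] c' [[V|e]|t].
  all: try by move=> /subV ->.
  all: try by move=> /subE[[V -> Ve]|->].
  all: try by move=> /subT[[V -> Ve]|[e -> te]|->].
  by move=> /subT[[V -> Ve]|[e -> te]|->] //= u; exact: res0ET_dif te.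
- by case=> [|[|[|k]]] [[V|e]|t] //= u ->.
- move=> k c'' c' [[V|e]|t].
  + by move=> s /subV E; move: s; rewrite E => /subV ->; case: k => [|k] //= u ->.
  + move=> s /subE[[V E Ve]|E]; move: s; rewrite E.
      by move=> /subV ->; case: k.
    by move=> /subE[[V -> Ve]|->]; case: k => [|[|k]] //= u ->.
  + move=> s /subT[[V E Vt]|[e E te]|E]; move: s; rewrite E.
    * by move=> /subV ->; case: k.
    * move=> /subE[[V -> Ve]|->]; case: k => [|[|[|k]]] //= u hu.
      (* The one nontrivial composite: from a triangle through an edge to a vertex. *)
      exact: res0VT_edge te Ve.
    * by move=> /subT[[V -> Vt]|[e -> te]|->]; case: k => [|[|[|k]]] //= u ->.
- move=> k [[V|e]|t] /= <- a x y hx hy; apply/lfunP => m; rewrite lfun_lin.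
  + by rewrite !linfun_lin; first exact: pairV_lin; by move=> ? ? ?; exact: pairV_linear.
  + have hs := A1E_lin a hx hy.
    by rewrite !linfun_lin; first exact: pairE_lin; by move=> ? ? ?; exact: pairE_linear.
  + have hs := A2T_lin a hx hy.
    by rewrite !linfun_lin; first exact: pairT_lin; by move=> ? ? ?; exact: pairT_linear.
exact: mesh_ev_dif.
Qed.

End MeshFES.

(** * Degrees of freedom and unisolvence *)

Section MeshDof.
Variables (R : realType) (K : ct_mesh R) (chi : edge K -> R * R).
Hypotheses (chi_neq0 : forall e, chi e != 0)
  (chi_mean0 : forall e, eint e (aff1 (chi e)) = 0).
Local Notation vert := (vert K).
Local Notation edge := (edge K).
Local Notation triangle := (triangle K).
Local Notation cell := (mesh_cell K).
Local Notation efield := ((R -> R) * (R -> R) * (R -> R))%type.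
Local Notation R3 := ((R * R) * R)%type.
Local Notation sub := (@subcell (mesh_complex K)).
Implicit Types (V : vert) (e : edge) (t : triangle) (c : cell).

Definition dof0E e (a b : R) (u : efield) : R :=
  a * eint e (fun s => derive1 u.1.1 s * aff1 (chi e) s) +
  b * eint e (fun s => 2^-1 * (u.2 s + derive1 u.1.2 s) * aff1 (chi e) s).

Definition dof1E e (m : R3) (a b : R) (u : efield) : R :=
  pairE e u m + a * eint e (fun s => u.1.1 s * aff1 (chi e) s) +
  b * eint e (fun s => u.1.2 s * aff1 (chi e) s).

Lemma dof0E_lin e a b (k : R) u v : A0E u -> A0E v ->
  dof0E e a b (k *: u + v) = k * dof0E e a b u + dof0E e a b v.
Proof.
move=> hu hv; have [l1 l2] := chi_lin k (chi_mean0 e) (difE_A1E hu) (difE_A1E hv).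
(* [dof0E] is this combination of moments composed with [difE], so linearity reduces to that of
   moments on [A^1(E)]. *)
pose m (w : efield) := a * eint e (fun s => w.1.1 s * aff1 (chi e) s)
            + b * eint e (fun s => w.1.2 s * aff1 (chi e) s).
transitivity (m (difE (k *: u + v))); first by [].
transitivity (k * m (difE u) + m (difE v)); last by [].
have -> : difE (k *: u + v) = k *: difE u + difE v by exact: difE_lin.
rewrite /m l1 l2.
by move: (eint _ _) (eint _ _) (eint _ _) (eint _ _) => i1 i2 i3 i4; ring.
Qed.

Lemma dof1E_lin e m a b (k : R) u v : A1E u -> A1E v ->
  dof1E e m a b (k *: u + v) = k * dof1E e m a b u + dof1E e m a b v.
Proof.
move=> hu hv; have [l1 l2] := chi_lin k (chi_mean0 e) hu hv.
by rewrite /dof1E l1 l2 pairE_lin //; ring.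
Qed.

Lemma mesh_dof_system : dof_system (mesh_dof chi).
Proof.
have Z (U : lmodType R) (A : set U) : [/\ forall l : U -> R, [set l | l = fun=> 0] l ->
      forall (a : R) u v, A u -> A v -> l (a *: u + v) = a * l u + l v,
    exists2 l : U -> R, [set l | l = fun=> 0] l & forall u, A u -> l u = 0
  & forall (a : R) (l1 l2 : U -> R), [set l | l = fun=> 0] l1 -> [set l | l = fun=> 0] l2 ->
     exists2 l : U -> R, [set l | l = fun=> 0] l & forall u, A u -> l u = a * l1 u + l2 u].
  split.
  - by move=> l -> a u v _ _; rewrite mulr0 addr0.
  - by exists (fun=> 0).
  - by move=> a l1 l2 -> ->; exists (fun=> 0) => // u _; rewrite mulr0 addr0.
case=> [|[|[|k]]] [[V|e]|t]; try exact: Z.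
- split.
  + by move=> l [m ->] a u v _ _; exact: pairV_lin.
  + by exists (fun u => pairV u 0); [exists 0|move=> u _; rewrite /pairV /dot /= !mulr0 !addr0].
  + move=> a l1 l2 [m1 ->] [m2 ->]; exists (fun u => pairV u (a *: m1 + m2)); first by exists (a *: m1 + m2).
    by move=> u _; exact: pairV_linear.
- split.
  + by move=> l [a' [b' ->]] a u v hu hv; exact: dof0E_lin.
  + by exists (dof0E e 0 0); [exists 0, 0|move=> u _; rewrite /dof0E !mul0r addr0].
  + move=> a l1 l2 [a1 [b1 ->]] [a2 [b2 ->]]; exists (dof0E e (a * a1 + a2) (a * b1 + b2)).
      by exists (a * a1 + a2), (a * b1 + b2).
    by move=> u _; rewrite /dof0E; ring.
- split.
  + by move=> l [m [a' [b' ->]]] a u v hu hv; exact: dof1E_lin.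
  + exists (dof1E e 0 0 0); first by exists 0, 0, 0.
    move=> u hu; have := pairE_linear e hu (-1) 0 0; rewrite scaleN1r addNr mulN1r addNr => h.
    by rewrite /dof1E h !mul0r !addr0.
  + move=> a l1 l2 [m1 [a1 [b1 ->]]] [m2 [a2 [b2 ->]]].
    exists (dof1E e (a *: m1 + m2) (a * a1 + a2) (a * b1 + b2)).
      by exists (a *: m1 + m2), (a * a1 + a2), (a * b1 + b2).
    by move=> u hu; rewrite /dof1E (pairE_linear e hu); ring.
- split.
  + by move=> l [m ->] a u v hu hv; exact: pairT_lin.
  + exists (fun u => pairT t u 0); first by exists 0.
    by move=> u hu; have := pairT_linear (-1) 0 0 hu; rewrite scaleN1r addNr mulN1r addNr.
  + move=> a l1 l2 [m1 ->] [m2 ->]; exists (fun u => pairT t u (a *: m1 + m2)).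
      by exists (a *: m1 + m2).
    by move=> u hu; exact: pairT_linear.
Qed.

Lemma mesh_fe_gt k c u : (mesh_dim c < k)%N -> @mesh_fe R K k c u -> u = 0.
Proof. by case: c k u => [[V|e]|t] [|[|[|k]]]. Qed.

Lemma mesh_dof_gt k c l : (mesh_dim c < k)%N -> mesh_dof chi l -> l = (fun=> 0) :> (mesh_amb k c -> R).
Proof. by case: c k l => [[V|e]|t] [|[|[|k]]]. Qed.

(** Elements of [A^0(T)] and [A^1(T)] vanish with their edge traces, which leaves single edges,
    treated by [A0E_unique] and [A1E_unique], and the pairing in degree 2. *)
Lemma mesh_dof_inj k c u : @mesh_fe R K k c u ->
  (forall c', sub c' c -> forall l : mesh_amb k c' -> R, mesh_dof chi l -> l (mesh_res c' u) = 0) -> u = 0.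
Proof.
have S c0 : sub c0 c0 by exact: fintype.subxx.
have E0 e (v : efield) : A0E v -> (forall V, V \in val e -> res0VE V e v = 0) ->
    (forall a b, dof0E e a b v = 0) -> v = 0.
  move=> hv h hd; have [Ev _] := edge_ends e.
  have h1 : res0VE (tail e) e v = 0 by apply: h; rewrite Ev !finset.inE eqxx.
  apply: (A0E_unique (chi_neq0 e) (chi_mean0 e) hv h1 (h _ (head_in e))).
    by have := hd 1 0; rewrite /dof0E mul1r mul0r addr0.
  by have := hd 0 1; rewrite /dof0E mul1r mul0r add0r.
have E1 e (v : efield) : A1E v -> (forall m a b, dof1E e m a b v = 0) -> v = 0.
  move=> hv hd; apply: (A1E_unique (chi_neq0 e) (chi_mean0 e) hv).
  - by move=> m; have := hd m 0 0; rewrite /dof1E !mul0r !addr0.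
  - have := hd 0 1 0; rewrite /dof1E mul1r mul0r addr0.
    by have := pairE_linear e hv (-1) 0 0; rewrite scaleN1r addNr mulN1r addNr => ->; rewrite add0r.
  - have := hd 0 0 1; rewrite /dof1E mul1r mul0r addr0.
    by have := pairE_linear e hv (-1) 0 0; rewrite scaleN1r addNr mulN1r addNr => ->; rewrite add0r.
have V0 (x : R3) : (forall m, pairV x m = 0) -> x = 0.
  by move=> h; apply: pairV_inj => m; rewrite h /pairV /dot /= !mul0r !addr0.
case: k c u S => [|[|[|k]]] [[V|e]|t] u S hu h; try exact: hu.
- by apply: V0 => m; apply: (h (inl (inl V)) (S _) (fun u => pairV u m)); exists m.
- apply: (E0 e u hu) => [V Ve|a b].
    apply: V0 => m; apply: (h (inl (inl V)) _ (fun u => pairV u m)); last by exists m.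
    by rewrite /subcell /= finset.sub1set.
  by apply: (h (inl (inr e)) (S _) (dof0E e a b)); exists a, b.
- apply: (A0T_eq0 hu) => e te; apply: (E0 e _ (res0ET_fe te hu)) => [V Ve|a b].
    rewrite -(res0VT_edge hu te Ve).
    apply: V0 => m; apply: (h (inl (inl V)) _ (fun u => pairV u m)); last by exists m.
    by rewrite /subcell /= finset.sub1set (fintype.subsetP te).
  by apply: (h (inl (inr e)) te (dof0E e a b)); exists a, b.
- by apply: (E1 e u hu) => m a b; apply: (h (inl (inr e)) (S _) (dof1E e m a b)); exists m, a, b.
- apply: (A1T_unique hu) => e te; apply: (E1 e _ (res1ET_fe te hu)) => m a b.
  by apply: (h (inl (inr e)) te (dof1E e m a b)); exists m, a, b.
- by apply: (pairT_eq0 hu) => m; apply: (h (inr t) (S _) (fun u => pairT t u m)); exists m.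
Qed.

Local Notation dual := (@dof_dual R (mesh_complex K) (mesh_bundle K) (mesh_fes K) (mesh_dof chi)).

(** A functional vanishing on the space satisfies [l = (-1) l + l] there, and [dof_dual] turns this
    relation into [y l = 0]. *)
Lemma dual_eq0 k c y (l : mesh_amb k c -> R) : @dual k c y -> mesh_dof chi l ->
  (forall u, mesh_fe u -> l u = 0) -> y l = 0.
Proof.
move=> hy hl h; have := hy (-1) l l l hl hl hl; rewrite mulN1r addNr; apply=> u hu.
by rewrite mulN1r addNr h.
Qed.

Lemma dual_vertex V y : @dual 0 (inl (inl V)) y ->
  exists x : R3, forall m, pairV x m = y (fun u => pairV u m).
Proof.
move=> hy; have [|x hx] := @pairV_rep R (fun m => y (fun u => pairV u m)); last by exists x.
move=> k m m'; apply: hy; [by exists m|by exists m'|by exists (k *: m + m')|].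
by move=> u _; exact: pairV_linear.
Qed.

(** A field is fitted to the values of [y] on the two generators; relations between functionals,
    passed through [dof_dual], then give all the combinations. *)
Lemma dual_edge0 e y (x : vert -> R3) : @dual 0 (inl (inr e)) y ->
  exists2 u, A0E u & (forall V, V \in val e -> res0VE V e u = x V) /\
    forall a b, dof0E e a b u = y (dof0E e a b).
Proof.
move=> hy; have F a b : @mesh_dof R K chi 0 (inl (inr e)) (dof0E e a b) by exists a, b.
have [u hu [ht hh d1 d2]] := A0E_exists (chi_neq0 e) (chi_mean0 e) (x (tail e)) (x (head e))
  (y (dof0E e 1 0)) (y (dof0E e 0 1)).
exists u => //; split.
  by move=> V; have [-> _] := edge_ends e; rewrite !finset.inE => /orP[] /eqP ->.
move=> a b; rewrite {1}/dof0E d1 d2.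
have y0 : y (dof0E e 0 0) = 0.
  by apply: (dual_eq0 hy (F 0 0)) => v _; rewrite /dof0E !mul0r addr0.
have yb : y (dof0E e 0 b) = b * y (dof0E e 0 1) + y (dof0E e 0 0).
  by apply: hy; try exact: F; move=> v _; rewrite /dof0E; ring.
rewrite y0 addr0 in yb; rewrite -yb; apply/esym; apply: hy; try exact: F.
by move=> v _; rewrite /dof0E; ring.
Qed.

Lemma dual_edge1 e y : @dual 1 (inl (inr e)) y ->
  exists2 u, A1E u & forall m a b, dof1E e m a b u = y (dof1E e m a b).
Proof.
move=> hy; have F m a b : @mesh_dof R K chi 1 (inl (inr e)) (dof1E e m a b) by exists m, a, b.
have P0 (v : efield) : A1E v -> pairE e v 0 = 0.
  by move=> hv; have := pairE_linear e hv (-1) 0 0; rewrite scaleN1r addNr mulN1r addNr.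
have [|g hg] := @pairV_rep R (fun m => y (dof1E e m 0 0)).
  by move=> k m m'; apply: hy; try exact: F; move=> v hv; rewrite /dof1E (pairE_linear e hv); ring.
have [u hu [hm d1 d2]] := A1E_exists (chi_neq0 e) (chi_mean0 e) g (y (dof1E e 0 1 0)) (y (dof1E e 0 0 1)).
exists u => // m a b; rewrite {1}/dof1E hm d1 d2.
have -> : g.1.1 * m.1.1 + g.1.2 * m.1.2 + g.2 * m.2 = y (dof1E e m 0 0) by rewrite hg /pairV /dot.
have ya : y (dof1E e m a 0) = a * y (dof1E e 0 1 0) + y (dof1E e m 0 0).
  by apply: hy; try exact: F; move=> v hv; rewrite /dof1E (P0 v hv); ring.
rewrite [X in X + _]addrC -ya addrC; apply/esym; apply: hy; try exact: F.
by move=> v hv; rewrite /dof1E (P0 v hv); ring.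
Qed.

Lemma dual_triangle t y : @dual 2 (inr t) y ->
  exists2 g, A2T t g & forall phi, pairT t g phi = y (fun u => pairT t u phi).
Proof.
move=> hy; apply: pairT_rep => k m m'; apply: hy; [by exists m|by exists m'|by exists (k *: m + m')|].
by move=> u hu; exact: pairT_linear.
Qed.

(** Fields are built upwards: vertex values, then edge fields with these end values and the
    prescribed moments, then an extension to the triangle. *)
Lemma mesh_dof_surj k c (y : forall c', (mesh_amb k c' -> R) -> R) :
  (forall c', sub c' c -> @dual k c' (y c')) ->
  exists2 u, @mesh_fe R K k c u & forall c', sub c' c -> forall l : mesh_amb k c' -> R,
    mesh_dof chi l -> l (mesh_res c' u) = y c' l.
Proof.
move=> hy; have S c0 : sub c0 c0 by exact: fintype.subxx.
have Z c' (l : mesh_amb k c' -> R) u : sub c' c -> mesh_dof chi l -> l = (fun=> 0) -> l u = y c' l.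
  by move=> s Fl l0; rewrite (dual_eq0 (hy _ s) Fl) ?l0.
have [kc|ck] := ltnP (mesh_dim c) k.
  exists 0; first by have [] := @mesh_fe_subspace R K k c.
  move=> c' s l Fl; apply: Z => //; apply: mesh_dof_gt Fl.
  exact: leq_ltn_trans (sub_dim s) kc.
case: k c y hy Z ck => [|[|[|k]]] [[V|e]|t] y hy Z // _.
- have [x hx] := dual_vertex (hy _ (S _)).
  by exists x => // c' /subV -> l [m ->]; exact: hx.
- have /choice[x hx] : forall V, exists x : R3, V \in val e ->
      forall m, pairV x m = y (inl (inl V)) (fun u => pairV u m).
    move=> V; have [Ve|_] := boolP (V \in val e); last by exists 0.
    have s : sub (inl (inl V)) (inl (inr e)) by rewrite /subcell /= finset.sub1set.
    by have [x hx] := dual_vertex (hy _ s); exists x.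
  have [u hu [u1 u2]] := dual_edge0 x (hy _ (S _)).
  exists u => // c' /subE[[V -> Ve]|->] l; last by move=> [a [b ->]]; exact: u2.
  by move=> [m ->] /=; rewrite u1 // hx.
- have /choice[x hx] : forall V, exists x : R3, V \in val t ->
      forall m, pairV x m = y (inl (inl V)) (fun u => pairV u m).
    move=> V; have [Vt|_] := boolP (V \in val t); last by exists 0.
    have s : sub (inl (inl V)) (inr t) by rewrite /subcell /= finset.sub1set.
    by have [x hx] := dual_vertex (hy _ s); exists x.
  have /choice[f hf] : forall e, exists f, tedge t e -> A0E f /\
      ((forall V, V \in val e -> res0VE V e f = x V) /\
       forall a b, dof0E e a b f = y (inl (inr e)) (dof0E e a b)).
    move=> e; have [te|_] := boolP (tedge t e); last by exists 0.
    by have [f hf H] := dual_edge0 x (hy (inl (inr e)) te); exists f.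
  have [u hu [u1 u2]] := A0T_extend (fun e te => (hf e te).1) (fun e V te => (hf e te).2.1 V).
  exists u => // c' s l; case: (subT s) => [[V E Vt]|[e E te]|E].
  + by move: l; rewrite E => l [m ->] /=; rewrite u2 // hx.
  + by move: l; rewrite E => l [a [b ->]]; rewrite -(hf e te).2.2 -u1.
  (* In degree 0 the triangle itself carries only the zero functional. *)
  + by move=> Fl; apply: Z => //; move: l Fl; rewrite E.
- have [u hu u1] := dual_edge1 (hy _ (S _)).
  exists u => // c' s l; case: (subE s) => [[V E Ve]|E].
    by move=> Fl; apply: Z => //; move: l Fl; rewrite E.
  by move: l; rewrite E => l [m [a [b ->]]]; exact: u1.
- have /choice[f hf] : forall e, exists f, tedge t e -> A1E f /\
       forall m a b, dof1E e m a b f = y (inl (inr e)) (dof1E e m a b).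
    move=> e; have [te|_] := boolP (tedge t e); last by exists 0.
    by have [f hf H] := dual_edge1 (hy (inl (inr e)) te); exists f.
  have [u hu u1] := A1T_extend (fun e te => (hf e te).1).
  exists u => // c' s l; case: (subT s) => [[V E Vt]|[e E te]|E].
  + by move=> Fl; apply: Z => //; move: l Fl; rewrite E.
  + by move: l; rewrite E => l [m [a [b ->]]]; rewrite -(hf e te).2 -u1.
  + by move=> Fl; apply: Z => //; move: l Fl; rewrite E.
- have [g hg g1] := dual_triangle (hy _ (S _)).
  exists g => // c' s l; case: (subT s) => [[V E Vt]|[e E te]|E].
  + by move=> Fl; apply: Z => //; move: l Fl; rewrite E.
  + by move=> Fl; apply: Z => //; move: l Fl; rewrite E.
  + by move: l; rewrite E => l [m ->]; exact: g1.
Qed.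

Lemma mesh_unisolvent : unisolvent (mesh_dof chi).
Proof.
move=> k c; split; last exact: mesh_dof_surj.
move=> u v hu hv h; apply/eqP; rewrite -subr_eq0 addrC -scaleN1r; apply/eqP.
have [_ sp] := @mesh_fe_subspace R K k c.
apply: (@mesh_dof_inj k c); first exact: sp.
move=> c' s l Fl; have [lin _ _] := mesh_dof_system k c'.
have fes := mesh_is_fes K.
have -> : mesh_res c' (-1 *: v + u) = -1 *: mesh_res c' v + mesh_res c' u.
  exact: (res_linear fes s (-1) hv hu).
rewrite (lin l Fl _ _ _ (res_fe fes s hv) (res_fe fes s hu)).
by rewrite mulN1r -(h c' s l Fl) addNr.
Qed.

End MeshDof.

(** * Flabbiness and local exactness *)

Section MeshCompatible.
Variables (R : realType) (K : ct_mesh R).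
Local Notation vert := (vert K).
Local Notation edge := (edge K).
Local Notation triangle := (triangle K).
Local Notation cell := (mesh_cell K).
Local Notation efield := ((R -> R) * (R -> R) * (R -> R))%type.
Local Notation R3 := ((R * R) * R)%type.
Local Notation sub := (@subcell (mesh_complex K)).
Local Notation cochainf := (forall c : cell, 'Hom(M c, R)).
Local Notation mcochain := (@cochain R (mesh_complex K) (mesh_bundle K)).
Local Notation mdelta := (@delta R (mesh_complex K) (mesh_bundle K)).
Local Notation mcob := (@coboundary R (mesh_complex K) (mesh_bundle K)).
Definition mderham k c (u : mesh_amb k c) : cochainf :=
  @derham R (mesh_complex K) (mesh_bundle K) (mesh_fes K) k c u.
Implicit Types (V : vert) (e : edge) (t : triangle) (c : cell).

Lemma mesh_flabby : flabby (mesh_fes K).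
Proof.
move=> c k w [hw hr].
have B c0 c1 : sub c0 c1 -> (mesh_dim c0 < mesh_dim c1)%N -> @boundary (mesh_complex K) c1 c0.
  by rewrite /boundary /= => s d; rewrite /= s /=; apply: contraTN d => /eqP ->; rewrite ltnn.
(* When all boundary cells have dimension below [k], the family is zero and the zero element extends
   it. *)
have triv : (forall c', @boundary (mesh_complex K) c c' -> (mesh_dim c' < k)%N) ->
    exists2 u, @mesh_fe R K k c u & forall c', @boundary (mesh_complex K) c c' -> mesh_res c' u = w c'.
  move=> d; exists 0; first by have [] := @mesh_fe_subspace R K k c.
  move=> c' hc'; rewrite (mesh_fe_gt (d _ hc') (hw _ hc')).
  apply: (mesh_fe_gt (d _ hc')); apply: (res_fe (mesh_is_fes K)); first by case/andP: hc'.
  by have [] := @mesh_fe_subspace R K k c.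
have bd c' : @boundary (mesh_complex K) c c' -> (mesh_dim c' < mesh_dim c)%N.
  move=> /andP[s n]; rewrite ltn_neqAle (sub_dim s) andbT.
  by apply: contra n => /eqP d; apply/eqP; exact: sub_eq s d.
have [ck|kc] := leqP (mesh_dim c) k.
  by apply: triv => c' /bd h; exact: leq_trans h ck.
case: k c kc w hw hr triv bd => [|[|k]] [[V|e]|t] // _ w hw hr triv bd.
- have chi0e := chi0_neq0 e.
  have [u hu [ht hh _ _]] := A0E_exists chi0e (chi0_mean0 e)
    (w (inl (inl (tail e)))) (w (inl (inl (head e)))) 0 0.
  exists u => // c' /andP[s n]; case: (subE s) => [[V E]|E]; last by rewrite E eqxx in n.
  have [-> _] := edge_ends e; move: n; rewrite E !finset.inE => _ /orP[] /eqP ->.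
    exact: ht.
  exact: hh.
- have bE e : tedge t e -> @boundary (mesh_complex K) (inr t) (inl (inr e)) by move=> te; exact: B.
  have bV V : V \in val t -> @boundary (mesh_complex K) (inr t) (inl (inl V)).
    by move=> Vt; apply: B => //; rewrite /subcell /= finset.sub1set.
  have [u hu [u1 u2]] := @A0T_extend R K t (fun e => w (inl (inr e))) (fun V => w (inl (inl V)))
    (fun e te => hw _ (bE e te))
    (fun e V te Ve => esym (hr (inl (inl V)) (inl (inr e)) (bV V (fintype.subsetP te V Ve)) (bE e te)
      (etrans (finset.sub1set _ _) Ve))).
  exists u => // c' /andP[s n]; case: (subT s) => [[V E Vt]|[e E te]|E]; last by rewrite E eqxx in n.
    by rewrite E; exact: u2.
  by rewrite E; exact: u1.
- have bE e : tedge t e -> @boundary (mesh_complex K) (inr t) (inl (inr e)) by move=> te; exact: B.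
  (* In degree 1 the vertices carry nothing, so the edge data are subject to no compatibility
     condition. *)
  have [u hu u1] := @A1T_extend R K t (fun e => w (inl (inr e))) (fun e te => hw _ (bE e te)).
  exists u => // c' /andP[s n]; case: (subT s) => [[V E Vt]|[e E te]|E]; last by rewrite E eqxx in n.
    have bV : @boundary (mesh_complex K) (inr t) (inl (inl V)) by apply: B => //; rewrite -E.
    by rewrite E; have := hw _ bV => /= ->.
  by rewrite E; exact: u1.
Qed.

Lemma pairV_rep_hom V (l : 'Hom(M (inl (inl V) : cell), R)) : exists x : R3, forall m, l m = pairV x m.
Proof. by apply: pairV_rep => k m m'; rewrite linearP. Qed.

Lemma delta_edge (P : pred cell) (f : cochainf) e (x : vert -> R3) m :
  (forall V, V \in val e -> forall m', f (inl (inl V)) m' = pairV (x V) m') ->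
  P (inl (inr e)) -> mdelta P f (inl (inr e)) m = cobE e x m.
Proof.
move=> hx Pe; rewrite /delta Pe sum_faceE add_lfunE !lfun_mulz !transportE.
have [E th] := edge_ends e; have et : tail e \in sval e by rewrite E !finset.inE eqxx.
rewrite /= eqxx (negbTE th) et (mulrNz 1) mulr1z mulN1r mul1r /cobE !hx //; last exact: head_in.
by rewrite addrC.
Qed.

Lemma delta_triangle (P : pred cell) (f : cochainf) t phi : P (inr t) ->
  mdelta P f (inr t) phi = osum t (fun e => f (inl (inr e)) (sET e phi)).
Proof.
move=> Pt; rewrite /delta Pt sum_faceT sum_lfunE; apply: eq_bigr => e te.
by rewrite lfun_mulz transportE.
Qed.

Lemma delta0 (P : pred cell) c : mdelta P (fun c => 0 : 'Hom(M c, R)) c = 0.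
Proof.
rewrite /delta; case: ifP => // _; apply: big1 => c' _; apply/lfunP => m.
by rewrite lfun_mulz transportE !zero_lfunE mulr0.
Qed.

Lemma coboundary0 (P : pred cell) k (f : cochainf) : (forall c, f c = 0) ->
  mcob P k f.
Proof.
case: k => [//|k] h; exists (fun c => 0 : 'Hom(M c, R)) => // c.
by rewrite h delta0.
Qed.

Lemma mesh_pair0 e m : pairE e (0 : efield) m = 0.
Proof.
have -> : (0 : efield) = (ql 0 0 0, ql 0 0 0, ql 0 0 0) by rewrite ql_zero.
by rewrite pairE_ql; ring.
Qed.

(** Injectivity: in degree 0 a cocycle is determined by its vertex values, and in positive degree
    every cocycle of [A(c)] is a coboundary. Surjectivity: a cocycle with the prescribed evaluations
    is found in degree 0 and in top degree; in degree 1 on a triangle the cochain is itself a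
    coboundary. *)
Lemma mesh_locally_exact : locally_exact (mesh_fes K).
Proof.
move=> c k; have S c0 : sub c0 c0 by exact: fintype.subxx.
have sp := @mesh_fe_subspace R K.
have dm := dif_linear (mesh_is_fes K).
have [ck|kc] := ltnP (mesh_dim c) k.
  split=> [u [hu _] _|f [cf _]].
    rewrite (mesh_fe_gt ck hu); case: k ck {hu u} => // k ck.
    by exists 0; [have [] := sp k c|apply: (mesh_fe_gt ck); apply: (dif_fe (mesh_is_fes K)); have [] := sp k c].
  exists 0.
    split; first by have [] := sp k c.
    apply: (@mesh_fe_gt R K k.+1 c); first exact: ltnW.
    by apply: (dif_fe (mesh_is_fes K)); have [] := sp k c.
  apply: coboundary0 => c'; have nk : ~~ (sub c' c && (mesh_dim c' == k)).
    by apply/negP => /andP[s /eqP d]; have := leq_ltn_trans (sub_dim s) ck; rewrite d ltnn.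
  by rewrite cf // /derham (negbTE nk) subr0.
(* In top degree a cochain on the subcells of [c] lives on [c] alone, so one evaluation has to
   match. *)
have top (f : cochainf) (u : mesh_amb k c) : mesh_dim c = k -> mcochain (subcells c) k f ->
    mesh_fe u -> mesh_dif u = 0 -> mesh_ev u = f c ->
    exists2 u, @fe_cocycle R (mesh_complex K) _ (mesh_fes K) k c u &
      mcob (subcells c) k (fun c' => f c' - mderham u c').
  move=> dk cf hu du eu; exists u => //; apply: coboundary0 => c'; rewrite /mderham /derham.
  case: ifP => [/andP[s /eqP d]|/negbT n]; last by rewrite cf ?subr0.
  have E : c' = c by apply: sub_eq s _; rewrite -dk in d.
  rewrite E -eu; apply/eqP; rewrite subr_eq0; apply/eqP; congr mesh_ev.
  exact/esym/(res_id (mesh_is_fes K)).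
have ver V (u : mesh_amb 0 c) : sub (inl (inl V)) c -> @mderham 0 c u (inl (inl V)) = 0 ->
    @mesh_res R K 0 (inl (inl V)) c u = 0.
  move=> s; rewrite /mderham /derham s /= => h; apply: pairV_inj => m.
  by rewrite -(@mesh_evV R K V) [mesh_ev _]h zero_lfunE /pairV /dot /= !mul0r !addr0.
have bot (f : cochainf) (u : mesh_amb 0 c) : mcochain (subcells c) 0 f ->
    mesh_fe u -> mesh_dif u = 0 ->
    (forall V, sub (inl (inl V)) c -> forall m, f (inl (inl V)) m = pairV (@mesh_res R K 0 (inl (inl V)) c u) m) ->
    exists2 u, @fe_cocycle R (mesh_complex K) _ (mesh_fes K) 0 c u &
      mcob (subcells c) 0 (fun c' => f c' - mderham u c').
  move=> cf hu du eu; exists u => // c'; rewrite /mderham /derham.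
  case: ifP => [/andP[s /eqP d]|/negbT n]; last by rewrite cf ?subr0.
  case: c' s d => [[V|e]|t] //= s _; apply/eqP; rewrite subr_eq0; apply/eqP/lfunP => m.
  by rewrite eu // -(@mesh_evV R K V).
have rep (f : cochainf) : exists x : vert -> R3, forall V m, f (inl (inl V)) m = pairV (x V) m.
  have /choice[x hx] : forall V, exists x : R3, forall m, f (inl (inl V)) m = pairV x m.
    by move=> V; exact: pairV_rep_hom.
  by exists x.
case: k c S sp dm kc top ver bot => [|[|[|k]]] [[V|e]|t] S sp dm // _ top ver bot.
- split=> [u _ cb|f [cf _]]; first exact: (ver V u (S (inl (inl V))) (cb (inl (inl V)))).
  have [x hx] := rep f; apply: (top f (x V)) => //.
  by apply/lfunP => m; rewrite hx -(@mesh_evV R K V).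
- split=> [u [hu du] cb|f [cf df]].
    have h := head_in e; apply: (difE_kernel_end h hu du).
    by apply: (ver _ _ _ (cb _)); rewrite /subcell /= finset.sub1set.
  have [x hx] := rep f.
  have hd m : cobE e x m = 0.
    have E := @delta_edge (@subcells (mesh_complex K) (inl (inr e))) f e x m (fun V _ => hx V) (S (inl (inr e))).
    by rewrite -E df zero_lfunE.
  have [u hu [du u1]] := @A0E_potential R K e 0 x (A1E0 R)
    (fun m => etrans (mesh_pair0 e m) (esym (hd m))).
  apply: (bot f u cf hu du) => V s m; rewrite hx; congr pairV.
  by apply/esym/u1; rewrite -finset.sub1set.
- split=> [u [hu du] cb|f [cf df]].
    apply: (A0T_kernel hu du) => V Vt.
    by apply: (ver V _ _ (cb _)); rewrite /subcell /= finset.sub1set.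
  have [x hx] := rep f.
  have hd e : tedge t e -> forall m, cobE e x m = 0.
    move=> te m; have E := @delta_edge (@subcells (mesh_complex K) (inr t)) f e x m (fun V _ => hx V) te.
    by rewrite -E df zero_lfunE.
  have [u hu [du u1]] := A0T_constant hd.
  apply: (bot f u cf hu du) => V s m; rewrite hx; congr pairV.
  by apply/esym/u1; rewrite -finset.sub1set.
- split=> [u [hu du] cb|f [cf df]].
    by have [v hv <-] := difE_surj hu; exists v.
  have [g hg] : exists g : R3, forall m, f (inl (inr e)) m = pairV g m.
    by apply: pairV_rep => l m m'; rewrite linearP.
  have [u hu [hm _ _]] := A1E_exists (chi0_neq0 e) (chi0_mean0 e) g 0 0.
  apply: (top f u) => //; apply/lfunP => m; rewrite [LHS](mesh_evE _ hu) hm hg.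
  by rewrite /pairV /dot.
- split=> [u [hu du] cb|f [cf df]].
    by have [v hv ->] := sven_kernel hu du; exists v.
  have [x hx] : exists x, forall e, tedge t e -> forall m, f (inl (inr e)) m = cobE e x m.
    apply: (@cochain_exact _ _ t (fun e m => f (inl (inr e)) m)).
      by move=> e te l m m'; rewrite linearP.
    move=> phi; have E := @delta_triangle (@subcells (mesh_complex K) (inr t)) f t phi (S (inr t)).
    by rewrite -E df zero_lfunE.
  (* The cochain is the coboundary of the vertex family [x], so the zero field represents its
     class. *)
  exists 0; first by split; [have [] := sp 1 (inr t)|rewrite /= -defT0 svenT_defT //; exact: A0T0].
  have dr0 c' : @mderham 1 (inr t) 0 c' = 0.
    rewrite /mderham /derham; case: ifP => // /andP[s /eqP d]; case: c' s d => [[V|e]|t'] // te _.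
    apply/lfunP => m; rewrite [LHS](_ : _ = @mesh_ev R K 1 (inl (inr e)) 0 m).
      by rewrite mesh_evE ?mesh_pair0 ?zero_lfunE //; exact: A1E0.
    by congr (mesh_ev _ _); exact: res1ET0 te.
  (* The potential [x] is cut off outside [t], since cochains must vanish on cells that are not
     subcells of [t]. *)
  pose g (c' : cell) : 'Hom(M c', R) := match c' with
    | inl (inl V) => if V \in val t then linfun (pairV (x V)) else 0 | _ => 0 end.
  exists g.
    case=> [[V|e]|t'] //=; rewrite /subcells /= finset.sub1set andbT.
    by move=> /negbTE ->.
  have gx V : V \in val t -> forall m, g (inl (inl V)) m = pairV (x V) m.
    by move=> Vt m; rewrite /g Vt; exact: mesh_evV.
  move=> c'; have := dr0 c'; rewrite /mderham => ->; rewrite subr0 {dr0}; case: c' => [[V|e]|t'].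
  + rewrite cf ?andbF // /delta big_pred0 ?if_same //.
  + have [te|nte] := boolP (tedge t e); last first.
      have ns : @subcells (mesh_complex K) (inr t) (inl (inr e)) = false by exact: negbTE nte.
      by rewrite cf /delta ns.
    apply/lfunP => m; have gV V : V \in val e -> forall m', g (inl (inl V)) m' = pairV (x V) m'.
      by move=> Ve; apply: gx; exact: fintype.subsetP te V Ve.
    by rewrite (@delta_edge (@subcells (mesh_complex K) (inr t)) g e x m gV te) hx.
  + rewrite cf ?andbF //; apply/lfunP => m; rewrite zero_lfunE /delta; case: ifP => [|_]; last by rewrite zero_lfunE.
    move=> _; rewrite sum_faceT sum_lfunE big1 // => e te.
    by rewrite lfun_mulz transportE zero_lfunE mulr0.
- split=> [u [hu du] cb|f [cf df]].
    by have [w hw <-] := W_sven_surj hu; exists w => //; exact: A1T_W.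
  have [u hu hm] : exists2 u, A2T t u & forall m, pairT t u m = f (inr t) m.
    by apply: pairT_rep => l m m'; rewrite linearP.
  by apply: (top f u) => //; apply/lfunP => m; rewrite [LHS](mesh_evT _ hu) hm.
Qed.

End MeshCompatible.

Theorem proposition6p6 (R : realType) (K : ct_mesh R) (chi : edge K -> R * R)
    (chi_neq0 : forall e, chi e != 0)
    (chi_mean0 : forall e, eint e (aff1 (chi e)) = 0) :
  (forall t : triangle K, [set defT v | v in A0T t] `&` W t = [set 0]) /\
  [/\ flat_bundle (mesh_bundle K), is_fes (mesh_fes K) & compatible (mesh_fes K)] /\
  (dof_system (mesh_dof chi) /\ unisolvent (mesh_dof chi)).
Proof.
split; first by move=> t; have [A [B [C [eA [eB [eC F]]]]]] := tframe_exists t; exact: def_W_trivial F.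
split; split.
- exact: mesh_flat.
- exact: mesh_is_fes.
- by split; [exact: mesh_flabby|exact: mesh_locally_exact].
- exact: mesh_dof_system.
- exact: mesh_unisolvent.
Qed.
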